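(* Let $g$ be an analytic function on the unit disc $\mathbb{D}$. Then the following statements hold. (i) The following are equivalent: (a) $\mathcal{H}_g:H^1\to H^2$ is bounded; (b) $\mathcal{H}_g:H^1\to H^2$ is compact; (c) $g'\in H^2$. Moreover, $$2\|g'\|_{H^2}\le \|\mathcal{H}_g\|_{H^1\to H^2}\le \pi\|g'\|_{H^2}.$$ (ii) If $1<p\le 2$, then $\mathcal{H}_g:H^p\to H^2$ is bounded if and only if $g\in\Lambda\left(2,\frac1p\right)$. Moreover, $$\|\mathcal{H}_g\|_{H^p\to H^2}\asymp \|g-g(0)\|_{\Lambda\left(2,\frac1p\right)}.$$ Furthermore, $\mathcal{H}_g:H^p\to H^2$ is compact if and only if $g\in\lambda\left(2,\frac1p\right)$. (iii) If $2<p<\infty$ and $\tilde p$ is defined by $\frac1{\tilde p}=\frac12-\frac1p$, then the following are equivalent: (a) $\mathcal{H}_g:H^p\to H^2$ is bounded; (b) $\mathcal{H}_g:H^p\to H^2$ is compact; (c) $g'\in A^{2,\tilde p}_{\tilde p/2}$. Moreover, $$\|\mathcal{H}_g\|_{H^p\to H^2}\asymp \|g'\|_{A^{2,\tilde p}_{\tilde p/2}}.$$ (iv) The following are equivalent: (a) $\mathcal{H}_g:H^\infty\to H^2$ is bounded; (b) $\mathcal{H}_g:H^\infty\to H^2$ is compact; (c) $g\in H^2$. Moreover, $$\|\mathcal{H}_g\|_{H^\infty\to H^2}=\|g-g(0)\|_{H^2}.$$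
   Context: $\mathbb{D}$ is the open unit disc in $\mathbb{C}$. For $f$ analytic on $\mathbb{D}$, $0<p<\infty$ and $0<r<1$, put $M_p(r,f)=\left(\frac1{2\pi}\int_0^{2\pi}|f(re^{i\theta})|^p\,d\theta\right)^{1/p}$ and $M_\infty(r,f)=\max_{|z|=r}|f(z)|$. The Hardy space $H^p$ ($0<p\le\infty$) consists of the analytic $f$ on $\mathbb{D}$ with $\|f\|_{H^p}=\sup_{0<r<1}M_p(r,f)<\infty$. For $g$ analytic on $\mathbb{D}$, the generalized Hilbert operator is $$\mathcal{H}_g(f)(z)=\int_0^1 f(t)g'(tz)\,dt,\qquad z\in\mathbb{D},\ f\in H^1;$$ the integral converges absolutely for $f\in H^1$ (by the Fejér–Riesz inequality) and defines an analytic function on $\mathbb{D}$. $\mathcal{H}_g:H^p\to H^q$ is bounded if there is a constant $C$ with $\|\mathcal{H}_g(f)\|_{H^q}\le C\|f\|_{H^p}$ for all $f\in H^p$; $\|\mathcal{H}_g\|_{H^p\to H^q}$ is the smallest such $C$ (and $\infty$ if there is none). Likewise a function norm is understood to be $\infty$ when the function does not belong to the space. Mixed-norm spaces: for $0<p\le\infty$, $0<q<\infty$, $\alpha>-1$, $A^{p,q}_\alpha$ consists of the analytic $f$ on $\mathbb{D}$ with $$\|f\|_{A^{p,q}_\alpha}^q=\int_0^1 M_p^q(r,f)\,(\alpha+1)(1-r^2)^\alpha\,dr<\infty.$$ Mean Lipschitz spaces: for $1\le p<\infty$, $0<\alpha\le1$, $\Lambda(p,\alpha)$ consists of the $g\in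 H^p$ whose non-tangential boundary values $g(e^{i\theta})$ satisfy $\omega_p(g,t)=O(t^\alpha)$ as $t\to0$, where $$\omega_p(g,t)=\sup_{0<h\le t}\left(\int_0^{2\pi}|g(e^{i(\theta+h)})-g(e^{i\theta})|^p\frac{d\theta}{2\pi}\right)^{1/p}.$$ Equivalently (Hardy–Littlewood), $g\in H^p$ and $M_p(r,g')=O((1-r)^{\alpha-1})$ as $r\to1^-$. The norm is $\|g\|_{\Lambda(p,\alpha)}=|g(0)|+\sup_{t>0}\omega_p(g,t)/t^\alpha$. The space $\lambda(p,\alpha)$ is the corresponding ''little oh'' space, defined with $\omega_p(g,t)=o(t^\alpha)$ as $t\to0$ in place of $O(t^\alpha)$. $a\asymp b$ means $C^{-1}b\le a\le Cb$ for a constant $C>0$ that depends only on $p$ (not on $g$). *)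

(* Defs.v *)
From HB Require Import structures.
From mathcomp Require Export all_boot all_order all_algebra.
From mathcomp Require Export complex.
From mathcomp Require Export all_classical all_reals all_analysis.
Set Implicit Arguments.
Unset Strict Implicit.
Unset Printing Implicit Defensive.
Import Order.TTheory GRing.Theory Num.Theory.
Import numFieldNormedType.Exports.
Local Open Scope classical_set_scope.
Local Open Scope ring_scope.
Local Open Scope complex_scope.

(* The regular module R[i]^o carries the normed-space structure of the complex
   numbers over the field R[i], so [derivable _ _ 1] and [derive1] below are
   complex differentiability and the complex derivative.  Functions on the unit
   disc are total functions whose values off the disc are never used. *)
Notation Cx R := ((R : realType)[i]^o).

Section HilbertOperator.
Context {R : realType}.
Implicit Types (f g h : Cx R -> Cx R) (z : Cx R) (r t x : R) (p q : \bar R).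

(* Real-valued modulus; the generic norm on R[i] takes its values in R[i]. *)
Definition cmod z : R := Normc.normc z.

Definition circle r x : Cx R := (r * cos x) +i* (r * sin x).

Definition analytic f : Prop := forall z, cmod z < 1 -> derivable f z 1.

Definition cderiv f : Cx R -> Cx R := derive1 f.

Definition circle_norm (s : R) (u : R -> Cx R) : \bar R :=
  (((2 * pi)^-1%:E *
    \int[lebesgue_measure]_(x in `[0%R, (2 * pi)%R]) (cmod (u x) `^ s)%:E)
   `^ s^-1)%E.

Definition integral_mean p r f : \bar R :=
  match p with
  | s%:E => circle_norm s (fun x => f (circle r x))
  | +oo%E => ereal_sup [set (cmod (f z))%:E | z in [set z | cmod z = r]]
  | -oo%E => 0%E
  end.

Definition hardy_norm p f : \bar R :=
  ereal_sup [set integral_mean p r f | r in `]0, 1[].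

Definition hardy p f : Prop := analytic f /\ (hardy_norm p f < +oo)%E.

Definition hilbert_op g f : Cx R -> Cx R := fun z =>
  (\int[lebesgue_measure]_(t in `[0, 1[)
     complex.Re (f t%:C * cderiv g (t%:C * z))) +i*
  (\int[lebesgue_measure]_(t in `[0, 1[)
     complex.Im (f t%:C * cderiv g (t%:C * z))).

Definition op_bound p q (T : (Cx R -> Cx R) -> Cx R -> Cx R) (M : R) : Prop :=
  forall f, hardy p f ->
    hardy q (T f) /\ (hardy_norm q (T f) <= M%:E * hardy_norm p f)%E.

Definition bounded_op p q T : Prop := exists M, op_bound p q T M.

Definition op_norm p q T : \bar R :=
  ereal_inf [set M%:E | M in [set M | op_bound p q T M]].

Definition compact_op p q T : Prop :=
  (forall f, hardy p f -> hardy q (T f)) /\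
  forall fs : nat -> Cx R -> Cx R,
    (forall n, hardy p (fs n)) ->
    (exists M : R, forall n, (hardy_norm p (fs n) <= M%:E)%E) ->
    exists2 phi : nat -> nat, increasing_seq phi &
    exists2 h, hardy q h &
      hardy_norm q (T (fs (phi n)) \- h) @[n --> \oo] --> 0%E.

Definition mixed_norm p (q a : R) f : \bar R :=
  ((\int[lebesgue_measure]_(r in `]0%R, 1%R[)
      (integral_mean p r f `^ q * ((a + 1) * (1 - r ^+ 2) `^ a)%:E))
   `^ q^-1)%E.

Definition mixed_space p (q a : R) f : Prop :=
  analytic f /\ (mixed_norm p q a f < +oo)%E.

Definition stolz (s : R) (w : Cx R) : set (Cx R) :=
  [set z | cmod z < 1 /\ cmod (z - w) < s * (1 - cmod z)].

Definition nt_limit f (w l : Cx R) : Prop :=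
  forall s : R, 1 < s -> f @ within (stolz s w) (nbhs w) --> l.

(* The non-tangential limit at the point of argument x, and 0 if there is none
   (a null set of arguments when f lies in a Hardy space). *)
Definition boundary f x : Cx R := xget 0 (nt_limit f (circle 1 x)).

Definition modulus_cont (s : R) g t : \bar R :=
  ereal_sup [set circle_norm s (fun x => boundary g (x + d) - boundary g x)
            | d in `]0, t]].

Definition lipschitz_mean (s a : R) g : Prop :=
  hardy s%:E g /\
  exists2 M : R, 0 < M &
    \forall t \near 0^'+, (modulus_cont s g t <= (M * t `^ a)%:E)%E.

Definition little_lipschitz_mean (s a : R) g : Prop :=
  hardy s%:E g /\
  forall e : R, 0 < e ->
    \forall t \near 0^'+, (modulus_cont s g t <= (e * t `^ a)%:E)%E.

Definition lipschitz_norm (s a : R) g : \bar R :=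
  if `[< lipschitz_mean s a g >] then
    ((cmod (g 0))%:E +
     ereal_sup [set modulus_cont s g t * ((t `^ a)^-1)%:E | t in `]0%R, +oo[])%E
  else +oo%E.

Definition comparable (M : R) (a b : \bar R) : Prop :=
  ((M^-1)%:E * b <= a)%E /\ (a <= M%:E * b)%E.

End HilbertOperator.

(* Main.v *)
(** With g' = sum c_n z^n, the operator has the coefficients c_n mu_n, where mu_n
    is the n-th moment of f on [0, 1), so by Parseval everything is about
    sum |c_n mu_n|^2.  Grouping n + 1 into the blocks [2^k, 2^(k+1)) and writing
    B_k for the l^2 norm of c on block k, a dyadic Fejer-Riesz inequality
      sum_k 2^-k sup_(1 - t ~ 2^-k) |f t|^p <= C ||f||_p^p
    (a Poisson-Jensen bound for f times an analytic majorant vanishing near 1)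
    and Schur's test bound sum_k (2^(k / p') |mu|_k)^p, with |mu|_k the largest
    |mu_n| on block k, while combinations of the kernels
    2^(-k(2 - 1/p)) (1 - (1 - 2^-k) z)^-2 make this sharp.  So, with
    beta_k = B_k 2^(-k / p'), the operator is bounded iff beta is bounded
    (p <= 2), or lies in l^(p~) (p > 2), and for p <= 2 it is compact iff beta
    tends to 0.  The same sequence measures the smoothness of the boundary values
    of g and the mixed norm of g'.  The constant pi for p = 1 comes from the
    Fejer-Riesz inequality with sharp constant, and the constant 2 from testing on
    (1 - r^2) / (1 - r z)^2, whose moments tend to 2 as r -> 1. *)
From HB Require Import structures.
Require Import Defs.
Import Order.TTheory GRing.Theory Num.Theory.
Import numFieldNormedType.Exports.
From mathcomp Require Import zify ring lra measurable_realfun.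
Set Implicit Arguments.
Unset Strict Implicit.
Unset Printing Implicit Defensive.
Local Open Scope classical_set_scope.
Local Open Scope ring_scope.
Local Open Scope complex_scope.

(** * Complex numbers with a real-valued modulus *)

Section ComplexToolkit.
Context {R : realType}.
Implicit Types (z w : Cx R) (x y r : R).

(** Analyticity here is bare complex differentiability, so Parseval has to be earned: Goursat's
    theorem in the coordinate log z makes Fourier coefficients on circles scale with the radius, and
    Bessel's inequality then produces the power series. The weight 2^(k / p') is forced by scaling:
    on the ring 1 - t ~ 2^-k a function of norm 1 may reach size 2^(k / p), and a moment of order
    2^k integrates it over a length 2^-k. A ring j and a block k that do not match cost 2^(-eps |j -
    k|) with eps = min (1/p, 1 - 1/p), which degenerates at p = 1 and p = oo; these are treated
    apart. The exponent 2 separates the interior cases because l^p embeds in l^2 only for p <= 2.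
    For p > 2 Hoelder's inequality pairs l^(p/2) with l^(p~/2), and the small tails of a convergent
    sum give compactness at once. The main obstacle is that mean Lipschitz spaces are defined by
    non-tangential limits. Their existence almost everywhere is Fatou's theorem, proved from a
    weak-type bound in Stolz angles, and norms of boundary values are computed through lower limits
    along radii, which are measurable functions. *)

Definition rc (r : R) : Cx R := r%:C.
Definition cconj (z : Cx R) : Cx R := conjc z.
Definition ei (x : R) : Cx R := cos x +i* sin x.

Lemma cmodE z : `|z| = (cmod z)%:C. Proof. by case: z. Qed.
Lemma cmod_ge0 z : 0 <= cmod z. Proof. by case: z => a b; exact: sqrtr_ge0. Qed.
Lemma cmodM z w : cmod (z * w) = cmod z * cmod w.
Proof. exact: Normc.normcM. Qed.
Lemma cmodD z w : cmod (z + w) <= cmod z + cmod w.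
Proof. exact: le_normcD. Qed.
Lemma cmodN z : cmod (- z) = cmod z. Proof. exact: normcN. Qed.
Lemma cmodB z w : cmod (z - w) <= cmod z + cmod w.
Proof. by rewrite -(cmodN w) cmodD. Qed.
Lemma cmodC z w : cmod (z - w) = cmod (w - z).
Proof. by rewrite -cmodN opprB. Qed.
Lemma cmod0 : cmod (0 : Cx R) = 0. Proof. exact: Normc.normc0. Qed.
Lemma cmod1 : cmod (1 : Cx R) = 1. Proof. exact: Normc.normc1. Qed.
Lemma cmod_eq0 z : (cmod z == 0) = (z == 0).
Proof.
apply/eqP/eqP => [|->]; [exact: Normc.eq0_normc|exact: cmod0].
Qed.
Lemma cmod_gt0 z : (0 < cmod z) = (z != 0).
Proof. by rewrite lt_neqAle cmod_ge0 andbT eq_sym cmod_eq0. Qed.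
Lemma cmodV z : cmod z^-1 = (cmod z)^-1. Proof. exact: Normc.normcV. Qed.
Lemma cmodX z n : cmod (z ^+ n) = cmod z ^+ n.
Proof. by elim: n => [|n IH]; rewrite ?cmod1// !exprS cmodM IH. Qed.
Lemma cmod_rc r : cmod (rc r) = `|r|.
Proof. by rewrite /cmod /= expr0n /= addr0 sqrtr_sqr. Qed.
Lemma cmod_sq z : cmod z ^+ 2 = complex.Re z ^+ 2 + complex.Im z ^+ 2.
Proof. by case: z => a b; rewrite /cmod /= sqr_sqrtr// addr_ge0// sqr_ge0. Qed.
Lemma cmod_triangle z w y : cmod (z - w) <= y -> cmod z <= cmod w + y.
Proof.
by move=> h; rewrite -{1}(subrK w z) addrC (le_trans (cmodD _ _))// lerD2l.
Qed.
Lemma cmod_sum (I : Type) (s : seq I) (P : pred I) (F : I -> Cx R) :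
  cmod (\sum_(i <- s | P i) F i) <= \sum_(i <- s | P i) cmod (F i).
Proof.
elim/big_ind2: _ => [|a b c d h1 h2|//]; first by rewrite cmod0.
by rewrite (le_trans (cmodD _ _))// lerD.
Qed.

Lemma normRe_le z : `|complex.Re z| <= cmod z.
Proof.
case: z => a b; rewrite /cmod /= -sqrtr_sqr ler_wsqrtr//.
by rewrite lerDl sqr_ge0.
Qed.
Lemma normIm_le z : `|complex.Im z| <= cmod z.
Proof.
case: z => a b; rewrite /cmod /= -sqrtr_sqr ler_wsqrtr//.
by rewrite lerDr sqr_ge0.
Qed.
Lemma cmod_le_ReIm z : cmod z <= `|complex.Re z| + `|complex.Im z|.
Proof.
case: z => a b; rewrite /= -[leRHS]ger0_norm ?addr_ge0// -sqrtr_sqr.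
rewrite /cmod /= ler_wsqrtr// sqrrD !real_normK ?num_real//.
by rewrite -addrA [_ *+ 2 + _]addrC addrA lerDl mulrn_wge0// mulr_ge0.
Qed.

Lemma CReD z w : complex.Re (z + w) = complex.Re z + complex.Re w.
Proof. by case: z; case: w. Qed.
Lemma CImD z w : complex.Im (z + w) = complex.Im z + complex.Im w.
Proof. by case: z; case: w. Qed.
Lemma CReN z : complex.Re (- z) = - complex.Re z. Proof. by case: z. Qed.
Lemma CImN z : complex.Im (- z) = - complex.Im z. Proof. by case: z. Qed.
Lemma CReM z w : complex.Re (z * w) =
  complex.Re z * complex.Re w - complex.Im z * complex.Im w.
Proof. by case: z; case: w. Qed.
Lemma CImM z w : complex.Im (z * w) =
  complex.Re z * complex.Im w + complex.Im z * complex.Re w.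
Proof. by case: z => a b; case: w => c d. Qed.
Lemma eq_ReIm z w : complex.Re z = complex.Re w ->
  complex.Im z = complex.Im w -> z = w.
Proof. by case: z; case: w => a b c d /= -> ->. Qed.

Lemma rcD x y : rc (x + y) = rc x + rc y. Proof. exact: rmorphD. Qed.
Lemma rcB x y : rc (x - y) = rc x - rc y. Proof. exact: rmorphB. Qed.
Lemma rcM x y : rc (x * y) = rc x * rc y. Proof. exact: rmorphM. Qed.
Lemma rcX x n : rc (x ^+ n) = rc x ^+ n. Proof. exact: rmorphXn. Qed.
Lemma rcV x : rc x^-1 = (rc x)^-1. Proof. exact: fmorphV. Qed.
Lemma rc0 : rc 0 = 0. Proof. by []. Qed.
Lemma rc1 : rc 1 = 1. Proof. by []. Qed.
Lemma rcn n : rc n%:R = n%:R. Proof. exact: rmorph_nat. Qed.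
Lemma rc_eq0 x : (rc x == 0) = (x == 0). Proof. exact: fmorph_eq0. Qed.
Lemma rc_inj : injective rc. Proof. by move=> x y []. Qed.
Lemma rc_sum (I : Type) (s : seq I) (P : pred I) (F : I -> R) :
  rc (\sum_(i <- s | P i) F i) = \sum_(i <- s | P i) rc (F i).
Proof. exact: rmorph_sum. Qed.

Lemma cmod_cconj z : cmod (cconj z) = cmod z.
Proof. by case: z => a b; rewrite /cmod /= sqrrN. Qed.
Lemma mul_cconj z : z * cconj z = rc (cmod z ^+ 2).
Proof.
by apply: eq_ReIm; rewrite ?CReM ?CImM ?cmod_sq; case: z => a b /=;
  [rewrite mulrN opprK !expr2|rewrite mulrN mulrC addNr].
Qed.
Lemma cconjB z w : cconj (z - w) = cconj z - cconj w. Proof. exact: rmorphB. Qed.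
Lemma cconjM z w : cconj (z * w) = cconj z * cconj w. Proof. exact: rmorphM. Qed.
Lemma cconj_rc x : cconj (rc x) = rc x.
Proof. by rewrite /cconj /rc /= oppr0. Qed.
Lemma cconjK z : cconj (cconj z) = z. Proof. exact: conjcK. Qed.
Lemma cconj_sum (I : Type) (s : seq I) (P : pred I) (F : I -> Cx R) :
  cconj (\sum_(i <- s | P i) F i) = \sum_(i <- s | P i) cconj (F i).
Proof. exact: rmorph_sum. Qed.

Lemma eiD x y : ei (x + y) = ei x * ei y.
Proof.
apply: eq_ReIm; rewrite ?CReM ?CImM /= ?cosD ?sinD//.
by rewrite addrC.
Qed.
Lemma ei0 : ei 0 = 1. Proof. by rewrite /ei cos0 sin0. Qed.
Lemma cmod_ei x : cmod (ei x) = 1.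
Proof. by rewrite /cmod /= cos2Dsin2 sqrtr1. Qed.
Lemma ei_neq0 x : ei x != 0. Proof. by rewrite -cmod_gt0 cmod_ei. Qed.
Lemma eiN x : ei (- x) = cconj (ei x).
Proof. by rewrite /ei /cconj /= cosN sinN. Qed.
Lemma ei_2pi : ei (2 * pi) = 1.
Proof. by rewrite /ei mulrC mulr_natr cos2pi sin2pi. Qed.
Lemma ei_period x : ei (x + 2 * pi) = ei x.
Proof. by rewrite eiD ei_2pi mulr1. Qed.
Lemma ei_mulrn x n : ei (n%:R * x) = ei x ^+ n.
Proof.
elim: n => [|n IH]; first by rewrite mul0r ei0.
by rewrite -addn1 natrD mulrDl mul1r eiD IH addn1 exprSr.
Qed.
Lemma ei_mulVr x : ei (- x) * ei x = 1.
Proof. by rewrite -eiD addNr ei0. Qed.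
Lemma ei_mulrV x : ei x * ei (- x) = 1.
Proof. by rewrite -eiD addrN ei0. Qed.
Lemma circleE r x : circle r x = rc r * ei x.
Proof. by rewrite /circle; apply: eq_ReIm; rewrite ?CReM ?CImM /= !mul0r ?subr0 ?addr0. Qed.
Lemma cmod_circle r x : cmod (circle r x) = `|r|.
Proof. by rewrite circleE cmodM cmod_rc cmod_ei mulr1. Qed.

(** The argument is [acos] of the normalised real part, and the sign of the imaginary part decides
    between it and its opposite. *)
Lemma polar z : exists x, z = rc (cmod z) * ei x.
Proof.
have [->|z0] := eqVneq z 0; first by exists 0; rewrite cmod0 mul0r.
have c0 : 0 < cmod z by rewrite cmod_gt0.
set a := complex.Re z / cmod z; set b := complex.Im z / cmod z.
have ab : a ^+ 2 + b ^+ 2 = 1.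
  by rewrite /a /b !exprMn -mulrDl -cmod_sq -exprMn divff ?expr1n ?gt_eqF.
have ha : -1 <= a <= 1.
  rewrite -ler_norml -(@ler_pXn2r _ 2)// ?nnegrE// expr1n real_normK ?num_real//.
  by rewrite -ab lerDl sqr_ge0.
have zE x : cos x = a -> sin x = b -> z = rc (cmod z) * ei x.
  move=> h1 h2; apply: eq_ReIm; rewrite ?CReM ?CImM /= h1 h2 mul0r ?subr0 ?addr0.
    by rewrite /a mulrC divfK ?gt_eqF.
  by rewrite /b mulrC divfK ?gt_eqF.
have sE : sin (acos a) = `|b|.
  by rewrite sin_acos// -ab addrAC subrr add0r sqrtr_sqr.
have [b0|b0] := leP 0 b.
  by exists (acos a); apply: zE; [rewrite acosK|rewrite sE ger0_norm].
exists (- acos a); apply: zE; first by rewrite cosN acosK.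
by rewrite sinN sE ltr0_norm// opprK.
Qed.

(** Balls of [Cx R] have radii in [R[i]], and positivity there forces the radius to be real; from
    here on limits are handled with a real epsilon. *)
Lemma nbhsC_P (P : set (Cx R)) z : nbhs z P <->
  exists2 d : R, 0 < d & forall w, cmod (w - z) < d -> P w.
Proof.
apply: (iff_trans (nbhs_ballP _ _)); split.
  case=> e /= e0 he; have [er ei'] : e = rc (complex.Re e) /\ 0 < complex.Re e.
    case: e e0 he => a b; rewrite ltcE /= => /andP[/eqP -> a0] _; split => //.
  exists (complex.Re e) => // w hw; apply: he.
  by rewrite -ball_normE /= er distrC cmodE ltcR.
case=> d d0 h; exists (rc d); first by rewrite /= ltcR.
move=> w; rewrite -ball_normE /= distrC cmodE ltcR => hw.
exact: h.
Qed.

Lemma cvgC_P (T : Type) (F : set_system T) {FF : Filter F} (u : T -> Cx R) (l : Cx R) :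
  u x @[x --> F] --> l <->
  forall e : R, 0 < e -> \forall x \near F, cmod (u x - l) <= e.
Proof.
split.
  move=> /cvgrPdist_le h e e0.
  have /h : 0 < rc e by rewrite ltcR.
  by apply: filterS => x; rewrite distrC cmodE lecR.
move=> h; apply/cvgrPdist_le => e.
case: e => a b; rewrite ltcE /= => /andP[/eqP -> a0].
by have := h _ a0; apply: filterS => x; rewrite distrC cmodE lecR.
Qed.

Lemma continuous_cmod_comp (T : topologicalType) (u : T -> Cx R) (x : T) :
  {for x, continuous u} -> {for x, continuous (fun t => cmod (u t))}.
Proof.
move=> /cvgC_P h; apply/cvgrPdist_le => e e0.
apply: filterS (h e e0) => y hy.
have h1 := cmod_triangle hy.
have h2 : cmod (u x) <= cmod (u y) + e by apply: cmod_triangle; rewrite cmodC.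
by rewrite ler_norml; apply/andP; split; lra.
Qed.

Lemma continuous_Re_comp (T : topologicalType) (u : T -> Cx R) (x : T) :
  {for x, continuous u} -> {for x, continuous (fun t => complex.Re (u t))}.
Proof.
move=> /cvgC_P h; apply/cvgrPdist_le => e e0.
apply: filterS (h e e0) => y hy.
by rewrite -CReN -CReD (le_trans (normRe_le _))// cmodC.
Qed.

Lemma continuous_Im_comp (T : topologicalType) (u : T -> Cx R) (x : T) :
  {for x, continuous u} -> {for x, continuous (fun t => complex.Im (u t))}.
Proof.
move=> /cvgC_P h; apply/cvgrPdist_le => e e0.
apply: filterS (h e e0) => y hy.
by rewrite -CImN -CImD (le_trans (normIm_le _))// cmodC.
Qed.

Lemma continuous_complex (T : topologicalType) (a b : T -> R) (x : T) :
  {for x, continuous a} -> {for x, continuous b} ->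
  {for x, continuous (fun t => (a t +i* b t) : Cx R)}.
Proof.
move=> /cvgrPdist_le ha /cvgrPdist_le hb; apply/cvgC_P => e e0.
have e2 : 0 < e / 2 by rewrite divr_gt0.
near=> y; apply: le_trans (cmod_le_ReIm _) _; rewrite /= (splitr e) lerD//.
  by rewrite distrC; near: y; exact: ha.
by rewrite distrC; near: y; exact: hb.
Unshelve. all: by end_near. Qed.

Lemma continuous_rc_comp (T : topologicalType) (a : T -> R) (x : T) :
  {for x, continuous a} -> {for x, continuous (fun t => rc (a t))}.
Proof. by move=> h; apply: continuous_complex h (cvg_cst _). Qed.

Lemma continuous_cconj_comp (T : topologicalType) (u : T -> Cx R) (x : T) :
  {for x, continuous u} -> {for x, continuous (fun t => cconj (u t))}.
Proof.
move=> /cvgC_P h; apply/cvgC_P => e e0.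
by apply: filterS (h e e0) => y; rewrite -cconjB cmod_cconj.
Qed.

Lemma continuous_ei x : {for x, continuous ei}.
Proof. by apply: continuous_complex; [exact: continuous_cos|exact: continuous_sin]. Qed.

(** Clearing the denominator h turns the limit of difference quotients into a linear error bound
    that also makes sense at h = 0, the form in which Goursat's theorem and power series use it. *)
Lemma derivable_cmodP (f : Cx R -> Cx R) z : derivable f z 1 <->
  exists l : Cx R, forall e : R, 0 < e -> exists2 d : R, 0 < d &
    forall h, cmod h < d -> cmod (f (z + h) - f z - l * h) <= e * cmod h.
Proof.
split.
  move=> /cvg_ex[l /= hl]; exists l => e e0.
  have [d d0 hd] := (nbhsC_P _ _).1 ((cvgC_P _ _).1 hl e e0).
  exists d => // h hlt; have [->|h0] := eqVneq h 0.
    by rewrite addr0 subrr mulr0 subr0 cmod0 mulr0.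
  have := hd h; rewrite subr0 => /(_ hlt h0) /=.
  rewrite [h *: 1]mulr1 /= [h + z]addrC => H.
  have -> : f (z + h) - f z - l * h = (h^-1 *: (f (z + h) - f z) - l) * h.
    rewrite mulrBl; congr (_ - _).
    by rewrite /GRing.scale /= mulrAC mulVf// mul1r.
  by rewrite cmodM ler_wpM2r ?cmod_ge0.
case=> l hl; apply/cvg_ex; exists l; apply/cvgC_P => e e0.
have [d d0 hd] := hl e e0; apply/nbhsC_P; exists d => // h.
rewrite subr0 => hlt h0; rewrite /= [h *: 1]mulr1 [h + z]addrC.
have := hd h hlt.
have -> : f (z + h) - f z - l * h = (h^-1 *: (f (z + h) - f z) - l) * h.
  rewrite mulrBl; congr (_ - _).
  by rewrite /GRing.scale /= mulrAC mulVf// mul1r.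
by rewrite cmodM ler_pM2r// cmod_gt0.
Qed.

Lemma cderiv_cmodP (f : Cx R -> Cx R) z (l : Cx R) :
  (forall e : R, 0 < e -> exists2 d : R, 0 < d &
    forall h, cmod h < d -> cmod (f (z + h) - f z - l * h) <= e * cmod h) ->
  cderiv f z = l.
Proof.
move=> hl; rewrite /cderiv derive1E; apply/cvg_lim => //; apply/cvgC_P => e e0.
have [d d0 hd] := hl e e0; apply/nbhsC_P; exists d => // h.
rewrite subr0 => hlt h0; rewrite /= [h *: 1]mulr1 [h + z]addrC.
have := hd h hlt.
have -> : f (z + h) - f z - l * h = (h^-1 *: (f (z + h) - f z) - l) * h.
  rewrite mulrBl; congr (_ - _).
  by rewrite /GRing.scale /= mulrAC mulVf// mul1r.
by rewrite cmodM ler_pM2r// cmod_gt0.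
Qed.

Lemma derivable_continuousC (f : Cx R -> Cx R) z :
  derivable f z 1 -> {for z, continuous f}.
Proof. by move=> /derivable1_diffP; exact: differentiable_continuous. Qed.

Lemma continuous_comp_derivable (T : topologicalType) (f : Cx R -> Cx R)
    (u : T -> Cx R) (x : T) :
  {for x, continuous u} -> derivable f (u x) 1 ->
  {for x, continuous (fun t => f (u t))}.
Proof.
move=> hu /derivable_continuousC /cvgC_P hf; apply/cvgC_P => e /hf.
by move/hu.
Qed.

Section Pointwise.
Context {T : topologicalType} (u v : T -> Cx R) (x : T).
Hypotheses (hu : {for x, continuous u}) (hv : {for x, continuous v}).

Lemma contC_cst (c : Cx R) : {for x, continuous (fun _ : T => c)}.
Proof. exact: cvg_cst. Qed.
Lemma contC_add : {for x, continuous (fun t => u t + v t)}.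
Proof. exact: cvgD hu hv. Qed.
Lemma contC_sub : {for x, continuous (fun t => u t - v t)}.
Proof. exact: cvgB hu hv. Qed.
Lemma contC_mul : {for x, continuous (fun t => u t * v t)}.
Proof. exact: (cvgM hu hv). Qed.
Lemma contC_inv : u x != 0 -> {for x, continuous (fun t => (u t)^-1)}.
Proof. by move=> h; exact: (cvgV h hu). Qed.
End Pointwise.

Lemma contC_exp (T : topologicalType) (u : T -> Cx R) (x : T) n :
  {for x, continuous u} -> {for x, continuous (fun t => u t ^+ n)}.
Proof.
move=> hu; elim: n => [|n IH]; first exact: contC_cst.
rewrite (_ : (fun t => _) = (fun t => u t * u t ^+ n)); first exact: contC_mul.
by apply/funext => t; rewrite exprS.
Qed.

Lemma contC_sum (T : topologicalType) (I : Type) (s : seq I) (P : pred I)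
    (F : I -> T -> Cx R) (x : T) :
  (forall i, {for x, continuous (F i)}) ->
  {for x, continuous (fun t => \sum_(i <- s | P i) F i t)}.
Proof.
move=> hF; elim: s => [|i s IH].
  rewrite (_ : (fun t => _) = (fun _ => 0)); first exact: contC_cst.
  by apply/funext => t; rewrite big_nil.
rewrite (_ : (fun t => _) = (fun t => (if P i then F i t else 0) +
    \sum_(i <- s | P i) F i t)).
  apply: contC_add; last exact: IH.
  by case: (P i); [exact: hF|exact: contC_cst].
by apply/funext => t; rewrite big_cons; case: (P i); rewrite ?add0r.
Qed.

Lemma continuous_circle r x : {for x, continuous (circle r : R -> Cx R)}.
Proof.
have -> : circle r = (fun t => rc r * ei t) by apply/funext => t; rewrite circleE.
by apply: contC_mul; [exact: contC_cst|exact: continuous_ei].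
Qed.

End ComplexToolkit.
#[global] Hint Extern 0 (is_true (0 <= cmod _)) => (exact: cmod_ge0) : core.
Arguments cmod {R} z : simpl never.
Arguments ei {R} x : simpl never.
Arguments rc {R} r : simpl never.
Arguments cconj {R} z : simpl never.

(** * Integrals of continuous functions over compact intervals *)

HB.lock Definition rint {R : realType} (a b : R) (f : R -> R) : R :=
  \int[@lebesgue_measure R]_(x in `[a, b]) f x.

Section Integrals.
Context {R : realType}.
Implicit Types (f g : R -> R) (u v : R -> Cx R) (a b c : R).
Local Notation mu := (@lebesgue_measure R).

(** Continuity is two-sided even at the end points, since the integrands extend past the interval;
    integrability then follows from compactness. *)
Definition rcontI a b f := forall x, a <= x <= b -> {for x, continuous f}.
Definition ccontI a b u := forall x, a <= x <= b -> {for x, continuous u}.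
Definition cint a b u : Cx R :=
  rint a b (fun x => complex.Re (u x)) +i* rint a b (fun x => complex.Im (u x)).

Lemma rcontI_integrable a b f : rcontI a b f ->
  mu.-integrable `[a, b] (EFin \o f).
Proof.
move=> hf; apply: continuous_compact_integrable; first exact: segment_compact.
apply: continuous_in_subspaceT => x; rewrite inE /= in_itv /= => xab.
exact: hf.
Qed.

Lemma ccontI_Re a b u : ccontI a b u -> rcontI a b (fun x => complex.Re (u x)).
Proof. by move=> h x /h; exact: continuous_Re_comp. Qed.
Lemma ccontI_Im a b u : ccontI a b u -> rcontI a b (fun x => complex.Im (u x)).
Proof. by move=> h x /h; exact: continuous_Im_comp. Qed.
Lemma ccontI_cmod a b u : ccontI a b u -> rcontI a b (fun x => cmod (u x)).
Proof. by move=> h x /h; exact: continuous_cmod_comp. Qed.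

Lemma eq_rint a b f g : (forall x, a <= x <= b -> f x = g x) ->
  rint a b f = rint a b g.
Proof.
by move=> h; rewrite rint.unlock; apply: eq_Rintegral => x; rewrite inE /= in_itv /= => /h.
Qed.

Lemma mu_itvcc a b : a <= b -> mu `[a, b] = (b - a)%:E.
Proof.
rewrite lebesgue_measure_itv /= lte_fin le_eqVlt => /orP[/eqP ->|->//].
by rewrite ltxx subrr.
Qed.

Lemma rint_cst a b c : a <= b -> rint a b (fun=> c) = c * (b - a).
Proof.
move=> ab; rewrite rint.unlock Rintegral_cst//.
by have /= -> := mu_itvcc ab.
Qed.

Lemma rintD a b f g : rcontI a b f -> rcontI a b g ->
  rint a b (fun x => f x + g x) = rint a b f + rint a b g.
Proof. by move=> hf hg; rewrite rint.unlock RintegralD//; exact: rcontI_integrable. Qed.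
Lemma rintB a b f g : rcontI a b f -> rcontI a b g ->
  rint a b (fun x => f x - g x) = rint a b f - rint a b g.
Proof. by move=> hf hg; rewrite rint.unlock RintegralB//; exact: rcontI_integrable. Qed.
Lemma rintZ a b k f : rcontI a b f ->
  rint a b (fun x => k * f x) = k * rint a b f.
Proof. by move=> hf; rewrite rint.unlock RintegralZl//; exact: rcontI_integrable. Qed.
Lemma le_rint a b f g : rcontI a b f -> rcontI a b g ->
  (forall x, a <= x <= b -> f x <= g x) -> rint a b f <= rint a b g.
Proof.
move=> hf hg h; rewrite rint.unlock; apply: le_Rintegral => //; exact: rcontI_integrable.
Qed.
Lemma rint_ge0 a b f : (forall x, a <= x <= b -> 0 <= f x) -> 0 <= rint a b f.
Proof. by move=> h; rewrite rint.unlock; apply: Rintegral_ge0 => x /=; rewrite in_itv /=; exact: h. Qed.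

Lemma rint_split a b c f : a <= c <= b -> rcontI a b f ->
  rint a b f = rint a c f + rint c b f.
Proof.
move=> /andP[ac cb] hf.
have hi := rcontI_integrable hf.
rewrite rint.unlock -(@Rintegral_itv_obnd_cbnd R c); last first.
  by apply: integrableS hi => //; apply: subset_itv; rewrite bnd_simp.
rewrite -Rintegral_setU//.
- by rewrite -itv_bndbnd_setU// bnd_simp.
- by rewrite -itv_bndbnd_setU// bnd_simp.
- apply/disj_setPS => x [] /=; rewrite !in_itv /= => /andP[_ h1] /andP[h2 _].
  by move: (lt_le_trans h2 h1); rewrite ltxx.
Qed.

Lemma rint_FTC a b f F : a <= b -> rcontI a b f ->
  (forall x : R, is_derive x 1 F (f x)) -> rint a b f = F b - F a.
Proof.
rewrite le_eqVlt => /orP[/eqP <-|ab] hf hF.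
  by rewrite subrr rint.unlock set_itv1 Rintegral_set1.
have cF x : {for x, continuous F}.
  by have [/derivable1_diffP + _] := hF x; exact: differentiable_continuous.
rewrite rint.unlock /Rintegral (continuous_FTC2 ab (f := f) (F := F)) //.
- apply: continuous_in_subspaceT => x; rewrite inE /= in_itv /= => xab.
  exact: hf.
- split; first by move=> x _; have [] := hF x.
  + exact/cvg_at_right_filter/cF.
  + exact/cvg_at_left_filter/cF.
- by move=> x _; rewrite derive1E; apply: derive_val.
Qed.

Lemma cintE a b u v : (forall x, a <= x <= b -> u x = v x) ->
  cint a b u = cint a b v.
Proof. by move=> h; rewrite /cint; congr (_ +i* _); apply: eq_rint => x /h ->. Qed.

Lemma cint_cst a b (k : Cx R) : a <= b -> cint a b (fun=> k) = rc (b - a) * k.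
Proof.
move=> ab; rewrite /cint !rint_cst//.
by apply: eq_ReIm; rewrite ?CReM ?CImM /= mul0r ?subr0 ?addr0 mulrC.
Qed.

Lemma cintD a b u v : ccontI a b u -> ccontI a b v ->
  cint a b (fun x => u x + v x) = cint a b u + cint a b v.
Proof.
move=> hu hv; apply: eq_ReIm; rewrite ?CReD ?CImD /= -rintD.
- by apply: eq_rint => x _; rewrite CReD.
- exact: ccontI_Re.
- exact: ccontI_Re.
- by apply: eq_rint => x _; rewrite CImD.
- exact: ccontI_Im.
- exact: ccontI_Im.
Qed.

Lemma ccontI_mul a b u v : ccontI a b u -> ccontI a b v ->
  ccontI a b (fun x => u x * v x).
Proof. by move=> hu hv x hx; apply: contC_mul; [exact: hu|exact: hv]. Qed.
Lemma ccontI_sub a b u v : ccontI a b u -> ccontI a b v ->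
  ccontI a b (fun x => u x - v x).
Proof. by move=> hu hv x hx; apply: contC_sub; [exact: hu|exact: hv]. Qed.
Lemma ccontI_cst a b (k : Cx R) : ccontI a b (fun=> k).
Proof. by move=> x _; exact: contC_cst. Qed.
Lemma ccontI_exp a b u n : ccontI a b u -> ccontI a b (fun x => u x ^+ n).
Proof. by move=> hu x /hu; exact: contC_exp. Qed.

Lemma cintZ a b (k : Cx R) u : ccontI a b u ->
  cint a b (fun x => k * u x) = k * cint a b u.
Proof.
move=> hu.
have hR := ccontI_Re hu; have hI := ccontI_Im hu.
have cR (r : R) f : rcontI a b f -> rcontI a b (fun x => r * f x).
  by move=> hf x /hf h; exact: (cvgM (cvg_cst r) h).
apply: eq_ReIm; rewrite ?CReM ?CImM /= -!rintZ//.
  by rewrite -rintB; [apply: eq_rint => x _; rewrite CReM|exact: cR|exact: cR].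
by rewrite -rintD; [apply: eq_rint => x _; rewrite CImM|exact: cR|exact: cR].
Qed.

Lemma ccontI_opp a b u : ccontI a b u -> ccontI a b (fun x => - u x).
Proof.
move=> hu; have -> : (fun x => - u x) = (fun x => (0 : Cx R) - u x).
  by apply/funext => x; rewrite sub0r.
by apply: ccontI_sub; [exact: ccontI_cst|exact: hu].
Qed.
Lemma cintN a b u : ccontI a b u -> cint a b (fun x => - u x) = - cint a b u.
Proof.
move=> hu; have := cintZ (-1) hu; rewrite mulN1r => <-.
by apply: cintE => x _; rewrite mulN1r.
Qed.
Lemma cintB a b u v : ccontI a b u -> ccontI a b v ->
  cint a b (fun x => u x - v x) = cint a b u - cint a b v.
Proof.
move=> hu hv; rewrite (cintD hu (ccontI_opp hv)); congr (_ + _).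
exact: cintN.
Qed.

Lemma cint_sum a b (I : Type) (s : seq I) (P : pred I) (F : I -> R -> Cx R) :
  (forall i, ccontI a b (F i)) -> a <= b ->
  cint a b (fun x => \sum_(i <- s | P i) F i x) = \sum_(i <- s | P i) cint a b (F i).
Proof.
move=> hF ab; elim: s => [|i s IH].
  rewrite big_nil -[RHS](mulr0 (rc (b - a))) -cint_cst//.
  by apply: cintE => x _; rewrite big_nil.
rewrite big_cons -IH; case: ifP => Pi.
  rewrite -cintD//; first by apply: cintE => x _; rewrite big_cons Pi.
  by move=> x hx; apply: contC_sum => j; exact: hF.
by apply: cintE => x _; rewrite big_cons Pi.
Qed.

Lemma cint_split a b c u : a <= c <= b -> ccontI a b u ->
  cint a b u = cint a c u + cint c b u.
Proof.
move=> h hu; apply: eq_ReIm; rewrite ?CReD ?CImD /= -rint_split//.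
  exact: ccontI_Re.
exact: ccontI_Im.
Qed.

(* Rotating the integral onto the positive axis gives the constant 1. *)
Lemma cmod_cint a b u : ccontI a b u ->
  cmod (cint a b u) <= rint a b (fun x => cmod (u x)).
Proof.
move=> hu; have [x hx] := polar (cint a b u).
have -> : cmod (cint a b u) = complex.Re (ei (- x) * cint a b u).
  by rewrite {2}hx mulrCA ei_mulVr mulr1.
rewrite -cintZ//; apply: le_rint.
- apply: ccontI_Re; apply: ccontI_mul; [exact: ccontI_cst|exact: hu].
- exact: ccontI_cmod.
- move=> y _; apply: le_trans (ler_norm _) _; apply: le_trans (normRe_le _) _.
  by rewrite cmodM cmod_ei mul1r.
Qed.

Lemma cmod_cint_bound a b u M : a <= b -> ccontI a b u ->
  (forall x, a <= x <= b -> cmod (u x) <= M) ->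
  cmod (cint a b u) <= M * (b - a).
Proof.
move=> ab hu h; apply: le_trans (cmod_cint hu) _; rewrite -rint_cst//.
apply: le_rint => //; first exact: ccontI_cmod.
by move=> x _; exact: cvg_cst.
Qed.

Lemma rint_bounded a b f : a <= b -> rcontI a b f ->
  exists2 M, 0 <= M & forall x, a <= x <= b -> `|f x| <= M.
Proof.
move=> ab hf.
have cf : {within `[a, b], continuous (fun x => `|f x|)}.
  apply: continuous_in_subspaceT => x; rewrite inE /= in_itv /= => xab.
  by apply: cvg_norm; exact: hf.
have [x _ hx] := EVT_max ab cf.
by exists `|f x| => // y hy; apply: hx; rewrite in_itv.
Qed.

Lemma cint_bounded a b u : a <= b -> ccontI a b u ->
  exists2 M, 0 <= M & forall x, a <= x <= b -> cmod (u x) <= M.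
Proof.
move=> ab /ccontI_cmod hu; have [M M0 h] := rint_bounded ab hu.
by exists M => // x /h; rewrite ger0_norm.
Qed.

Lemma ccontI_ei a b k : ccontI a b (fun x => ei (k * x)).
Proof.
move=> x _; apply: continuous_complex.
  apply: (@continuous_comp _ _ _ (fun x => k * x) cos); last exact: continuous_cos.
  exact: mulrl_continuous.
apply: (@continuous_comp _ _ _ (fun x => k * x) sin); last exact: continuous_sin.
exact: mulrl_continuous.
Qed.

(** The primitives sin (k x) / k and - cos (k x) / k take equal values at both ends because k is an
    integer. *)
Lemma cint_ei a (k : int) : k != 0 ->
  cint a (a + 2 * pi) (fun x => ei (k%:~R * x)) = 0.
Proof.
move=> k0; have k0' : (k%:~R : R) != 0 by rewrite intr_eq0.
have ab : a <= a + 2 * pi by rewrite lerDl mulr_ge0// pi_ge0.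
set b := a + 2 * pi in ab *.
have e : ei (k%:~R * b) = ei (k%:~R * a).
  rewrite /b mulrDr eiD [ei (_ * (2 * pi))](_ : _ = 1) ?mulr1//.
  case: k {k0 k0' b ab} => n; first by rewrite -pmulrn ei_mulrn ei_2pi expr1n.
  by rewrite NegzE mulrNz -pmulrn mulNr eiN ei_mulrn ei_2pi expr1n cconj_rc.
move: e => [eC eS].
have hc := @ccontI_ei a b k%:~R.
have dk (x : R) : is_derive x 1 (fun x : R => k%:~R * x) (k%:~R : R).
  by apply: is_derive_eq; rewrite /GRing.scale /= mulr1 // mulr0 add0r.
have dS (x : R) : is_derive x 1 (fun x : R => k%:~R^-1 * sin (k%:~R * x)) (cos (k%:~R * x)).
  have d2 := @is_derive1_comp _ sin (fun x : R => k%:~R * x) x _ _ (is_derive_sin _) (dk x).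
  rewrite (_ : (fun x => _) = k%:~R^-1 \*: (sin \o (fun x : R => k%:~R * x)))//.
  by apply: is_derive_eq; rewrite /GRing.scale /=; field.
have dC (x : R) : is_derive x 1 (fun x : R => - (k%:~R^-1 * cos (k%:~R * x))) (sin (k%:~R * x)).
  have d2 := @is_derive1_comp _ cos (fun x : R => k%:~R * x) x _ _ (is_derive_cos _) (dk x).
  rewrite (_ : (fun x => _) = (- k%:~R^-1) \*: (cos \o (fun x : R => k%:~R * x))); last first.
    by apply/funext => y; rewrite -mulNr.
  by apply: is_derive_eq; rewrite /GRing.scale /=; field.
rewrite /cint (rint_FTC ab (ccontI_Re hc) dS) (rint_FTC ab (ccontI_Im hc) dC).
by rewrite eC eS !subrr.
Qed.

End Integrals.
Arguments cint {R} a b u : simpl never.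

(** * Goursat's theorem for rectangles *)

Section Goursat.
Context {R : realType}.
Implicit Types (F : Cx R -> Cx R) (a b c d x y : R).

Definition ii : Cx R := 0 +i* 1.
Definition pt x y : Cx R := x +i* y.

Lemma iiM : ii * ii = -1.
Proof. by apply: eq_ReIm; rewrite ?CReM ?CImM /= ?mul0r ?mulr0 ?mulr1 ?add0r ?addr0 ?oppr0. Qed.
Lemma cmod_ii : cmod ii = 1.
Proof. by rewrite /cmod /= expr0n expr1n /= add0r sqrtr1. Qed.
Lemma ptE x y : pt x y = rc x + ii * rc y.
Proof. by apply: eq_ReIm; rewrite ?CReD ?CImD ?CReM ?CImM /= ?mul0r ?mulr0 ?mul1r ?subr0 ?addr0 ?add0r. Qed.

Definition hseg F a b y : Cx R := cint a b (fun x => F (pt x y)).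
Definition vseg F c d x : Cx R := cint c d (fun y => F (pt x y)).
(** The contour integral of F along the boundary, counterclockwise: dz is dx on the horizontal sides
    and i dy on the vertical ones. *)
Definition rect F a b c d : Cx R :=
  hseg F a b c + ii * vseg F c d b - hseg F a b d - ii * vseg F c d a.

Definition in_rect a b c d (P : R -> R -> Prop) :=
  forall x y, a <= x <= b -> c <= y <= d -> P x y.

Lemma continuous_pt_l x y : {for x, continuous (fun x => pt x y)}.
Proof. by apply: continuous_complex; [exact: cvg_id|exact: cvg_cst]. Qed.
Lemma continuous_pt_r x y : {for y, continuous (fun y => pt x y)}.
Proof. by apply: continuous_complex; [exact: cvg_cst|exact: cvg_id]. Qed.

Definition crect F a b c d := in_rect a b c d (fun x y => {for pt x y, continuous F}).

Lemma crect_h F a b c d y : crect F a b c d -> c <= y <= d ->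
  ccontI a b (fun x => F (pt x y)).
Proof.
move=> h hy x hx; apply: (@continuous_comp _ _ _ (fun x => pt x y) F).
  exact: continuous_pt_l.
exact: h.
Qed.
Lemma crect_v F a b c d x : crect F a b c d -> a <= x <= b ->
  ccontI c d (fun y => F (pt x y)).
Proof.
move=> h hx y hy; apply: (@continuous_comp _ _ _ (fun y => pt x y) F).
  exact: continuous_pt_r.
exact: h.
Qed.

Lemma rect_split F a b c d m n : crect F a b c d -> a <= m <= b -> c <= n <= d ->
  rect F a b c d = rect F a m c n + rect F m b c n + rect F a m n d + rect F m b n d.
Proof.
move=> h hm hn; have [/andP[am mb] /andP[cn nd]] := (hm, hn).
have ab := le_trans am mb; have cd := le_trans cn nd.
rewrite /rect /hseg /vseg.
rewrite (cint_split hm (crect_h h (_ : c <= c <= d))) ?lexx//.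
rewrite (cint_split hm (crect_h h (_ : c <= d <= d))) ?lexx ?andbT//.
rewrite (cint_split hn (crect_v h (_ : a <= a <= b))) ?lexx//.
rewrite (cint_split hn (crect_v h (_ : a <= b <= b))) ?lexx ?andbT//.
set i := ii; do ![set X := cint _ _ _; move: X => ?].
ring.
Qed.

Lemma cint_affine a b (p q : Cx R) : a <= b ->
  cint a b (fun x => p + q * rc x) =
  p * rc (b - a) + q * rc ((b ^+ 2 - a ^+ 2) / 2).
Proof.
move=> ab; have hid : ccontI a b rc.
  by move=> x _; apply: continuous_rc_comp; exact: cvg_id.
have hc := @ccontI_cst R a b.
rewrite (cintD (hc p) (ccontI_mul (hc q) hid)).
rewrite (cint_cst _ ab) (cintZ _ hid) mulrC; congr (_ + _ * _).
rewrite /cint rint_cst// mul0r.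
have hF (x : R) : is_derive x 1 (fun x : R => x ^+ 2 / 2) x.
  rewrite (_ : (fun x => _) = 2^-1 \*: (fun x : R => x ^+ 2)); last first.
    by apply/funext => y; rewrite mulrC.
  by apply: is_derive_eq; rewrite /GRing.scale /= ?expr1 ?mulr1; field.
rewrite (rint_FTC ab _ hF); last by move=> x _; exact: cvg_id.
by rewrite -mulrBl.
Qed.

Lemma rect_affine (p q : Cx R) a b c d : a <= b -> c <= d ->
  rect (fun w => p + q * w) a b c d = 0.
Proof.
move=> ab cd; rewrite /rect /hseg /vseg.
have hH y : cint a b (fun x => p + q * pt x y) =
    (p + q * ii * rc y) * rc (b - a) + q * rc ((b ^+ 2 - a ^+ 2) / 2).
  rewrite -cint_affine//; apply: cintE => x _; rewrite ptE; ring.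
have hV x : cint c d (fun y => p + q * pt x y) =
    (p + q * rc x) * rc (d - c) + q * ii * rc ((d ^+ 2 - c ^+ 2) / 2).
  rewrite -cint_affine//; apply: cintE => y _; rewrite ptE; ring.
rewrite !hH !hV !rcM !rcB !rcX rcV (rcn 2).
have := iiM; move: ii (rc a) (rc b) (rc c) (rc d) => i A B C D hi.
have i2 : i ^+ 2 = -1 by rewrite expr2.
have -> : forall s t u v : Cx R, s + i * t - u - i * v = s - u + i * (t - v) by move=> *; ring.
have n2 : (2 : Cx R) != 0 by rewrite pnatr_eq0.
transitivity ((i ^+ 2 + 1) * q * ((D ^+ 2 - C ^+ 2) / 2 - (D ^+ 2 - C ^+ 2) / 2) : Cx R).
  by field.
by rewrite subrr mulr0.
Qed.

Lemma rectB F G a b c d : a <= b -> c <= d ->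
  crect F a b c d -> crect G a b c d ->
  rect (fun w => F w - G w) a b c d = rect F a b c d - rect G a b c d.
Proof.
move=> ab cd hF hG; rewrite /rect /hseg /vseg.
have [lc ld] : c <= c <= d /\ c <= d <= d by rewrite !lexx cd.
have [la lb] : a <= a <= b /\ a <= b <= b by rewrite !lexx ab.
rewrite (cintB (crect_h hF lc) (crect_h hG lc)) (cintB (crect_h hF ld) (crect_h hG ld)).
rewrite (cintB (crect_v hF la) (crect_v hG la)) (cintB (crect_v hF lb) (crect_v hG lb)).
ring.
Qed.

Lemma rect_bound F a b c d M : a <= b -> c <= d -> crect F a b c d ->
  in_rect a b c d (fun x y => cmod (F (pt x y)) <= M) ->
  cmod (rect F a b c d) <= 2 * M * (b - a + (d - c)).
Proof.
move=> ab cd hF hM; rewrite /rect.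
have [lc ld] : c <= c <= d /\ c <= d <= d by rewrite !lexx cd.
have [la lb] : a <= a <= b /\ a <= b <= b by rewrite !lexx ab.
have h1 : cmod (hseg F a b c) <= M * (b - a).
  by apply: cmod_cint_bound => //; [exact: crect_h hF lc|move=> x hx; exact: hM].
have h2 : cmod (hseg F a b d) <= M * (b - a).
  by apply: cmod_cint_bound => //; [exact: crect_h hF ld|move=> x hx; exact: hM].
have h3 : cmod (ii * vseg F c d a) <= M * (d - c).
  rewrite cmodM cmod_ii mul1r.
  by apply: cmod_cint_bound => //; [exact: crect_v hF la|move=> x hx; exact: hM].
have h4 : cmod (ii * vseg F c d b) <= M * (d - c).
  rewrite cmodM cmod_ii mul1r.
  by apply: cmod_cint_bound => //; [exact: crect_v hF lb|move=> x hx; exact: hM].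
have := cmodB (hseg F a b c + ii * vseg F c d b - hseg F a b d) (ii * vseg F c d a).
have := cmodB (hseg F a b c + ii * vseg F c d b) (hseg F a b d).
have := cmodD (hseg F a b c) (ii * vseg F c d b).
lra.
Qed.

Lemma cmod_pt_le x y : cmod (pt x y) <= `|x| + `|y|.
Proof. exact: cmod_le_ReIm. Qed.

(** The affine tangent of F at the point has boundary integral 0; what is left is at most e / 2
    times the half-perimeter, on a boundary of twice that length. *)
Lemma rect_local F x0 y0 (e : R) : derivable F (pt x0 y0) 1 -> 0 < e ->
  exists2 dl : R, 0 < dl & forall a b c d, a <= x0 <= b -> c <= y0 <= d ->
    b - a + (d - c) < dl -> crect F a b c d ->
    cmod (rect F a b c d) <= e * (b - a + (d - c)) ^+ 2.
Proof.
move=> /derivable_cmodP[l hl] e0.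
have e2 : 0 < e / 2 by rewrite divr_gt0.
have [dl dl0 hd] := hl _ e2; exists dl => // a b c d /[dup] hx /andP[ax xb].
move=> /[dup] hy /andP[cy yd] hlt hF.
have ab := le_trans ax xb; have cd := le_trans cy yd.
set w0 := pt x0 y0 in hd.
pose A w := (F w0 - l * w0) + l * w.
have hA : crect A a b c d.
  move=> x y _ _; apply: contC_add; first exact: contC_cst.
  by apply: contC_mul; [exact: contC_cst|exact: cvg_id].
have -> : rect F a b c d = rect (fun w => F w - A w) a b c d.
  by rewrite rectB// [rect A _ _ _ _]rect_affine// subr0.
have hB : crect (fun w => F w - A w) a b c d.
  by move=> x y hx' hy'; apply: contC_sub; [exact: hF|exact: hA].
apply: le_trans (rect_bound (M := e / 2 * (b - a + (d - c))) ab cd hB _) _.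
  move=> x y /andP[h1 h2] /andP[h3 h4].
  have hh : cmod (pt x y - w0) <= b - a + (d - c).
    have -> : pt x y - w0 = pt (x - x0) (y - y0) by [].
    apply: le_trans (cmod_pt_le _ _) _; apply: lerD; rewrite ler_norml;
      apply/andP; split; lra.
  have := hd (pt x y - w0) (le_lt_trans hh hlt).
  rewrite [w0 + _]addrC subrK => h5.
  have -> : F (pt x y) - A (pt x y) = F (pt x y) - F w0 - l * (pt x y - w0).
    by rewrite /A; ring.
  by apply: le_trans h5 _; rewrite ler_wpM2l// ltW.
by rewrite le_eqVlt; apply/orP; left; apply/eqP; field.
Qed.

(** Bisection by contradiction. The squared half-perimeter of a rectangle is the sum of those of its
    four quarters, so a rectangle violating the bound e times this square has a violating quarter;
    the nested rectangles close in on a point, where [rect_local] contradicts the violation. *)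
Theorem goursat F a b c d : a <= b -> c <= d ->
  in_rect a b c d (fun x y => derivable F (pt x y) 1) -> rect F a b c d = 0.
Proof.
move=> ab cd hD; apply/eqP; rewrite -cmod_eq0; apply/eqP.
have sub a' b' c' d' : a <= a' -> b' <= b -> c <= c' -> d' <= d -> crect F a' b' c' d'.
  move=> h1 h2 h3 h4 x y /andP[h5 h6] /andP[h7 h8]; apply: derivable_continuousC.
  by apply: hD; apply/andP; split; lra.
apply/eqP; rewrite eq_le cmod_ge0 andbT; apply/ler_addgt0Pl => e' e'0.
rewrite addr0 leNgt; apply/negP => hgt.
pose L := b - a + (d - c).
have L0 : 0 <= L by rewrite /L addr_ge0// subr_ge0.
(* With this e the bound for the whole rectangle would give a value at most e', so the whole
   rectangle is the first bad one. The + 1 covers the degenerate case L = 0. *)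
pose e : R := e' / (L ^+ 2 + 1).
have L1 : 0 < L ^+ 2 + 1 by rewrite ltr_wpDl// sqr_ge0.
have e0 : 0 < e by rewrite divr_gt0.
pose good (q : R * R * (R * R)) :=
  cmod (rect F q.1.1 q.1.2 q.2.1 q.2.2) <= e * (q.1.2 - q.1.1 + (q.2.2 - q.2.1)) ^+ 2.
pose valid (q : R * R * (R * R)) :=
  [/\ a <= q.1.1, q.1.1 <= q.1.2, q.1.2 <= b & [/\ c <= q.2.1, q.2.1 <= q.2.2 & q.2.2 <= d]].
pose half (u : bool) (p : R * R) := let m := (p.1 + p.2) / 2 in
  if u then (m, p.2) else (p.1, m).
(* Bad rectangles are carried in a sigma type so that the choice of a bad quarter can be
   iterated. *)
have step (q : {q | valid q /\ ~ good q}) : exists q' : {q | valid q /\ ~ good q},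
    exists uv : bool * bool, sval q' = (half uv.1 (sval q).1, half uv.2 (sval q).2).
  case: q => -[[a1 b1] [c1 d1]] /= [[/= h1 h2 h3 [h4 h5 h6]] ng].
  pose m := (a1 + b1) / 2; pose n := (c1 + d1) / 2.
  have hm : a1 <= m <= b1 by rewrite /m; apply/andP; split; lra.
  have hn : c1 <= n <= d1 by rewrite /n; apply/andP; split; lra.
  apply: contrapT => hno; apply: ng; rewrite /good /=.
  have ch u v : good (half u (a1, b1), half v (c1, d1)).
    apply: contrapT => ngc; apply: hno.
    have hv : valid (half u (a1, b1), half v (c1, d1)).
      rewrite /valid /half /= -/m -/n; clear -hm hn h1 h2 h3 h4 h5 h6.
      clearbody m n; move: hm hn => /andP[? ?] /andP[? ?].
      by case: u; case: v => /=; split=> //; try split => //; lra.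
    by exists (exist (fun q => valid q /\ ~ good q) _ (conj hv ngc)); exists (u, v).
  rewrite (rect_split (sub _ _ _ _ h1 h3 h4 h6) hm hn).
  have := ch false false; have := ch true false; have := ch false true; have := ch true true.
  rewrite /good /half /= -/m -/n => g1 g2 g3 g4.
  have -> : e * (b1 - a1 + (d1 - c1)) ^+ 2 =
    e * (m - a1 + (n - c1)) ^+ 2 + e * (b1 - m + (n - c1)) ^+ 2 +
    e * (m - a1 + (d1 - n)) ^+ 2 + e * (b1 - m + (d1 - n)) ^+ 2.
    by rewrite /m /n; field.
  apply: le_trans (cmodD _ _) (lerD _ g1).
  apply: le_trans (cmodD _ _) (lerD _ g2).
  by apply: le_trans (cmodD _ _) (lerD _ g3).
have q0 : valid ((a, b), (c, d)) /\ ~ good ((a, b), (c, d)).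
  split; first by rewrite /valid /= !lexx.
  rewrite /good /= -/L => hle; move: hgt; rewrite ltNge => /negP; apply.
  apply: le_trans hle _; rewrite /e mulrAC ler_pdivrMr// ler_wpM2l ?(ltW e'0)//.
  by rewrite lerDl.
pose nx q := sval (cid (step q)).
pose s n := iter n nx (exist _ _ q0).
pose A n := (sval (s n)).1.1; pose B n := (sval (s n)).1.2.
pose C n := (sval (s n)).2.1; pose D n := (sval (s n)).2.2.
have Hs n : valid (sval (s n)) /\ ~ good (sval (s n)) by exact: svalP (s n).
have Hn n : exists uv : bool * bool, sval (s n.+1) = (half uv.1 (sval (s n)).1, half uv.2 (sval (s n)).2).
  by rewrite /s iterS; exact: svalP (cid (step (iter n nx (exist _ _ q0)))).
have mono n : [/\ A n <= A n.+1, B n.+1 <= B n, B n.+1 - A n.+1 = (B n - A n) / 2 &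
    [/\ C n <= C n.+1, D n.+1 <= D n & D n.+1 - C n.+1 = (D n - C n) / 2]].
  have [[u v] /= E] := Hn n; have [[/= _ hAB _ [_ hCD _]] _] := Hs n.
  rewrite /A /B /C /D E /half /=; move: (sval (s n)) hAB hCD => [[p q] [r t]] /=.
  clear => hpq hrt.
  by case: u; case: v => /=; split; try split; lra.
have wid n : B n - A n + (D n - C n) = L / 2 ^+ n.
  elim: n => [|n IH]; first by rewrite expr0 divr1.
  have [_ _ -> [_ _ ->]] := mono n.
  by rewrite -mulrDl IH exprSr invfM mulrA.
have nest n k : [/\ A n <= A (n + k)%N, B (n + k)%N <= B n & C n <= C (n + k)%N /\ D (n + k)%N <= D n].
  elim: k => [|k [h1 h2 [h3 h4]]]; first by rewrite addn0.
  rewrite addnS; have [m1 m2 _ [m3 m4 _]] := mono (n + k)%N.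
  by split; [exact: le_trans h1 m1|exact: le_trans m2 h2|split; [exact: le_trans h3 m3|exact: le_trans m4 h4]].
have cross n k : A n <= B k /\ C n <= D k.
  have [h1 _ [h2 _]] := nest n k; have [_ h3 [_ h4]] := nest k n.
  have [[/= _ hAB _ [_ hCD _]] _] := Hs (n + k)%N.
  rewrite addnC in h3 h4.
  by split; [exact: le_trans h1 (le_trans hAB h3)|exact: le_trans h2 (le_trans hCD h4)].
have supP (X Y : nat -> R) : (forall n k, X n <= Y k) ->
    forall n, X n <= sup (range X) <= Y n.
  move=> h n; apply/andP; split.
    apply: ub_le_sup; last by exists n.
    by exists (Y 0%N) => _ [k _ <-].
  by apply: ge_sup; [exists (X 0%N); exists 0%N|move=> _ [k _ <-]].
have hx := supP A B (fun n k => (cross n k).1).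
have hy := supP C D (fun n k => (cross n k).2).
set x0 := sup (range A) in hx; set y0 := sup (range C) in hy.
have [dl dl0 hdl] := rect_local (hD x0 y0 (hx 0%N) (hy 0%N)) e0.
have [n hn] : exists n, L / 2 ^+ n < dl.
  have hn := archi_boundP (divr_ge0 L0 (ltW dl0)); exists (Num.bound (L / dl)).
  rewrite ltr_pdivrMr ?exprn_gt0// mulrC -ltr_pdivrMr//.
  apply: lt_trans hn _; rewrite -natrX ltr_nat; exact: ltn_expl.
have [[/= v1 v2 v3 [v4 v5 v6]]] := Hs n; apply.
apply: hdl; [exact: hx|exact: hy|by rewrite -/(A n) -/(B n) -/(C n) -/(D n) wid|].
exact: sub.
Qed.

End Goursat.

(* Locked so that closing tactics do not unfold filters. *)
HB.lock Definition ccont {R : realType} (u : R -> Cx R) : Prop :=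
  forall x : R, {for x, continuous u}.

(** * Means over a period and Bessel's inequality *)

Section Means.
Context {R : realType}.
Implicit Types (u v : R -> Cx R) (a x y : R).

Definition mean a u : Cx R := rc (2 * pi)^-1 * cint a (a + 2 * pi) u.
Lemma ccontP u : ccont u <-> forall x : R, {for x, continuous u}.
Proof. by rewrite ccont.unlock. Qed.
Definition fcoef a u (n : int) : Cx R := mean a (fun x => u x * ei (- n%:~R * x)).

Lemma pi2_gt0 : 0 < 2 * pi :> R. Proof. by rewrite mulr_gt0// pi_gt0. Qed.
Lemma le_a2pi a : a <= a + 2 * pi. Proof. by rewrite lerDl ltW// pi2_gt0. Qed.
Lemma ccontW a b u : ccont u -> ccontI a b u.
Proof. by move=> /ccontP h x _; exact: h. Qed.
Lemma ccont_cst (k : Cx R) : ccont (fun=> k).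
Proof. by apply/ccontP => x; exact: contC_cst. Qed.
Lemma ccont_mul u v : ccont u -> ccont v -> ccont (fun x => u x * v x).
Proof.
by move=> /ccontP hu /ccontP hv; apply/ccontP => x; apply: contC_mul; [exact: hu|exact: hv].
Qed.
Lemma ccont_add u v : ccont u -> ccont v -> ccont (fun x => u x + v x).
Proof.
by move=> /ccontP hu /ccontP hv; apply/ccontP => x; apply: contC_add; [exact: hu|exact: hv].
Qed.
Lemma ccont_sub u v : ccont u -> ccont v -> ccont (fun x => u x - v x).
Proof.
by move=> /ccontP hu /ccontP hv; apply/ccontP => x; apply: contC_sub; [exact: hu|exact: hv].
Qed.
Lemma ccont_cconj u : ccont u -> ccont (fun x => cconj (u x)).
Proof. by move=> /ccontP hu; apply/ccontP => x; exact: continuous_cconj_comp. Qed.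
Lemma ccont_ei (k : R) : ccont (fun x => ei (k * x)).
Proof. by apply/ccontP => x; apply: (@ccontI_ei R x x k); rewrite lexx. Qed.
Lemma ccont_sum (I : Type) (s : seq I) (P : pred I) (F : I -> R -> Cx R) :
  (forall i, ccont (F i)) -> ccont (fun x => \sum_(i <- s | P i) F i x).
Proof. by move=> h; apply/ccontP => x; apply: contC_sum => i; by move: (h i) => /ccontP; exact. Qed.

Lemma meanE a u v : (forall x, a <= x <= a + 2 * pi -> u x = v x) -> mean a u = mean a v.
Proof. by move=> h; rewrite /mean (cintE h). Qed.
Lemma meanD a u v : ccont u -> ccont v ->
  mean a (fun x => u x + v x) = mean a u + mean a v.
Proof. by move=> hu hv; rewrite /mean (cintD (ccontW hu) (ccontW hv)) mulrDr. Qed.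
Lemma meanB a u v : ccont u -> ccont v ->
  mean a (fun x => u x - v x) = mean a u - mean a v.
Proof. by move=> hu hv; rewrite /mean (cintB (ccontW hu) (ccontW hv)) mulrBr. Qed.
Lemma meanZ a k u : ccont u -> mean a (fun x => k * u x) = k * mean a u.
Proof. by move=> hu; rewrite /mean (cintZ k (ccontW hu)) mulrCA. Qed.
Lemma mean_cst a k : mean a (fun=> k) = k.
Proof.
rewrite /mean (cint_cst k (le_a2pi a)) [a + _]addrC addrK mulrA -rcM mulVf ?mul1r//.
by rewrite gt_eqF// pi2_gt0.
Qed.
Lemma mean_sum a (I : Type) (s : seq I) (P : pred I) (F : I -> R -> Cx R) :
  (forall i, ccont (F i)) ->
  mean a (fun x => \sum_(i <- s | P i) F i x) = \sum_(i <- s | P i) mean a (F i).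
Proof.
by move=> h; rewrite /mean (cint_sum _ _ (fun i => ccontW (h i)) (le_a2pi a)) mulr_sumr.
Qed.
Lemma mean_cconj a u : ccont u -> mean a (fun x => cconj (u x)) = cconj (mean a u).
Proof.
move=> hu; rewrite /mean cconjM cconj_rc; congr (_ * _).
have hI : rcontI a (a + 2 * pi) (fun x => complex.Im (u x)).
  exact: ccontI_Im (ccontW hu).
apply: eq_ReIm => /=.
  by rewrite /cint /=; apply: eq_rint => x _; case: (u x).
rewrite /cint /= -mulN1r -(rintZ _ hI); apply: eq_rint => x _.
by rewrite mulN1r; case: (u x).
Qed.
Lemma mean_bound a u M : ccont u ->
  (forall x, a <= x <= a + 2 * pi -> cmod (u x) <= M) -> cmod (mean a u) <= M.
Proof.
move=> hu hM; rewrite /mean cmodM cmod_rc ger0_norm ?invr_ge0 ?(ltW pi2_gt0)//.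
rewrite mulrC ler_pdivrMr ?pi2_gt0//.
by have := cmod_cint_bound (le_a2pi a) (ccontW hu) hM; rewrite addrAC subrr add0r.
Qed.
Lemma mean_ei a (n : int) : mean a (fun x => ei (n%:~R * x)) = (n == 0)%:R.
Proof.
have [->|n0] := eqVneq n 0; last by rewrite /mean cint_ei// mulr0.
rewrite -[RHS](mean_cst a); apply: meanE => x _; by rewrite mul0r ei0.
Qed.
Lemma cmod_mean_le a u : ccont u ->
  cmod (mean a u) <= (2 * pi)^-1 * rint a (a + 2 * pi) (fun x => cmod (u x)).
Proof.
move=> hu; rewrite /mean cmodM cmod_rc ger0_norm ?invr_ge0 ?(ltW pi2_gt0)//.
by apply: ler_wpM2l; [rewrite invr_ge0 (ltW pi2_gt0)|exact: cmod_cint (ccontW hu)].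
Qed.
Lemma mean_real a (f : R -> R) :
  mean a (fun x => rc (f x)) = rc ((2 * pi)^-1 * rint a (a + 2 * pi) f).
Proof.
rewrite /mean rcM; congr (_ * _); rewrite /cint; apply: eq_ReIm => //=.
by rewrite (rint_cst _ (le_a2pi a)) mul0r.
Qed.

Lemma fcoef_ei a (n m : int) : fcoef a (fun x => ei (n%:~R * x)) m = (n == m)%:R.
Proof.
rewrite /fcoef -subr_eq0 -(mean_ei a); apply: meanE => x _.
by rewrite -eiD -mulrDl intrD rmorphN.
Qed.

(** The remainder after projecting on finitely many exponentials is orthogonal to the projection, so
    the mean squares add up. An arbitrary injective choice of frequencies is allowed because
    [dan_has_ps] also applies this to the negative indices alone. *)
Lemma bessel a u (phi : nat -> int) N : injective phi -> ccont u ->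
  \sum_(k < N) cmod (fcoef a u (phi k)) ^+ 2 <=
  complex.Re (mean a (fun x => u x * cconj (u x))).
Proof.
move=> hphi hu; pose c k := fcoef a u (phi k).
pose e (k : nat) x : Cx R := ei ((phi k)%:~R * x).
have he k : ccont (e k) by exact: ccont_ei.
have hce k : ccont (fun x => c k * e k x) by apply: ccont_mul => //; exact: ccont_cst.
pose S x := \sum_(k < N) c k * e k x.
have hS : ccont S by apply: ccont_sum => k; exact: hce.
pose D x := u x - S x.
have hD : ccont D by exact: ccont_sub.
have ecE k x : cconj (e k x) = ei (- (phi k)%:~R * x) by rewrite /e -eiN mulNr.
have hDe k : (k < N)%N -> mean a (fun x => D x * cconj (e k x)) = 0.
  move=> kN.
  rewrite (meanE (v := fun x => u x * ei (- (phi k)%:~R * x) - S x * ei (- (phi k)%:~R * x))); last first.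
    by move=> x _; rewrite ecE mulrBl.
  have h1 : ccont (fun x => ei (- (phi k)%:~R * x) : Cx R) by exact: ccont_ei.
  rewrite meanB; [|exact: ccont_mul|exact: ccont_mul].
  rewrite -/(fcoef a u (phi k)) -/(c k).
  rewrite (meanE (v := fun x => \sum_(j < N) c j * (e j x * ei (- (phi k)%:~R * x)))); last first.
    by move=> x _; rewrite mulr_suml; apply: eq_bigr => j _; rewrite mulrA.
  have h2 j : ccont (fun x => e j x * ei (- (phi k)%:~R * x)) by exact: ccont_mul.
  rewrite mean_sum; last by move=> j; apply: ccont_mul; [exact: ccont_cst|exact: h2].
  rewrite (bigD1 (Ordinal kN)) //= big1 ?addr0.
    by rewrite meanZ// -/(fcoef a (e k) (phi k)) fcoef_ei eqxx mulr1 subrr.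
  move=> j jk; rewrite meanZ// -/(fcoef a (e j) (phi k)) fcoef_ei.
  rewrite (inj_eq hphi) (_ : (j == k :> nat) = false) ?mulr0//.
  by apply/negbTE; apply: contra jk => /eqP jk; apply/eqP/val_inj.
have hSD : mean a (fun x => D x * cconj (S x)) = 0.
  rewrite (meanE (v := fun x => \sum_(k < N) cconj (c k) * (D x * cconj (e k x)))); last first.
    by move=> x _; rewrite cconj_sum mulr_sumr; apply: eq_bigr => k _; rewrite cconjM mulrCA.
  have h2 k : ccont (fun x => D x * cconj (e k x)) by apply: ccont_mul => //; exact: ccont_cconj.
  rewrite mean_sum; last by move=> j; apply: ccont_mul; [exact: ccont_cst|exact: h2].
  by rewrite big1// => k _; rewrite meanZ// hDe ?mulr0.
have hSu : mean a (fun x => u x * cconj (S x)) = rc (\sum_(k < N) cmod (c k) ^+ 2).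
  rewrite (meanE (v := fun x => \sum_(k < N) cconj (c k) * (u x * ei (- (phi k)%:~R * x)))); last first.
    by move=> x _; rewrite cconj_sum mulr_sumr; apply: eq_bigr => k _; rewrite cconjM mulrCA ecE.
  have h2 k : ccont (fun x => u x * ei (- (phi k)%:~R * x)) by apply: ccont_mul => //; exact: ccont_ei.
  rewrite mean_sum; last by move=> j; apply: ccont_mul; [exact: ccont_cst|exact: h2].
  by rewrite rc_sum; apply: eq_bigr => k _; rewrite meanZ// -mul_cconj mulrC.
have key : mean a (fun x => u x * cconj (u x)) =
    mean a (fun x => D x * cconj (D x)) + rc (\sum_(k < N) cmod (c k) ^+ 2).
  have hDc : mean a (fun x => S x * cconj (D x)) = 0.
    rewrite (meanE (v := fun x => cconj (D x * cconj (S x)))); last first.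
      by move=> x _; rewrite cconjM cconjK mulrC.
    rewrite mean_cconj; last by apply: ccont_mul => //; exact: ccont_cconj.
    by rewrite hSD /cconj conjc0.
  rewrite -hSu -[mean a (fun x => D x * _)]addr0 -hDc -meanD; first last.
  - by apply: ccont_mul => //; exact: ccont_cconj.
  - by apply: ccont_mul => //; exact: ccont_cconj.
  rewrite -meanD; first last.
  - by apply: ccont_mul => //; exact: ccont_cconj.
  - by apply: ccont_add; apply: ccont_mul => //; exact: ccont_cconj.
  by apply: meanE => x _; rewrite /D cconjB; ring.
rewrite key CReD (_ : complex.Re (rc _) = \sum_(k < N) cmod (fcoef a u (phi k)) ^+ 2)// lerDr.
rewrite (meanE (v := fun x => rc (cmod (D x) ^+ 2))); last by move=> x _; rewrite mul_cconj.
rewrite mean_real (_ : complex.Re (rc _) = (2 * pi)^-1 * rint a (a + 2 * pi) (fun x => cmod (D x) ^+ 2))// mulr_ge0 ?invr_ge0 ?(ltW pi2_gt0)//.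
by apply: rint_ge0 => x _; exact: sqr_ge0.
Qed.

End Means.

(** * The complex exponential *)

Section ComplexExponential.
Context {R : realType}.
Implicit Types (w h : Cx R) (s t : R).

Definition cexp w : Cx R := rc (expR (complex.Re w)) * ei (complex.Im w).

Lemma cexpD w h : cexp (w + h) = cexp w * cexp h.
Proof. by rewrite /cexp CReD CImD expRD eiD rcM; ring. Qed.

Lemma is_derive_dist (f : R -> R) (x l e : R) : is_derive x 1 f l -> 0 < e ->
  exists2 d : R, 0 < d & forall s, `|s| < d -> `|f (x + s) - f x - l * s| <= e * `|s|.
Proof.
move=> [/cvg_ex[l' hl'] hd] e0.
have ll : l' = l by rewrite -hd; apply/esym/cvg_lim.
move/cvgrPdist_le : hl' => /(_ _ e0) /nbhs_ballP[d /= d0 hdd].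
exists d => // s hs; have [->|s0] := eqVneq s 0.
  by rewrite addr0 subrr mulr0 subr0 normr0 mulr0.
have := hdd s; rewrite -ball_normE /= sub0r normrN => /(_ hs s0).
rewrite [s *: 1]mulr1 ll [s + x]addrC distrC => H.
have -> : f (x + s) - f x - l * s = (s^-1 *: (f (x + s) - f x) - l) * s.
  by rewrite mulrBl /GRing.scale /= mulrAC mulVf// mul1r.
by rewrite normrM ler_wpM2r.
Qed.

(** The functional equation moves the point w to 0, where the real derivatives of exp, cos and sin
    control both parts of [cexp h - 1 - h]. *)
Lemma derivable_cexp w : derivable cexp w 1.
Proof.
apply/derivable_cmodP; exists (cexp w) => e e0.
have cw : 0 < cmod (cexp w) + 1 by rewrite ltr_wpDl.
(* The real and imaginary parts contribute at most 3 k |h| each, which 8 covers; the + 1 keeps the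
   denominator positive at once. *)
pose k := Num.min (e / (cmod (cexp w) + 1) / 8) 1.
have k0 : 0 < k by rewrite lt_min ltr01 !divr_gt0.
have [d1 d10 h1] := is_derive_dist (is_derive_expR 0) k0.
have [d2 d20 h2] := is_derive_dist (is_derive_cos 0) k0.
have [d3 d30 h3] := is_derive_dist (is_derive_sin 0) k0.
rewrite expR0 in h1; rewrite cos0 sin0 in h2; rewrite cos0 sin0 in h3.
pose d := Num.min (Num.min d1 d2) (Num.min d3 (Num.min (k / 2) 1)).
exists d.
  by rewrite !lt_min d10 d20 d30 ltr01 divr_gt0.
move=> h; rewrite !lt_min => /andP[/andP[hd1 hd2] /andP[hd3 /andP[hd4 hd5]]].
have -> : cexp (w + h) - cexp w - cexp w * h = cexp w * (cexp h - 1 - h).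
  by rewrite cexpD; ring.
rewrite cmodM.
set s := complex.Re h; set t := complex.Im h.
have sh : `|s| <= cmod h := normRe_le h.
have th : `|t| <= cmod h := normIm_le h.
have {}h1 := h1 s (le_lt_trans sh hd1); rewrite add0r mul1r in h1.
have {}h2 := h2 t (le_lt_trans th hd2); rewrite add0r oppr0 mul0r subr0 in h2.
have {}h3 := h3 t (le_lt_trans th hd3); rewrite add0r mul1r subr0 in h3.
have k1 : k <= 1 by rewrite ge_min lexx orbT.
have hk : k <= e / (cmod (cexp w) + 1) / 8 by rewrite ge_min lexx.
have ct : `|cos t| <= 1 by rewrite ler_norml cos_geN1 cos_le1.
have st : `|sin t| <= 2 * cmod h.
  have := ler_normD (sin t - t) t; rewrite subrK => /le_trans -> //.
  have : k * `|t| <= 1 * cmod h by apply: ler_pM => //; exact: ltW.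
  by lra.
have es : `|expR s - 1| <= k.
  have := ler_normD (expR s - 1 - s) s; rewrite subrK => /le_trans -> //.
  have : k * `|s| <= 1 * cmod h by apply: ler_pM => //; exact: ltW.
  by lra.
have hre : `|complex.Re (cexp h - 1 - h)| <= 3 * k * cmod h.
  have -> : complex.Re (cexp h - 1 - h) =
      (expR s - 1 - s) * cos t + (1 + s) * (cos t - 1).
    rewrite !CReD !CReN /cexp CReM /= -/s -/t mul0r subr0; ring.
  apply: le_trans (ler_normD _ _) _; rewrite !normrM.
  have a1 : `|expR s - 1 - s| * `|cos t| <= k * cmod h * 1.
    by apply: ler_pM => //; apply: le_trans h1 _; rewrite ler_wpM2l// ltW.
  have a2 : `|1 + s| * `|cos t - 1| <= 2 * (k * cmod h).
    apply: ler_pM => //; last by apply: le_trans h2 _; rewrite ler_wpM2l// ltW.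
    apply: le_trans (ler_normD _ _) _; rewrite normr1; lra.
  lra.
have him : `|complex.Im (cexp h - 1 - h)| <= 3 * k * cmod h.
  have -> : complex.Im (cexp h - 1 - h) =
      (expR s - 1) * sin t + (sin t - t).
    rewrite !CImD !CImN /cexp CImM /= -/s -/t mul0r addr0; ring.
  apply: le_trans (ler_normD _ _) _; rewrite !normrM.
  have a1 : `|expR s - 1| * `|sin t| <= k * (2 * cmod h) by apply: ler_pM.
  have a2 : k * `|t| <= k * cmod h by rewrite ler_wpM2l// ltW.
  lra.
have tot : cmod (cexp h - 1 - h) <= 8 * k * cmod h.
  apply: le_trans (cmod_le_ReIm _) _.
  have : 0 <= k * cmod h by rewrite mulr_ge0// ltW.
  lra.
apply: le_trans (_ : cmod (cexp w) * (8 * k * cmod h) <= _); first by rewrite ler_wpM2l.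
rewrite mulrA ler_wpM2r//.
apply: le_trans (_ : (cmod (cexp w) + 1) * (8 * (e / (cmod (cexp w) + 1) / 8)) <= _).
  apply: ler_pM => //.
  - by rewrite mulr_ge0// ltW.
  - by rewrite lerDl.
  - by rewrite ler_wpM2l.
by rewrite le_eqVlt; apply/orP; left; apply/eqP; field; rewrite gt_eqF.
Qed.

Lemma derivable_compC (f g : Cx R -> Cx R) w : derivable g w 1 ->
  derivable f (g w) 1 -> derivable (fun z => f (g z)) w 1.
Proof.
move=> /derivable1_diffP hg /derivable1_diffP hf.
apply: ((derivable1_diffP (f \o g) w).2 _).
exact: (@differentiable_comp _ _ _ _ g f w hg hf).
Qed.

End ComplexExponential.
Arguments cexp {R} w : simpl never.
Arguments mean {R} a u : simpl never.

(** * Power series *)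

Section PowerSeries.
Context {R : realType}.
Implicit Types (A B : nat -> Cx R) (f g : Cx R -> Cx R) (z w h l : Cx R) (r q C : R).

Definition psum A N z : Cx R := \sum_(n < N) A n * z ^+ n.
(** Radius of convergence at least [R0], in the form of Cauchy estimates: bounded terms at every
    smaller radius already give geometric decay ([crad_geom]). *)
Definition crad (R0 : R) A :=
  forall r, 0 <= r < R0 -> exists C, forall n, cmod (A n) * r ^+ n <= C.
Definition has_ps (R0 : R) f A :=
  crad R0 A /\ forall z, cmod z < R0 -> psum A n z @[n --> \oo] --> f z.

Lemma cvgC_unique (u : nat -> Cx R) l l' :
  u n @[n --> \oo] --> l -> u n @[n --> \oo] --> l' -> l = l'.
Proof.
move=> /cvgC_P h /cvgC_P h'; apply/eqP; rewrite -subr_eq0 -cmod_eq0 eq_le cmod_ge0 andbT.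
apply/ler_addgt0Pl => e e0; rewrite addr0.
have e2 : 0 < e / 2 by rewrite divr_gt0.
have [n [/= h1 h2]] : exists n, cmod (u n - l) <= e / 2 /\ cmod (u n - l') <= e / 2.
  by near \oo => n; exists n; split; near: n; [exact: h|exact: h'].
have -> : l - l' = (u n - l') - (u n - l) by ring.
by have := cmodB (u n - l') (u n - l); lra.
Unshelve. all: by end_near. Qed.

Lemma cmod_lim_le (u : nat -> Cx R) l M N :
  u n @[n --> \oo] --> l -> (forall n, (N <= n)%N -> cmod (u n) <= M) -> cmod l <= M.
Proof.
move=> /cvgC_P h hM; apply/ler_addgt0Pl => e e0; rewrite addrC.
have [n [/= h1 h2]] : exists n, cmod (u n - l) <= e /\ (N <= n)%N.
  by near \oo => n; exists n; split; near: n; [exact: h|exact: nbhs_infty_ge].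
have := cmodB (u n) (u n - l); have -> : u n - (u n - l) = l by ring.
by have := hM n h2; lra.
Unshelve. all: by end_near. Qed.

Lemma geom_tail q N M : 0 <= q < 1 -> (N <= M)%N ->
  \sum_(N <= n < M) q ^+ n <= q ^+ N / (1 - q).
Proof.
move=> /andP[q0 q1] NM; have h : 0 < 1 - q by rewrite subr_gt0.
rewrite ler_pdivlMr// mulrBr mulr1 big_distrl /=.
have -> : \sum_(N <= n < M) q ^+ n - \sum_(N <= n < M) q ^+ n * q = q ^+ N - q ^+ M.
  under [X in _ - X]eq_bigr do rewrite -exprSr.
  rewrite -sumrB; have := telescope_sumr (fun n => - q ^+ n) NM.
  by under eq_bigr do rewrite opprK addrC; rewrite opprK addrC.
by rewrite lerBlDr lerDl exprn_ge0.
Qed.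

Lemma geom_sum q N : 0 <= q < 1 -> \sum_(n < N) q ^+ n <= (1 - q)^-1.
Proof.
by move=> hq; have := geom_tail hq (leq0n N); rewrite big_mkord expr0 mul1r.
Qed.

(** Each of the first n + 1 powers of q is at least q^n. Later this bounds (n + 1) (1 - t) t^n by
    1. *)
Lemma natmul_exp_le q n : 0 <= q < 1 -> n.+1%:R * q ^+ n <= (1 - q)^-1.
Proof.
move=> hq; have [q0 q1] := andP hq; apply: le_trans (geom_sum n.+1 hq).
rewrite -[n.+1 in leLHS]card_ord -sum1_card natr_sum mulr_suml.
apply: ler_sum => i _; rewrite mul1r ler_wiXn2l// ?ltW//.
by rewrite -ltnS.
Qed.

(** At the midpoint r' of r and [R0] the terms are bounded, and r / r' < 1 is the ratio. *)
Lemma crad_geom R0 A r : crad R0 A -> 0 <= r < R0 ->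
  exists C q, [/\ 0 <= C, 0 <= q < 1 & forall n, cmod (A n) * r ^+ n <= C * q ^+ n].
Proof.
move=> hA /andP[r0 rR]; pose r' := (r + R0) / 2.
have r'0 : 0 < r' by rewrite /r'; lra.
have hr' : 0 <= r' < R0 by rewrite /r'; apply/andP; split; lra.
have [C hC] := hA r' hr'.
exists C, (r / r'); split.
- by have := hC 0%N; rewrite expr0 mulr1; exact: le_trans.
- by rewrite divr_ge0 ?(ltW r'0)//= ltr_pdivrMr// mul1r /r'; lra.
- move=> n; rewrite expr_div_n.
  have -> : cmod (A n) * r ^+ n = (cmod (A n) * r' ^+ n) * (r ^+ n / r' ^+ n).
    by field; rewrite expf_neq0// gt_eqF.
  by rewrite ler_wpM2r// divr_ge0 ?exprn_ge0// ltW.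
Qed.

Lemma crad_muln R0 A : crad R0 A -> crad R0 (fun n => n%:R * A n).
Proof.
move=> hA r hr; have [C [q [C0 hq hC]]] := crad_geom hA hr.
exists (C * (1 - q)^-1) => n.
rewrite cmodM -rcn cmod_rc ger0_norm// -mulrA.
apply: le_trans (_ : n%:R * (C * q ^+ n) <= _); first by rewrite ler_wpM2l.
rewrite mulrCA ler_wpM2l//; apply: le_trans (natmul_exp_le n hq).
have [q0 q1] := andP hq.
by rewrite ler_wpM2r ?exprn_ge0// ler_nat.
Qed.

Lemma crad_shift R0 A : crad R0 A -> crad R0 (fun n => A n.+1).
Proof.
move=> hA r /andP[r0 rR]; pose r' := (r + R0) / 2.
have r'0 : 0 < r' by rewrite /r'; lra.
have hr' : 0 <= r' < R0 by rewrite /r'; apply/andP; split; lra.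
have [C hC] := hA r' hr'.
exists (C / r') => n; rewrite ler_pdivlMr//; apply: le_trans (hC n.+1).
rewrite exprSr mulrA ler_wpM2r ?(ltW r'0)// ler_wpM2l// lerXn2r// ?nnegrE// ?(ltW r'0)//.
by rewrite /r'; lra.
Qed.

Lemma crad_le R0 A B : crad R0 A -> (forall n, cmod (B n) <= cmod (A n)) -> crad R0 B.
Proof.
move=> hA hAB r /[dup] hr /andP[r0 _]; have [C hC] := hA r hr.
by exists C => n; apply: le_trans (hC n); rewrite ler_wpM2r// exprn_ge0.
Qed.

Lemma psum_tail A r C q z N M : 0 <= C -> 0 <= q < 1 -> cmod z <= r ->
  (forall n, cmod (A n) * r ^+ n <= C * q ^+ n) -> (N <= M)%N ->
  cmod (psum A M z - psum A N z) <= C / (1 - q) * q ^+ N.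
Proof.
move=> C0 hq hz hC NM.
have -> : psum A M z - psum A N z = \sum_(N <= n < M) A n * z ^+ n.
  rewrite /psum -!(big_mkord xpredT (fun n => A n * z ^+ n)).
  by rewrite (big_cat_nat _ NM)//= addrAC subrr add0r.
apply: le_trans (cmod_sum _ _ _) _.
apply: le_trans (_ : \sum_(N <= n < M) C * q ^+ n <= _).
  apply: ler_sum => n _; rewrite cmodM cmodX; apply: le_trans (hC n).
  by rewrite ler_wpM2l// lerXn2r// nnegrE// (le_trans (cmod_ge0 z)).
rewrite -mulr_sumr -mulrA ler_wpM2l// mulrC; exact: geom_tail.
Qed.

Lemma has_ps_unif R0 f A r : has_ps R0 f A -> 0 <= r < R0 ->
  exists C q, [/\ 0 <= C, 0 <= q < 1 &
    forall z, cmod z <= r -> forall N, cmod (f z - psum A N z) <= C * q ^+ N].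
Proof.
move=> [hA hf] hr; have [C [q [C0 hq hC]]] := crad_geom hA hr.
have [q0 q1] := andP hq; have [r0 rR] := andP hr.
exists (C / (1 - q)), q; split => //; first by rewrite divr_ge0// subr_ge0 ltW.
move=> z hz N; apply: (@cmod_lim_le (fun n => psum A n z - psum A N z) _ _ N).
  by have := hf z (le_lt_trans hz rR) => h; apply: cvgB h (cvg_cst _).
by move=> n Nn; apply: (@psum_tail A r).
Qed.

Lemma crad_ps R0 A : crad R0 A -> exists f, has_ps R0 f A.
Proof.
move=> hA.
have key z : exists l : Cx R, cmod z < R0 -> psum A n z @[n --> \oo] --> l.
  have [hz|hz] := boolP (cmod z < R0); last by exists 0.
  have [|C [q [C0 hq hC]]] := @crad_geom R0 A (cmod z) hA; first by rewrite cmod_ge0.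
  have [q0 q1] := andP hq.
  have hcvg (u : nat -> R) : (forall n, `|u n| <= cmod (A n * z ^+ n)) ->
      cvgn (series u).
    move=> hu; apply: normed_cvg.
    apply: (@series_le_cvg _ _ (geometric C q)) => [n|n|n|] /=.
    - exact: normr_ge0.
    - by rewrite mulr_ge0// exprn_ge0.
    - by apply: le_trans (hu n) _; rewrite cmodM cmodX.
    - by apply: is_cvg_geometric_series; rewrite ger0_norm.
  pose a n := complex.Re (A n * z ^+ n); pose b n := complex.Im (A n * z ^+ n).
  have ha : cvgn (series a) by apply: hcvg => n; exact: normRe_le.
  have hb : cvgn (series b) by apply: hcvg => n; exact: normIm_le.
  exists (limn (series a) +i* limn (series b)) => _; apply/cvgC_P => e e0.
  have e2 : 0 < e / 2 by rewrite divr_gt0.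
  have psE n : psum A n z = (series a n) +i* (series b n).
    elim: n => [|n IH]; first by rewrite /psum big_ord0 /series /= !big_nil.
    rewrite /psum big_ord_recr /= -/(psum A n z) IH /series /= !big_nat_recr//=.
    by rewrite /a /b; case: (A n * z ^+ n).
  move/cvgrPdist_le : ha => /(_ _ e2) ha; move/cvgrPdist_le : hb => /(_ _ e2) hb.
  near=> n; rewrite psE; apply: le_trans (cmod_le_ReIm _) _ => /=.
  rewrite (splitr e); apply: lerD; rewrite distrC; near: n; [exact: ha|exact: hb].
pose f z := sval (cid (key z)); exists f; split; [exact: hA|move=> z hz].
exact: (svalP (cid (key z)) hz).
Unshelve. all: by end_near. Qed.

Lemma has_ps_eq R0 f g A : has_ps R0 f A -> (forall z, cmod z < R0 -> g z = f z) ->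
  has_ps R0 g A.
Proof. by move=> [h1 h2] hg; split; [exact: h1|move=> z hz; rewrite (hg z hz); exact: h2]. Qed.

(** Induction on n: the next step multiplies the error by z + h and adds n z^(n-1) h^2, and n^2 + n
    <= (n + 1)^2. *)
Lemma expansion_error z h (n : nat) r : 0 < r -> cmod z <= r -> cmod (z + h) <= r ->
  cmod ((z + h) ^+ n - z ^+ n - n%:R * z ^+ n.-1 * h) <=
  (n ^ 2)%:R * r ^+ n / r ^+ 2 * cmod h ^+ 2.
Proof.
move=> r0 hz hzh; elim: n => [|n IH].
  by rewrite !expr0 subrr sub0r mul0r mul0r oppr0 cmod0 mul0r !mul0r.
have -> : (z + h) ^+ n.+1 - z ^+ n.+1 - n.+1%:R * z ^+ n * h =
  (z + h) * ((z + h) ^+ n - z ^+ n - n%:R * z ^+ n.-1 * h) + n%:R * z ^+ n.-1 * h ^+ 2.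
  case: n {IH} => [|n] /=; first by rewrite !expr1 !expr0; ring.
  by rewrite !exprS -[n.+2%:R]natr1; ring.
apply: le_trans (cmodD _ _) _; rewrite cmodM [X in _ + X]cmodM [cmod (n%:R * _)]cmodM.
have b1 : cmod (z + h) * cmod ((z + h) ^+ n - z ^+ n - n%:R * z ^+ n.-1 * h) <=
    r * ((n ^ 2)%:R * r ^+ n / r ^+ 2 * cmod h ^+ 2) by apply: ler_pM.
have b2 : cmod (n%:R : Cx R) * cmod (z ^+ n.-1) * cmod (h ^+ 2) <=
    n%:R * (r ^+ n.+1 / r ^+ 2) * cmod h ^+ 2.
  rewrite !cmodX -rcn cmod_rc ger0_norm// ler_wpM2r ?sqr_ge0//.
  case: n {IH b1} => [|n]; first by rewrite !mul0r.
  rewrite ler_wpM2l// /= -addn2 exprD mulfK ?expf_neq0 ?gt_eqF//.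
  by rewrite lerXn2r// nnegrE// ltW.
apply: le_trans (lerD b1 b2) _.
rewrite mulrA -mulrDl ler_wpM2r ?sqr_ge0//.
have -> : r * ((n ^ 2)%:R * r ^+ n / r ^+ 2) = (n ^ 2)%:R * (r ^+ n.+1 / r ^+ 2).
  by rewrite [r ^+ n.+1]exprS; field; rewrite gt_eqF.
rewrite -mulrDl -mulrA ler_wpM2r ?divr_ge0 ?exprn_ge0 ?(ltW r0)//.
by rewrite -natrD ler_nat -[n.+1]addn1 sqrnD muln1 -addnA leq_add2l mul2n -addnn addnA leq_addl.
Qed.

(** The second-order error of the n-th term carries a factor n^2, which geometric decay absorbs. The
    total is K |h|^2 with K independent of h, so |h| < e / (K + 1) suffices. *)
Lemma has_ps_derive R0 f g A z : has_ps R0 f A ->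
  has_ps R0 g (fun n => n.+1%:R * A n.+1) -> cmod z < R0 ->
  forall e : R, 0 < e -> exists2 d : R, 0 < d &
    forall h, cmod h < d -> cmod (f (z + h) - f z - g z * h) <= e * cmod h.
Proof.
move=> [hA hf] [_ hg] hz e e0.
pose r := (cmod z + R0) / 2.
have r0 : 0 < r by rewrite /r; have := cmod_ge0 z; lra.
have rR : 0 <= r < R0 by rewrite (ltW r0) /r /=; lra.
have zr : cmod z < r by rewrite /r; lra.
have [C [q [C0 hq hC]]] := crad_geom (crad_muln (crad_muln hA)) rR.
have [q0 q1] := andP hq.
pose K := C / (1 - q) / r ^+ 2.
have K0 : 0 <= K by rewrite !divr_ge0 ?exprn_ge0 ?subr_ge0 ?(ltW q1) ?(ltW r0).
have K1 : 0 < K + 1 by rewrite ltr_wpDl.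
exists (Num.min (r - cmod z) (e / (K + 1))).
  by rewrite lt_min subr_gt0 zr divr_gt0.
move=> h; rewrite lt_min => /andP[h1 h2].
have hzh : cmod (z + h) <= r by have := cmodD z h; lra.
have zhR : cmod (z + h) < R0 by apply: le_lt_trans hzh _; case/andP: rR.
have lim : (psum A n.+1 (z + h) - psum A n.+1 z - psum (fun n => n.+1%:R * A n.+1) n z * h)
    @[n --> \oo] --> f (z + h) - f z - g z * h.
  apply: cvgB; last by apply: (cvgM (hg z hz) (cvg_cst h)).
  apply: cvgB; first by have := hf _ zhR; rewrite -cvg_shiftS.
  by have := hf _ hz; rewrite -cvg_shiftS.
have bnd : cmod (f (z + h) - f z - g z * h) <= K * cmod h ^+ 2.
  apply: (cmod_lim_le (N := 0) lim) => n _.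
  have -> : psum A n.+1 (z + h) - psum A n.+1 z - psum (fun n => n.+1%:R * A n.+1) n z * h
      = \sum_(k < n.+1) A k * ((z + h) ^+ k - z ^+ k - k%:R * z ^+ k.-1 * h).
    rewrite /psum -sumrB.
    have -> : (\sum_(k < n) (k.+1%:R * A k.+1 * z ^+ k)) * h =
        \sum_(k < n.+1) A k * (k%:R * z ^+ k.-1 * h).
      rewrite big_ord_recl /= mul0r mul0r mulr0 add0r mulr_suml.
      by apply: eq_bigr => k _; rewrite /bump /= add1n; ring.
    by rewrite -sumrB; apply: eq_bigr => k _; ring.
  apply: le_trans (cmod_sum _ _ _) _.
  apply: le_trans (_ : \sum_(k < n.+1) C * q ^+ k / r ^+ 2 * cmod h ^+ 2 <= _).
    apply: ler_sum => k _; rewrite cmodM.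
    apply: le_trans (_ : cmod (A k) * ((k ^ 2)%:R * r ^+ k / r ^+ 2 * cmod h ^+ 2) <= _).
      by rewrite ler_wpM2l// expansion_error// ltW.
    move: (sqr_ge0 (cmod h)); move: (cmod h ^+ 2) => t t0; rewrite !mulrA.
    apply: ler_wpM2r; first exact: t0.
    apply: ler_wpM2r; first by rewrite invr_ge0 exprn_ge0// ltW.
    apply: le_trans (hC k); rewrite !cmodM -rcn cmod_rc ger0_norm// -mulnn natrM.
    by rewrite le_eqVlt; apply/orP; left; apply/eqP; ring.
  rewrite -!mulr_suml -mulr_sumr; apply: ler_wpM2r; first exact: sqr_ge0.
  apply: ler_wpM2r; first by rewrite invr_ge0 exprn_ge0// ltW.
  by rewrite ler_wpM2l// geom_sum.
apply: le_trans bnd _; rewrite expr2 mulrA ler_wpM2r//.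
apply: le_trans (_ : (K + 1) * cmod h <= _); first by rewrite ler_wpM2r// lerDl.
by rewrite mulrC -ler_pdivlMr// ltW.
Qed.

Lemma crad_derive R0 A : crad R0 A -> crad R0 (fun n => n.+1%:R * A n.+1).
Proof. by move=> /crad_muln/crad_shift. Qed.

Lemma has_ps_derivable R0 f A z : has_ps R0 f A -> cmod z < R0 -> derivable f z 1.
Proof.
move=> hf hz; have [g hg] := crad_ps (crad_derive hf.1).
by apply/derivable_cmodP; exists (g z); exact: has_ps_derive hf hg hz.
Qed.

Lemma has_ps_cderiv R0 f A : has_ps R0 f A ->
  has_ps R0 (cderiv f) (fun n => n.+1%:R * A n.+1).
Proof.
move=> hf; have [g hg] := crad_ps (crad_derive hf.1).
apply: (has_ps_eq hg) => z hz; apply: cderiv_cmodP.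
exact: has_ps_derive hf hg hz.
Qed.

End PowerSeries.

(** * Cauchy theory: from differentiability to power series *)

Section CauchyTheory.
Context {R : realType}.
Implicit Types (A : nat -> Cx R) (f g : Cx R -> Cx R) (z w : Cx R) (r a : R).

Definition dan (R0 : R) f := forall z, cmod z < R0 -> derivable f z 1.

Lemma ccont_circle r : ccont (circle r : R -> Cx R).
Proof. by apply/ccontP => x; exact: continuous_circle. Qed.

Lemma ccont_comp_circle R0 f r : 0 <= r < R0 ->
  (forall z, cmod z < R0 -> {for z, continuous f}) -> ccont (fun x => f (circle r x)).
Proof.
move=> /andP[r0 rR] hf; apply/ccontP => x.
apply: (@continuous_comp _ _ _ (circle r) f); first exact: continuous_circle.
by apply: hf; rewrite cmod_circle ger0_norm.
Qed.

Lemma dan_ccont R0 f r : dan R0 f -> 0 <= r < R0 -> ccont (fun x => f (circle r x)).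
Proof.
move=> hf hr; apply: (ccont_comp_circle hr) => z hz.
exact/derivable_continuousC/hf.
Qed.

Lemma ccont_inv (u : R -> Cx R) : ccont u -> (forall x, u x != 0) -> ccont (fun x => (u x)^-1).
Proof.
by move=> /ccontP hu h0; apply/ccontP => x; apply: contC_inv; [exact: hu|exact: h0].
Qed.
Lemma ccont_exp (u : R -> Cx R) n : ccont u -> ccont (fun x => u x ^+ n).
Proof. by move=> /ccontP hu; apply/ccontP => x; apply: contC_exp; exact: hu. Qed.

Lemma circle_exp r x n : circle r x ^+ n = rc (r ^+ n) * ei (n%:~R * x).
Proof. by rewrite circleE exprMn rcX -ei_mulrn -pmulrn. Qed.

Lemma cexp_circle s x : cexp (pt s x) = circle (expR s) x :> Cx R.
Proof. by rewrite circleE. Qed.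

(* In the coordinate log z, an arc of angle 2 pi bounds a rectangle whose
   horizontal sides cancel. *)
Lemma fcoef_scale R0 f a (n : int) (s t : R) : dan R0 f -> s <= t -> expR t < R0 ->
  rc (expR (- n%:~R * s)) * fcoef a (fun x => f (circle (expR s) x)) n =
  rc (expR (- n%:~R * t)) * fcoef a (fun x => f (circle (expR t) x)) n.
Proof.
move=> hf st tR; pose k : R := - n%:~R.
pose F (w : Cx R) : Cx R := f (cexp w) * cexp (rc k * w).
have FE u x : F (pt u x) = rc (expR (k * u)) * (f (circle (expR u) x) * ei (k * x)).
  rewrite /F cexp_circle.
  have -> : rc k * pt u x = pt (k * u) (k * x).
    by apply: eq_ReIm; rewrite ?CReM ?CImM /= mul0r ?subr0 ?addr0.
  by rewrite cexp_circle [circle (expR (k * u)) _]circleE; ring.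
have dF : in_rect s t a (a + 2 * pi) (fun x y => derivable F (pt x y) 1).
  move=> u x /andP[_ ut] _; apply: derivableM.
    apply: derivable_compC; first exact: derivable_cexp.
    apply: hf; rewrite cexp_circle cmod_circle ger0_norm ?expR_ge0//.
    by apply: le_lt_trans tR; rewrite ler_expR.
  apply: derivable_compC; last exact: derivable_cexp.
  by apply: derivableM; [exact: derivable_cst|exact: derivable_id].
have := goursat st (le_a2pi a) dF.
have vE u : u <= t -> vseg F a (a + 2 * pi) u =
    rc (expR (k * u)) * cint a (a + 2 * pi) (fun x => f (circle (expR u) x) * ei (k * x)).
  move=> ut; rewrite /vseg -cintZ; first by apply: cintE => x _; exact: FE.
  apply: ccontW; apply: ccont_mul; last exact: ccont_ei.
  apply: (dan_ccont hf); rewrite expR_ge0 /=; apply: le_lt_trans tR.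
  by rewrite ler_expR.
have hE : hseg F s t (a + 2 * pi) = hseg F s t a.
  apply: cintE => u _; rewrite !FE !circleE ei_period mulrDr eiD.
  have -> : ei (k * (2 * pi)) = 1 :> Cx R.
    rewrite /k; case: n {k F FE dF vE} => n.
      by rewrite -pmulrn mulNr eiN ei_mulrn ei_2pi expr1n -rc1 cconj_rc.
    by rewrite NegzE mulrNz opprK -pmulrn ei_mulrn ei_2pi expr1n.
  by rewrite mulr1.
rewrite /rect hE (vE t (lexx t)) (vE s st) /fcoef /mean -/k.
set u := cint _ _ _; set v := cint _ _ _; move: (hseg _ _ _ _) u v => p u v h.
have : ii * (rc (expR (k * t)) * u - rc (expR (k * s)) * v) = 0 by rewrite -{}h; ring.
move=> /eqP; rewrite mulf_eq0 -cmod_eq0 cmod_ii oner_eq0 /= subr_eq0 => /eqP e.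
by rewrite mulrCA -e mulrCA.
Qed.

Lemma exp_ln r : 0 < r -> expR (ln r) = r.
Proof. by move=> r0; rewrite lnK. Qed.

Lemma fcoef_pos R0 f a (n : nat) r t : dan R0 f -> 0 < r -> r <= t -> t < R0 ->
  fcoef a (fun x => f (circle t x)) n = rc ((t / r) ^+ n) * fcoef a (fun x => f (circle r x)) n.
Proof.
move=> hf r0 rt tR; have t0 := lt_le_trans r0 rt.
have := @fcoef_scale R0 f a n (ln r) (ln t) hf; rewrite !exp_ln// ler_ln// => /(_ rt tR).
have E u : 0 < u -> expR (- n%:~R * ln u) = (u ^+ n)^-1.
  by move=> u0; rewrite mulNr expRN -pmulrn expRM_natl lnK.
rewrite !E// => H; rewrite expr_div_n rcM -mulrA H mulrA -rcM divff ?mul1r//.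
by rewrite expf_neq0// gt_eqF.
Qed.

(** The product of t^(m+1) and the coefficient of index -(m+1) does not depend on t, and it tends to
    0 with t because f is bounded near 0. *)
Lemma fcoef_neg R0 f a (m : nat) t : dan R0 f -> 0 < t < R0 ->
  fcoef a (fun x => f (circle t x)) (- (m.+1)%:Z) = 0.
Proof.
move=> hf /andP[t0 tR]; set n := - _.
have f0 : {for 0, continuous f}.
  by apply/derivable_continuousC/hf; rewrite cmod0 (lt_trans t0).
have [d d0 hd] : exists2 d, 0 < d & forall z, cmod z < d -> cmod (f z) <= cmod (f 0) + 1.
  have [d d0 hd] := (nbhsC_P _ _).1 ((cvgC_P _ _).1 f0 1 ltr01).
  exists d => // z zd; apply: cmod_triangle; apply: hd; by rewrite subr0.
apply/eqP; rewrite -cmod_eq0 eq_le cmod_ge0 andbT; apply/ler_addgt0Pl => e e0.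
rewrite addr0; set M := cmod (f 0) + 1 in hd.
have M0 : 0 < M by rewrite ltr_wpDl.
(* d / 2 keeps the circle inside the disc where f is bounded by M. One factor, r M <= e t, gives the
   epsilon; for the other m factors r <= t is enough. *)
pose r := Num.min (d / 2) (Num.min t (e * t / M)).
have r0 : 0 < r by rewrite !lt_min t0 !divr_gt0// mulr_gt0.
have rt : r <= t by rewrite !ge_min lexx orbT.
have := @fcoef_scale R0 f a n (ln r) (ln t) hf; rewrite !exp_ln// ler_ln// => /(_ rt tR).
have E u : 0 < u -> expR (- n%:~R * ln u) = u ^+ m.+1.
  by move=> u0; rewrite /n mulrNz opprK -pmulrn expRM_natl lnK.
rewrite !E// => H.
have h1 : cmod (fcoef a (fun x => f (circle r x)) n) <= M.
  apply: mean_bound.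
    apply: ccont_mul; last exact: ccont_ei.
    by apply: (dan_ccont hf); rewrite (ltW r0) (le_lt_trans rt).
  move=> x _; rewrite cmodM cmod_ei mulr1; apply: hd.
  rewrite cmod_circle ger0_norm ?(ltW r0)//.
  by apply: (@le_lt_trans _ _ (d / 2)); [rewrite ge_min lexx|lra].
have : t ^+ m.+1 * cmod (fcoef a (fun x => f (circle t x)) n) <= r ^+ m.+1 * M.
  have <- : cmod (rc (t ^+ m.+1) : Cx R) = t ^+ m.+1.
    by rewrite cmod_rc ger0_norm// exprn_ge0 ?ltW.
  rewrite -cmodM -H cmodM cmod_rc ger0_norm ?exprn_ge0 ?(ltW r0)//.
  by rewrite ler_wpM2l// exprn_ge0 ?(ltW r0).
rewrite -ler_pdivlMl ?exprn_gt0// => /le_trans; apply.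
rewrite ler_pdivrMl ?exprn_gt0// !exprSr.
have h2 : r * M <= e * t.
  by rewrite -ler_pdivlMr// !ge_min lexx !orbT.
have h3 : r ^+ m <= t ^+ m by rewrite lerXn2r// nnegrE ltW.
rewrite -!mulrA; apply: le_trans (_ : t ^+ m * (r * M) <= _).
  by rewrite ler_wpM2r// mulr_ge0 ?ltW.
by rewrite ler_wpM2l ?exprn_ge0 ?(ltW t0)// [t * e]mulrC.
Qed.

Lemma fcoef_bound R0 f a r (n : int) M : dan R0 f -> 0 <= r < R0 ->
  (forall x, a <= x <= a + 2 * pi -> cmod (f (circle r x)) <= M) ->
  cmod (fcoef a (fun x => f (circle r x)) n) <= M.
Proof.
move=> hf hr hM; apply: mean_bound.
  by apply: ccont_mul; [exact: dan_ccont hf hr|exact: ccont_ei].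
by move=> x hx; rewrite cmodM cmod_ei mulr1; exact: hM.
Qed.

Lemma circle_bounded R0 f r : dan R0 f -> 0 <= r < R0 ->
  exists2 M, 0 <= M & forall x, cmod (f (circle r x)) <= M.
Proof.
move=> hf hr; have h := dan_ccont hf hr.
have [M M0 hM] := cint_bounded (le_a2pi 0) (ccontW h).
exists M => // x.
have per (y : R) (n : nat) : circle r (y + n%:R * (2 * pi)) = circle r y :> Cx R.
  by rewrite !circleE eiD ei_mulrn ei_2pi expr1n mulr1.
pose k := Num.floor (x / (2 * pi)).
have hk : 0 <= x - k%:~R * (2 * pi) <= 0 + 2 * pi.
  have h1 := floor_le_tmp (x / (2 * pi)); have h2 := ltW (floorD1_gt (x / (2 * pi))).
  rewrite ler_pdivlMr ?pi2_gt0// in h1; rewrite ler_pdivrMr ?pi2_gt0// intrD mulrDl mul1r in h2.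
  by rewrite -/k in h1 h2; apply/andP; split; lra.
have -> : circle r x = circle r (x - k%:~R * (2 * pi)) :> Cx R; last exact: hM.
case: k {hk} => n; first by rewrite -pmulrn -[in RHS](per _ n) subrK.
by rewrite NegzE mulrNz -pmulrn mulNr opprK per.
Qed.

Lemma contC_P (T : topologicalType) (u : T -> Cx R) (x : T) :
  {for x, continuous u} <->
  (forall e : R, 0 < e -> \forall t \near x, cmod (u t - u x) <= e).
Proof. exact: cvgC_P. Qed.

(** The quotient (f z - f z0) / (z / z0 - 1) with its singularity filled by the derivative times z0;
    continuity is what Bessel's inequality asks of it in [dan_has_ps]. *)
Lemma quotient_continuous f z0 : derivable f z0 1 -> exists2 l : Cx R, True &
  {for z0, continuous (fun z => if z == z0 then l * z0 else (f z - f z0) * z0 / (z - z0))}.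
Proof.
move=> /derivable_cmodP[l hl]; exists l => //.
apply/contC_P => e e0; rewrite eqxx.
have c0 : 0 < cmod z0 + 1 by rewrite ltr_wpDl.
have e1 : 0 < e / (cmod z0 + 1) by rewrite divr_gt0.
have [d d0 hd] := hl _ e1; apply/nbhsC_P; exists d => // w hw.
case: eqP => [_|/eqP wz]; first by rewrite subrr cmod0 ltW.
have wz0 : w - z0 != 0 by rewrite subr_eq0.
have := hd _ hw; rewrite [z0 + _]addrC subrK => h.
have -> : (f w - f z0) * z0 / (w - z0) - l * z0 =
  (f w - f z0 - l * (w - z0)) / (w - z0) * z0 by field.
rewrite !cmodM cmodV; apply: le_trans (_ : e / (cmod z0 + 1) * cmod z0 <= _).
  by rewrite ler_wpM2r// ler_pdivrMr ?cmod_gt0.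
by rewrite mulrAC ler_pdivrMr// ler_wpM2l ?(ltW e0)// lerDl.
Qed.

(* The n-th partial sum at z0 differs from f z0 by the n-th Fourier coefficient
   of the continuous function (f z - f z0) / (z / z0 - 1), which tends to 0. *)
Theorem dan_has_ps R0 f : 0 < R0 -> dan R0 f -> exists A, has_ps R0 f A.
Proof.
move=> R00 hf; pose r0 := R0 / 2.
have r00 : 0 < r0 by rewrite divr_gt0.
have r0R : r0 < R0 by rewrite /r0; lra.
(* Taylor coefficients read off at the radius R0 / 2; by [fcoef_pos] every other radius gives the
   same ones. *)
pose A (n : nat) := rc ((r0^-1) ^+ n) * fcoef 0 (fun x => f (circle r0 x)) n.
have AE r n : 0 < r < R0 -> fcoef 0 (fun x => f (circle r x)) n%:Z = A n * rc (r ^+ n).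
  move=> /andP[r_0 rR]; rewrite /A.
  have [h|h] := leP r0 r.
    by rewrite (fcoef_pos _ _ hf r00 h rR) expr_div_n exprVn rcM; ring.
  rewrite (fcoef_pos _ _ hf r_0 (ltW h) r0R) expr_div_n exprVn !rcM.
  have n0 : rc (r0 ^+ n) != 0 :> Cx R by rewrite rc_eq0 expf_neq0// gt_eqF.
  have n1 : rc (r ^+ n) != 0 :> Cx R by rewrite rc_eq0 expf_neq0// gt_eqF.
  by rewrite !rcV; field; rewrite n0 n1.
exists A; split.
  move=> r /andP[r_0 rR]; pose t := (r + R0) / 2.
  have t0 : 0 < t by rewrite /t; lra.
  have tR : t < R0 by rewrite /t; lra.
  have [M M0 hM] := circle_bounded hf (introT andP (conj (ltW t0) tR)).
  exists M => n; apply: le_trans (_ : cmod (A n) * t ^+ n <= _).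
    by rewrite ler_wpM2l// lerXn2r// ?nnegrE// ?(ltW t0)// /t; lra.
  have <- : cmod (rc (t ^+ n) : Cx R) = t ^+ n by rewrite cmod_rc ger0_norm// exprn_ge0// ltW.
  rewrite -cmodM -AE ?t0 ?tR//.
  by apply: (@fcoef_bound R0 f 0 t n M hf) => [|x _]; [rewrite ltW|exact: hM].
move=> z0 z0R; have [z00|z0n0] := eqVneq z0 0.
  rewrite z00; have h0 : A 0%N = f 0.
    have h n : psum A n.+1 0 = A 0%N.
      by rewrite /psum big_ord_recl expr0 mulr1 big1 ?addr0// => i _; rewrite exprS mul0r mulr0.
    have f0 : {for 0, continuous f} by apply/derivable_continuousC/hf; rewrite cmod0.
    apply/eqP; rewrite -subr_eq0 -cmod_eq0 eq_le cmod_ge0 andbT.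
    apply/ler_addgt0Pl => e e0; rewrite addr0.
    have [d d0 hd] := (nbhsC_P _ _).1 ((cvgC_P _ _).1 f0 e e0).
    pose r := Num.min (d / 2) r0.
    have r_0 : 0 < r by rewrite lt_min r00 divr_gt0.
    have rR : r < R0 by apply: le_lt_trans r0R; rewrite ge_min lexx orbT.
    have := AE r 0%N; rewrite r_0 rR expr0 mulr1 => /(_ isT) <-.
    rewrite /fcoef -{1}(mean_cst 0 (f 0)) -meanB; last 2 first.
    - apply: ccont_mul; last exact: ccont_ei.
      by apply: (dan_ccont hf); rewrite ltW.
    - exact: ccont_cst.
    apply: mean_bound.
      apply: ccont_sub; last exact: ccont_cst.
      apply: ccont_mul; last exact: ccont_ei.
      by apply: (dan_ccont hf); rewrite ltW.
    move=> x _; rewrite oppr0 mul0r ei0 mulr1; apply: hd.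
    rewrite subr0 cmod_circle ger0_norm ?(ltW r_0)//.
    by apply: (@le_lt_trans _ _ (d / 2)); [rewrite ge_min lexx|lra].
  apply/cvgC_P => e e0; near=> n.
  have n0 : (0 < n)%N by near: n; exact: nbhs_infty_gt.
  have -> : psum A n 0 = A 0%N.
    rewrite -(prednK n0) /psum big_ord_recl expr0 mulr1 big1 ?addr0// => i _.
    by rewrite exprS mul0r mulr0.
  by rewrite h0 subrr cmod0 ltW.
have [x0 hx0] := polar z0; set r := cmod z0 in hx0.
have r_0 : 0 < r by rewrite cmod_gt0.
have z0E : z0 = circle r x0 by rewrite circleE.
have [l _ hl] := quotient_continuous (hf z0 z0R).
pose H z := if z == z0 then l * z0 else (f z - f z0) * z0 / (z - z0).
pose h x := H (circle r x).
have hr : 0 <= r < R0 by rewrite ltW.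
have ch : ccont h.
  apply: (ccont_comp_circle hr) => z zR.
  have [->|zz0] := eqVneq z z0; first exact: hl.
  have cz : {for z, continuous (fun z => (f z - f z0) * z0 / (z - z0))}.
    apply: contC_mul; last first.
      apply: contC_inv; last by rewrite subr_eq0.
      by apply: contC_sub; [exact: cvg_id|exact: contC_cst].
    apply: contC_mul; last exact: contC_cst.
    by apply: contC_sub; [exact/derivable_continuousC/hf|exact: contC_cst].
  apply/contC_P => e e0.
  have [d d0 hd] := (nbhsC_P _ _).1 ((contC_P _ _).1 cz e e0).
  apply/nbhsC_P; exists (Num.min d (cmod (z - z0))).
    by rewrite lt_min d0 cmod_gt0 subr_eq0.
  move=> w; rewrite lt_min => /andP[w1 w2].
  rewrite /H (negbTE zz0); have [wz|_] := eqVneq w z0; last exact: hd.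
  by move: w2; rewrite wz cmodC ltxx.
have hq x : ei (- x0) * ei (1%:~R * x) = circle r x / z0.
  rewrite mul1r hx0 circleE eiN; have e0 := mul_cconj (ei x0).
  rewrite cmod_ei expr1n in e0.
  have r1 : rc r != 0 :> Cx R by rewrite rc_eq0 gt_eqF.
  have -> : cconj (ei x0) = (ei x0)^-1.
    by apply: (mulfI (ei_neq0 x0)); rewrite e0 divff// ei_neq0.
  by field; rewrite ei_neq0 r1.
have hfh x : f (circle r x) = f z0 * ei (0%:~R * x) + (ei (- x0) * (h x * ei (1%:~R * x)) - h x).
  rewrite mul0r ei0 mulr1 mulrCA hq /h /H; case: eqP => [->|/eqP cz].
    by rewrite divff// mulr1 subrr addr0.
  have cz0 : circle r x - z0 != 0 by rewrite subr_eq0.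
  by field; rewrite z0n0 cz0.
pose Hn (n : int) := fcoef 0 h n * ei (n%:~R * x0).
(* Multiplying h by z / z0 - 1 shifts its Fourier coefficients, so those of f, rotated to the
   argument of z0, are differences of consecutive [Hn], apart from the constant f z0 at n = 0. *)
have rec n : fcoef 0 (fun x => f (circle r x)) n * ei (n%:~R * x0) =
    (n == 0)%:R * f z0 + Hn (n - 1) - Hn n.
  have cn : ccont (fun x => ei (- n%:~R * x) : Cx R) by exact: ccont_ei.
  have -> : fcoef 0 (fun x => f (circle r x)) n =
      f z0 * fcoef 0 (fun x => ei (0%:~R * x)) n + (ei (- x0) * fcoef 0 h (n - 1) - fcoef 0 h n).
    have c1 : ccont (fun x => h x * ei (- (n - 1)%:~R * x)) by apply: ccont_mul; [exact: ch|exact: ccont_ei].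
    have c2 : ccont (fun x => h x * ei (- n%:~R * x)) by apply: ccont_mul; [exact: ch|exact: cn].
    have c3 : ccont (fun x => ei (0%:~R * x) * ei (- n%:~R * x) : Cx R) by apply: ccont_mul; exact: ccont_ei.
    have cc := @ccont_cst R.
    transitivity (mean 0 (fun x => f z0 * (ei (0%:~R * x) * ei (- n%:~R * x)) +
        (ei (- x0) * (h x * ei (- (n - 1)%:~R * x)) - h x * ei (- n%:~R * x)))); last first.
      rewrite (meanD 0 (ccont_mul (cc _) c3) (ccont_sub (ccont_mul (cc _) c1) c2)).
      by rewrite (meanB 0 (ccont_mul (cc _) c1) c2) (meanZ 0 _ c3) (meanZ 0 _ c1).
    apply: meanE => x _; rewrite hfh.
    have -> : ei (- (n - 1)%:~R * x) = ei (1%:~R * x) * ei (- n%:~R * x) :> Cx R.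
      by rewrite -eiD; congr ei; rewrite intrB -[1%:~R]/(1 : R); ring.
    ring.
  rewrite fcoef_ei [0 == n]eq_sym /Hn.
  have -> : ei ((n - 1)%:~R * x0) = ei (n%:~R * x0) * ei (- x0) :> Cx R.
    by rewrite -eiD; congr ei; rewrite intrB -[1%:~R]/(1 : R); ring.
  case: eqP => [->|_]; last by rewrite !mul0r mulr0 !add0r; ring.
  by rewrite mul0r ei0; ring.
have [M M0 hM] : exists2 M, 0 <= M & forall (phi : nat -> int) N, injective phi ->
    \sum_(k < N) cmod (Hn (phi k)) ^+ 2 <= M.
  exists (Num.max 0 (complex.Re (mean 0 (fun x => h x * cconj (h x))))).
    by rewrite le_max lexx.
  move=> phi N hphi; rewrite le_max; apply/orP; right.
  apply: le_trans (bessel 0 N hphi ch); apply: ler_sum => k _.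
  by rewrite /Hn cmodM cmod_ei mulr1.
(* Negative coefficients of f vanish, so [Hn] is constant on negative indices; Bessel's inequality
   makes this constant square summable, hence 0. *)
have Hneg : Hn (-1) = 0.
  have hn m : Hn (- (m.+1)%:Z) = Hn (-1).
    elim: m => [//|m IH]; rewrite -IH.
    have := rec (- (m.+1)%:Z); rewrite (fcoef_neg _ _ hf) ?r_0// mul0r.
    have -> : (- (m.+1)%:Z == 0 :> int) = false by [].
    rewrite mul0r add0r => /eqP; rewrite eq_sym subr_eq0 => /eqP <-.
    by congr Hn; rewrite -[m.+2]addn1 PoszD opprD.
  apply/eqP; rewrite -cmod_eq0 -sqrf_eq0; apply/eqP.
  set c := cmod (Hn (-1)) ^+ 2.
  have c0 : 0 <= c by rewrite sqr_ge0.
  have hc N : c * N%:R <= M.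
    have inj : injective (fun m : nat => - (m.+1)%:Z) by move=> x y /oppr_inj [].
    have := hM _ N inj.
    rewrite (eq_bigr (fun=> c)); last by move=> k _; rewrite /c -(hn k).
    by rewrite sumr_const card_ord mulr_natr.
  apply/eqP; rewrite eq_le c0 andbT leNgt; apply/negP => cp.
  have h1 := archi_boundP (divr_ge0 M0 c0).
  by move: h1; rewrite ltNge ler_pdivlMr// mulrC hc.
have e1 (k : nat) : k.+1%:Z - 1 = k%:Z by rewrite intS addrC addKr.
(* The recursion telescopes. *)
have psE N : psum A N z0 = f z0 * (N != 0%N)%:R - Hn (N%:Z - 1).
  elim: N => [|N IH].
    by rewrite /psum big_ord0 mulr0 !sub0r Hneg oppr0.
  rewrite /psum big_ord_recr /= -/(psum A N z0) IH.
  have -> : A N * z0 ^+ N = fcoef 0 (fun x => f (circle r x)) N * ei (N%:~R * x0).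
    by rewrite AE ?r_0//= {1}z0E circle_exp mulrA.
  rewrite rec e1; case: N {IH} => [|N] /=; first by rewrite Hneg; ring.
  ring.
have Hlim : (fun n => cmod (Hn n%:Z) ^+ 2) @ \oo --> 0.
  apply: cvg_series_cvg_0; apply: nondecreasing_is_cvgn.
    by apply: nondecreasing_series => n _ _; exact: sqr_ge0.
  exists M => _ [N _ <-]; rewrite /series /= big_mkord.
  by apply: (hM Posz) => x y [].
rewrite -cvg_shiftS; apply/cvgC_P => e e0.
have e2 : 0 < e ^+ 2 by rewrite exprn_gt0.
move/cvgrPdist_le : Hlim => /(_ _ e2); apply: filterS => n.
rewrite sub0r normrN ger0_norm ?sqr_ge0// => hle.
rewrite psE mulr1 e1 addrAC subrr add0r cmodN.
by rewrite -(@ler_pXn2r _ 2)// ?nnegrE// ltW.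
Unshelve. all: by end_near. Qed.

End CauchyTheory.

(** * Hardy norms, Parseval's identity and Cauchy's formula *)

Section HardyNorms.
Context {R : realType}.
Implicit Types (A : nat -> Cx R) (f g : Cx R -> Cx R) (u : R -> Cx R) (z w : Cx R) (r a s M : R).

Lemma has_ps_dan R0 f A : has_ps R0 f A -> dan R0 f.
Proof. by move=> hf z hz; exact: has_ps_derivable hf hz. Qed.

Lemma le_geom0 (x C q : R) N0 : 0 <= q < 1 -> (forall N, (N0 <= N)%N -> x <= C * q ^+ N) ->
  x <= 0.
Proof.
move=> /andP[q0 q1] h; have := @cvg_geometric R C q; rewrite ger0_norm// => /(_ q1) hc.
rewrite -(cvg_lim (@Rhausdorff R) hc); apply: limr_ge; first by apply/cvg_ex; exists 0.
by near=> N; apply: h; near: N; exact: nbhs_infty_ge.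
Unshelve. all: by end_near. Qed.

Lemma fcoef_trig a (c : nat -> Cx R) N (m : int) :
  fcoef a (fun x => \sum_(n < N) c n * ei (n%:~R * x)) m = \sum_(n < N) c n * (n%:Z == m)%:R.
Proof.
have h (n : nat) : ccont (fun x => ei (n%:~R * x) * ei (- m%:~R * x) : Cx R).
  by apply: ccont_mul; exact: ccont_ei.
rewrite /fcoef (meanE (v := fun x => \sum_(n < N) c n * (ei (n%:~R * x) * ei (- m%:~R * x)))).
  rewrite mean_sum; last by move=> n; apply: ccont_mul; [exact: ccont_cst|exact: h].
  by apply: eq_bigr => n _; rewrite (meanZ _ _ (h n)) -/(fcoef a _ m) fcoef_ei.
by move=> x _; rewrite mulr_suml; apply: eq_bigr => n _; rewrite mulrA.
Qed.

Lemma psum_circle A N r x :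
  psum A N (circle r x) = \sum_(n < N) (A n * rc (r ^+ n)) * ei (n%:~R * x).
Proof. by apply: eq_bigr => n _; rewrite circle_exp mulrA. Qed.

Lemma ccont_trig (c : nat -> Cx R) N : ccont (fun x => \sum_(n < N) c n * ei (n%:~R * x)).
Proof. by apply: ccont_sum => n; apply: ccont_mul; [exact: ccont_cst|exact: ccont_ei]. Qed.

Lemma ccont_psum A N r : ccont (fun x => psum A N (circle r x)).
Proof. by under eq_fun do rewrite psum_circle; exact: (ccont_trig (fun n => A n * rc (r ^+ n))). Qed.

Lemma has_ps_fcoef R0 f A a r (k : nat) : has_ps R0 f A -> 0 <= r < R0 ->
  fcoef a (fun x => f (circle r x)) k = A k * rc (r ^+ k).
Proof.
move=> hf hr; have [C [q [C0 hq h]]] := has_ps_unif hf hr.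
apply/eqP; rewrite -subr_eq0 -cmod_eq0 eq_le cmod_ge0 andbT.
apply: (@le_geom0 _ C q k.+1) => // N kN.
have -> : A k * rc (r ^+ k) = fcoef a (fun x => psum A N (circle r x)) k.
  rewrite /fcoef (meanE (v := fun x => (\sum_(n < N) (A n * rc (r ^+ n)) * ei (n%:~R * x)) * ei (- k%:~R * x))).
    rewrite -/(fcoef a _ k) (fcoef_trig a (fun n => A n * rc (r ^+ n))).
    rewrite (bigD1 (Ordinal kN))//= eqxx mulr1 big1 ?addr0// => i ik.
    rewrite (_ : _ == _ = false) ?mulr0//; apply: contra_neqF ik.
    by move=> /eqP [] ik; exact: val_inj.
  by move=> x _; rewrite psum_circle.
have c1 := dan_ccont (has_ps_dan hf) hr.
have c2 := ccont_psum A N r.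
have ce : ccont (fun x => ei (- k%:~R * x) : Cx R) by exact: ccont_ei.
rewrite /fcoef -(meanB a (ccont_mul c1 ce) (ccont_mul c2 ce)); apply: mean_bound.
  exact: ccont_sub (ccont_mul c1 ce) (ccont_mul c2 ce).
move=> x _; rewrite -mulrBl cmodM cmod_ei mulr1; apply: h.
by rewrite cmod_circle ger0_norm//; case/andP: hr.
Qed.

Lemma mean_trig_sq (c : nat -> Cx R) N :
  mean 0 (fun x => (\sum_(n < N) c n * ei (n%:~R * x)) * cconj (\sum_(n < N) c n * ei (n%:~R * x)))
  = rc (\sum_(n < N) cmod (c n) ^+ 2).
Proof.
set S := fun x => \sum_(n < N) c n * ei (n%:~R * x).
have cS : ccont S by exact: ccont_trig.
have h (n : nat) : ccont (fun x => ei (n%:~R * x) * cconj (S x)).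
  by apply: ccont_mul; [exact: ccont_ei|exact: ccont_cconj].
rewrite (meanE (v := fun x => \sum_(n < N) c n * (ei (n%:~R * x) * cconj (S x)))); last first.
  by move=> x _; rewrite -/(S x) {1}/S mulr_suml; apply: eq_bigr => n _; rewrite mulrA.
rewrite mean_sum; last by move=> n; apply: ccont_mul; [exact: ccont_cst|exact: h].
rewrite rc_sum; apply: eq_bigr => n _; rewrite (meanZ _ _ (h n)) -mul_cconj; congr (_ * _).
rewrite (meanE (v := fun x => cconj (S x * ei (- n%:~R * x)))); last first.
  by move=> x _; rewrite cconjM mulNr eiN cconjK mulrC.
rewrite mean_cconj; last by apply: ccont_mul => //; exact: ccont_ei.
rewrite -/(fcoef 0 S n) fcoef_trig (bigD1 n)//= eqxx mulr1 big1 ?addr0// => i ik.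
rewrite (_ : _ == _ = false) ?mulr0//; apply: contra_neqF ik.
by move=> /eqP [] ik; exact: val_inj.
Qed.

Definition rmean (F : R -> R) : R := (2 * pi)^-1 * rint 0 (2 * pi) F.
Definition rcont (F : R -> R) := forall x : R, {for x, continuous F}.

Lemma rmeanE F G : (forall x, F x = G x) -> rmean F = rmean G.
Proof. by move=> h; congr rmean; exact/funext. Qed.
Lemma rcontW a b F : rcont F -> rcontI a b F. Proof. by move=> h x _; exact: h. Qed.
Lemma rmean_rc F : mean 0 (fun x => rc (F x)) = rc (rmean F).
Proof. by rewrite mean_real /rmean add0r. Qed.
Lemma le_rmean F G : rcont F -> rcont G -> (forall x, F x <= G x) -> rmean F <= rmean G.
Proof.
move=> hF hG h; apply: ler_wpM2l; first by rewrite invr_ge0 ltW// pi2_gt0.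
apply: le_rint; [exact: rcontW|exact: rcontW|by move=> x _; exact: h].
Qed.
Lemma rmean_cst k : rmean (fun=> k) = k.
Proof.
by apply: rc_inj; rewrite -rmean_rc mean_cst.
Qed.
Lemma rmean_ge0 F : (forall x, 0 <= F x) -> 0 <= rmean F.
Proof.
move=> h; apply: mulr_ge0; first by rewrite invr_ge0 ltW// pi2_gt0.
by apply: rint_ge0 => x _; exact: h.
Qed.
Lemma rmeanD F G : rcont F -> rcont G -> rmean (fun x => F x + G x) = rmean F + rmean G.
Proof. by move=> hF hG; rewrite /rmean (rintD (rcontW hF) (rcontW hG)) mulrDr. Qed.
Lemma rmeanZ k F : rcont F -> rmean (fun x => k * F x) = k * rmean F.
Proof. by move=> hF; rewrite /rmean (rintZ _ (rcontW hF)) mulrCA. Qed.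
Lemma rcont_cst k : rcont (fun=> k). Proof. by move=> x; exact: cvg_cst. Qed.
Lemma rcont_add F G : rcont F -> rcont G -> rcont (fun x => F x + G x).
Proof. by move=> hF hG x; exact: cvgD (hF x) (hG x). Qed.
Lemma rcont_mul F G : rcont F -> rcont G -> rcont (fun x => F x * G x).
Proof. by move=> hF hG x; exact: (cvgM (hF x) (hG x)). Qed.
Lemma rcont_cmod u : ccont u -> rcont (fun x => cmod (u x)).
Proof. by move=> /ccontP hu x; exact: continuous_cmod_comp. Qed.
Lemma rcont_exp F n : rcont F -> rcont (fun x => F x ^+ n).
Proof.
move=> hF; elim: n => [|n IH]; first exact: rcont_cst.
by under eq_fun do rewrite exprS; exact: rcont_mul.
Qed.
Lemma cmod_mean_le0 u : ccont u -> cmod (mean 0 u) <= rmean (fun x => cmod (u x)).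
Proof. by move=> hu; have := cmod_mean_le 0 hu; rewrite add0r. Qed.

Lemma rmean_sq u : rc (rmean (fun x => cmod (u x) ^+ 2)) = mean 0 (fun x => u x * cconj (u x)).
Proof. by rewrite -rmean_rc; apply: meanE => x _; rewrite mul_cconj. Qed.

Lemma parseval_ge R0 f A r N : has_ps R0 f A -> 0 <= r < R0 ->
  \sum_(n < N) cmod (A n) ^+ 2 * r ^+ (2 * n) <= rmean (fun x => cmod (f (circle r x)) ^+ 2).
Proof.
move=> hf hr; have [r0 rR] := andP hr.
have cf := dan_ccont (has_ps_dan hf) hr.
have := @bessel R 0 _ Posz N (fun x y e => let: erefl := e in erefl) cf.
rewrite -rmean_sq; apply: le_trans; apply: ler_sum => n _.
rewrite (has_ps_fcoef 0 n hf hr) cmodM cmod_rc ger0_norm ?exprn_ge0// exprMn mulnC exprM.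
by rewrite -!exprM mulnC.
Qed.

(** Replacing f by its N-th partial sum changes the mean square by at most a constant times q^N, and
    for a trigonometric polynomial orthogonality gives the mean square exactly. *)
Lemma parseval_le R0 f A r M : has_ps R0 f A -> 0 <= r < R0 ->
  (forall N, \sum_(n < N) cmod (A n) ^+ 2 * r ^+ (2 * n) <= M) ->
  rmean (fun x => cmod (f (circle r x)) ^+ 2) <= M.
Proof.
move=> hf hr hM; have [r0 rR] := andP hr.
have cf := dan_ccont (has_ps_dan hf) hr.
have [B B0 hB] := circle_bounded (has_ps_dan hf) hr.
have [C [q [C0 hq h]]] := has_ps_unif hf hr; have [q0 q1] := andP hq.
rewrite -subr_le0; apply: (@le_geom0 _ (C * (2 * B + C)) q 0) => // N _.
rewrite lerBlDl.
have hS : rmean (fun x => cmod (psum A N (circle r x)) ^+ 2) <= M.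
  apply: le_trans (hM N); rewrite le_eqVlt; apply/orP; left; apply/eqP.
  apply: rc_inj; rewrite rmean_sq.
  under eq_fun do rewrite psum_circle; rewrite (mean_trig_sq (fun n => A n * rc (r ^+ n))).
  congr rc; apply: eq_bigr => n _.
  by rewrite cmodM cmod_rc ger0_norm ?exprn_ge0// exprMn -!exprM mulnC.
apply: (@le_trans _ _ (rmean (fun x => cmod (psum A N (circle r x)) ^+ 2 + C * (2 * B + C) * q ^+ N))).
  have cp := ccont_psum A N r.
  apply: le_rmean.
  - exact/rcont_exp/rcont_cmod.
  - apply: rcont_add; last exact: rcont_cst.
    exact/rcont_exp/rcont_cmod.
  - move=> x; have h1 : cmod (f (circle r x) - psum A N (circle r x)) <= C * q ^+ N.
      by apply: h; rewrite cmod_circle ger0_norm.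
    have h2 := hB x; move: (cmod_ge0 (f (circle r x))) h1 h2.
    set F := f _; set S := psum _ _ _ => F0 h1 h2.
    have h3 := cmod_triangle h1; have h4 : cmod S <= cmod F + C * q ^+ N.
      by apply: cmod_triangle; rewrite cmodC.
    have qN : q ^+ N <= 1 by apply: exprn_ile1 => //; exact: ltW.
    have qN0 : 0 <= q ^+ N by exact: exprn_ge0.
    set d := C * q ^+ N in h1 h3 h4.
    have d0 : 0 <= d by exact: mulr_ge0.
    have dC : d <= C by rewrite /d ler_piMr.
    have -> : C * (2 * B + C) * q ^+ N = d * (2 * B + C) by rewrite /d; ring.
    have S0 := cmod_ge0 S.
    have : cmod F ^+ 2 - cmod S ^+ 2 <= d * (cmod F + cmod S).
      rewrite subr_sqr; apply: ler_wpM2r; first exact: addr_ge0.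
      by lra.
    have : d * (cmod F + cmod S) <= d * (2 * B + C) by apply: ler_wpM2l => //; lra.
    lra.
rewrite rmeanD; [|exact/rcont_exp/rcont_cmod/ccont_psum|exact: rcont_cst].
by rewrite rmean_cst lerD2r.
Qed.

(** Away from the zeros of F this is exp (s ln F); at a zero ln is singular and closeness e^(1/s) is
    used directly. *)
Lemma continuous_powR_comp (T : topologicalType) (F : T -> R) (x : T) s : 0 < s ->
  (forall t, 0 <= F t) -> {for x, continuous F} -> {for x, continuous (fun t => F t `^ s)}.
Proof.
move=> s0 F0 hF; have [Fx|Fx] := eqVneq (F x) 0.
  apply/cvgrPdist_le => e e0; move/cvgrPdist_le : hF => /(_ (e `^ s^-1)).
  rewrite powR_gt0// => /(_ isT); apply: filterS => t.
  rewrite Fx powR0 ?gt_eqF// !sub0r !normrN !ger0_norm ?powR_ge0// => h.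
  have := @ge0_ler_powR _ s (ltW s0) _ _ _ _ h; rewrite !nnegrE => /(_ (F0 t) (powR_ge0 _ _)).
  by rewrite -powRrM mulVf ?gt_eqF// powRr1// ltW.
have Fx0 : 0 < F x by rewrite lt_neqAle eq_sym Fx F0.
have h : {for x, continuous (fun t => expR (s * ln (F t)))}.
  apply: continuous_comp; last exact: continuous_expR.
  apply: (cvgM (cvg_cst s)); apply: continuous_comp; [exact: hF|exact: continuous_ln].
suff : F t `^ s @[t --> x] --> F x `^ s by [].
rewrite [X in _ --> X]/powR (negbTE Fx); apply: cvg_trans h; apply: near_eq_cvg.
have : \forall t \near x, 0 < F t.
  by move/cvgr_gt : hF => /(_ 0 Fx0).
by apply: filterS => t; rewrite /powR lt0r => /andP[/negbTE -> _].
Qed.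

Lemma rcont_powR F s : 0 < s -> (forall x, 0 <= F x) -> rcont F -> rcont (fun x => F x `^ s).
Proof. by move=> s0 F0 hF x; exact: continuous_powR_comp. Qed.

Lemma integral_rint a b F : rcontI a b F ->
  (\int[lebesgue_measure]_(x in `[a, b]) (F x)%:E)%E = (rint a b F)%:E.
Proof.
move=> /rcontI_integrable hF; rewrite rint.unlock /Rintegral fineK//.
exact: integrable_fin_num.
Qed.

Lemma circle_normE s u : 0 < s -> ccont u ->
  circle_norm s u = (rmean (fun x => cmod (u x) `^ s) `^ s^-1)%:E.
Proof.
move=> s0 cu; rewrite /circle_norm (@integral_rint _ _ (fun x => cmod (u x) `^ s))//.
by apply: rcontW; apply: rcont_powR => //; exact: rcont_cmod.
Qed.

Lemma powR_inv_le (s x y : R) : 0 < s -> 0 <= x -> 0 <= y ->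
  (x `^ s^-1 <= y) = (x <= y `^ s).
Proof.
move=> s0 x0 y0; apply/idP/idP => h.
  have := @ge0_ler_powR _ s (ltW s0) _ _ _ _ h; rewrite !nnegrE => /(_ (powR_ge0 _ _) y0).
  by rewrite -powRrM mulVf ?gt_eqF// powRr1.
have si : 0 <= s^-1 by rewrite invr_ge0 ltW.
have := @ge0_ler_powR _ s^-1 si _ _ _ _ h; rewrite !nnegrE => /(_ x0 (powR_ge0 _ _)).
by rewrite -powRrM divff ?gt_eqF// powRr1.
Qed.

Lemma hardy_pP s M f : 0 < s -> 0 <= M -> analytic f ->
  (hardy_norm s%:E f <= M%:E)%E <->
  (forall r, 0 < r < 1 -> rmean (fun x => cmod (f (circle r x)) `^ s) <= M `^ s).
Proof.
move=> s0 M0 hf.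
have E r : 0 < r < 1 -> integral_mean s%:E r f =
    (rmean (fun x => cmod (f (circle r x)) `^ s) `^ s^-1)%:E.
  move=> /andP[r0 r1]; rewrite /= circle_normE//.
  by apply: (dan_ccont hf); rewrite ltW.
have ge0 r : 0 <= rmean (fun x => cmod (f (circle r x)) `^ s).
  by apply: rmean_ge0 => x; exact: powR_ge0.
split => [h r hr|h].
  rewrite -powR_inv_le// -lee_fin -E//; apply: le_trans h.
  by apply: ereal_sup_ubound; exists r => //; rewrite /= in_itv.
apply: ge_ereal_sup => x [r /=]; rewrite in_itv /= => hr <-.
by rewrite -/(integral_mean s%:E r f) E// lee_fin powR_inv_le//; exact: h.
Qed.

Lemma hardy_norm_ge0 p f : p != -oo%E -> (0 <= hardy_norm p f)%E.
Proof.
move=> pN; have h2 : (2^-1 : R) \in `]0, 1[ by rewrite in_itv /=; apply/andP; split; lra.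
have : (0 <= integral_mean p 2^-1 f)%E.
  case: p pN => [s||]// _; first exact: poweR_ge0.
  apply: (@le_trans _ _ (cmod (f (rc 2^-1)))%:E); first by rewrite lee_fin.
  by apply: ereal_sup_ubound; exists (rc 2^-1) => //=; rewrite cmod_rc ger0_norm// invr_ge0.
move/le_trans; apply; apply: ereal_sup_ubound; by exists 2^-1.
Qed.

Lemma hardy_fin p f : p != -oo%E -> hardy p f ->
  exists2 N : R, 0 <= N & hardy_norm p f = N%:E.
Proof.
move=> pN [_ hf]; have h0 := hardy_norm_ge0 f pN.
exists (fine (hardy_norm p f)); first exact: fine_ge0.
by rewrite fineK// ge0_fin_numE.
Qed.

(** A finite sum may be taken to r = 1: by Bernoulli's inequality the radius 1 - d loses at most d
    times the fixed number K. *)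
Lemma sum_r1_le (b : nat -> R) (k : nat -> nat) N M : (forall n, 0 <= b n) ->
  (forall r, 0 < r < 1 -> \sum_(n < N) b n * r ^+ k n <= M) -> \sum_(n < N) b n <= M.
Proof.
move=> b0 h; apply/ler_addgt0Pl => e e0.
pose K := \sum_(n < N) b n * (k n)%:R.
have K0 : 0 <= K by apply: sumr_ge0 => n _; exact: mulr_ge0.
pose d := Num.min (2^-1) (e / (K + 1)).
have K1 : 0 < K + 1 by rewrite ltr_wpDl.
have d0 : 0 < d by rewrite lt_min invr_gt0 ltr0n divr_gt0.
have d2 : d <= 2^-1 by rewrite ge_min lexx.
have hr : 0 < 1 - d < 1 by apply/andP; split; lra.
have dK : d * K <= e.
  apply: (@le_trans _ _ (d * (K + 1))); first by rewrite ler_wpM2l ?(ltW d0)// lerDl.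
  by rewrite -ler_pdivlMr// ge_min lexx orbT.
have bern n : 1 - n%:R * d <= (1 - d) ^+ n.
  elim: n => [|n IH]; first by rewrite mul0r subr0 expr0.
  rewrite exprS; apply: (@le_trans _ _ ((1 - d) * (1 - n%:R * d))); last first.
    by rewrite ler_wpM2l//; lra.
  rewrite -natr1; have : 0 <= n%:R * d * d by rewrite !mulr_ge0// ltW.
  by lra.
have := h _ hr => h1.
have : \sum_(n < N) b n - d * K <= \sum_(n < N) b n * (1 - d) ^+ k n.
  rewrite /K mulr_sumr -sumrB; apply: ler_sum => n _.
  apply: (@le_trans _ _ (b n * (1 - (k n)%:R * d))); last by rewrite ler_wpM2l.
  by rewrite le_eqVlt; apply/orP; left; apply/eqP; ring.
lra.
Qed.

(** The isometry of H^2 with l^2, through which the operator questions become questions about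
    coefficients. *)
Lemma hardy2P f A M : has_ps 1 f A -> 0 <= M ->
  (hardy_norm 2%:E f <= M%:E)%E <-> (forall N, \sum_(n < N) cmod (A n) ^+ 2 <= M ^+ 2).
Proof.
move=> hf M0; have af : analytic f := has_ps_dan hf.
have E r : rmean (fun x => cmod (f (circle r x)) `^ 2) = rmean (fun x => cmod (f (circle r x)) ^+ 2).
  by apply: rmeanE => x; rewrite powR_mulrn.
rewrite (hardy_pP _ M0 af)// powR_mulrn//; split => [h N|h r hr].
  apply: (@sum_r1_le (fun n => cmod (A n) ^+ 2) (fun n => (2 * n)%N)) => [n|r hr]; first exact: sqr_ge0.
  apply: le_trans (parseval_ge N hf _) _; last by rewrite -E; exact: h.
  by case/andP: hr => /ltW -> ->.
have [r0 r1] := andP hr; rewrite E; apply: (parseval_le hf); first by rewrite ltW.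
move=> N; apply: le_trans (h N); apply: ler_sum => n _.
by rewrite ler_piMr ?sqr_ge0// exprn_ile1// ltW.
Qed.

Lemma hardy2_fin f A M : has_ps 1 f A -> 0 <= M ->
  (forall N, \sum_(n < N) cmod (A n) ^+ 2 <= M ^+ 2) ->
  hardy 2%:E f /\ (hardy_norm 2%:E f <= M%:E)%E.
Proof.
move=> hf M0 /(hardy2P hf M0) h; split => //; split; first exact: has_ps_dan hf.
exact: le_lt_trans h (ltry _).
Qed.

(** The kernel is a geometric series in z / circle r x; against its N-th partial sum the mean of f
    is the N-th Taylor polynomial, and both sides converge. *)
Lemma cauchy_formula R0 f a r z : dan R0 f -> cmod z < r -> r < R0 ->
  f z = mean a (fun x => f (circle r x) * (1 - z / circle r x)^-1).
Proof.
move=> hf zr rR; have r0 : 0 < r := le_lt_trans (cmod_ge0 z) zr.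
have hr : 0 <= r < R0 by rewrite ltW.
have [A hA] := dan_has_ps (lt_trans r0 rR) hf.
have cne x : circle r x != 0 by rewrite -cmod_gt0 cmod_circle gtr0_norm.
pose q := cmod z / r.
have q0 : 0 <= q by rewrite divr_ge0// ltW.
have q1 : q < 1 by rewrite ltr_pdivrMr// mul1r.
have cq x : cmod (z / circle r x) = q by rewrite cmodM cmodV cmod_circle gtr0_norm.
have ne1 x : 1 - z / circle r x != 0.
  rewrite subr_eq0; apply/eqP => /(congr1 cmod); rewrite cq cmod1 => h.
  by move: q1; rewrite -h ltxx.
have [B B0 hB] := circle_bounded hf hr.
have cf := dan_ccont hf hr.
have cz : ccont (fun x => z / circle r x).
  by apply: ccont_mul; [exact: ccont_cst|apply: ccont_inv; [exact: ccont_circle|exact: cne]].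
have ck : ccont (fun x => (1 - z / circle r x)^-1).
  by apply: ccont_inv; [apply: ccont_sub; [exact: ccont_cst|exact: cz]|exact: ne1].
apply: (cvgC_unique (hA.2 z (lt_trans zr rR))); apply/cvgC_P => e e0.
have hg := @cvg_geometric R (B / (1 - q)) q; rewrite ger0_norm// in hg.
move/cvgrPdist_le : (hg q1) => /(_ _ e0); apply: filterS => N.
rewrite sub0r normrN /= => /(le_trans (ler_norm _)); apply: le_trans.
have -> : psum A N z = mean a (fun x => f (circle r x) * \sum_(n < N) (z / circle r x) ^+ n).
  rewrite (meanE (v := fun x => \sum_(n < N) z ^+ n / rc (r ^+ n) * (f (circle r x) * ei (- n%:~R * x)))).
    have ch (n : nat) : ccont (fun x => f (circle r x) * ei (- n%:~R * x)).
      by apply: ccont_mul; [exact: cf|exact: ccont_ei].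
    rewrite mean_sum; last by move=> n; apply: ccont_mul; [exact: ccont_cst|exact: ch].
    apply: eq_bigr => n _; rewrite (meanZ _ _ (ch n)) -/(fcoef a (fun x => f (circle r x)) n).
    rewrite (has_ps_fcoef a n hA hr) mulrCA divfK// rc_eq0 expf_neq0// gt_eqF//.
  move=> x _; rewrite mulr_sumr; apply: eq_bigr => n _.
  rewrite expr_div_n circle_exp invfM mulNr eiN.
  have -> : (ei (n%:~R * x))^-1 = cconj (ei (n%:~R * x)) :> Cx R.
    apply: (mulfI (ei_neq0 (n%:~R * x))).
    by rewrite mul_cconj cmod_ei expr1n divff// ei_neq0.
  ring.
have cs : ccont (fun x => f (circle r x) * \sum_(n < N) (z / circle r x) ^+ n).
  by apply: ccont_mul; [exact: cf|apply: ccont_sum => n; exact: ccont_exp].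
have cfk := ccont_mul cf ck.
rewrite -(meanB a cs cfk); apply: mean_bound; first exact: ccont_sub.
move=> x _; rewrite -mulrBr cmodM.
have -> : \sum_(n < N) (z / circle r x) ^+ n - (1 - z / circle r x)^-1 =
    - ((z / circle r x) ^+ N / (1 - z / circle r x)).
  have h := ne1 x; have := subrX1 (z / circle r x) N; move: (z / circle r x) h => y h hy.
  have -> : y ^+ N = 1 + (y - 1) * \sum_(i < N) y ^+ i by rewrite -hy addrC subrK.
  by move: (\sum_(i < N) y ^+ i) => S; field.
rewrite cmodN cmodM cmodV cmodX cq mulrA [B / _ * _]mulrAC.
apply: ler_pM; [by rewrite mulr_ge0// exprn_ge0|by rewrite invr_ge0| |].
  by rewrite ler_wpM2r ?exprn_ge0.
rewrite lef_pV2 ?posrE ?subr_gt0// ?cmod_gt0//.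
by have := @cmod_triangle _ 1 (z / circle r x) _ (lexx _); rewrite cmod1 cq; lra.
Qed.

End HardyNorms.

(** * The Poisson kernel and the kernel of Fejer and Riesz *)

Section PoissonFejerRiesz.
Context {R : realType}.
Implicit Types (f g : Cx R -> Cx R) (u : R -> Cx R) (z w : Cx R) (r a s t x M : R).

(** The tangent line of a convex power, from Young's inequality for y and m^(p-1) with exponents p
    and p / (p - 1). Averaged, it serves as Jensen's inequality throughout. *)
Lemma powR_tangent (p y m : R) : 1 <= p -> 0 <= y -> 0 <= m ->
  m `^ p + p * m `^ (p - 1) * (y - m) <= y `^ p.
Proof.
move=> p1 y0 m0; have [->|pn1] := eqVneq p 1.
  by rewrite !powRr1// subrr powRr0; lra.
have p0 : 0 < p by lra.
have p10 : 0 < p - 1 by rewrite subr_gt0 lt_neqAle eq_sym pn1.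
have mp : m `^ (p - 1) * m = m `^ p.
  have [->|mn0] := eqVneq m 0; first by rewrite mulr0 powR0// gt_eqF.
  by rewrite -{2}(powRr1 m0) -powRD ?subrK// mn0 implybT.
pose q := p / (p - 1).
have q0 : 0 < q by rewrite divr_gt0.
have := @conjugate_powR _ y (m `^ (p - 1)) p q y0 (powR_ge0 _ _) p0 q0.
rewrite -powRrM /q [(p - 1) * _]mulrC divfK ?gt_eqF// => H.
have {}H : y * m `^ (p - 1) <= y `^ p / p + m `^ p / (p / (p - 1)).
  by apply: H; field; rewrite gt_eqF// gt_eqF.
have e1 : m `^ p / (p / (p - 1)) = m `^ p - m `^ p / p by field; rewrite gt_eqF// gt_eqF.
have : p * (y * m `^ (p - 1)) <= p * (y `^ p / p + m `^ p / (p / (p - 1))).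
  by rewrite ler_wpM2l// ltW.
rewrite e1 mulrDr mulrBr ![p * (_ / p)]mulrCA divff ?gt_eqF// !mulr1.
rewrite -mp; lra.
Qed.

Definition poisson r z x : R := (r ^+ 2 - cmod z ^+ 2) / cmod (circle r x - z) ^+ 2.

Lemma circle_neq r z x : cmod z < r -> circle r x - z != 0.
Proof.
move=> zr; rewrite subr_eq0; apply/eqP => e; move: zr; rewrite -e cmod_circle.
by rewrite ltNge ler_norm.
Qed.

Lemma poisson_ge0 r z x : cmod z < r -> 0 <= poisson r z x.
Proof.
move=> zr; rewrite divr_ge0 ?sqr_ge0// subr_ge0 lerXn2r// ?nnegrE ?(ltW zr)//.
exact: le_trans (ltW zr).
Qed.

Lemma rcont_inv (F : R -> R) : rcont F -> (forall x, F x != 0) -> rcont (fun x => (F x)^-1).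
Proof. by move=> hF h x; exact: (cvgV (h x) (hF x)). Qed.

Lemma rcont_poisson r z : cmod z < r -> rcont (poisson r z).
Proof.
move=> zr; apply: rcont_mul; first exact: rcont_cst.
apply: rcont_inv; last by move=> x; rewrite expf_neq0// cmod_eq0 circle_neq.
apply/rcont_exp/rcont_cmod/ccont_sub; [exact: ccont_circle|exact: ccont_cst].
Qed.

Lemma ccont_rc (F : R -> R) : rcont F -> ccont (fun x => rc (F x)).
Proof. by move=> hF; apply/ccontP => x; exact: continuous_rc_comp. Qed.

(* Cauchy's formula for f z (r^2 - |z|^2) / (r^2 - conj z * _). *)
Lemma poisson_formula f a r z : analytic f -> cmod z < r -> r < 1 ->
  f z = mean a (fun x => f (circle r x) * rc (poisson r z x)).
Proof.
move=> hf zr r1; have r0 : 0 < r := le_lt_trans (cmod_ge0 z) zr.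
have zz : cmod z ^+ 2 < r ^+ 2 by rewrite ltrXn2r// ?nnegrE ?ltW.
pose m := Num.max (cmod z) (r ^+ 2).
have m0 : 0 < m by rewrite lt_max exprn_gt0 ?orbT.
pose R1 := r ^+ 2 / m.
have R11 : R1 <= 1 by rewrite ler_pdivrMr// mul1r le_max lexx orbT.
have rR : r < R1.
  rewrite ltr_pdivlMr// expr2 ltr_pM2l// gt_max zr /= expr2.
  by rewrite -{3}(mulr1 r) ltr_pM2l.
pose D (w : Cx R) : Cx R := rc (r ^+ 2) - cconj z * w.
have D0 w : cmod w < R1 -> D w != 0.
  move=> hw; rewrite subr_eq0; apply/eqP => /(congr1 cmod).
  rewrite cmod_rc cmodM cmod_cconj ger0_norm ?sqr_ge0// => e.
  have : cmod z * cmod w <= m * cmod w by rewrite ler_wpM2r// le_max lexx.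
  rewrite leNgt -e; move/negP; apply.
  by rewrite mulrC -ltr_pdivlMr.
pose F w : Cx R := f w * (rc (r ^+ 2 - cmod z ^+ 2) / D w).
have dF : dan R1 F.
  move=> w hw; apply: derivableM; first by apply: hf; exact: lt_le_trans R11.
  apply: derivableM; first exact: derivable_cst.
  apply: derivableV; first exact: D0.
  apply: derivableB; first exact: derivable_cst.
  by apply: derivableM; [exact: derivable_cst|exact: derivable_id].
have := cauchy_formula a dF zr rR.
have -> : F z = f z.
  rewrite /F /D [cconj z * z]mulrC mul_cconj -rcB divff ?mulr1//.
  by rewrite rc_eq0 subr_eq0 gt_eqF.
move=> ->; apply: meanE => x _; rewrite /F /poisson.
have cn0 : circle r x != 0 :> Cx R by rewrite -cmod_gt0 cmod_circle gtr0_norm.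
have cz := circle_neq x zr.
have DE : D (circle r x) = circle r x * cconj (circle r x - z).
  by rewrite /D cconjB mulrBr mul_cconj cmod_circle ger0_norm ?(ltW r0)// [cconj z * _]mulrC.
have ccz : cconj (circle r x - z) != 0 by rewrite -cmod_eq0 cmod_cconj cmod_eq0.
rewrite DE [rc (_ / _)]rcM rcV -mul_cconj -mulrA; congr (_ * _).
move: (cconj (circle r x - z)) ccz => c c0.
by move: (circle r x) cn0 cz (rc _) => y y0 yz k; field; rewrite y0 yz c0.
Qed.

Lemma rmean_poisson r z : cmod z < r -> r < 1 -> rmean (poisson r z) = 1.
Proof.
move=> zr r1; apply: rc_inj; rewrite -rmean_rc.
have h1 : analytic (fun=> 1 : Cx R) by move=> w _; exact: derivable_cst.
rewrite rc1 [RHS](poisson_formula 0 h1 zr r1).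
by apply: meanE => x _; rewrite mul1r.
Qed.

Lemma poisson_le f r z : analytic f -> cmod z < r -> r < 1 ->
  cmod (f z) <= rmean (fun x => cmod (f (circle r x)) * poisson r z x).
Proof.
move=> hf zr r1; have r0 : 0 < r := le_lt_trans (cmod_ge0 z) zr.
have hr : 0 <= r < 1 by rewrite ltW.
rewrite (poisson_formula 0 hf zr r1).
apply: le_trans (cmod_mean_le0 (ccont_mul (dan_ccont hf hr) (ccont_rc (rcont_poisson zr)))) _.
rewrite le_eqVlt; apply/orP; left; apply/eqP/rmeanE => x.
by rewrite cmodM cmod_rc ger0_norm// poisson_ge0.
Qed.

(** The tangent inequality at m, the Poisson mean of |f|, is integrated against a kernel of total
    mass 1, which cancels the linear term. *)
Lemma poisson_jensen f r z (p : R) : 1 <= p -> analytic f -> cmod z < r -> r < 1 ->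
  cmod (f z) `^ p <= rmean (fun x => cmod (f (circle r x)) `^ p * poisson r z x).
Proof.
move=> p1 hf zr r1; have r0 : 0 < r := le_lt_trans (cmod_ge0 z) zr.
have hr : 0 <= r < 1 by rewrite ltW.
have p0 : 0 < p by lra.
have cF : rcont (fun x => cmod (f (circle r x))) by exact/rcont_cmod/(dan_ccont hf hr).
have cFp := rcont_powR p0 (fun x => cmod_ge0 (f (circle r x))) cF.
have cP := rcont_poisson zr.
have hm := poisson_le hf zr r1; set m := rmean _ in hm.
apply: (@le_trans _ _ (m `^ p)).
  by apply: ge0_ler_powR; rewrite ?nnegrE ?(ltW p0)//; exact: le_trans hm.
have m0 : 0 <= m by exact: le_trans hm.
pose k := p * m `^ (p - 1).
have -> : m `^ p = rmean (fun x => (m `^ p - k * m) * poisson r z x + k * (cmod (f (circle r x)) * poisson r z x)).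
  have cFP := rcont_mul cF cP.
  rewrite (rmeanD (rcont_mul (@rcont_cst R _) cP) (rcont_mul (@rcont_cst R k) cFP)).
  by rewrite (rmeanZ _ cP) (rmeanZ _ cFP) rmean_poisson// -/m mulr1 subrK.
apply: le_rmean.
- by apply: rcont_add; apply: rcont_mul; (try exact: rcont_cst) => //; exact: rcont_mul.
- exact: rcont_mul.
- move=> x; rewrite mulrA -mulrDl; apply: ler_wpM2r; first exact: poisson_ge0.
  have := powR_tangent p1 (cmod_ge0 (f (circle r x))) m0; rewrite -/k; lra.
Qed.

(* Multiplying by an analytic function that equals 1 at r t and vanishes at r
   makes the Poisson bound summable (resp. integrable) in t. *)
Lemma weighted_poisson f r t (E : Cx R -> Cx R) (p : R) : 1 <= p -> analytic f -> analytic E ->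
  0 <= t < 1 -> 0 < r < 1 -> E (rc (r * t)) = 1 ->
  cmod (f (rc (r * t))) `^ p <= rmean (fun x => cmod (f (circle r x)) `^ p *
     (cmod (E (circle r x)) `^ p * ((1 - t ^+ 2) / cmod (ei x - rc t) ^+ 2))).
Proof.
move=> p1 hf hE /andP[t0 t1] /andP[r0 r1] Et.
have zr : cmod (rc (r * t)) < r.
  by rewrite cmod_rc ger0_norm ?mulr_ge0 ?(ltW r0)// -{2}(mulr1 r) ltr_pM2l.
have hfE : analytic (fun z => f z * E z) by move=> z hz; apply: derivableM; [exact: hf|exact: hE].
have := poisson_jensen p1 hfE zr r1; rewrite Et mulr1 => /le_trans; apply.
rewrite le_eqVlt; apply/orP; left; apply/eqP/rmeanE => x.
rewrite cmodM powRM// -mulrA; congr (_ * (_ * _)); rewrite /poisson.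
have -> : circle r x - rc (r * t) = rc r * (ei x - rc t) by rewrite circleE rcM mulrBr.
rewrite cmodM !cmod_rc !ger0_norm ?mulr_ge0 ?(ltW r0)// !exprMn.
have -> : r ^+ 2 - r ^+ 2 * t ^+ 2 = r ^+ 2 * (1 - t ^+ 2) by ring.
by rewrite -mulf_div divff ?mul1r// expf_neq0// gt_eqF.
Qed.

Lemma sin_half x : cmod (1 - ei x) ^+ 2 = 4 * sin (x / 2) ^+ 2.
Proof.
rewrite cmod_sq !CReD !CImD CReN CImN /ei /= sub0r sqrrN.
have -> : x = x / 2 + x / 2 by field.
have -> : (x / 2 + x / 2) / 2 = x / 2 by field.
rewrite cosD sinD; have := cos2Dsin2 (x / 2).
move: (cos _) (sin _) => c s h.
have -> : (1 + - (c * c - s * s)) ^+ 2 + (s * c + c * s) ^+ 2 =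
  1 - 2 * (c ^+ 2 - s ^+ 2) + (c ^+ 2 + s ^+ 2) ^+ 2 by ring.
rewrite h; have -> : c ^+ 2 = 1 - s ^+ 2 by rewrite -h; ring.
ring.
Qed.

Lemma dist_ei_rc t x : cmod (ei x - rc t) ^+ 2 = (1 - t) ^+ 2 + 4 * t * sin (x / 2) ^+ 2.
Proof.
have := sin_half x; rewrite !cmod_sq !CReD !CImD !CReN !CImN /ei /rc /= sub0r oppr0 addr0 sqrrN.
have := cos2Dsin2 x; move: (cos x) (sin x) (sin (x / 2)) => c s h e1 e2.
have -> : 4 * t * h ^+ 2 = t * (4 * h ^+ 2) by ring.
rewrite -e2; have -> : s ^+ 2 = 1 - c ^+ 2 by rewrite -e1; ring.
ring.
Qed.

Lemma derivable_affine (p q : Cx R) z : derivable (fun w => p + q * w) z 1.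
Proof.
apply: derivableD; first exact: derivable_cst.
by apply: derivableM; [exact: derivable_cst|exact: derivable_id].
Qed.

(* FRK s t is the t-derivative of 2 atan (s (1 + t) / (1 - t)); with
   s = |sin (x / 2)| it dominates the kernel of [weighted_poisson]. *)
Definition FRK (s t : R) : R := 4 * s / ((1 - t) ^+ 2 + s ^+ 2 * (1 + t) ^+ 2).

(** After clearing denominators the difference is a product of factors that are visibly nonnegative
    for s and t in [0, 1]. *)
Lemma FRK_dom s t : 0 <= s <= 1 -> 0 <= t < 1 -> 
  (1 + t) * (2 * s) / ((1 - t) ^+ 2 + 4 * t * s ^+ 2) <= FRK s t.
Proof.
move=> /andP[s0 s1] /andP[t0 t1]; rewrite /FRK.
have t10 : 0 < (1 - t) ^+ 2 by rewrite exprn_gt0// subr_gt0.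
have s2 : 0 <= s ^+ 2 by exact: sqr_ge0.
have s21 : s ^+ 2 <= 1 by rewrite expr_le1.
have d1 : 0 < (1 - t) ^+ 2 + 4 * t * s ^+ 2 by rewrite ltr_wpDr// mulr_ge0// mulr_ge0.
have d2 : 0 < (1 - t) ^+ 2 + s ^+ 2 * (1 + t) ^+ 2 by rewrite ltr_wpDr// mulr_ge0// sqr_ge0.
rewrite ler_pdivrMr// mulrAC ler_pdivlMr// -subr_ge0.
have -> : 4 * s * ((1 - t) ^+ 2 + 4 * t * s ^+ 2) -
    (1 + t) * (2 * s) * ((1 - t) ^+ 2 + s ^+ 2 * (1 + t) ^+ 2) =
  2 * s * ((1 - t) * ((1 - s ^+ 2) * (1 - t) ^+ 2 + s ^+ 2 * (2 * t * (1 + t)))) by ring.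
apply: mulr_ge0; first exact: mulr_ge0.
apply: mulr_ge0; first by rewrite subr_ge0 ltW.
apply: addr_ge0; first by rewrite mulr_ge0 ?subr_ge0// ltW.
by rewrite !mulr_ge0// addr_ge0.
Qed.

Lemma rcontI_FRK (s r T : R) : 0 < r -> T < r -> rcontI 0 T (fun t => FRK s (t / r)).
Proof.
move=> r0 Tr.
move=> t /andP[t0 tT].
have tr : 0 < 1 - t / r by rewrite subr_gt0 ltr_pdivrMr// mul1r (le_lt_trans tT).
apply: cvgM; first exact: cvg_cst.
have c1 : {for t, continuous (fun t => t / r)} by exact: cvgM cvg_id (cvg_cst _).
have c2 : {for t, continuous (fun t => 1 - t / r)} by exact: cvgB (cvg_cst _) c1.
have c3 : {for t, continuous (fun t => 1 + t / r)} by exact: cvgD (cvg_cst _) c1.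
apply: cvgV; first by rewrite gt_eqF// ltr_wpDr ?exprn_gt0// mulr_ge0// sqr_ge0.
apply: cvgD; first exact: (cvgM c2 c2).
by apply: cvgM; [exact: cvg_cst|exact: (cvgM c3 c3)].
Qed.

(** The primitive is 2 r times an [atan] of nonnegative argument, hence at most 2 r (pi / 2) with r
    <= 1. This is the pi of the case p = 1. *)
Lemma rint_FRK (s r T : R) : 0 <= s -> 0 < r <= 1 -> 0 <= T < r ->
  rint 0 T (fun t => FRK s (t / r)) <= pi.
Proof.
move=> s0 /andP[r0 r1] /andP[T0 Tr].
pose Th (t : R) : R := (2 * r) * atan (s * ((r + t) / (r - t))).
have cont := @rcontI_FRK s r T r0 Tr.
have dTh t : 0 <= t <= T -> is_derive t 1 Th (FRK s (t / r)).
  move=> /andP[t0 tT].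
  have rt : r - t != 0 by rewrite gt_eqF// subr_gt0 (le_lt_trans tT).
  have d1 : is_derive t 1 (fun t => r + t) 1.
    by apply: (is_derive_eq (is_deriveD (is_derive_cst r t 1) (is_derive_id t 1))); rewrite add0r.
  have d2 : is_derive t 1 (fun t => r - t) (-1).
    by apply: (is_derive_eq (is_deriveB (is_derive_cst r t 1) (is_derive_id t 1))); rewrite sub0r.
  have d3 := @is_deriveV R (fun t => r - t) t (-1) 1 rt d2.
  have d4 : is_derive t 1 ((fun t => r + t) * (fun t => (r - t)^-1)) (2 * r / (r - t) ^+ 2).
    apply: (is_derive_eq (is_deriveM d1 d3)).
    by rewrite /GRing.scale /=; field.
  have d5 : is_derive t 1 (s \*: ((fun t => r + t) * (fun t => (r - t)^-1))) (s *: (2 * r / (r - t) ^+ 2)).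
    exact: is_deriveZ.
  have d6 := @is_derive1_comp R atan _ t _ _ (is_derive1_atan _) d5.
  have -> : Th = (2 * r) \*: (atan \o (s \*: ((fun t => r + t) * (fun t => (r - t)^-1)))) by [].
  apply: (is_derive_eq (is_deriveZ _ d6)).
  rewrite /GRing.scale /= /FRK.
  have r0' : r != 0 by rewrite gt_eqF.
  have p1 : 0 < (r - t) ^+ 2 by rewrite exprn_gt0// subr_gt0 (le_lt_trans tT).
  have p2 : (r - t) ^+ 2 + s ^+ 2 * (r + t) ^+ 2 != 0.
    by rewrite gt_eqF// ltr_wpDr// mulr_ge0// sqr_ge0.
  have -> : (1 - t / r) ^+ 2 + s ^+ 2 * (1 + t / r) ^+ 2 =
     ((r - t) ^+ 2 + s ^+ 2 * (r + t) ^+ 2) / r ^+ 2 by field.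
  have -> : 1 + (s * ((r + t) / (r - t))) ^+ 2 =
     ((r - t) ^+ 2 + s ^+ 2 * (r + t) ^+ 2) / (r - t) ^+ 2 by field.
  move: p2; set N := (r - t) ^+ 2 + _ => N0.
  by rewrite !invf_div; field; rewrite N0 rt.
have : rint 0 T (fun t => FRK s (t / r)) = Th T - Th 0.
  move: T0; rewrite le_eqVlt => /orP[/eqP T0|T0].
    by rewrite -T0 subrr rint.unlock set_itv1 Rintegral_set1.
  have cTh t : 0 <= t <= T -> {for t, continuous Th}.
    by move=> /dTh[/derivable1_diffP + _]; exact: differentiable_continuous.
  rewrite rint.unlock /Rintegral (continuous_FTC2 T0 (f := fun t => FRK s (t / r)) (F := Th))//.
  - by apply: continuous_in_subspaceT => t; rewrite inE /= in_itv /=; exact: cont.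
  - split; first by move=> t; rewrite in_itv /= => /andP[h1 h2]; have [] := dTh t; rewrite ?ltW.
    + by apply/cvg_at_right_filter/cTh; rewrite lexx ltW.
    + by apply/cvg_at_left_filter/cTh; rewrite lexx ltW.
  - move=> t; rewrite in_itv /= => /andP[h1 h2]; rewrite derive1E.
    by have [] := dTh t; rewrite ?ltW.
move=> ->.
have h1 := atan_ltpi2 (s * ((r + T) / (r - T))).
have h2 : 0 <= Th 0.
  rewrite /Th mulr_ge0 ?mulr_ge0 ?(ltW r0)// addr0 subr0 divff ?gt_eqF// mulr1.
  by rewrite -(@atan0 R) le_atan.
have h3 : Th T <= 2 * r * (pi / 2) by rewrite /Th ler_wpM2l ?mulr_ge0 ?(ltW r0)// ltW.
have : r * pi <= 1 * pi by rewrite ler_wpM2r// pi_ge0.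
lra.
Qed.

End PoissonFejerRiesz.

(** * The Fejer-Riesz inequality *)

Section FejerRiesz.
Context {R : realType}.
Implicit Types (f g : Cx R -> Cx R) (z w : Cx R) (r a s t x M : R).
Local Notation mu := (@lebesgue_measure R).

(** Both iterated integrals are those of one function on the plane, cut off by the indicators of the
    intervals. Measurability is stated for any I with the right values so that it applies to named
    inner integrals. *)
Lemma tonelli_itv (a b c d : R) (F : R -> R -> R) :
  measurable_fun setT (fun p : R * R => F p.1 p.2) ->
  (forall t x, 0 <= F t x) ->
  (forall I : R -> \bar R,
    (forall t, I t = \int[mu]_(x in `[c, d]) (F t x)%:E)%E -> measurable_fun `[a, b] I) /\
  (forall I : R -> \bar R,
    (forall x, I x = \int[mu]_(t in `[a, b]) (F t x)%:E)%E -> measurable_fun `[c, d] I) /\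
  (\int[mu]_(t in `[a, b]) \int[mu]_(x in `[c, d]) (F t x)%:E =
   \int[mu]_(x in `[c, d]) \int[mu]_(t in `[a, b]) (F t x)%:E)%E.
Proof.
move=> mF F0.
pose G (p : R * R) : \bar R :=
  ((\1_`[a, b] p.1 * \1_`[c, d] p.2) * F p.1 p.2)%:E.
have mG : measurable_fun setT G.
  apply/measurable_EFinP; apply: measurable_funM => //; apply: measurable_funM.
    by apply: measurableT_comp => //; exact: measurable_indic.
  by apply: measurableT_comp => //; exact: measurable_indic.
have G0 p : (0 <= G p)%E by rewrite lee_fin !mulr_ge0.
have H := @fubini_tonelli _ _ _ _ R mu mu G mG G0.
have E1 t : (\int[mu]_x G (t, x) = if t \in `[a, b]%R then \int[mu]_(x in `[c, d]) (F t x)%:E else 0)%E.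
  rewrite /G /= indicE mem_setE; case: ifP => _.
    rewrite [RHS]integral_mkcond; apply: eq_integral => x _; rewrite patchE indicE.
    by case: ifP => _; rewrite mul1r ?mul1r ?mul0r.
  by under eq_integral do rewrite !mul0r; rewrite integral0.
have E2 x : (\int[mu]_t G (t, x) = if x \in `[c, d]%R then \int[mu]_(t in `[a, b]) (F t x)%:E else 0)%E.
  rewrite /G /= [\1_`[c, d] x]indicE mem_setE; case: ifP => _.
    rewrite [RHS]integral_mkcond; apply: eq_integral => t _; rewrite patchE indicE.
    by case: ifP => _; rewrite mulr1 ?mul1r ?mul0r.
  by under eq_integral do rewrite mulr0 mul0r; rewrite integral0.
split=> [I hI|]; last split=> [I hI|].
  have mFF := @measurable_fun_fubini_tonelli_F _ _ _ _ R mu G mG G0.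
  apply: (eq_measurable_fun (fun t => \int[mu]_x G (t, x))%E).
    by move=> t; rewrite inE /= => tab; rewrite E1 tab hI.
  exact: (measurable_funS measurableT (@subsetT _ _) mFF).
  have mGG := @measurable_fun_fubini_tonelli_G _ _ _ _ R mu G mG G0.
  apply: (eq_measurable_fun (fun x => \int[mu]_t G (t, x))%E).
    by move=> x; rewrite inE /= => xcd; rewrite E2 xcd hI.
  exact: (measurable_funS measurableT (@subsetT _ _) mGG).
rewrite integral_mkcond [RHS]integral_mkcond.
transitivity (\int[mu]_t \int[mu]_x G (t, x))%E.
  by apply: eq_integral => t _; rewrite E1 patchE mem_setE.
transitivity (\int[mu]_x \int[mu]_t G (t, x))%E; first exact: H.
by apply: eq_integral => x _; rewrite E2 patchE mem_setE.
Qed.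

Lemma measurable_FRK (A : R -> R) r : rcont A ->
  measurable_fun setT (fun p : R * R =>
    A p.2 * FRK `|sin (p.2 / 2)| (p.1 / r)).
Proof.
move=> cA.
have mc (F : R -> R) : rcont F -> measurable_fun setT F.
  by move=> hF; apply: continuous_measurable_fun => x; exact: hF.
have m1 (F : R -> R) : rcont F -> measurable_fun setT (fun p : R * R => F p.1).
  by move=> hF; apply: (measurableT_comp (mc _ hF)).
have m2 (F : R -> R) : rcont F -> measurable_fun setT (fun p : R * R => F p.2).
  by move=> hF; apply: (measurableT_comp (mc _ hF)).
have cid : rcont (fun x => x) by move=> x; exact: cvg_id.
have cc := @rcont_cst R.
have cs : rcont (fun x : R => `|sin (x / 2)|).
  move=> x; apply: cvg_norm; apply: continuous_comp; last exact: continuous_sin.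
  exact: (rcont_mul cid (@rcont_cst R 2^-1)).
have ct : rcont (fun t : R => t / r) by exact: (rcont_mul cid (@rcont_cst R r^-1)).
have c1 : rcont (fun t : R => (1 - t / r) ^+ 2).
  apply: rcont_exp => t; exact: cvgB (cvg_cst _) (ct t).
have c2 : rcont (fun t : R => (1 + t / r) ^+ 2).
  apply: rcont_exp => t; exact: cvgD (cvg_cst _) (ct t).
rewrite /FRK; apply: measurable_funM; first exact: m2.
apply: measurable_funM.
  by apply: measurable_funM => //; exact: (m2 (fun x => `|sin (x / 2)|) cs).
have mD : measurable_fun setT (fun p : R * R =>
    (1 - p.1 / r) ^+ 2 + `|sin (p.2 / 2)| ^+ 2 * (1 + p.1 / r) ^+ 2).
  apply: measurable_funD; first exact: (m1 (fun t => (1 - t / r) ^+ 2)).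
  apply: measurable_funM; last exact: (m1 (fun t => (1 + t / r) ^+ 2)).
  by apply: measurable_funX; exact: (m2 (fun x => `|sin (x / 2)|) cs).
have := measurableT_comp (@measurable_powR R (-1)) mD.
congr measurable_fun; apply/funext => p /=.
by rewrite powR_inv1// addr_ge0 ?sqr_ge0// mulr_ge0 ?sqr_ge0.
Qed.

Lemma rcont_abs_sin_half : rcont (fun x : R => `|sin (x / 2)|).
Proof.
move=> x; apply: cvg_norm; apply: continuous_comp; last exact: continuous_sin.
exact: (cvgM cvg_id (cvg_cst _)).
Qed.

Lemma fejer_riesz_pointwise f r t : analytic f -> 0 < r < 1 -> 0 <= t < r ->
  cmod (f (rc t)) <=
  rmean (fun x => cmod (f (circle r x)) * FRK `|sin (x / 2)| (t / r)).
Proof.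
move=> hf /[dup] hr /andP[r0 r1] /andP[t0 tr]; pose t' := t / r; rewrite -/t'.
pose A x := cmod (f (circle r x)).
have hr' : 0 <= r < 1 by rewrite ltW.
have cA : rcont A by exact/rcont_cmod/(dan_ccont hf hr').
pose s x := `|sin (x / 2)| : R.
have s01 x : 0 <= s x <= 1 by rewrite /s normr_ge0 ler_norml sin_geN1 sin_le1.
have cs := rcont_abs_sin_half.
have t'0 : 0 <= t' by rewrite divr_ge0// ltW.
have t'1 : t' < 1 by rewrite ltr_pdivrMr// mul1r.
have tE : t = r * t' by rewrite /t' mulrC divfK ?gt_eqF.
have d1 : 0 < 1 - t' by rewrite subr_gt0.
(* The affine factor (1 - w / r) / (1 - t') is 1 at r t' and 0 at r; its modulus on the circle
   supplies the numerator 2 |sin (x / 2)| of [FRK_dom]. *)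
pose E (w : Cx R) : Cx R := rc (1 - t')^-1 + (- rc ((1 - t')^-1 / r)) * w.
have aE : analytic E by move=> w _; exact: derivable_affine.
have Ec y : E (rc r * y) = rc (1 - t')^-1 * (1 - y).
  rewrite /E mulNr mulrA -rcM divfK ?gt_eqF//; ring.
have E1 : E (rc (r * t')) = 1.
  by rewrite rcM Ec -rc1 -rcB -rcM mulVf// gt_eqF.
have := weighted_poisson (lexx 1) hf aE (introT andP (conj t'0 t'1)) hr E1.
rewrite -tE powRr1// => /le_trans; apply.
have cEc : ccont (fun x => E (circle r x)).
  by apply: (@dan_ccont _ 1); [exact: aE|exact: hr'].
have cd : rcont (fun x => (cmod (ei x - rc t') ^+ 2)^-1).
  apply: rcont_inv; last first.
    move=> x; rewrite expf_neq0// gt_eqF//.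
    have := @cmod_triangle _ (ei x) (rc t') _ (lexx _).
    by rewrite cmod_ei cmod_rc ger0_norm//; lra.
  apply/rcont_exp/rcont_cmod/ccont_sub; last exact: ccont_cst.
  by have := @ccont_ei R 1; under eq_fun do rewrite mul1r.
apply: le_rmean.
- apply: rcont_mul; first by apply: rcont_powR => //; exact: cA.
  apply: rcont_mul; first by apply: rcont_powR => //; exact: rcont_cmod.
  exact: rcont_mul (@rcont_cst R _) cd.
- apply: rcont_mul; first exact: cA.
  apply: rcont_mul; first exact: (rcont_mul (@rcont_cst R 4) cs).
  apply: rcont_inv; last first.
    by move=> x; rewrite gt_eqF// ltr_wpDr ?exprn_gt0// mulr_ge0 ?sqr_ge0.
  apply: rcont_add; first exact: rcont_cst.
  by apply: rcont_mul; [exact: rcont_exp|exact: rcont_cst].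
move=> x; rewrite !powRr1// -/(A x); apply: ler_wpM2l; first exact: cmod_ge0.
apply: le_trans (FRK_dom (s01 x) _); last by rewrite t'0.
rewrite le_eqVlt; apply/orP; left; apply/eqP.
rewrite circleE Ec cmodM cmod_rc ger0_norm ?invr_ge0 ?(ltW d1)// dist_ei_rc.
have -> : cmod (1 - ei x) = 2 * s x.
  apply/eqP; rewrite -(@eqrXn2 _ 2) ?mulr_ge0//; last exact: normr_ge0.
  by rewrite sin_half exprMn /s real_normK ?num_real// -natrX.
rewrite /s real_normK ?num_real//; have D0 : 0 < (1 - t') ^+ 2 + 4 * t' * sin (x / 2) ^+ 2.
  by rewrite ltr_wpDr ?exprn_gt0// mulr_ge0 ?sqr_ge0// mulr_ge0.
by field; rewrite !gt_eqF.
Qed.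

Lemma rint_rmean_le (h A : R -> R) (K : R -> R -> R) T M : rcontI 0 T h -> rcont A ->
  (forall t, 0 <= h t) -> (forall x, 0 <= A x) -> (forall x t, 0 <= K x t) ->
  measurable_fun setT (fun p : R * R => A p.2 * K p.2 p.1) ->
  (forall t, 0 <= t <= T -> rcont (fun x => K x t)) -> (forall x, rcontI 0 T (K x)) ->
  (forall t, 0 <= t <= T -> h t <= rmean (fun x => A x * K x t)) ->
  (forall x, rint 0 T (K x) <= M) -> rint 0 T h <= M * rmean A.
Proof.
move=> ch cA h0 A0 K0 mK cx ct hle hM.
pose F t x := A x * K x t.
have F0 t x : 0 <= F t x by rewrite mulr_ge0.
have [mI [mJ swap]] := @tonelli_itv 0 T 0 (2 * pi) F mK F0.
pose I t := (\int[mu]_(x in `[0%R, (2 * pi)%R]) (F t x)%:E)%E.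
pose J x := (\int[mu]_(t in `[0%R, T]) (F t x)%:E)%E.
have mI' := mI I (fun=> erefl); have mJ' := mJ J (fun=> erefl).
have pi20 : (0 <= ((2 * pi)^-1)%:E :> \bar R)%E by rewrite lee_fin invr_ge0 ltW// pi2_gt0.
have I0 t : (0 <= I t)%E by apply: integral_ge0 => x _; rewrite lee_fin.
have J0 x : (0 <= J x)%E by apply: integral_ge0 => t _; rewrite lee_fin.
have IE t : 0 <= t <= T -> I t = (rint 0 (2 * pi) (F t))%:E.
  by move=> ht; rewrite /I integral_rint//; exact: rcontW (rcont_mul cA (cx t ht)).
have JE x : J x = (A x * rint 0 T (K x))%:E.
  rewrite /J integral_rint ?(rintZ _ (ct x))// => t ht.
  exact: (cvgM (cvg_cst (A x)) (ct x t ht)).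
have {mI mJ} : (\int[mu]_(t in `[0%R, T]) I t = \int[mu]_(x in `[0%R, (2 * pi)%R]) J x)%E := swap.
move: {swap} I J mI' mJ' I0 J0 IE JE => I J mI mJ I0 J0 IE JE swap.
have cAM : rcontI 0 (2 * pi) (fun x => A x * M).
  by apply: rcontW; apply: rcont_mul => //; exact: rcont_cst.
rewrite -lee_fin -(integral_rint ch).
apply: (@le_trans _ _ (\int[mu]_(t in `[0%R, T]) (((2 * pi)^-1)%:E * I t))%E).
  apply: ge0_le_integral => //.
  - by move=> t _; rewrite lee_fin.
  - exact: measurable_int (rcontI_integrable ch).
  - exact: measurable_funeM.
  - by move=> t; rewrite /= in_itv /= => ht; rewrite (IE t ht) -EFinM lee_fin; exact: hle.
rewrite ge0_integralZl// swap.
apply: (@le_trans _ _ (((2 * pi)^-1)%:E * \int[mu]_(x in `[0%R, (2 * pi)%R]) (A x * M)%:E)%E).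
  apply: lee_wpmul2l => //; apply: ge0_le_integral => //.
  - exact: measurable_int (rcontI_integrable cAM).
  - by move=> x _; rewrite JE lee_fin; apply: ler_wpM2l.
rewrite (integral_rint cAM) -EFinM lee_fin -/(rmean (fun x => A x * M)).
have -> : (fun x => A x * M) = (fun x => M * A x) by apply/funext => x; rewrite mulrC.
by rewrite rmeanZ.
Qed.

(** The pointwise kernel bound is integrated in t and the order of integration swapped: for every x
    the kernel has t-integral at most pi. *)
Lemma fejer_riesz f r T : analytic f -> 0 < r < 1 -> 0 <= T < r ->
  rint 0 T (fun t => cmod (f (rc t))) <= pi * rmean (fun x => cmod (f (circle r x))).
Proof.
move=> hf /[dup] hr /andP[r0 r1] /[dup] hT /andP[T0 Tr].
have hr' : 0 <= r < 1 by rewrite ltW.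
have cA : rcont (fun x => cmod (f (circle r x))) by exact/rcont_cmod/(dan_ccont hf hr').
have cs := rcont_abs_sin_half.
apply: (@rint_rmean_le _ _ (fun x t => FRK `|sin (x / 2)| (t / r))).
- move=> t /andP[t0 tT]; apply: continuous_cmod_comp.
  apply: (continuous_comp_derivable (u := rc)).
    by apply: continuous_rc_comp; exact: cvg_id.
  by apply: hf; rewrite cmod_rc ger0_norm// (le_lt_trans tT)// (lt_trans Tr).
- exact: cA.
- by move=> t; exact: cmod_ge0.
- by move=> t; exact: cmod_ge0.
- move=> x t; apply: divr_ge0; first exact: mulr_ge0.
  by apply: addr_ge0; [exact: sqr_ge0|apply: mulr_ge0; exact: sqr_ge0].
- exact: (measurable_FRK r cA).
- move=> t /andP[t0 tT]; apply: rcont_mul; first exact: (rcont_mul (@rcont_cst R 4) cs).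
  have d1 : 0 < 1 - t / r by rewrite subr_gt0 ltr_pdivrMr// mul1r (le_lt_trans tT).
  apply: rcont_inv; last first.
    by move=> x; rewrite gt_eqF// ltr_wpDr ?exprn_gt0// mulr_ge0 ?sqr_ge0.
  apply: rcont_add; first exact: rcont_cst.
  by apply: rcont_mul; [exact: rcont_exp|exact: rcont_cst].
- by move=> x; exact: rcontI_FRK.
- by move=> t /andP[t0 tT]; apply: fejer_riesz_pointwise; rewrite // t0 (le_lt_trans tT).
- by move=> x; apply: rint_FRK => //; rewrite r0 ltW.
Qed.

End FejerRiesz.

(** * Schur's test for geometric kernels *)

Section DyadicSums.
Context {R : realType}.
Implicit Types (q x y t M p : R).

Lemma powR_predM (m p : R) : 1 <= p -> 0 <= m -> m `^ (p - 1) * m = m `^ p.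
Proof.
move=> p1 m0; have [->|mn0] := eqVneq m 0; first by rewrite mulr0 powR0// gt_eqF//; lra.
by rewrite -[X in _ * X](powRr1 m0) -powRD ?subrK// mn0 implybT.
Qed.

(** The tangent inequality at m = S / A. When the total weight W falls short of A, the deficit
    contributes (p - 1) m^p (A - W), which has the right sign. *)
Lemma power_mean (p A : R) J (k y : 'I_J -> R) : 1 <= p -> 0 < A ->
  (forall j, 0 <= k j) -> (forall j, 0 <= y j) -> \sum_j k j <= A ->
  (\sum_j k j * y j) `^ p <= A `^ (p - 1) * \sum_j k j * y j `^ p.
Proof.
move=> p1 A0 k0 y0 hA; have p0 : 0 < p by lra.
set S := \sum_j k j * y j; have S0 : 0 <= S by apply: sumr_ge0 => j _; exact: mulr_ge0.
pose m := S / A; have m0 : 0 <= m by rewrite divr_ge0// ltW.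
have SE : S = m * A by rewrite /m divfK// gt_eqF.
have mp := powR_predM p1 m0; clearbody m.
have h : m `^ p * A <= \sum_j k j * y j `^ p.
  apply: (@le_trans _ _ (\sum_j k j * (m `^ p + p * m `^ (p - 1) * (y j - m)))); last first.
    by apply: ler_sum => j _; apply: ler_wpM2l => //; exact: powR_tangent.
  have -> : \sum_j k j * (m `^ p + p * m `^ (p - 1) * (y j - m)) =
      (m `^ p - p * m `^ (p - 1) * m) * \sum_j k j + p * m `^ (p - 1) * S.
    by rewrite /S !mulr_sumr -big_split; apply: eq_bigr => j _ /=; ring.
  set W := \sum_j k j.
  have -> : (m `^ p - p * m `^ (p - 1) * m) * W + p * m `^ (p - 1) * S =
    m `^ p * W + p * m `^ p * (A - W) by rewrite SE -mp; ring.
  have : 0 <= (p - 1) * m `^ p * (A - W).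
    by rewrite !mulr_ge0 ?powR_ge0 ?subr_ge0.
  lra.
rewrite SE powRM ?(ltW A0)// -(powR_predM p1 (ltW A0)).
by rewrite mulrCA ler_wpM2l ?powR_ge0.
Qed.

(** Power means along rows give A^(p-1); exchanging the sums and using the column bound gives the
    last factor A. *)
Lemma schur (p A : R) K J (k : 'I_K -> 'I_J -> R) (y : 'I_J -> R) : 1 <= p -> 0 < A ->
  (forall i j, 0 <= k i j) -> (forall j, 0 <= y j) ->
  (forall i, \sum_j k i j <= A) -> (forall j, \sum_i k i j <= A) ->
  \sum_i (\sum_j k i j * y j) `^ p <= A `^ p * \sum_j y j `^ p.
Proof.
move=> p1 A0 k0 y0 hr hc.
apply: (@le_trans _ _ (\sum_i A `^ (p - 1) * \sum_j k i j * y j `^ p)).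
  by apply: ler_sum => i _; apply: power_mean.
rewrite -mulr_sumr exchange_big /=.
rewrite -(powR_predM p1 (ltW A0)) -mulrA ler_wpM2l ?powR_ge0// mulr_sumr; apply: ler_sum => j _.
by rewrite -mulr_suml ler_wpM2r ?powR_ge0.
Qed.

(** The exponent is |i - j|, written with truncated subtractions. *)
Definition gk q (i j : nat) : R := q ^+ ((i - j) + (j - i)).

Lemma gk_ge0 q i j : 0 <= q -> 0 <= gk q i j. Proof. exact: exprn_ge0. Qed.
Lemma gkC q i j : gk q i j = gk q j i. Proof. by rewrite /gk addnC. Qed.

(** The indices on each side of i form a geometric series; multiplied by 1 - q its partial sums
    telescope, which is the form proved by induction on J. *)
Lemma gk_sum q i J : 0 <= q < 1 -> \sum_(j < J) gk q i j <= 2 / (1 - q).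
Proof.
move=> /andP[q0 q1]; have d0 : 0 < 1 - q by rewrite subr_gt0.
have h1 : (1 - q) * \sum_(j < J) (j <= i)%:R * q ^+ (i - j) <= q ^+ (i.+1 - J).
  elim: J => [|J IH]; first by rewrite big_ord0 mulr0 exprn_ge0.
  rewrite big_ord_recr /= mulrDr; apply: (le_trans (lerD IH (lexx _))).
  case: (leqP J i) => hJ.
    by rewrite mul1r (subSn hJ) subSS exprS le_eqVlt; apply/orP; left; apply/eqP; ring.
  rewrite mul0r mulr0 addr0 subSS.
  have /eqP -> : (i.+1 - J == 0)%N by rewrite subn_eq0.
  by have /eqP -> : (i - J == 0)%N by rewrite subn_eq0 ltnW.
have h2 : (1 - q) * \sum_(j < J) (i <= j)%:R * q ^+ (j - i) <= 1 - q ^+ (J - i).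
  elim: J {h1} => [|J IH]; first by rewrite big_ord0 mulr0 sub0n expr0 subrr.
  rewrite big_ord_recr /= mulrDr; apply: (le_trans (lerD IH (lexx _))).
  case: (leqP i J) => hJ.
    by rewrite mul1r (subSn hJ) exprS le_eqVlt; apply/orP; left; apply/eqP; ring.
  rewrite mul0r mulr0 addr0.
  have /eqP -> : (J.+1 - i == 0)%N by rewrite subn_eq0.
  by have /eqP -> : (J - i == 0)%N by rewrite subn_eq0 ltnW.
rewrite ler_pdivlMr// mulrC.
apply: (@le_trans _ _ ((1 - q) * (\sum_(j < J) (j <= i)%:R * q ^+ (i - j) + \sum_(j < J) (i <= j)%:R * q ^+ (j - i)))).
  apply: ler_wpM2l; first exact: ltW.
  rewrite -big_split; apply: ler_sum => j _ /=; rewrite /gk.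
  have X0 n : 0 <= q ^+ n by exact: exprn_ge0.
  case: (ltngtP j i) => h; rewrite ?mul1r ?mul0r ?addr0 ?add0r.
  - have /eqP -> : (j - i == 0)%N by rewrite subn_eq0 ltnW.
    by rewrite addn0.
  - have /eqP -> : (i - j == 0)%N by rewrite subn_eq0 ltnW.
    by rewrite add0n.
  - by rewrite h subnn addn0 lerDl.
rewrite mulrDr.
have : q ^+ (i.+1 - J) <= 1 by apply: exprn_ile1 => //; exact: ltW.
have : 0 <= q ^+ (J - i) by exact: exprn_ge0.
lra.
Qed.

Lemma schur_geom (p q : R) K J (y : 'I_J -> R) : 1 <= p -> 0 <= q < 1 ->
  (forall j, 0 <= y j) ->
  \sum_(i < K) (\sum_(j < J) gk q i j * y j) `^ p <= (2 / (1 - q)) `^ p * \sum_j y j `^ p.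
Proof.
move=> p1 hq y0; have [q0 q1] := andP hq.
apply: (schur (k := fun i j => gk q i j)) => //.
- by rewrite divr_gt0// subr_gt0.
- by move=> i j; exact: gk_ge0.
- by move=> i; exact: gk_sum.
- by move=> j; under eq_bigr do rewrite gkC; exact: gk_sum.
Qed.

Definition dy (k : nat) : R := (2^-1) ^+ k.
Lemma dy_gt0 k : 0 < dy k. Proof. by rewrite exprn_gt0// invr_gt0. Qed.
Lemma dy_le1 k : dy k <= 1. Proof. by rewrite exprn_ile1// invf_le1// ler1n. Qed.
Lemma dyS k : dy k.+1 = dy k / 2. Proof. by rewrite /dy exprSr. Qed.
Lemma dyV k : (dy k)^-1 = (2 ^ k)%:R. Proof. by rewrite /dy exprVn invrK natrX. Qed.
Lemma dy_powR k : dy k = 2 `^ (- k%:R).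
Proof. by rewrite powRN powR_mulrn// /dy exprVn. Qed.
Lemma dy_le (j k : nat) : (j <= k)%N -> dy k <= dy j.
Proof. by move=> jk; rewrite /dy ler_wiXn2l// invf_le1// ler1n. Qed.

Definition q_ (e : R) : R := 2 `^ (- e).
Lemma q_lt1 e : 0 < e -> 0 <= q_ e < 1.
Proof.
move=> e0; rewrite powR_ge0 /= /q_ powRN invf_lt1 ?powR_gt0//.
have := @gt0_ltr_powR _ e e0 1 2; rewrite !nnegrE powR1 => -> //.
by rewrite ltr1n.
Qed.

(** The condition s <= - e |i - j| is split into two linear inequalities so that arithmetic on
    exponents can discharge it. *)
Lemma pow2_gk (e s : R) (i j : nat) : 0 <= e ->
  s <= - e * (i%:R - j%:R) -> s <= - e * (j%:R - i%:R) -> 2 `^ s <= gk (q_ e) i j.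
Proof.
move=> e0 h1 h2; have two : (1 : R) <= 2 by rewrite ler1n.
have h n : (q_ e) ^+ n = 2 `^ (- e * n%:R).
  by rewrite powRrM powR_mulrn ?powR_ge0.
rewrite /gk h; apply: ler_powR => //.
case: (leqP i j) => hij.
  have /eqP -> : (i - j == 0)%N by rewrite subn_eq0.
  by rewrite add0n natrB.
have /eqP -> : (j - i == 0)%N by rewrite subn_eq0 ltnW.
by rewrite addn0 natrB// ltnW.
Qed.

End DyadicSums.

(** * The dyadic Fejer-Riesz inequality inside the disc *)

Section DyadicFejerRiesz.
Context {R : realType}.
Implicit Types (f g : Cx R -> Cx R) (z w : Cx R) (r a s t x M p : R).

Lemma ccont_ei1 : ccont (@ei R).
Proof. by apply/ccontP => x; exact: continuous_ei. Qed.

(** The factor 6 bounds the multiplier of [fr_dyadic_lt]; 288 = 36 * 8 is the loss of the comparison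
    in [fr_kernel_sum]. *)
Definition CFR p : R := 288 * 6 `^ p.

(** With psi k = 2^-k / (2^-k + u), each term is at most a constant times psi k - psi (k+1), so the
    sum telescopes whatever u is. The power p is lowered to 1 because u / (d k + u) <= 1. *)
Lemma fr_kernel_sum p (K : nat) (d : nat -> R) (u : R) : 1 <= p -> 0 <= u ->
  (forall k, (k < K)%N -> dy k / 2 <= d k <= dy k) ->
  \sum_(k < K) dy k * ((6 * (u / (d k + u))) `^ p * (18 * d k / (d k + u) ^+ 2)) <= CFR p.
Proof.
move=> p1 u0 hd; have p0 : 0 < p by lra.
pose psi k : R := dy k / (dy k + u).
have ps0 k : 0 < dy k + u by rewrite ltr_wpDr// dy_gt0.
have c6 : 0 <= 6 `^ p by exact: powR_ge0.
apply: (@le_trans _ _ (\sum_(k < K) 288 * 6 `^ p * (psi k - psi k.+1))).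
  apply: ler_sum => k _; have /andP[d1 d2] := hd k (ltn_ord k).
  have w0 : 0 < dy k :> R := dy_gt0 k; set w := dy k in d1 d2 w0 *.
  have dk0 : 0 < d k by lra.
  have du : 0 < d k + u by rewrite ltr_wpDr.
  set v := u / (d k + u).
  have v0 : 0 <= v by rewrite divr_ge0// ltW.
  have v1 : v <= 1 by rewrite ler_pdivrMr// mul1r lerDr ltW.
  have hv : v `^ p <= v.
    have [->|vn0] := eqVneq v 0; first by rewrite powR0// gt_eqF.
    have vp : 0 < v by rewrite lt_neqAle eq_sym vn0.
    by rewrite -{2}(powRr1 v0); apply: ger_powR => //; rewrite vp.
  rewrite powRM//.
  have hD : psi k - psi k.+1 = w * u / ((w + u) * (w + 2 * u)).
    rewrite /psi dyS -/w; have := ps0 k; rewrite -/w => wu.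
    by field; rewrite !gt_eqF//; lra.
  have wu0 : 0 < w + u by lra.
  have wu2 : 0 < w + 2 * u by lra.
  have hC : w * (v * (18 * d k / (d k + u) ^+ 2)) <= 288 * (psi k - psi k.+1).
    rewrite hD /v.
    have b1 : w * (u / (d k + u) * (18 * d k / (d k + u) ^+ 2)) <= 36 * (d k * u / (d k + u) ^+ 2).
      have -> : w * (u / (d k + u) * (18 * d k / (d k + u) ^+ 2)) =
         18 * (w / (d k + u)) * (d k * u / (d k + u) ^+ 2) by field; rewrite gt_eqF.
      apply: ler_wpM2r; first by rewrite divr_ge0 ?sqr_ge0// mulr_ge0// ltW.
      have : w / (d k + u) <= 2 by rewrite ler_pdivrMr//; lra.
      lra.
    apply: (le_trans b1); rewrite !mulrA ler_pdivlMr ?mulr_gt0//.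
    rewrite mulrAC ler_pdivrMr ?exprn_gt0//.
    have -> : 36 * d k * u * ((w + u) * (w + 2 * u)) = (36 * u) * (d k * ((w + u) * (w + 2 * u))) by ring.
    have -> : 288 * w * u * (d k + u) ^+ 2 = (36 * u) * (8 * w * (d k + u) ^+ 2) by ring.
    apply: ler_wpM2l; first exact: mulr_ge0.
    apply: (@le_trans _ _ (w * ((2 * (d k + u)) * (2 * (2 * (d k + u)))))).
      apply: ler_pM => //; [exact: ltW|by rewrite mulr_ge0//; lra|].
      by apply: ler_pM; lra.
    by rewrite le_eqVlt; apply/orP; left; apply/eqP; ring.
  have -> : w * (6 `^ p * v `^ p * (18 * d k / (d k + u) ^+ 2)) =
      6 `^ p * (w * (v `^ p * (18 * d k / (d k + u) ^+ 2))) by ring.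
  have -> : 288 * 6 `^ p * (psi k - psi k.+1) = 6 `^ p * (288 * (psi k - psi k.+1)) by ring.
  apply: ler_wpM2l => //; apply: le_trans hC; apply: ler_wpM2l; first exact: ltW.
  by apply: ler_wpM2r => //; rewrite divr_ge0 ?sqr_ge0// mulr_ge0// ltW.
rewrite -mulr_sumr -/(CFR p); apply: ler_piMr; first exact: mulr_ge0 (ler0n _ _) (powR_ge0 _ _).
have -> : \sum_(k < K) (psi k - psi k.+1) = psi 0%N - psi K.
  elim: K {hd} => [|K IH]; first by rewrite big_ord0 subrr.
  by rewrite big_ord_recr /= IH; ring.
have : 0 <= psi K by rewrite divr_ge0 ?ltW ?dy_gt0.
have : psi 0%N <= 1 by rewrite /psi ler_pdivrMr// mul1r lerDl.
lra.
Qed.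

(** [weighted_poisson] with a multiplier that is not only 1 at r t and 0 at r but also bounded: an
    affine one would grow like u / d, whose p-th power is not summable over scales for p >= 2. The
    price is a pole at r (1 + d k), which the inequality 1 <= r (1 + d k) keeps off the open
    disc. *)
Lemma fr_dyadic_lt f p r K (t : nat -> R) : 1 <= p -> analytic f -> 0 < r < 1 ->
  (forall k, (k < K)%N -> 1 <= r * (1 + (1 - t k))) ->
  (forall k, (k < K)%N -> 1 - dy k <= t k <= 1 - dy k / 2) ->
  \sum_(k < K) dy k * cmod (f (rc (r * t k))) `^ p <=
  CFR p * rmean (fun x => cmod (f (circle r x)) `^ p).
Proof.
move=> p1 hf /[dup] hr /andP[r0 r1] hrt ht; have p0 : 0 < p by lra.
have hr' : 0 <= r < 1 by rewrite ltW.
pose A x := cmod (f (circle r x)) `^ p.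
have cA : rcont A.
  by apply: rcont_powR => //; exact/rcont_cmod/(dan_ccont hf hr').
pose d k := 1 - t k.
have hd k : (k < K)%N -> dy k / 2 <= d k <= dy k.
  by move=> /ht /andP[h1 h2]; rewrite /d; apply/andP; split; lra.
pose u x := cmod (1 - ei x).
have u0 x : 0 <= u x by exact: cmod_ge0.
have cei := ccont_ei1.
have cu : rcont u by apply/rcont_cmod/ccont_sub => //; exact: ccont_cst.
pose Q k x := (6 * (u x / (d k + u x))) `^ p * (18 * d k / (d k + u x) ^+ 2).
have du k x : (k < K)%N -> 0 < d k + u x.
  by move=> /hd /andP[h _]; rewrite ltr_wpDr//; have : 0 < dy k :> R := dy_gt0 k; lra.
have cQ k : (k < K)%N -> rcont (Q k).
  move=> kK; have cdu : rcont (fun x => d k + u x) by apply: rcont_add => //; exact: rcont_cst.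
  have civ : rcont (fun x => (d k + u x)^-1).
    by apply: rcont_inv => // x; rewrite gt_eqF// du.
  apply: rcont_mul.
    apply: rcont_powR => //; first by move=> x; rewrite mulr_ge0// divr_ge0// ltW// du.
    by apply: rcont_mul; [exact: rcont_cst|exact: rcont_mul].
  apply: rcont_mul; first exact: rcont_cst.
  apply: rcont_inv; last by move=> x; rewrite expf_neq0// gt_eqF// du.
  exact: rcont_exp.
have bound k : (k < K)%N -> cmod (f (rc (r * t k))) `^ p <= rmean (fun x => A x * Q k x).
  move=> kK; have /andP[d1 d2] := hd k kK; have dk0 : 0 < d k by have : 0 < dy k :> R := dy_gt0 k; lra.
  have w1 : dy k <= 1 :> R := dy_le1 k.
  have tE : t k = 1 - d k by rewrite /d; ring.
  have t01 : 0 <= t k < 1 by rewrite tE; apply/andP; split; lra.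
  have hrk := hrt k kK; rewrite -/(d k) in hrk.
  pose D (w : Cx R) : Cx R := rc (1 + d k) + (- rc r^-1) * w.
  have rcr : rc r * rc r^-1 = 1 :> Cx R by rewrite -rcM divff// gt_eqF.
  have D0 w : cmod w < 1 -> D w != 0.
    move=> hw; rewrite /D mulNr subr_eq0; apply/eqP => /(congr1 (fun z => cmod (rc r * z))).
    rewrite mulrA rcr mul1r -rcM cmod_rc ger0_norm; last by rewrite mulr_ge0 ?(ltW r0)// addr_ge0// ltW.
    by move=> e; move: hw; rewrite -e ltNge hrk.
  pose E (w : Cx R) : Cx R := (2 + (- rc (2 / r)) * w) * (D w)^-1.
  have aE : analytic E.
    move=> w hw; apply: derivableM; first exact: derivable_affine.
    by apply: derivableV; [exact: D0|exact: derivable_affine].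
  have Ec y : E (rc r * y) = 2 * (1 - y) / (rc (1 + d k) - y).
    rewrite /E /D rcM !mulNr -!mulrA ![rc r^-1 * (rc r * y)]mulrA [rc r^-1 * _]mulrC rcr mul1r.
    by rewrite (rcn 2) mulrA mulrBr mulr1.
  have E1 : E (rc (r * t k)) = 1.
    rewrite rcM Ec tE.
    have -> : 1 - rc (1 - d k) = rc (d k) :> Cx R by rewrite rcB rc1; ring.
    have -> : rc (1 + d k) - rc (1 - d k) = 2 * rc (d k) :> Cx R by rewrite rcB rcD rc1; ring.
    by rewrite divff// mulf_neq0 ?pnatr_eq0// rc_eq0 gt_eqF.
  have := weighted_poisson p1 hf aE t01 hr E1; move/le_trans; apply.
  have key x : cmod (E (circle r x)) `^ p * ((1 - t k ^+ 2) / cmod (ei x - rc (t k)) ^+ 2) <= Q k x.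
    have ux := u0 x; have dux := du k x kK.
    have e1 : cmod (ei x - rc (t k)) <= cmod (1 - ei x) + cmod (1 - rc (t k)).
      rewrite cmodC; have -> : rc (t k) - ei x = (1 - ei x) - (1 - rc (t k)) by ring.
      exact: cmodB.
    have e2 : d k <= cmod (ei x - rc (t k)).
      have := @cmod_triangle _ (ei x) (rc (t k)) _ (lexx _).
      by rewrite cmod_ei cmod_rc ger0_norm; [rewrite /d; lra|case/andP: t01].
    have e3 : u x <= cmod (ei x - rc (t k)) + d k.
      rewrite /u; have -> : 1 - ei x = (1 - rc (t k)) - (ei x - rc (t k)) by ring.
      apply: le_trans (cmodB _ _) _; rewrite -rc1 -rcB cmod_rc -/(d k) ger0_norm ?(ltW dk0)//.
      by rewrite addrC.
    have e4 : (d k + u x) / 3 <= cmod (ei x - rc (t k)) by lra.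
    have f2 : d k <= cmod (rc (1 + d k) - ei x).
      have h := @cmod_triangle _ (rc (1 + d k)) (ei x) _ (lexx _).
      by move: h; rewrite cmod_ei cmod_rc ger0_norm; lra.
    have f3 : u x <= cmod (rc (1 + d k) - ei x) + d k.
      rewrite /u; have -> : 1 - ei x = (rc (1 + d k) - ei x) - rc (d k) by rewrite rcD rc1; ring.
      by apply: le_trans (cmodB _ _) _; rewrite cmod_rc (ger0_norm (ltW dk0)).
    have f4 : (d k + u x) / 3 <= cmod (rc (1 + d k) - ei x) by lra.
    have d3 : 0 < (d k + u x) / 3 by rewrite divr_gt0.
    apply: ler_pM; [exact: powR_ge0| | |].
    - rewrite divr_ge0 ?sqr_ge0// subr_ge0 expr_le1//; first by case/andP: t01 => _ /ltW.
      by case/andP: t01.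
    - apply: ge0_ler_powR; rewrite ?nnegrE ?(ltW p0)//.
        by rewrite mulr_ge0// divr_ge0// ltW.
      rewrite circleE Ec !cmodM cmodV -(rcn 2) cmod_rc ger0_norm// -/(u x).
      rewrite ler_pdivrMr; last exact: lt_le_trans f4.
      apply: (@le_trans _ _ (6 * (u x / (d k + u x)) * ((d k + u x) / 3))).
        by rewrite le_eqVlt; apply/orP; left; apply/eqP; field; rewrite gt_eqF.
      by rewrite ler_wpM2l// mulr_ge0// divr_ge0// ltW.
    - have c0 : 0 < cmod (ei x - rc (t k)) by exact: lt_le_trans e4.
      rewrite ler_pdivrMr ?exprn_gt0//.
      apply: (@le_trans _ _ (18 * d k / (d k + u x) ^+ 2 * ((d k + u x) / 3) ^+ 2)).
        have -> : 18 * d k / (d k + u x) ^+ 2 * ((d k + u x) / 3) ^+ 2 = 2 * d k.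
          by field; rewrite gt_eqF.
        rewrite tE; have : 0 <= d k ^+ 2 by exact: sqr_ge0.
        have -> : 1 - (1 - d k) ^+ 2 = 2 * d k - d k ^+ 2 by ring.
        lra.
      apply: ler_wpM2l; first by rewrite divr_ge0 ?sqr_ge0// mulr_ge0// ltW.
      by rewrite lerXn2r// nnegrE ltW.
  have cd : rcont (fun x => (cmod (ei x - rc (t k)) ^+ 2)^-1).
    apply: rcont_inv; last first.
      move=> x; rewrite expf_neq0// gt_eqF//.
      have := @cmod_triangle _ (ei x) (rc (t k)) _ (lexx _).
      by rewrite cmod_ei cmod_rc ger0_norm; [rewrite tE; lra|case/andP: t01].
    by apply/rcont_exp/rcont_cmod/ccont_sub => //; exact: ccont_cst.
  apply: le_rmean.
  - apply: rcont_mul; first exact: cA.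
    apply: rcont_mul; last by apply: rcont_mul; [exact: rcont_cst|exact: cd].
    apply: rcont_powR => //; apply: rcont_cmod.
    by apply: (@dan_ccont _ 1); [exact: aE|exact: hr'].
  - by apply: rcont_mul; [exact: cA|exact: cQ].
  - by move=> x; apply: ler_wpM2l; [exact: powR_ge0|exact: key].
apply: (@le_trans _ _ (\sum_(k < K) dy k * rmean (fun x => A x * Q k x))).
  by apply: ler_sum => k _; apply: ler_wpM2l; [exact/ltW/dy_gt0|exact: bound].
have -> : \sum_(k < K) dy k * rmean (fun x => A x * Q k x) =
    rmean (fun x => \sum_(k < K) dy k * (A x * Q k x)).
  have h (N : nat) : (N <= K)%N -> rcont (fun x => \sum_(k < N) dy k * (A x * Q k x)) /\
     \sum_(k < N) dy k * rmean (fun x => A x * Q k x) = rmean (fun x => \sum_(k < N) dy k * (A x * Q k x)).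
    elim: N => [_|N IH NK].
      split; first by under eq_fun do rewrite big_ord0; exact: rcont_cst.
      by rewrite big_ord0; under [X in rmean X]eq_fun do rewrite big_ord0; rewrite rmean_cst.
    have [c1 e1] := IH (ltnW NK).
    have cN : rcont (fun x => A x * Q N x) by apply: rcont_mul; [exact: cA|exact: cQ].
    have cN' : rcont (fun x => dy N * (A x * Q N x)) by apply: rcont_mul => //; exact: rcont_cst.
    split; first by under eq_fun do rewrite big_ord_recr /=; exact: rcont_add.
    rewrite big_ord_recr /= e1 -rmeanZ// -rmeanD//.
    by congr rmean; apply/funext => x; rewrite big_ord_recr.
  exact: (h K (leqnn K)).2.
rewrite -rmeanZ//; apply: le_rmean.
- have h (N : nat) : (N <= K)%N -> rcont (fun x => \sum_(k < N) dy k * (A x * Q k x)).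
    elim: N => [_|N IH NK]; first by under eq_fun do rewrite big_ord0; exact: rcont_cst.
    under eq_fun do rewrite big_ord_recr /=; apply: rcont_add; first exact: IH (ltnW NK).
    apply: rcont_mul; first exact: rcont_cst.
    by apply: rcont_mul; [exact: cA|exact: cQ].
  exact: (h K (leqnn K)).
- by apply: rcont_mul; [exact: rcont_cst|exact: cA].
- move=> x; rewrite mulrC.
  apply: (@le_trans _ _ (A x * \sum_(k < K) dy k * Q k x)).
    by rewrite mulr_sumr le_eqVlt; apply/orP; left; apply/eqP; apply: eq_bigr => k _; ring.
  by apply: ler_wpM2l; [exact: powR_ge0|exact: fr_kernel_sum].
Qed.

End DyadicFejerRiesz.

(** * Moments and the power series of the operator *)

Section Moments.
Context {R : realType}.
Implicit Types (f g : Cx R -> Cx R) (u : R -> Cx R) (z w : Cx R) (h : R -> R)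
  (c : nat -> Cx R) (r a s t x M p B T : R).
Local Notation mu := (@lebesgue_measure R).
Local Notation dy := (@dy R).

(** Truncation points exhausting [0, 1), at which integrands may blow up near 1. They also bound the
    dyadic rings. *)
Definition cut (J : nat) : R := 1 - dy J.
Lemma cut0 : cut 0 = 0. Proof. by rewrite /cut /dy expr0 subrr. Qed.
Lemma cut_ge0 J : 0 <= cut J. Proof. by rewrite subr_ge0 dy_le1. Qed.
Lemma cut_lt1 J : cut J < 1. Proof. by rewrite /cut ltrBlDr ltrDl dy_gt0. Qed.
Lemma cut_le (i j : nat) : (i <= j)%N -> cut i <= cut j.
Proof. by move=> ij; rewrite lerD2l lerN2 dy_le. Qed.
Lemma cutS J : cut J.+1 - cut J = dy J / 2.
Proof. by rewrite /cut dyS; field. Qed.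
Lemma cut_near t : t < 1 -> exists J, t <= cut J.
Proof.
move=> t1; have d0 : 0 < 1 - t by rewrite subr_gt0.
have hg := @cvg_geometric R 1 2^-1; rewrite ger0_norm ?invr_ge0// invf_lt1// ltr1n in hg.
move/cvgrPdist_le : (hg isT) => /(_ _ d0) [J _ /(_ J (leqnn J))].
rewrite sub0r normrN /= mul1r => /(le_trans (ler_norm _)) h; exists J.
by rewrite /cut /dy; lra.
Qed.

Definition hcont h := forall T, T < 1 -> rcontI 0 T h.
Definition ucont u := forall T, T < 1 -> ccontI 0 T u.

Lemma bigcup_cut : \bigcup_J `[0, cut J]%classic = `[0, 1[%classic :> set R.
Proof.
apply/seteqP; split => [x [J _] /=|x /=]; rewrite !in_itv /=.
  by move=> /andP[-> /le_lt_trans]; apply; exact: cut_lt1.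
by move=> /andP[x0 /cut_near[J hJ]]; exists J => //=; rewrite in_itv /= x0.
Qed.

Lemma half_open_ge0 h B : hcont h -> (forall t, 0 <= h t) -> (forall J, rint 0 (cut J) h <= B) ->
  mu.-integrable `[0%R, 1%R[ (EFin \o h) /\
  rint 0 (cut J) h @[J --> \oo] --> \int[mu]_(t in `[0%R, 1%R[) h t.
Proof.
move=> hc h0 hB.
have mh J : measurable_fun `[0, cut J]%classic (EFin \o h).
  exact: measurable_int (rcontI_integrable (hc _ (cut_lt1 J))).
have ndF : nondecreasing_seq (fun J => `[0, cut J]%classic : set R).
  move=> i j ij; rewrite subsetEset; apply: subset_itvl; rewrite bnd_simp; exact: cut_le.
have mall : measurable_fun (`[0, 1[%classic : set R) (EFin \o h).
  by rewrite -bigcup_cut; apply/measurable_fun_bigcup.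
have := @ge0_nondecreasing_set_cvg_integral _ (measurableTypeR R) R (fun J => `[0, cut J]%classic)
  (EFin \o h) mu ndF (fun J => measurable_itv _) mh (fun J x _ => h0 x).
rewrite bigcup_cut => lim.
have E J : (\int[mu]_(x in `[0%R, cut J]) (EFin \o h) x = (rint 0 (cut J) h)%:E)%E.
  exact: (integral_rint (hc _ (cut_lt1 J))).
have {}lim : (rint 0 (cut J) h)%:E @[J --> \oo] --> (\int[mu]_(x in `[0%R, 1%R[) (EFin \o h) x)%E.
  by move: lim; under eq_cvg do rewrite E.
have le : (\int[mu]_(x in `[0%R, 1%R[) (EFin \o h) x <= B%:E)%E.
  rewrite -(cvg_lim (@ereal_hausdorff R) lim); apply: lime_le; first exact: cvgP lim.
  by apply: nearW => J; rewrite lee_fin.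
have ge : (0 <= \int[mu]_(x in `[0%R, 1%R[) (EFin \o h) x)%E.
  by apply: integral_ge0 => x _; rewrite lee_fin.
have fin : (\int[mu]_(x in `[0%R, 1%R[) (EFin \o h) x)%E \is a fin_num.
  by rewrite ge0_fin_numE//; apply: le_lt_trans le (ltry _).
split.
  apply/integrableP; split => //.
  under eq_integral do rewrite gee0_abs ?lee_fin//.
  exact: le_lt_trans le (ltry _).
rewrite -(fineK fin) in lim; exact: fine_cvg lim.
Qed.

(** h is the difference of h + |h| and |h|, two nonnegative functions to which monotone convergence
    applies. *)
Lemma half_open h B : hcont h -> (forall J, rint 0 (cut J) (fun t => `|h t|) <= B) ->
  rint 0 (cut J) h @[J --> \oo] --> \int[mu]_(t in `[0%R, 1%R[) h t.
Proof.
move=> hc hB.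
have ca : hcont (fun t => `|h t|) by move=> T T1 t ht; apply: cvg_norm; exact: hc T1 t ht.
have cb : hcont (fun t => h t + `|h t|).
  by move=> T T1 t ht; exact: cvgD (hc T T1 t ht) (ca T T1 t ht).
have [i1 l1] := half_open_ge0 ca (fun t => normr_ge0 _) hB.
have b0 t : 0 <= h t + `|h t| by have := ler_norm (- h t); rewrite normrN; lra.
have bB J : rint 0 (cut J) (fun t => h t + `|h t|) <= B + B.
  rewrite rintD; [|exact: hc (cut_lt1 J)|exact: ca (cut_lt1 J)].
  apply: lerD => //; apply: le_trans (hB J); apply: le_rint.
  - exact: hc (cut_lt1 J).
  - exact: ca (cut_lt1 J).
  - by move=> t _; exact: ler_norm.
have [i2 l2] := half_open_ge0 cb b0 bB.
have -> : \int[mu]_(t in `[0%R, 1%R[) h t =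
   \int[mu]_(t in `[0%R, 1%R[) (h t + `|h t|) - \int[mu]_(t in `[0%R, 1%R[) `|h t|.
  rewrite -RintegralB//; apply: eq_Rintegral => t _; by rewrite addrK.
have -> : (fun J => rint 0 (cut J) h) =
    (fun J => rint 0 (cut J) (fun t => h t + `|h t|) - rint 0 (cut J) (fun t => `|h t|)).
  apply/funext => J; rewrite rintD ?addrK//; [exact: hc (cut_lt1 J)|exact: ca (cut_lt1 J)].
exact: cvgB.
Qed.

Definition cint01 u : Cx R :=
  (\int[mu]_(t in `[0%R, 1%R[) complex.Re (u t)) +i* (\int[mu]_(t in `[0%R, 1%R[) complex.Im (u t)).

Lemma cint01_lim u B : ucont u -> (forall J, rint 0 (cut J) (fun t => cmod (u t)) <= B) ->
  cint 0 (cut J) u @[J --> \oo] --> cint01 u.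
Proof.
move=> uc hB.
have lim (F : Cx R -> R) : (forall z, `|F z| <= cmod z) -> hcont (fun t => F (u t)) ->
    rint 0 (cut J) (fun t => F (u t)) @[J --> \oo] --> \int[mu]_(t in `[0%R, 1%R[) F (u t).
  move=> hF cF; apply: (@half_open _ B) => // J; apply: le_trans (hB J); apply: le_rint.
  - by move=> t ht; apply: cvg_norm; exact: cF (cut_lt1 J) t ht.
  - by move=> t ht; apply: continuous_cmod_comp; exact: uc (cut_lt1 J) t ht.
  - by move=> t _; exact: hF.
have hRe : hcont (fun t => complex.Re (u t)) by move=> T T1; apply: ccontI_Re; exact: uc T1.
have hIm : hcont (fun t => complex.Im (u t)) by move=> T T1; apply: ccontI_Im; exact: uc T1.
have lR := lim (@complex.Re R) (@normRe_le R) hRe.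
have lI := lim (@complex.Im R) (@normIm_le R) hIm.
apply/cvgC_P => e e0; have e2 : 0 < e / 2 by rewrite divr_gt0.
move/cvgrPdist_le : lR => /(_ _ e2) lR; move/cvgrPdist_le : lI => /(_ _ e2) lI.
near=> J; apply: le_trans (cmod_le_ReIm _) _ => /=.
by rewrite (splitr e); apply: lerD; rewrite distrC; near: J; [exact: lR|exact: lI].
Unshelve. all: by end_near. Qed.

Lemma cint01_bound u B : ucont u -> (forall J, rint 0 (cut J) (fun t => cmod (u t)) <= B) ->
  cmod (cint01 u) <= B.
Proof.
move=> uc hB; apply: (cmod_lim_le (N := 0) (cint01_lim uc hB)) => J _.
exact: le_trans (cmod_cint (uc _ (cut_lt1 J))) (hB J).
Qed.

(** What Fejer-Riesz provides: absolute integrability of f on the radius with bound B, phrased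
    through truncations. *)
Definition rad f (B : R) := analytic f /\ forall J, rint 0 (cut J) (fun t => cmod (f (rc t))) <= B.

Lemma ucont_radial f : analytic f -> ucont (fun t => f (rc t)).
Proof.
move=> hf T T1 t /andP[t0 tT]; apply: (continuous_comp_derivable (u := rc)).
  by apply: continuous_rc_comp; exact: cvg_id.
by apply: hf; rewrite cmod_rc ger0_norm// (le_lt_trans tT).
Qed.

Lemma ucont_mul u v : ucont u -> ucont v -> ucont (fun t => u t * v t).
Proof. by move=> hu hv T T1; apply: ccontI_mul; [exact: hu|exact: hv]. Qed.
Lemma ucont_cst (k : Cx R) : ucont (fun=> k).
Proof. by move=> T T1; exact: ccontI_cst. Qed.
Lemma ucont_rcX n : ucont (fun t => rc t ^+ n).
Proof.
by move=> T T1; apply: ccontI_exp => t _; apply: continuous_rc_comp; exact: cvg_id.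
Qed.

Definition mom f n : Cx R := cint01 (fun t => f (rc t) * rc t ^+ n).

Lemma rad_weight f B u (C : R) : rad f B -> 0 <= C -> ucont u ->
  (forall t, 0 <= t < 1 -> cmod (u t) <= C) ->
  forall J, rint 0 (cut J) (fun t => cmod (f (rc t) * u t)) <= C * B.
Proof.
move=> [hf hB] C0 cu hu J.
have cf := ccontI_cmod (ucont_radial hf (cut_lt1 J)).
have cCf : rcontI 0 (cut J) (fun t => C * cmod (f (rc t))).
  by move=> t ht; exact: (cvgM (cvg_cst C) (cf t ht)).
apply: (@le_trans _ _ (rint 0 (cut J) (fun t => C * cmod (f (rc t))))).
  apply: le_rint => //.
    exact: ccontI_cmod (ucont_mul (ucont_radial hf) cu (cut_lt1 J)).
  move=> t /andP[t0 tJ]; rewrite cmodM mulrC ler_wpM2r// hu// t0.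
  exact: le_lt_trans tJ (cut_lt1 J).
by rewrite (rintZ _ cf) ler_wpM2l.
Qed.

Lemma mom_lim f B n : rad f B ->
  cint 0 (cut J) (fun t => f (rc t) * rc t ^+ n) @[J --> \oo] --> mom f n.
Proof.
move=> hf; apply: (@cint01_lim _ (1 * B)).
- by apply: ucont_mul; [exact: (ucont_radial hf.1)|exact: ucont_rcX].
- apply: (rad_weight hf) => //; first exact: ucont_rcX.
  move=> t /andP[t0 t1]; rewrite cmodX cmod_rc ger0_norm// exprn_ile1//; exact: ltW.
Qed.

Lemma mom_le f B n : rad f B -> cmod (mom f n) <= B.
Proof.
move=> hf; rewrite -[B]mul1r; apply: cint01_bound.
- by apply: ucont_mul; [exact: (ucont_radial hf.1)|exact: ucont_rcX].
- apply: (rad_weight hf) => //; first exact: ucont_rcX.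
  move=> t /andP[t0 t1]; rewrite cmodX cmod_rc ger0_norm// exprn_ile1//; exact: ltW.
Qed.

(** The Taylor series of g' converges uniformly on the disc of radius |z|, which contains every t z,
    so its partial sums may be integrated against f with an error at most C q^N B. *)
Lemma hilbert_has_ps g f c B : has_ps 1 (cderiv g) c -> rad f B ->
  has_ps 1 (hilbert_op g f) (fun n => c n * mom f n).
Proof.
move=> hc hf; have B0 : 0 <= B by apply: le_trans (mom_le 0 hf).
split.
  have h : crad 1 (fun n => rc B * c n).
    move=> r hr; have [C hC] := hc.1 r hr; exists (B * C) => n.
    by rewrite cmodM cmod_rc (ger0_norm B0) -mulrA ler_wpM2l.
  apply: (crad_le h) => n; rewrite !cmodM cmod_rc (ger0_norm B0) mulrC.
  by rewrite ler_wpM2r// mom_le.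
move=> z z1; have hz : 0 <= cmod z < 1 by rewrite cmod_ge0.
have [C [q [C0 hq hu]]] := has_ps_unif hc hz; have [q0 q1] := andP hq.
pose G (t : R) := cderiv g (rc t * z).
have tz t : 0 <= t < 1 -> cmod (rc t * z) <= cmod z.
  move=> /andP[t0 t1]; rewrite cmodM cmod_rc ger0_norm// ler_piMl//; exact: ltW.
have cG : ucont G.
  move=> T T1 t /andP[t0 tT].
  apply: (continuous_comp_derivable (u := fun t => rc t * z)).
    apply: contC_mul; last exact: contC_cst.
    by apply: continuous_rc_comp; exact: cvg_id.
  apply: (has_ps_derivable hc); apply: le_lt_trans z1; apply: tz.
  by rewrite t0 (le_lt_trans tT).
have -> : hilbert_op g f z = cint01 (fun t => f (rc t) * G t) by [].
have cfG : ucont (fun t => f (rc t) * G t) := ucont_mul (ucont_radial hf.1) cG.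
have cft n : ucont (fun t => f (rc t) * rc t ^+ n).
  by apply: ucont_mul; [exact: (ucont_radial hf.1)|exact: ucont_rcX].
pose S N t := \sum_(n < N) (c n * z ^+ n) * rc t ^+ n.
have cS N : ucont (S N).
  move=> T T1 t ht; apply: contC_sum => n; apply: contC_mul; first exact: contC_cst.
  exact: (@ucont_rcX n T T1 t ht).
have dE N J : cint 0 (cut J) (fun t => f (rc t) * (G t - S N t)) =
    cint 0 (cut J) (fun t => f (rc t) * G t) -
    \sum_(n < N) (c n * z ^+ n) * cint 0 (cut J) (fun t => f (rc t) * rc t ^+ n).
  have J1 := cut_lt1 J.
  have c1 := cfG _ J1; have c2 n := cft n _ J1.
  have c3 (n : nat) : ccontI 0 (cut J) (fun t => (c n * z ^+ n) * (f (rc t) * rc t ^+ n)).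
    by apply: ccontI_mul (c2 n); exact: ccontI_cst.
  have -> : \sum_(n < N) (c n * z ^+ n) * cint 0 (cut J) (fun t => f (rc t) * rc t ^+ n) =
      cint 0 (cut J) (fun t => \sum_(n < N) (c n * z ^+ n) * (f (rc t) * rc t ^+ n)).
    rewrite cint_sum; [|by move=> n; exact: c3|exact: cut_ge0].
    by apply: eq_bigr => n _; rewrite (cintZ _ (c2 n)).
  have c4 : ccontI 0 (cut J) (fun t => \sum_(n < N) (c n * z ^+ n) * (f (rc t) * rc t ^+ n)).
    by move=> t ht; apply: contC_sum => n; exact: c3.
  rewrite -(cintB c1 c4); apply: cintE => t _; rewrite mulrBr; congr (_ - _).
  by rewrite /S mulr_sumr; apply: eq_bigr => n _; ring.
have lfG : cint 0 (cut J) (fun t => f (rc t) * G t) @[J --> \oo] --> cint01 (fun t => f (rc t) * G t).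
  have [M M0 hM] : exists2 M, 0 <= M & forall t, 0 <= t < 1 -> cmod (G t) <= M.
    exists C => // t ht; have := hu _ (tz t ht) 0%N.
    by rewrite expr0 mulr1 /psum big_ord0 subr0.
  by apply: (cint01_lim cfG); exact: (rad_weight hf M0 cG hM).
have main N : cmod (cint01 (fun t => f (rc t) * G t) - psum (fun n => c n * mom f n) N z) <= C * q ^+ N * B.
  apply: (cmod_lim_le (u := fun J => cint 0 (cut J) (fun t => f (rc t) * (G t - S N t))) (N := 0%N)).
    have -> : (fun J => cint 0 (cut J) (fun t => f (rc t) * (G t - S N t))) = (fun J =>
        cint 0 (cut J) (fun t => f (rc t) * G t) -
        \sum_(n < N) (c n * z ^+ n) * cint 0 (cut J) (fun t => f (rc t) * rc t ^+ n)).
      by apply/funext => J; exact: dE.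
    apply: cvgB; first exact: lfG.
    rewrite /psum; elim: N => [|N IH].
      under eq_fun do rewrite big_ord0; rewrite big_ord0; exact: cvg_cst.
    under eq_fun do rewrite big_ord_recr /=; rewrite big_ord_recr /=.
    apply: cvgD; first exact: IH.
    rewrite mulrAC; apply: (cvgM (cvg_cst _)); exact: mom_lim hf.
  move=> J _; apply: le_trans (cmod_cint _) _.
    apply: (ucont_mul (ucont_radial hf.1) _ (cut_lt1 J)) => T T1.
    by apply: ccontI_sub; [exact: cG|exact: cS].
  apply: (rad_weight hf).
  - by rewrite mulr_ge0// exprn_ge0.
  - by move=> T T1; apply: ccontI_sub; [exact: cG|exact: cS].
  move=> t ht; rewrite (_ : S N t = psum c N (rc t * z)); first exact: hu _ (tz t ht) N.
  by rewrite /psum /S; apply: eq_bigr => n _; rewrite exprMn; ring.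
apply/cvgC_P => e e0.
have hg := @cvg_geometric R (C * B) q; rewrite ger0_norm// in hg.
move/cvgrPdist_le : (hg q1) => /(_ _ e0); apply: filterS => N.
rewrite sub0r normrN /= => /(le_trans (ler_norm _)); apply: le_trans.
by rewrite cmodC; apply: le_trans (main N) _; rewrite mulrAC.
Qed.

Lemma rad_p1 f M : 0 <= M -> analytic f -> (hardy_norm 1%:E f <= M%:E)%E -> rad f (pi * M).
Proof.
move=> M0 hf; rewrite (hardy_pP ltr01 M0 hf) powRr1// => h; split => // J.
pose r := (cut J + 1) / 2.
have J1 := cut_lt1 J; have J0 := cut_ge0 J.
have hr : 0 < r < 1 by rewrite /r; apply/andP; split; lra.
apply: (@le_trans _ _ (pi * rmean (fun x => cmod (f (circle r x))))).
  by apply: fejer_riesz => //; rewrite J0 /r /=; lra.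
apply: ler_wpM2l; first exact: pi_ge0.
have := h r hr; have -> : (fun x => cmod (f (circle r x)) `^ 1) = (fun x => cmod (f (circle r x))) => //.
by apply/funext => x; rewrite powRr1.
Qed.

Lemma hardy_mono f (p M : R) : 1 <= p -> 0 <= M -> analytic f ->
  (hardy_norm p%:E f <= M%:E)%E -> (hardy_norm 1%:E f <= M%:E)%E.
Proof.
move=> p1 M0 hf; have p0 : 0 < p by lra.
rewrite (hardy_pP p0 M0 hf) (hardy_pP ltr01 M0 hf) powRr1// => h r hr.
have hr' : 0 <= r < 1 by case/andP: hr => /ltW -> ->.
have cF := rcont_cmod (dan_ccont hf hr').
have -> : (fun x => cmod (f (circle r x)) `^ 1) = (fun x => cmod (f (circle r x))).
  by apply/funext => x; rewrite powRr1.
set F := fun x => cmod (f (circle r x)); set m := rmean F.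
have m0 : 0 <= m by apply: rmean_ge0 => x; exact: cmod_ge0.
have hm : m `^ p <= M `^ p.
  apply: le_trans (h r hr); pose k := p * m `^ (p - 1).
  have -> : m `^ p = rmean (fun x => (m `^ p - k * m) + k * F x).
    rewrite (rmeanD (@rcont_cst R _) (rcont_mul (@rcont_cst R k) cF)).
    by rewrite rmean_cst (rmeanZ _ cF) subrK.
  apply: le_rmean.
  - exact: rcont_add (@rcont_cst R _) (rcont_mul (@rcont_cst R k) cF).
  - by apply: rcont_powR => // x; exact: cmod_ge0.
  - move=> x; have := powR_tangent p1 (cmod_ge0 (f (circle r x))) m0.
    by rewrite -/k /F; lra.
rewrite leNgt; apply/negP => lt.
have := @gt0_ltr_powR _ p p0 M m; rewrite !nnegrE => /(_ M0 m0 lt).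
by rewrite ltNge hm.
Qed.

Lemma hardy_inftyP f M : analytic f -> 
  (hardy_norm +oo%E f <= M%:E)%E <-> (forall z, 0 < cmod z < 1 -> cmod (f z) <= M).
Proof.
move=> hf; split => [h z hz|h].
  rewrite -lee_fin; apply: le_trans h; apply: (@le_trans _ _ (integral_mean +oo%E (cmod z) f)).
    by apply: ereal_sup_ubound; exists z.
  by apply: ereal_sup_ubound; exists (cmod z) => //=; rewrite in_itv.
apply: ge_ereal_sup => x [r /=]; rewrite in_itv /= => hr <-.
by apply: ge_ereal_sup => _ [z /= zr <-]; rewrite lee_fin; apply: h; rewrite zr.
Qed.

Lemma CFR_ge0 p : 0 <= CFR p.
Proof. exact: mulr_ge0 (ler0n _ _) (powR_ge0 _ _). Qed.

(** The finite sum S is continuous in r up to r = 1, and [fr_dyadic_lt] applies once r is so close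
    to 1 that no pole of a multiplier lies in the disc. *)
Lemma fr_dyadic f p M K (t : nat -> R) : 1 <= p -> 0 <= M -> analytic f ->
  (hardy_norm p%:E f <= M%:E)%E ->
  (forall k, 1 - dy k <= t k <= 1 - dy k / 2) ->
  \sum_(k < K) dy k * cmod (f (rc (t k))) `^ p <= CFR p * M `^ p.
Proof.
move=> p1 M0 hf; have p0 : 0 < p by lra.
rewrite (hardy_pP p0 M0 hf) => h ht.
have t01 k : 0 <= t k < 1.
  have /andP[h1 h2] := ht k; have := dy_le1 (R := R) k; have := dy_gt0 (R := R) k.
  by move=> ? ?; apply/andP; split; lra.
pose S (r : R) := \sum_(k < K) dy k * cmod (f (rc (r * t k))) `^ p.
have cS : {for 1, continuous S}.
  rewrite /S; elim: K @S => [|K IH].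
    move=> S; rewrite (_ : (fun r => _) = fun=> 0); first exact: cvg_cst.
    by apply/funext => r; rewrite big_ord0.
  move=> S; rewrite (_ : (fun r => _) = (fun r => \sum_(k < K) dy k * cmod (f (rc (r * t k))) `^ p +
    dy K * cmod (f (rc (r * t K))) `^ p)); last by apply/funext => r; rewrite big_ord_recr.
  apply: cvgD; first exact: IH.
  apply: cvgM; first exact: cvg_cst.
  apply: (@continuous_powR_comp R _ (fun r => cmod (f (rc (r * t K)))) 1 p p0) => //.
  apply: continuous_cmod_comp; apply: (continuous_comp_derivable (u := fun r => rc (r * t K))).
    by apply: continuous_rc_comp; exact: (cvgM cvg_id (cvg_cst _)).
  have /andP[t0 t1] := t01 K.
  by apply: hf; rewrite mul1r cmod_rc ger0_norm.
apply/ler_addgt0Pl => e e0; rewrite addrC.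
have /cvg_at_left_filter/cvgrPdist_le/(_ _ e0) near1 := cS.
(* The last condition serves all k < K at once, since 1 - t k >= 2^-K for them. *)
have [r [hS r1 hrK]] : exists r, [/\ `|S 1 - S r| <= e, r < 1 & (1 + dy K)^-1 <= r].
  near (1 : R)^'- => r; exists r; split; near: r.
  - exact: near1.
  - exact: nbhs_left_lt.
  - apply: nbhs_left_ge; rewrite invf_lt1; first by rewrite ltrDl dy_gt0.
    by rewrite ltr_wpDl// dy_gt0.
have dK := dy_gt0 (R := R) K.
have r0 : 0 < r by apply: lt_le_trans hrK; rewrite invr_gt0; lra.
have hr : 0 < r < 1 by rewrite r0.
have S1 : S 1 = \sum_(k < K) dy k * cmod (f (rc (t k))) `^ p.
  by apply: eq_bigr => k _; rewrite mul1r.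
have Sr : S r <= CFR p * M `^ p.
  apply: le_trans (fr_dyadic_lt p1 hf hr _ (fun k _ => ht k)) _.
    move=> k kK; have /andP[_ h2] := ht k.
    have hk : dy K <= dy k / 2 by rewrite -dyS; exact: dy_le.
    apply: (@le_trans _ _ (r * (1 + dy K))).
      by rewrite -ler_pdivrMr ?mul1r//; lra.
    by rewrite ler_wpM2l ?(ltW r0)//; lra.
  exact: (ler_wpM2l (CFR_ge0 p) (h r hr)).
rewrite -S1; move: hS; rewrite ler_norml => /andP[_]; lra.
Unshelve. all: by end_near. Qed.

End Moments.

(** * The dyadic estimate of moments *)

Section MomentEstimate.
Context {R : realType}.
Implicit Types (f g : Cx R -> Cx R) (u : R -> Cx R) (z w : Cx R) (h : R -> R)
  (c : nat -> Cx R) (r a s t x M p B T : R).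
Local Notation dy := (@dy R).
Local Notation cut := (@cut R).

Lemma cvg_powR (T : Type) (F : set_system T) {FF : Filter F} (v : T -> R) (l s : R) : 0 < s ->
  (forall y, 0 <= v y) -> 0 <= l -> v @ F --> l -> (fun y => v y `^ s) @ F --> l `^ s.
Proof.
move=> s0 v0 l0 hv.
have hc : {for l, continuous (fun y : R => `|y| `^ s)}.
  apply: (@continuous_powR_comp R _ (fun y : R => `|y|)) => //; exact: norm_continuous.
have := cvg_comp v _ hv hc; rewrite /= (ger0_norm l0).
by rewrite (_ : (fun y => `|y| `^ s) \o v = (fun y => v y `^ s))//; apply/funext => y /=; rewrite ger0_norm.
Qed.

(** Truncation leaves finitely many dyadic rings, so that the finite form of Schur's test applies
    before J tends to infinity. *)
Definition amom f J n := rint 0 (cut J) (fun t => cmod (f (rc t)) * t ^+ n).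

Lemma ucont_amom f n T : analytic f -> T < 1 -> rcontI 0 T (fun t => cmod (f (rc t)) * t ^+ n).
Proof.
move=> hf T1 t ht; apply: cvgM; last exact: exprn_continuous.
exact: ccontI_cmod (ucont_radial hf T1) t ht.
Qed.

Lemma cmod_mom_trunc f J n : analytic f ->
  cmod (cint 0 (cut J) (fun t => f (rc t) * rc t ^+ n)) <= amom f J n.
Proof.
move=> hf; have hu := ucont_mul (ucont_radial hf) (@ucont_rcX R n) (cut_lt1 J).
apply: le_trans (cmod_cint hu) _; apply: le_rint.
- exact: ccontI_cmod hu.
- exact: ucont_amom (cut_lt1 J).
- by move=> t /andP[t0 _]; rewrite cmodM cmodX cmod_rc ger0_norm.
Qed.

Lemma amom_ge0 f J n : analytic f -> 0 <= amom f J n.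
Proof. move=> hf; exact: le_trans (cmod_ge0 _) (cmod_mom_trunc J n hf). Qed.

Lemma mom_sum_le f B K (n : nat -> nat) (w : nat -> R) p C : 0 < p -> rad f B ->
  (forall k, 0 <= w k) ->
  (forall J, \sum_(k < K) (w k * amom f J (n k)) `^ p <= C) ->
  \sum_(k < K) (w k * cmod (mom f (n k))) `^ p <= C.
Proof.
move=> p0 hf w0 hJ.
pose U J k := cmod (cint 0 (cut J) (fun t => f (rc t) * rc t ^+ (n k))).
have lim : \sum_(k < K) (w k * U J k) `^ p @[J --> \oo] --> \sum_(k < K) (w k * cmod (mom f (n k))) `^ p.
  elim: K {hJ} => [|K IH].
    by rewrite big_ord0; under eq_fun do rewrite big_ord0; exact: cvg_cst.
  rewrite big_ord_recr /=; under eq_fun do rewrite big_ord_recr /=.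
  apply: cvgD; first exact: IH.
  apply: cvg_powR => //; [|by rewrite mulr_ge0 ?cmod_ge0|].
    by move=> J; rewrite mulr_ge0 ?cmod_ge0.
  apply: (cvgM (cvg_cst _)).
  have := (@mom_lim R f B (n K) hf).
  move=> hl; apply/cvgrPdist_le => e e0; move/cvgC_P : hl => /(_ _ e0).
  apply: filterS => J /=; apply: le_trans.
  rewrite distrC /U; set X := cint _ _ _; set Y := mom _ _.
  have h1 := cmodD (X - Y) Y; have h2 := cmodD (Y - X) X.
  rewrite subrK in h1; rewrite subrK (cmodC Y) in h2.
  by rewrite ler_norml; apply/andP; split; lra.
rewrite -(cvg_lim (@Rhausdorff R) lim); apply: limr_le; first exact: cvgP lim.
apply: nearW => J; apply: le_trans (hJ J); apply: ler_sum => k _.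
apply: ge0_ler_powR; rewrite ?nnegrE ?mulr_ge0 ?cmod_ge0 ?(ltW p0)//.
  exact: amom_ge0 hf.1.
by apply: ler_wpM2l => //; exact: cmod_mom_trunc hf.1.
Qed.

Lemma amom_dyadic f J n (s : nat -> R) : analytic f ->
  (forall j t, 1 - dy j <= t <= 1 - dy j / 2 -> cmod (f (rc t)) <= s j) ->
  amom f J n <= \sum_(j < J) dy j / 2 * ((1 - dy j / 2) ^+ n * s j).
Proof.
move=> hf hs; elim: J => [|J IH].
  by rewrite big_ord0 /amom cut0 rint.unlock set_itv1 Rintegral_set1.
have J1 := cut_lt1 (R := R) J.+1; have J0 := cut_ge0 (R := R) J.
have JS : cut J <= cut J.+1 by exact: cut_le.
rewrite big_ord_recr /= /amom (@rint_split R 0 (cut J.+1) (cut J)); last first.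
  - exact: ucont_amom J1.
  - by rewrite J0.
apply: lerD => //.
rewrite -cutS mulrC -(@rint_cst R (cut J) (cut J.+1))//; apply: le_rint.
- by move=> t /andP[t0 tT]; apply: (ucont_amom hf J1); rewrite tT (le_trans J0).
- by move=> t _; exact: cvg_cst.
move=> t /andP[h1 h2]; have t0 := le_trans J0 h1.
have h3 : cut J.+1 = 1 - dy J / 2 by rewrite /cut dyS.
rewrite mulrC; apply: ler_pM; rewrite ?exprn_ge0 ?cmod_ge0//.
  by rewrite cutS -h3; apply: lerXn2r; rewrite ?nnegrE ?(le_trans t0 h2).
by apply: hs; rewrite -h3 h1.
Qed.

(** Two regimes. For j >= k the factor (1 - 2^-j / 2)^n is bounded by 1 and the gain is 2^(-(1 -
    1/p) (j - k)); for j < k the bound on (n + 1) q^n trades 2^-j for 2^-k and the gain is 2^(-(k -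
    j) / p). The smaller rate is kept. *)
Lemma amom_kernel p (k j n : nat) : 1 < p -> (2 ^ k <= n.+1)%N ->
  2 `^ ((1 - p^-1) * k%:R) * (dy j / 2 * (1 - dy j / 2) ^+ n) <=
  gk (q_ (Num.min p^-1 (1 - p^-1))) k j * 2 `^ (- (j%:R / p)).
Proof.
move=> p1 hn; have p0 : 0 < p by lra.
have i0 : 0 < p^-1 by rewrite invr_gt0.
have i1 : p^-1 < 1 by rewrite invf_lt1.
set e := Num.min _ _; have e0 : 0 < e by rewrite lt_min i0 subr_gt0.
have [e1 e2] : e <= p^-1 /\ e <= 1 - p^-1 by rewrite !ge_min !lexx orbT.
have d0 := dy_gt0 (R := R) j; have d1 := dy_le1 (R := R) j.
set q := 1 - dy j / 2; have q0 : 0 <= q by rewrite /q; lra.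
have q1 : q < 1 by rewrite /q; lra.
have qn0 : 0 <= q ^+ n by exact: exprn_ge0.
have P2 (x y : R) : 2 `^ x * 2 `^ y = 2 `^ (x + y) :> R by rewrite powRD// pnatr_eq0 implybT.
have key s : 2 `^ ((1 - p^-1) * k%:R) * (dy j / 2 * q ^+ n) <= 2 `^ (s - j%:R / p) ->
    s <= - e * (k%:R - j%:R) -> s <= - e * (j%:R - k%:R) ->
    2 `^ ((1 - p^-1) * k%:R) * (dy j / 2 * q ^+ n) <= gk (q_ e) k j * 2 `^ (- (j%:R / p)).
  move=> h h1 h2; apply: le_trans h _; rewrite -P2 ler_wpM2r ?powR_ge0//.
  by apply: pow2_gk => //; exact: ltW.
case: (leqP k j) => kj.
  have kj' : k%:R <= j%:R :> R by rewrite ler_nat.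
  apply: (key ((1 - p^-1) * (k%:R - j%:R))).
  - apply: (@le_trans _ _ (2 `^ ((1 - p^-1) * k%:R) * dy j)).
      apply: ler_wpM2l; first exact: powR_ge0.
      have : q ^+ n <= 1 by apply: exprn_ile1 => //; exact: ltW.
      nra.
    rewrite dy_powR P2 le_eqVlt; apply/orP; left; apply/eqP; congr (_ `^ _); ring.
  - nra.
  - nra.
have kj' : j%:R < k%:R :> R by rewrite ltr_nat.
apply: (key (- p^-1 * (k%:R - j%:R))).
- apply: (@le_trans _ _ (2 `^ ((1 - p^-1) * k%:R) * dy k)).
    apply: ler_wpM2l; first exact: powR_ge0.
    have h : n.+1%:R * q ^+ n <= (1 - q)^-1 by apply: natmul_exp_le; rewrite q0.
    have qE : 1 - q = dy j / 2 by rewrite /q; ring.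
    rewrite qE in h.
    have h1 : dy j / 2 * (n.+1%:R * q ^+ n) <= 1.
      by rewrite mulrC -ler_pdivlMr ?div1r// divr_gt0.
    have h2 : (dy k)^-1 * (dy j / 2 * q ^+ n) <= 1.
      apply: le_trans h1; rewrite mulrCA; apply: ler_wpM2l; first by rewrite divr_ge0// ltW.
      by rewrite dyV; apply: ler_wpM2r => //; rewrite ler_nat.
    by rewrite mulrC ler_pdivrMr ?dy_gt0// mul1r in h2.
  rewrite dy_powR P2 le_eqVlt; apply/orP; left; apply/eqP; congr (_ `^ _); ring.
- nra.
- nra.
Qed.

Definition Cmom p := (2 / (1 - q_ (Num.min p^-1 (1 - p^-1)))) `^ p * CFR p : R.

Lemma Cmom_ge0 p : 0 <= Cmom p.
Proof. by apply: mulr_ge0; [exact: powR_ge0|exact: CFR_ge0]. Qed.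

(** [s j] is the maximum of |f| on the ring 1 - t ~ 2^-j. The kernel decay and Schur's test bound
    the moments by the [s j], which the dyadic Fejer-Riesz inequality controls at the points where
    the maxima are attained. *)
Lemma mom_dyadic f M p K (n : nat -> nat) : 1 < p -> 0 <= M -> analytic f ->
  (hardy_norm p%:E f <= M%:E)%E -> (forall k, (2 ^ k <= (n k).+1)%N) ->
  \sum_(k < K) (2 `^ ((1 - p^-1) * k%:R) * cmod (mom f (n k))) `^ p <= Cmom p * M `^ p.
Proof.
move=> p1 M0 hf hM hn; have p0 : 0 < p by lra.
have hr := rad_p1 M0 hf (hardy_mono (ltW p1) M0 hf hM).
have [t ht] : {t : nat -> R & forall j, 1 - dy j <= t j <= 1 - dy j / 2 /\
    forall x, 1 - dy j <= x <= 1 - dy j / 2 -> cmod (f (rc x)) <= cmod (f (rc (t j)))}.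
  apply: (@choice _ _ (fun j t => 1 - dy j <= t <= 1 - dy j / 2 /\
    forall x, 1 - dy j <= x <= 1 - dy j / 2 -> cmod (f (rc x)) <= cmod (f (rc t)))) => j.
  have d0 := dy_gt0 (R := R) j; have d1 := dy_le1 (R := R) j.
  have [||t] := @EVT_max R (fun x => cmod (f (rc x))) (1 - dy j) (1 - dy j / 2).
  - by lra.
  - apply: continuous_in_subspaceT => x; rewrite inE /= in_itv /= => /andP[h1 h2].
    apply: (ccontI_cmod (ucont_radial hf (T := 1 - dy j / 2) _)); first by lra.
    by rewrite h2 andbT; lra.
  rewrite in_itv /= => ht hm; exists t; split; [exact: ht|exact: hm].
pose s j := cmod (f (rc (t j))); pose y j := 2 `^ (- (j%:R / p)) * s j.
have y0 j : 0 <= y j by rewrite mulr_ge0 ?powR_ge0 ?cmod_ge0.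
apply: (@mom_sum_le f _ K n (fun k => 2 `^ ((1 - p^-1) * k%:R)) p _ p0 hr) => [k|J]; first exact: powR_ge0.
set e := Num.min p^-1 (1 - p^-1).
have i0 : 0 < p^-1 by rewrite invr_gt0.
have i1 : p^-1 < 1 by rewrite invf_lt1.
have he : 0 <= q_ e < 1 by apply: q_lt1; rewrite lt_min i0 subr_gt0.
apply: (@le_trans _ _ (\sum_(k < K) (\sum_(j < J) gk (q_ e) k j * y j) `^ p)).
  apply: ler_sum => k _; apply: ge0_ler_powR.
  - exact: ltW.
  - by rewrite nnegrE; apply: mulr_ge0; [exact: powR_ge0|exact: amom_ge0].
  - rewrite nnegrE; apply: sumr_ge0 => j _; apply: mulr_ge0 => //; apply: gk_ge0.
    by case/andP: he.
  apply: (@le_trans _ _ (2 `^ ((1 - p^-1) * k%:R) * \sum_(j < J) dy j / 2 * ((1 - dy j / 2) ^+ (n k) * s j))).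
    apply: ler_wpM2l; first exact: powR_ge0.
    by apply: amom_dyadic => // j x hx; case: (ht j) => _; exact.
  rewrite mulr_sumr; apply: ler_sum => j _.
  rewrite /y [leRHS]mulrA [X in _ * X]mulrA mulrA; apply: ler_wpM2r; first exact: cmod_ge0.
  exact: amom_kernel.
apply: le_trans (schur_geom K (ltW p1) he (fun j => y0 j)) _.
rewrite /Cmom -mulrA; apply: ler_wpM2l; first exact: powR_ge0.
apply: le_trans (fr_dyadic J (ltW p1) M0 hf hM (fun j => (ht j).1)).
apply: ler_sum => j _; rewrite /y powRM ?powR_ge0 ?cmod_ge0// -powRrM dy_powR.
by rewrite mulNr divfK// gt_eqF.
Qed.

(** One index per block carries the largest moment there, so a block is governed by a single term of
    [mom_dyadic]. Blocks are shifted by one: n + 1 runs through [2^k, 2^(k+1)), and n = 0 alone is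
    block 0. *)
Lemma mom_dyadic_max f : exists2 n : nat -> nat, (forall k, (2 ^ k <= (n k).+1)%N) &
  forall k m, ((2 ^ k).-1 <= m < (2 ^ k.+1).-1)%N -> cmod (mom f m) <= cmod (mom f (n k)).
Proof.
have [n hn] : {n : nat -> nat & forall k, (2 ^ k <= (n k).+1)%N /\
  forall m, ((2 ^ k).-1 <= m < (2 ^ k.+1).-1)%N -> cmod (mom f m) <= cmod (mom f (n k))}; last first.
  by exists n => k; have [] := hn k.
apply: (@choice _ _ (fun k n => (2 ^ k <= n.+1)%N /\
  forall m, ((2 ^ k).-1 <= m < (2 ^ k.+1).-1)%N -> cmod (mom f m) <= cmod (mom f n))) => k.
have k0 : (0 < 2 ^ k)%N by rewrite expn_gt0.
have hk : ((2 ^ k).-1 < (2 ^ k.+1).-1)%N by rewrite expnS; lia.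
have main N : ((2 ^ k).-1 < N)%N -> exists n, (2 ^ k <= n.+1)%N /\
  forall m, ((2 ^ k).-1 <= m < N)%N -> cmod (mom f m) <= cmod (mom f n).
  elim: N => // N IH; rewrite ltnS leq_eqVlt => /orP[/eqP E|hN].
    exists N; split; first by rewrite -E prednK.
    move=> m /andP[a b]; have -> : m = N by apply/eqP; rewrite eqn_leq -ltnS b -E a.
    by [].
  have [n [h1 h2]] := IH hN; case: (lerP (cmod (mom f N)) (cmod (mom f n))) => h.
    exists n; split => // m /andP[a]; rewrite ltnS leq_eqVlt => /orP[/eqP ->//|b].
    by apply: h2; rewrite a.
  have NN : (2 ^ k <= N.+1)%N.
    by lia.
  exists N; split => // m /andP[a]; rewrite ltnS leq_eqVlt => /orP[/eqP ->//|b].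
  by apply: le_trans (ltW h); apply: h2; rewrite a.
exact: main.
Qed.

End MomentEstimate.

(** * Dyadic blocks of coefficients *)

Section Blocks.
Context {R : realType}.
Implicit Types (f g : Cx R -> Cx R) (c : nat -> Cx R) (M p B T : R).

Lemma block_sum (F : nat -> R) K0 K : (K0 <= K)%N ->
  \sum_((2 ^ K0).-1 <= n < (2 ^ K).-1) F n =
  \sum_(K0 <= k < K) \sum_((2 ^ k).-1 <= n < (2 ^ k.+1).-1) F n.
Proof.
elim: K => [|K IH]; first by rewrite leqn0 => /eqP ->; rewrite !big_geq.
rewrite leq_eqVlt => /orP[/eqP ->|]; first by rewrite !big_geq.
rewrite ltnS => hK; rewrite big_nat_recr//= -IH// (@big_cat_nat _ _ _ (2 ^ K).-1)//=.
  by have := leq_pexp2l (isT : (0 < 2)%N) hK; lia.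
by have := leq_pexp2l (isT : (0 < 2)%N) (leqnSn K); lia.
Qed.

(** The square of the block norm B_k. *)
Definition blk c k : R := \sum_((2 ^ k).-1 <= n < (2 ^ k.+1).-1) cmod (c n) ^+ 2.

Lemma blk_ge0 c k : 0 <= blk c k.
Proof. by apply: sumr_ge0 => n _; exact: sqr_ge0. Qed.

Lemma mom_block_sum f c : exists2 n : nat -> nat, (forall k, (2 ^ k <= (n k).+1)%N) &
  forall K0 K, (K0 <= K)%N ->
  \sum_((2 ^ K0).-1 <= m < (2 ^ K).-1) cmod (c m * mom f m) ^+ 2 <=
  \sum_(K0 <= k < K) blk c k * cmod (mom f (n k)) ^+ 2.
Proof.
have [n hn hm] := mom_dyadic_max f; exists n => // K0 K hK.
rewrite block_sum//; apply: ler_sum_nat => k _.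
rewrite /blk mulr_suml !big_nat; apply: ler_sum => m hmk.
rewrite cmodM exprMn ler_wpM2l ?sqr_ge0//.
by apply: lerXn2r; rewrite ?nnegrE ?cmod_ge0// hm.
Qed.

End Blocks.

(** * Boundedness and compactness read off coefficients *)

Section OperatorNorm.
Context {R : realType}.
Implicit Types (f g h : Cx R -> Cx R) (z w : Cx R) (c : nat -> Cx R) (M B : R) (p : \bar R).

Lemma has_ps_sub R0 f h (A B : nat -> Cx R) : has_ps R0 f A -> has_ps R0 h B ->
  has_ps R0 (f \- h) (fun n => A n - B n).
Proof.
move=> [hA1 hA2] [hB1 hB2]; split.
  move=> r hr; have [C hC] := hA1 r hr; have [D hD] := hB1 r hr; exists (C + D) => n.
  apply: le_trans (lerD (hC n) (hD n)); rewrite -mulrDl; apply: ler_wpM2r.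
    by case/andP: hr => r0 _; rewrite exprn_ge0.
  exact: cmodB.
move=> z hz.
have E N : psum (fun n => A n - B n) N z = psum A N z - psum B N z.
  by rewrite /psum -sumrB; apply: eq_bigr => n _; rewrite mulrBl.
under eq_fun do rewrite E.
exact: (cvgB (hA2 z hz) (hB2 z hz)).
Qed.

(** A real bound B in place of the extended norm keeps the estimates in [R]; [HB_of_hardy] converts
    back. *)
Definition HB p f B := [/\ analytic f, 0 <= B & (hardy_norm p f <= B%:E)%E].

Lemma HB_hardy p f B : HB p f B -> hardy p f.
Proof. by move=> [h _ hB]; split => //; apply: le_lt_trans hB (ltry _). Qed.

Lemma HB_one p f B : (1 <= p)%E -> HB p f B -> HB 1%:E f B.
Proof.
case: p => [s||]// s1 [hf B0 hB]; split => //.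
  by apply: (@hardy_mono _ f s).
apply/(hardy_pP ltr01 B0 hf) => r hr; have r0 : 0 <= r < 1 by case/andP: hr => /ltW -> ->.
rewrite powRr1// -[leRHS]rmean_cst; apply: le_rmean => [||x].
- by apply: (rcont_powR ltr01 _ (rcont_cmod (dan_ccont hf r0))) => x; exact: cmod_ge0.
- exact: (@rcont_cst R _).
- rewrite powRr1 ?cmod_ge0//; move/(hardy_inftyP _ hf) : hB; apply.
  by rewrite cmod_circle ger0_norm//; case/andP: r0.
Qed.

Lemma HB_rad p f B : (1 <= p)%E -> HB p f B -> rad f (pi * B).
Proof. by move=> p1 /(HB_one p1)[hf B0 hB]; exact: rad_p1. Qed.

Lemma HB_of_hardy p f : (1 <= p)%E -> hardy p f ->
  exists2 B, HB p f B & hardy_norm p f = B%:E.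
Proof.
move=> p1 hf; have pN : p != -oo%E by case: p p1 {hf}.
have [B B0 hB] := hardy_fin pN hf; exists B => //; split => //; first exact: hf.1.
by rewrite hB.
Qed.

Lemma HB_scale p f B k : (1 <= p)%E -> 0 <= k -> HB p f B ->
  HB p (fun z => rc k * f z) (k * B).
Proof.
move=> p1 k0 [hf B0 hB].
have hkf : analytic (fun z => rc k * f z).
  by move=> z z1; apply: derivableM; [exact: derivable_cst|exact: hf].
have kB : 0 <= k * B by exact: mulr_ge0.
split => //; case: p p1 hB => [s||]// s1 hB.
  have s0 : 0 < s by apply: lt_le_trans ltr01 _; rewrite -lee_fin.
  apply/(hardy_pP s0 kB hkf) => r hr; have hB' := (hardy_pP s0 B0 hf).1 hB r hr.
  have r0 : 0 <= r < 1 by case/andP: hr => /ltW -> ->.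
  rewrite (powRM _ k0 B0) (_ : rmean _ = k `^ s * rmean (fun x => cmod (f (circle r x)) `^ s)).
    by apply: ler_wpM2l hB'; exact: powR_ge0.
  rewrite -rmeanZ; last first.
    by apply: (rcont_powR s0 _ (rcont_cmod (dan_ccont hf r0))) => x; exact: cmod_ge0.
  by apply: rmeanE => x; rewrite cmodM cmod_rc (ger0_norm k0) powRM ?cmod_ge0.
apply/(hardy_inftyP _ hkf) => z hz; rewrite cmodM cmod_rc (ger0_norm k0).
by apply: ler_wpM2l => //; exact: (hardy_inftyP _ hf).1 hB z hz.
Qed.

Lemma mom_scale f B k n : rad f B -> mom (fun z => rc k * f z) n = rc k * mom f n.
Proof.
move=> hf.
have hk : rad (fun z => rc k * f z) (`|k| * B).
  split.
    by move=> z z1; apply: derivableM; [exact: derivable_cst|exact: hf.1].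
  move=> J; have := @rad_weight R f B (fun=> rc k) `|k| hf (normr_ge0 _) (@ucont_cst R (rc k)) _ J.
  under eq_fun do rewrite mulrC; apply => t _; by rewrite cmod_rc.
have E : (fun J => cint 0 (cut J) (fun t => rc k * f (rc t) * rc t ^+ n)) =
    (fun J => rc k * cint 0 (cut J) (fun t => f (rc t) * rc t ^+ n)).
  apply/funext => J.
  rewrite -(cintZ _ (ucont_mul (ucont_radial hf.1) (@ucont_rcX R n) (cut_lt1 J))).
  by apply: cintE => t _; rewrite mulrA.
have h1 := @mom_lim R _ _ n hk; rewrite E in h1.
apply: (cvgC_unique h1).
exact: (cvgM (cvg_cst _) (@mom_lim R _ _ n hf)).
Qed.

Section FixedSymbol.
Variables (g : Cx R -> Cx R) (c : nat -> Cx R).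
Hypothesis gc : has_ps 1 (cderiv g) c.
Local Notation T := (hilbert_op g).

Lemma hilbert_ps p f B : (1 <= p)%E -> HB p f B -> has_ps 1 (T f) (fun n => c n * mom f n).
Proof. by move=> p1 /(HB_rad p1); exact: hilbert_has_ps. Qed.

Lemma op_boundP p M : (1 <= p)%E -> 0 <= M ->
  op_bound p 2%:E T M <-> (forall f B, HB p f B ->
    forall N, \sum_(n < N) cmod (c n * mom f n) ^+ 2 <= (M * B) ^+ 2).
Proof.
move=> p1 M0; split => [h f B hf|h f /(HB_of_hardy p1)[B hf E]].
  have [_ hn] := h f (HB_hardy hf); have [_ B0 hB] := hf.
  apply/(hardy2P (hilbert_ps p1 hf)); first exact: mulr_ge0.
  by apply: le_trans hn _; rewrite EFinM; apply: lee_wpmul2l => //; rewrite lee_fin.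
have [_ B0 _] := hf; rewrite E -EFinM.
by apply: (hardy2_fin (hilbert_ps p1 hf)); [exact: mulr_ge0|exact: h].
Qed.

Lemma analytic_cst (k : Cx R) : analytic (fun=> k).
Proof. by move=> z _; exact: derivable_cst. Qed.

Lemma HB_cst1 p : (1 <= p)%E -> HB p (fun=> 1) 1.
Proof.
move=> p1; split; [exact: analytic_cst|exact: ler01|].
case: p p1 => [s||]// s1.
  apply/(hardy_pP (lt_le_trans ltr01 s1) ler01 (@analytic_cst 1)) => r hr.
  by rewrite (_ : cmod 1 = 1) ?rmean_cst// (_ : 1 = rc 1)// cmod_rc normr1.
apply/(hardy_inftyP _ (@analytic_cst 1)) => z hz.
by rewrite (_ : 1 = rc 1)// cmod_rc normr1.
Qed.

(** The constant function 1 has positive norm, so a negative M would bound the norm of its image by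
    a negative number. *)
Lemma op_bound_ge0 p M : (1 <= p)%E -> op_bound p 2%:E T M -> 0 <= M.
Proof.
move=> p1 h; rewrite leNgt; apply/negP => M0.
have h1 := HB_cst1 p1; have [_ hn] := h _ (HB_hardy h1).
have [B hB E] := HB_of_hardy p1 (HB_hardy h1).
have [_ B0 _] := hB.
have [B00|Bn0] := eqVneq B 0.
  have : HB 1%:E (fun=> 1 : Cx R) 0 by apply: (HB_one p1); rewrite -B00.
  move=> [_ _] /(hardy_pP ltr01 (lexx _) (@analytic_cst 1)) /(_ 2^-1).
  rewrite (_ : cmod 1 = 1); last by rewrite (_ : 1 = rc 1)// cmod_rc normr1.
  rewrite rmean_cst powR1 powR0// => H; have : (1 : R) <= 0 by apply: H; apply/andP; split; lra.
  by rewrite ler10.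
have : (0 <= M%:E * B%:E)%E by rewrite -E; apply: le_trans hn; exact: hardy_norm_ge0.
by rewrite -EFinM lee_fin pmulr_lge0 ?lt_neqAle 1?eq_sym ?Bn0// leNgt M0.
Qed.

Lemma op_norm_le p M : op_bound p 2%:E T M -> (op_norm p 2%:E T <= M%:E)%E.
Proof. by move=> h; apply: ereal_inf_lbound; exists M. Qed.

Lemma le_op_norm p x : (forall M, op_bound p 2%:E T M -> (x <= M%:E)%E) ->
  (x <= op_norm p 2%:E T)%E.
Proof. by move=> h; apply: le_ereal_inf_tmp => _ [M /= hM <-]; exact: h. Qed.

Lemma tail_le (F : nat -> R) N0 N C : (forall n, 0 <= F n) ->
  (forall K, \sum_(N0 <= n < K) F n <= C) -> \sum_(n < N) F n <= \sum_(n < N0) F n + C.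
Proof.
move=> F0 h; case: (leqP N N0) => hN.
  have C0 : 0 <= C by have := h N0; rewrite big_geq.
  rewrite -(subnKC hN) big_split_ord /=; have : 0 <= \sum_(i < N0 - N) F (N + i)%N by apply: sumr_ge0.
  lra.
rewrite -!(big_mkord xpredT F) (@big_cat_nat _ _ _ N0)//=; last exact: ltnW.
by apply: lerD.
Qed.

(** An ultrafilter finer than the filter at infinity makes all coordinates converge at once; the
    n-th term of the subsequence is then picked close to the limit in the first n + 1
    coordinates. *)
Lemma diag_extract (m : nat -> nat -> Cx R) B : (forall n k, cmod (m n k) <= B) ->
  exists2 phi : nat -> nat, increasing_seq phi & exists l : nat -> Cx R,
    forall n k, (k <= n)%N -> cmod (m (phi n) k - l k) <= n.+1%:R^-1.
Proof.
move=> hm; have [G [UG hG]] := @ultraFilterLemma nat \oo _.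
have hlim (u : nat -> R) : (forall n, `|u n| <= B) -> exists l : R, u @ G --> l.
  move=> hu; have [|l [_ hl]] := @segment_compact R (- B) B (u @ G) _.
    change (G (u @^-1` `[- B, B])); apply: (filterS (P := setT)); last exact: filterT.
    by move=> n _ /=; rewrite in_itv /= -ler_norml; exact: hu.
  exists (l : R) => V hV; have [//|hN] := in_ultra_setVsetC (u @^-1` V) UG.
  have hN' : (u @ G) (~` V) by [].
  by have [x []] := hl _ _ hN' hV.
have [l hl] : {l : nat -> Cx R & forall k e, 0 < e -> G [set n | cmod (m n k - l k) <= e]}.
  apply: (@choice _ _ (fun k l => forall e, 0 < e -> G [set n | cmod (m n k - l) <= e])) => k.
  have [a ha] := hlim (fun n => complex.Re (m n k)) (fun n => le_trans (normRe_le _) (hm n k)).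
  have [b hb] := hlim (fun n => complex.Im (m n k)) (fun n => le_trans (normIm_le _) (hm n k)).
  exists (a +i* b) => e e0; have e2 : 0 < e / 2 by rewrite divr_gt0.
  move/cvgrPdist_le : ha => /(_ _ e2) ha; move/cvgrPdist_le : hb => /(_ _ e2) hb.
  near=> n => /=; apply: le_trans (cmod_le_ReIm _) _ => /=.
  by rewrite CReD CImD CReN CImN /= (splitr e); apply: lerD; rewrite distrC; near: n.
have hpick n N : exists j, (N < j)%N /\ forall k, (k <= n)%N -> cmod (m j k - l k) <= n.+1%:R^-1.
  have n0 : 0 < n.+1%:R^-1 :> R by rewrite invr_gt0.
  have hk K : G [set j | forall k, (k < K)%N -> cmod (m j k - l k) <= n.+1%:R^-1].
    elim: K => [|K IH]; first by apply: filterS filterT => j _ k.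
    apply: filterS2 IH (hl K _ n0) => j h1 h2 k; rewrite ltnS leq_eqVlt => /orP[/eqP ->//|].
    exact: h1.
  have hN : G [set j | (N < j)%N] by apply: hG; exists N.+1.
  have [j [h1 h2]] := filter_ex (filterI hN (hk n.+1)); exists j; split; [exact: h1|exact: h2].
have [pick hp] : {pick : nat -> nat -> nat & forall n N, (N < pick n N)%N /\
    forall k, (k <= n)%N -> cmod (m (pick n N) k - l k) <= n.+1%:R^-1}.
  have [P hP] := @choice (nat * nat)%type nat (fun nN j => (nN.2 < j)%N /\
    forall k, (k <= nN.1)%N -> cmod (m j k - l k) <= nN.1.+1%:R^-1) (fun nN => hpick nN.1 nN.2).
  by exists (fun n N => P (n, N)) => n N; exact: hP (n, N).
pose phi := fix F n := if n is n'.+1 then pick n (F n') else pick 0%N 0%N.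
exists phi; first by apply/increasing_seqP => n /=; have [] := hp n.+1 (phi n).
by exists l => -[|n] k kn; [have [_] := hp 0%N 0%N|have [_] := hp n.+1 (phi n)]; exact.
Unshelve. all: by end_near. Qed.

Lemma sqr_cmodB_le (a b : Cx R) : cmod (a - b) ^+ 2 <= 2 * cmod a ^+ 2 + 2 * cmod b ^+ 2.
Proof.
have h : cmod (a - b) ^+ 2 <= (cmod a + cmod b) ^+ 2.
  by apply: lerXn2r; rewrite ?nnegrE ?addr_ge0 ?cmod_ge0//; exact: cmodB.
by apply: le_trans h _; have := sqr_ge0 (cmod a - cmod b); nra.
Qed.

Lemma sum_lim_le (a : nat -> nat -> Cx R) (b : nat -> Cx R) N0 N C :
  (forall n, (N0 <= n < N)%N -> a j n @[j --> \oo] --> b n) ->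
  (forall j, \sum_(N0 <= n < N) cmod (a j n) ^+ 2 <= C) -> \sum_(N0 <= n < N) cmod (b n) ^+ 2 <= C.
Proof.
move=> hl hC.
have lim : \sum_(N0 <= n < N) cmod (a j n) ^+ 2 @[j --> \oo] --> \sum_(N0 <= n < N) cmod (b n) ^+ 2.
  rewrite big_nat; under eq_fun do rewrite big_nat; apply: cvg_big; [exact: add_continuous|move=> n hn].
  have hc : cmod (a j n) @[j --> \oo] --> cmod (b n).
    apply/cvgrPdist_le => e e0; move/cvgC_P : (hl n hn) => /(_ _ e0); apply: filterS => j.
    apply: le_trans; have h1 := cmodD (a j n - b n) (b n); have h2 := cmodD (b n - a j n) (a j n).
    rewrite subrK in h1; rewrite subrK (cmodC (b n)) in h2.
    by rewrite ler_norml; apply/andP; split; lra.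
  exact: (cvgM hc hc).
rewrite -(cvg_lim (@Rhausdorff R) lim); apply: limr_le; first exact: cvgP lim.
by apply: nearW.
Qed.

(** Uniform smallness of the l^2 tails on the image of the unit ball: the criterion from which
    compactness is obtained for every p. *)
Definition small_tails p := forall e, 0 < e -> exists N0, forall f, HB p f 1 ->
  forall N, \sum_(N0 <= n < N) cmod (c n * mom f n) ^+ 2 <= e.

Lemma small_tails_ball p M : (1 <= p)%E -> small_tails p -> 0 <= M ->
  forall e, 0 < e -> exists N0, forall f, HB p f M ->
  forall N, \sum_(N0 <= n < N) cmod (c n * mom f n) ^+ 2 <= e.
Proof.
move=> p1 hs M0 e e0; pose K := M + 1; have K0 : 0 < K by rewrite /K; lra.
have eK : 0 < e / K ^+ 2 by rewrite divr_gt0// exprn_gt0.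
have [N0 hN] := hs _ eK; exists N0 => f hf N.
have h1 : HB p (fun z => rc K^-1 * f z) 1.
  have Ki : 0 <= K^-1 by rewrite invr_ge0 ltW.
  have [a b d] := HB_scale p1 Ki hf.
  split => //; apply: le_trans d _.
  by rewrite lee_fin mulrC ler_pdivrMr// mul1r /K; lra.
have := hN _ h1 N; rewrite ler_pdivlMr ?exprn_gt0// mulr_suml; apply: le_trans.
apply: ler_sum => n _; rewrite (mom_scale _ _ (HB_rad p1 hf)) [c _ * (rc _ * _)]mulrCA.
rewrite [cmod (rc _ * _)]cmodM cmod_rc ger0_norm ?invr_ge0 ?(ltW K0)// exprMn.
by rewrite exprVn mulrAC mulVf ?mul1r// expf_neq0// gt_eqF.
Qed.

Lemma mom_bound p f B n : (1 <= p)%E -> HB p f B -> cmod (mom f n) <= pi * B.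
Proof. by move=> p1 hf; exact: mom_le (HB_rad p1 hf). Qed.

Lemma small_tails_bounded p : (1 <= p)%E -> small_tails p -> bounded_op p 2%:E T.
Proof.
move=> p1 hs; have [N0 hN] := hs 1 ltr01.
(* The head is bounded by the crude moment bound pi, the tail by 1. Since D >= 1 it is at most D^2,
   so D itself can serve as the operator bound. *)
pose D := \sum_(n < N0) (cmod (c n) * pi) ^+ 2 + 1.
have D1 : 1 <= D by rewrite lerDr; apply: sumr_ge0 => n _; exact: sqr_ge0.
have D0 : 0 <= D by lra.
have key f N : HB p f 1 -> \sum_(n < N) cmod (c n * mom f n) ^+ 2 <= D.
  move=> hf; apply: le_trans (tail_le N _ (hN f hf)) _; first by move=> n; exact: sqr_ge0.
  apply: lerD => //; apply: ler_sum => n _; apply: lerXn2r; rewrite ?nnegrE ?cmod_ge0//.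
    by rewrite mulr_ge0 ?cmod_ge0 ?pi_ge0.
  rewrite cmodM ler_wpM2l ?cmod_ge0//; have := mom_bound n p1 hf; by rewrite mulr1.
exists D; apply/(op_boundP p1 D0) => f B hf N.
have [_ B0 _] := hf; have [BE|Bn0] := eqVneq B 0.
  rewrite big1 ?sqr_ge0// => n _; have := mom_bound n p1 hf; rewrite BE mulr0 => h.
  have /eqP h0 : cmod (mom f n) == 0 by rewrite eq_le h cmod_ge0.
  by rewrite cmodM h0 mulr0 expr0n.
have Bp : 0 < B by rewrite lt_neqAle eq_sym Bn0.
have h1 : HB p (fun z => rc B^-1 * f z) 1.
  by rewrite -(mulVf Bn0); apply: HB_scale => //; rewrite invr_ge0.
have := key _ N h1; rewrite (eq_bigr (fun n : 'I_N => (B^-1) ^+ 2 * cmod (c n * mom f n) ^+ 2)); last first.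
  move=> n _; rewrite (mom_scale _ _ (HB_rad p1 hf)) [c _ * (rc _ * _)]mulrCA.
  by rewrite [in LHS]cmodM cmod_rc ger0_norm ?invr_ge0// exprMn.
rewrite -mulr_sumr exprVn mulrC ler_pdivrMr ?exprn_gt0// => h.
apply: le_trans h _; rewrite exprMn; apply: ler_wpM2r; first exact: sqr_ge0.
by rewrite expr2; nra.
Qed.

(** The limit function has coefficients c_n l_n, with l_n the limit of the n-th moments along the
    subsequence. The first N0 coefficients converge, and the tails are uniformly small along the
    sequence and hence for the limit. *)
Lemma small_tails_compact p : (1 <= p)%E -> small_tails p -> compact_op p 2%:E T.
Proof.
move=> p1 hs; have [M0 hM0] := small_tails_bounded p1 hs; split.
  by move=> f hf; exact: (hM0 f hf).1.
move=> fs hfs [M' hM']; pose M := Num.max 0 M'.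
have MM : 0 <= M by rewrite le_max lexx.
have hH n : HB p (fs n) M.
  split => //; first exact: (hfs n).1.
  by apply: le_trans (hM' n) _; rewrite lee_fin le_max lexx orbT.
have [phi hphi [l hl]] := diag_extract (fun n k => mom_bound k p1 (hH n)).
exists phi => //.
have liml k : mom (fs (phi j)) k @[j --> \oo] --> l k.
  apply/cvgC_P => e e0; near=> j; apply: le_trans (hl j k _) _; first by near: j; exists k.
  near: j; have := @near_infty_natSinv_lt R (PosNum e0); apply: filterS => j /ltW; exact.
have lB k : cmod (l k) <= pi * M.
  by apply: (cmod_lim_le (N := 0) (liml k)) => j _; exact: (mom_bound k p1 (hH (phi j))).
have tails e : 0 < e -> exists N0, forall N,
    (forall j, \sum_(N0 <= n < N) cmod (c n * mom (fs (phi j)) n) ^+ 2 <= e) /\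
    \sum_(N0 <= n < N) cmod (c n * l n) ^+ 2 <= e.
  move=> e0; have [N0 hN] := small_tails_ball p1 hs MM e0; exists N0 => N; split.
    by move=> j; exact: hN.
  apply: (@sum_lim_le (fun j n => c n * mom (fs (phi j)) n)) => [n _|j]; last exact: hN.
  exact: (cvgM (cvg_cst _) (liml n)).
have [h hh] : exists h, has_ps 1 h (fun n => c n * l n).
  apply: crad_ps => r hr; have [C hC] := gc.1 r hr; exists (C * (pi * M)) => n.
  rewrite cmodM mulrAC; apply: ler_pM => //; rewrite ?cmod_ge0//.
  by rewrite mulr_ge0 ?cmod_ge0// exprn_ge0//; case/andP: hr.
exists h.
  have [N0 hN] := tails 1 ltr01; pose D := \sum_(n < N0) cmod (c n * l n) ^+ 2 + 1.
  have D1 : 1 <= D by rewrite lerDr; apply: sumr_ge0 => n _; exact: sqr_ge0.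
  have D0 : 0 <= D by lra.
  have [] // := @hardy2_fin R h _ D hh D0 _ => N.
  apply: le_trans (@tail_le (fun n => cmod (c n * l n) ^+ 2) N0 N 1 _ (fun K => (hN K).2)) _.
    by move=> n; exact: sqr_ge0.
  by rewrite -/D expr2; nra.
have small e : 0 < e -> \forall j \near \oo, (hardy_norm 2%:E (T (fs (phi j)) \- h)%R <= e%:E)%E.
  (* The tail of the difference costs 4 d and the head d, within e^2 = 8 d. *)
  move=> e0; pose d := e ^+ 2 / 8; have d0 : 0 < d by rewrite divr_gt0// exprn_gt0.
  have [N0 hN] := tails d d0.
  pose D := \sum_(n < N0) cmod (c n) ^+ 2 + 1.
  have D1 : 1 <= D by rewrite lerDr; apply: sumr_ge0 => n _; exact: sqr_ge0.
  have dD : 0 < d / D by rewrite divr_gt0//; lra.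
  near=> j.
  have hj := has_ps_sub (hilbert_ps p1 (hH (phi j))) hh.
  apply/(hardy2P hj (ltW e0)) => N.
  have hT K : \sum_(N0 <= n < K) cmod (c n * mom (fs (phi j)) n - c n * l n) ^+ 2 <= 4 * d.
    apply: (@le_trans _ _ (2 * \sum_(N0 <= n < K) cmod (c n * mom (fs (phi j)) n) ^+ 2 +
        2 * \sum_(N0 <= n < K) cmod (c n * l n) ^+ 2)).
      by rewrite !mulr_sumr -big_split; apply: ler_sum => n _; exact: sqr_cmodB_le.
    have [h1 h2] := hN K; have := h1 j; lra.
  apply: le_trans (@tail_le (fun n => cmod (c n * mom (fs (phi j)) n - c n * l n) ^+ 2) N0 N _ _ hT) _.
    by move=> n; exact: sqr_ge0.
  have : \sum_(n < N0) cmod (c n * mom (fs (phi j)) n - c n * l n) ^+ 2 <= d.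
    apply: (@le_trans _ _ (\sum_(n < N0) cmod (c n) ^+ 2 * (d / D))).
      apply: ler_sum => n _; rewrite -mulrBr cmodM exprMn ler_wpM2l ?sqr_ge0//.
      have nj : (n <= j)%N by apply: (@leq_trans N0); [exact: ltnW|near: j; exists N0].
      apply: (@le_trans _ _ ((j.+1%:R^-1) ^+ 2)).
        by apply: lerXn2r; rewrite ?nnegrE ?cmod_ge0 ?invr_ge0//; exact: hl.
      apply: (@le_trans _ _ (j.+1%:R^-1)).
        by rewrite expr2 ler_piMl ?invr_ge0// invf_le1 ?ler1n.
      near: j; have := @near_infty_natSinv_lt R (PosNum dD); apply: filterS => j /ltW; exact.
    rewrite -mulr_suml mulrCA; apply: ler_piMr; first exact: ltW.
    by rewrite ler_pdivrMr ?mul1r; [rewrite /D; lra|lra].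
  have : e ^+ 2 = 8 * d by rewrite /d; field.
  lra.
apply/fine_cvgP; split.
  have := small 1 ltr01; apply: filterS => j hj; rewrite ge0_fin_numE; last exact: hardy_norm_ge0.
  exact: le_lt_trans hj (ltry _).
apply/cvgrPdist_le => e e0; have := small e e0; apply: filterS => j hj /=.
have h0 : (0 <= hardy_norm 2%:E (T (fs (phi j)) \- h)%R)%E by exact: hardy_norm_ge0.
have hf : hardy_norm 2%:E (T (fs (phi j)) \- h)%R \is a fin_num.
  by rewrite ge0_fin_numE//; exact: le_lt_trans hj (ltry _).
by rewrite sub0r normrN ger0_norm ?fine_ge0// -lee_fin fineK.
Unshelve. all: by end_near. Qed.

(** Without a bound there are unit vectors whose n-th image has norm above n, whereas the images
    along a convergent subsequence stay bounded. *)
Lemma compact_bounded p : (1 <= p)%E -> compact_op p 2%:E T -> bounded_op p 2%:E T.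
Proof.
move=> p1 [hT hc]; apply: contrapT => /forallNP hn.
have bad n : exists f, HB p f 1 /\ exists N, n%:R ^+ 2 < \sum_(k < N) cmod (c k * mom f k) ^+ 2.
  have /op_boundP := hn n%:R; move=> /(_ p1 (ler0n _ _)) /existsNP[f /existsNP[B]].
  move=> /not_implyP[hf /existsNP[N /negP]]; rewrite -ltNge => hN.
  have [_ B0 _] := hf; have [BE|Bn0] := eqVneq B 0.
    exfalso; move: hN; rewrite BE mulr0 expr0n big1 ?ltxx// => k _.
    have := mom_bound k p1 hf; rewrite BE mulr0 => h.
    have /eqP h0 : cmod (mom f k) == 0 by rewrite eq_le h cmod_ge0.
    by rewrite cmodM h0 mulr0 expr0n.
  exists (fun z => rc B^-1 * f z); split.
    by rewrite -(mulVf Bn0); apply: HB_scale => //; rewrite invr_ge0.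
  exists N; rewrite (eq_bigr (fun n : 'I_N => (B^-1) ^+ 2 * cmod (c n * mom f n) ^+ 2)); last first.
    move=> k _; rewrite (mom_scale _ _ (HB_rad p1 hf)) [c _ * (rc _ * _)]mulrCA.
    by rewrite [in LHS]cmodM cmod_rc ger0_norm ?invr_ge0// exprMn.
  rewrite -mulr_sumr exprVn mulrC ltr_pdivlMr; last by rewrite exprn_gt0// lt_neqAle eq_sym Bn0.
  by rewrite -exprMn.
have [fs hfs] := @choice _ _ _ bad.
have hB1 : exists M : R, forall n, (hardy_norm p (fs n) <= M%:E)%E.
  by exists 1 => n; have [[]] := hfs n.
have [phi hphi [h hh hlim]] := hc fs (fun n => HB_hardy (hfs n).1) hB1.
have [A hA] := dan_has_ps ltr01 hh.1.
have [Q Q0 hQ] := hardy_fin (isT : 2%:E != -oo%E) hh.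
have hQ' : (hardy_norm 2%:E h <= Q%:E)%E by rewrite hQ.
have hA2 := (hardy2P hA Q0).1 hQ'.
have [J hJ] : exists J, forall j, (J <= j)%N ->
    (hardy_norm 2%:E (T (fs (phi j)) \- h)%R <= 1%:E)%E.
  have /fine_cvgP[hfin /cvgrPdist_le/(_ 1 ltr01) h1] := hlim.
  have [J _ hJ] := filterI hfin h1; exists J => j /hJ [/= h2].
  rewrite sub0r normrN => /(le_trans (ler_norm _)).
  by rewrite -lee_fin fineK.
pose D := 2 * 1 + 2 * Q ^+ 2; have D0 : 0 <= D by rewrite /D; have := sqr_ge0 Q; lra.
near \oo => j.
have hj : (J <= j)%N by near: j; exists J.
have [hF [N hN]] := hfs (phi j).
have hps := hilbert_ps p1 hF; have hsub := has_ps_sub hps hA.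
have h1 := (hardy2P hsub ler01).1 (hJ j hj) N.
have : \sum_(k < N) cmod (c k * mom (fs (phi j)) k) ^+ 2 <= D.
  apply: (@le_trans _ _ (2 * \sum_(k < N) cmod (c k * mom (fs (phi j)) k - A k) ^+ 2 +
      2 * \sum_(k < N) cmod (A k) ^+ 2)).
    rewrite !mulr_sumr -big_split; apply: ler_sum => k _ /=.
    have := sqr_cmodB_le (c k * mom (fs (phi j)) k - A k) (- A k).
    by rewrite opprK subrK cmodN.
  by rewrite expr1n in h1; have := hA2 N; rewrite /D; lra.
apply/negP; rewrite -ltNge; apply: lt_trans hN.
have hphij : (j <= phi j)%N.
  elim: (j) => // i IH; apply: leq_ltn_trans IH _.
  by move/increasing_seqP : hphi; exact.
have h2 : D + 1 <= j%:R by near: j; exact: nbhs_infty_ger.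
have h3 : j%:R <= (phi j)%:R :> R by rewrite ler_nat.
nra.
Unshelve. all: by end_near. Qed.

End FixedSymbol.
End OperatorNorm.

(** * Square kernels and the lower bound for p = 1 *)

Section TestFunctions.
Context {R : realType}.
Implicit Types (f g h : Cx R -> Cx R) (z w : Cx R) (c : nat -> Cx R) (r s t x a b M B p : R).
Local Notation dy := (@dy R).
Local Notation cut := (@cut R).

Lemma rint_FTC_itv a b (f F : R -> R) : a <= b -> rcontI a b f ->
  (forall x, a <= x <= b -> is_derive x 1 F (f x)) -> rint a b f = F b - F a.
Proof.
rewrite le_eqVlt => /orP[/eqP <-|ab] hf hF.
  by rewrite subrr rint.unlock set_itv1 Rintegral_set1.
have cF x : a <= x <= b -> {for x, continuous F}.
  by move=> /hF[/derivable1_diffP + _]; exact: differentiable_continuous.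
rewrite rint.unlock /Rintegral (continuous_FTC2 ab (f := f) (F := F)) //.
- apply: continuous_in_subspaceT => x; rewrite inE /= in_itv /= => xab.
  exact: hf.
- split; first by move=> x; rewrite in_itv /= => /andP[h1 h2]; have [|] := hF x; rewrite ?(ltW h1) ?(ltW h2).
  + by apply/cvg_at_right_filter/cF; rewrite lexx ltW.
  + by apply/cvg_at_left_filter/cF; rewrite lexx ltW.
- move=> x; rewrite in_itv /= => /andP[h1 h2]; rewrite derive1E; apply: derive_val.
  by apply: hF; rewrite !ltW.
Qed.

(** A real part that is nonnegative on the radius allows the moment integral to be cut down to any
    subinterval. *)
Lemma mom_ge f B n a b : rad f B -> 0 <= a -> a <= b -> b < 1 ->
  (forall t, 0 <= t < 1 -> 0 <= complex.Re (f (rc t))) ->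
  rint a b (fun t => complex.Re (f (rc t)) * t ^+ n) <= complex.Re (mom f n).
Proof.
move=> hf a0 ab b1 f0; apply/ler_addgt0Pl => e e0; rewrite addrC.
have /cvgC_P/(_ _ e0) near1 := @mom_lim R f B n hf.
have [J0 hJ0] := cut_near b1.
near \oo => J.
have bJ : b <= cut J by apply: le_trans hJ0 _; apply: cut_le; near: J; exists J0.
have J1 := cut_lt1 (R := R) J.
have hu := ucont_mul (ucont_radial hf.1) (@ucont_rcX R n) J1.
have hJ : cmod (cint 0 (cut J) (fun t => f (rc t) * rc t ^+ n) - mom f n) <= e by near: J.
have hE t : complex.Re (f (rc t) * rc t ^+ n) = complex.Re (f (rc t)) * t ^+ n.
  by rewrite -rcX CReM /= mulr0 subr0.
have hr : rcontI 0 (cut J) (fun t => complex.Re (f (rc t)) * t ^+ n).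
  by move=> t ht; rewrite (_ : (fun t => _) = (fun t => complex.Re (f (rc t) * rc t ^+ n))); [exact: ccontI_Re hu t ht|apply/funext => y; rewrite hE].
have hsub x y : 0 <= x -> y <= cut J -> rcontI x y (fun t => complex.Re (f (rc t)) * t ^+ n).
  by move=> x0 yJ t /andP[h1 h2]; apply: hr; rewrite (le_trans x0 h1) (le_trans h2 yJ).
have h0 x y : 0 <= x -> x <= y -> y <= cut J -> 0 <= rint x y (fun t => complex.Re (f (rc t)) * t ^+ n).
  move=> x0 xy yJ; rewrite -[leLHS](mul0r (y - x)) -rint_cst//; apply: le_rint.
  - by move=> t _; exact: cvg_cst.
  - exact: hsub.
  - move=> t /andP[h1 h2]; have t0 := le_trans x0 h1; apply: mulr_ge0; last exact: exprn_ge0.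
    by apply: f0; rewrite t0 (le_lt_trans (le_trans h2 yJ)).
have e1 : complex.Re (cint 0 (cut J) (fun t => f (rc t) * rc t ^+ n)) =
    rint 0 (cut J) (fun t => complex.Re (f (rc t)) * t ^+ n).
  by rewrite /cint /=; apply: eq_rint => t _; exact: hE.
have e2 := @rint_split R 0 (cut J) a _ _ hr; rewrite a0 (le_trans ab bJ) in e2.
have e3 := @rint_split R a (cut J) b _ _ (hsub _ _ a0 (lexx _)); rewrite ab bJ in e3.
have := h0 0 a (lexx _) a0 (le_trans ab bJ); have := h0 b (cut J) (le_trans a0 ab) bJ (lexx _).
have := le_trans (normRe_le _) hJ; rewrite CReD CReN ler_norml => /andP[_].
rewrite e1 e2// e3//; lra.
Unshelve. all: by end_near. Qed.

(** The Bergman kernel: positive on the radius, and of modulus a multiple of the Poisson kernel on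
    circles. *)
Definition sqk r z : Cx R := (1 - rc r * z)^-1 ^+ 2.

Lemma sqk_den r z : 0 <= r <= 1 -> cmod z < 1 -> 1 - rc r * z != 0.
Proof.
move=> /andP[r0 r1] z1; rewrite -cmod_gt0.
have h1 := cmodD (1 - rc r * z) (rc r * z); rewrite subrK cmod1 cmodM cmod_rc ger0_norm// in h1.
have := cmod_ge0 z; nra.
Qed.

Lemma sqk_analytic r : 0 <= r <= 1 -> analytic (sqk r).
Proof.
move=> hr z z1.
have hi : derivable (fun w : Cx R => (1 - rc r * w)^-1) z 1.
  have h := @derivable_affine R 1 (- rc r) z.
  apply: derivableV; last first.
    by rewrite (_ : (fun w => _) = (fun w => 1 + - rc r * w))//; apply/funext => w; rewrite mulNr.
  exact: sqk_den.
by rewrite /sqk; under eq_fun do rewrite expr2; exact: derivableM.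
Qed.

Lemma sqk_real r t : sqk r (rc t) = rc ((1 - r * t)^-1 ^+ 2).
Proof. by rewrite /sqk rcX rcV rcB rcM. Qed.

Lemma is_derive_sqk r t : 1 - r * t != 0 ->
  is_derive t 1 (fun t => t / (1 - r * t)) ((1 - r * t)^-1 ^+ 2).
Proof.
move=> h.
have d1 : is_derive t 1 (fun t : R => 1 - r * t) (- r).
  by apply: is_derive_eq; rewrite /GRing.scale/=; ring.
have d3 := is_deriveM (is_derive_id t 1) (@is_deriveV R (fun t : R => 1 - r * t) t (- r) 1 h d1).
apply: is_derive_eq d3 _; rewrite /GRing.scale /=; field; exact: h.
Qed.

Lemma rint_sqk r T : 0 <= r < 1 -> 0 <= T <= 1 ->
  rint 0 T (fun t => (1 - r * t)^-1 ^+ 2) = T / (1 - r * T).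
Proof.
move=> /andP[r0 r1] /andP[T0 T1].
have hn t : 0 <= t <= T -> 1 - r * t != 0.
  by move=> /andP[h1 h2]; rewrite subr_eq0 eq_sym lt_eqF//; nra.
have c1 : rcontI 0 T (fun t => (1 - r * t)^-1 ^+ 2).
  move=> t ht; have c1 : {for t, continuous (fun t : R => (1 - r * t)^-1)}.
    by apply: cvgV; [exact: hn|exact: (cvgB (cvg_cst _) (cvgM (cvg_cst _) cvg_id))].
  exact: (cvgM c1 c1).
have hd t : 0 <= t <= T -> is_derive t 1 (fun t => t / (1 - r * t)) ((1 - r * t)^-1 ^+ 2).
  by move=> ht; apply: is_derive_sqk; exact: hn.
by rewrite (rint_FTC_itv T0 c1 hd) mul0r subr0.
Qed.

Lemma cmod_sqk_real r t : cmod (sqk r (rc t)) = (1 - r * t)^-1 ^+ 2.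
Proof. by rewrite sqk_real cmod_rc ger0_norm ?sqr_ge0. Qed.

Lemma rcontI_sqk r T : 0 <= r < 1 -> T <= 1 -> rcontI 0 T (fun t => (1 - r * t)^-1 ^+ 2).
Proof.
move=> /andP[r0 r1] T1 t /andP[t0 tT].
have hn : 1 - r * t != 0 by rewrite subr_eq0 eq_sym lt_eqF//; nra.
have c1 : {for t, continuous (fun t : R => (1 - r * t)^-1)}.
  by apply: cvgV; [exact: hn|exact: (cvgB (cvg_cst _) (cvgM (cvg_cst _) cvg_id))].
exact: (cvgM c1 c1).
Qed.

Lemma rad_sqk k r : 0 <= k -> 0 <= r < 1 -> rad (fun z => rc k * sqk r z) (k / (1 - r)).
Proof.
move=> k0 hr; have [r0 r1] := andP hr; split.
  move=> z z1; apply: derivableM; first exact: derivable_cst.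
  by apply: sqk_analytic => //; rewrite r0 ltW.
move=> J; have [J0 J1] := (cut_ge0 (R := R) J, cut_lt1 (R := R) J).
have -> : (fun t => cmod (rc k * sqk r (rc t))) = (fun t => k * (1 - r * t)^-1 ^+ 2).
  by apply/funext => t; rewrite cmodM cmod_rc (ger0_norm k0) cmod_sqk_real.
rewrite (rintZ _ (rcontI_sqk hr (ltW J1))) rint_sqk// ?J0 ?(ltW J1)//.
apply: ler_wpM2l => //; have h1 : 0 < 1 - r * cut J by nra.
by rewrite ler_pdivrMr// mulrC ler_pdivlMr//; nra.
Qed.

Lemma cmod_1_ei s x : cmod (1 - rc s * ei x) = cmod (ei x - rc s).
Proof.
rewrite -[LHS]cmod_cconj cconjB cconjM cconj_rc -eiN -[LHS]mul1r -(cmod_ei x) -cmodM mulrBr.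
rewrite (_ : cconj 1 = 1) ?mulr1; last by rewrite -rc1 cconj_rc.
by rewrite mulrCA ei_mulrV mulr1.
Qed.

Lemma cmod_sqk_circle r rho x : cmod (sqk r (circle rho x)) = (cmod (ei x - rc (r * rho)) ^+ 2)^-1.
Proof. by rewrite /sqk cmodX cmodV circleE mulrA -rcM cmod_1_ei exprVn. Qed.

Lemma HB_sqk r : 0 <= r < 1 -> HB 1%:E (fun z => rc (1 - r ^+ 2) * sqk r z) 1.
Proof.
move=> hr; have [r0 r1] := andP hr; have d0 : 0 < 1 - r ^+ 2 by nra.
have ha := (rad_sqk (ltW d0) hr).1; split => //.
apply/(hardy_pP ltr01 ler01 ha) => rho /andP[p0 p1]; rewrite powR1.
have h0 : 0 <= r * rho by rewrite mulr_ge0// ltW.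
have h1 : r * rho < 1 by nra.
pose k := (1 - r ^+ 2) / (1 - (r * rho) ^+ 2); set sg := r * rho.
have d1 : 0 < 1 - sg ^+ 2 by rewrite /sg; nra.
have hz : cmod (rc (sg / 2) : Cx R) < 2^-1 by rewrite cmod_rc ger0_norm /sg; lra.
have h2 : 2^-1 < 1 :> R by lra.
(* [rmean_poisson] wants a radius below 1. The Poisson kernel is unchanged when point and radius are
   scaled together, so radius 1/2 and point sg / 2 replace 1 and sg. *)
rewrite (rmeanE (G := fun x => k * poisson 2^-1 (rc (sg / 2)) x)); last first.
  move=> x; rewrite powRr1 ?cmod_ge0// cmodM cmod_rc (ger0_norm (ltW d0)) cmod_sqk_circle -/sg.
  have -> : poisson 2^-1 (rc (sg / 2)) x = (1 - sg ^+ 2) / cmod (ei x - rc sg) ^+ 2.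
    rewrite /poisson cmod_rc circleE rcM [rc sg * _]mulrC -mulrBr cmodM cmod_rc.
    rewrite ger0_norm; last by rewrite /sg; lra.
    have n0 : ei x - rc sg != 0.
      have := @circle_neq R 1 (rc sg) x; rewrite circleE rc1 mul1r; apply.
      by rewrite cmod_rc ger0_norm.
    rewrite -cmod_gt0 in n0; rewrite (ger0_norm (_ : 0 <= 2^-1)) ?invr_ge0//.
    by field; rewrite gt_eqF.
  by rewrite /k mulrA divfK// gt_eqF.
rewrite (rmeanZ _ (rcont_poisson hz)) (rmean_poisson hz h2) mulr1 /k ler_pdivrMr// mul1r /sg.
by rewrite lerD2l lerN2; apply: lerXn2r; rewrite ?nnegrE//; nra.
Qed.

(** As r tends to 1 the mass of (1 - r^2) / (1 - r t)^2 concentrates at t = 1 with total tending to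
    2. With u = 1 - r t, Bernoulli's inequality gives t^m >= 1 - m u, and the resulting term in 1 /
    u is split by the arithmetic-geometric mean inequality, so that [rint_sqk] is the only integral
    to evaluate. *)
Lemma mom_sqk_lower n e : 0 < e -> exists2 r, 0 <= r < 1 &
  forall m, (m <= n)%N -> 2 - e <= complex.Re (mom (fun z => rc (1 - r ^+ 2) * sqk r z) m).
Proof.
move=> e0; pose N : R := n%:R + 3; have n0 : 0 <= n%:R :> R by [].
pose e' := Num.min e 1; have e'0 : 0 < e' by rewrite lt_min e0 ltr01.
have e'1 : e' <= 1 by rewrite ge_min lexx orbT.
have ee : e' <= e by rewrite ge_min lexx.
pose a : R := Num.min (2^-1) (e' / (4 * N)); have N0 : 0 < N by rewrite /N; lra.
have a0 : 0 < a by rewrite lt_min invr_gt0 ltr0n /= divr_gt0// mulr_gt0.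
have a2 : a <= 2^-1 by rewrite ge_min lexx.
have aN : a * (4 * N) <= e' by rewrite -ler_pdivlMr ?mulr_gt0// ge_min lexx orbT.
(* 1 - r is a^2, and the cut 1 - T = a^3 is negligible beside it. All errors together stay below 4
   (n + 3) a, which the choice of a keeps below e. *)
pose r := 1 - a ^+ 2; have r0 : 0 <= r by rewrite /r; nra.
have r1 : r < 1 by rewrite /r; nra.
exists r; first by rewrite r0.
move=> m mn; have mn' : m%:R <= n%:R :> R by rewrite ler_nat.
have m0 : 0 <= m%:R :> R by [].
have d0 : 0 < 1 - r ^+ 2 by nra.
have hr : 0 <= r < 1 by rewrite r0.
pose T := 1 - a ^+ 3; have a3 : 0 < a ^+ 3 by exact: exprn_gt0.
have a31 : a ^+ 3 <= 1 by apply: exprn_ile1; lra.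
have T0 : 0 <= T by rewrite /T; lra.
have T1 : T < 1 by rewrite /T; lra.
have reE t : complex.Re (rc (1 - r ^+ 2) * sqk r (rc t)) = (1 - r ^+ 2) * (1 - r * t)^-1 ^+ 2.
  by rewrite sqk_real -rcM.
apply: le_trans (@mom_ge _ _ m 0 T (rad_sqk (ltW d0) hr) (lexx _) T0 T1 _); last first.
  by move=> t _; rewrite reE mulr_ge0 ?sqr_ge0// ltW.
have cq := rcontI_sqk hr (ltW T1).
pose lo t := (1 - r ^+ 2) * (1 - m%:R * a) * (1 - r * t)^-1 ^+ 2 + (- ((1 - r ^+ 2) * m%:R / (4 * a))).
have clo : rcontI 0 T lo.
  by move=> t ht; apply: cvgD; [exact: (cvgM (cvg_cst _) (cq t ht))|exact: cvg_cst].
apply: (@le_trans _ _ (rint 0 T lo)); last first.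
  apply: le_rint => //.
    move=> t ht; under [X in {for _, continuous X}]eq_fun do rewrite reE.
    exact: (cvgM (cvgM (cvg_cst _) (cq t ht)) (@exprn_continuous R m t)).
  move=> t /andP[t0 tT]; rewrite reE /lo.
  have u0 : 0 < 1 - r * t by nra.
  set u := 1 - r * t in u0 *; set v := u^-1.
  have v0 : 0 < v by rewrite invr_gt0.
  have uv : u * v = 1 by rewrite mulfV// gt_eqF.
  have bern : 1 - m%:R * u <= t ^+ m.
    have tu : 1 - t <= u by rewrite /u; nra.
    have t1 : t <= 1 by lra.
    apply: (@le_trans _ _ (1 - m%:R * (1 - t))).
      by rewrite lerD2l lerN2; apply: ler_wpM2l.
    elim: (m) => [|j IH]; first by rewrite mul0r subr0 expr0.
    rewrite exprS; have := exprn_ile1 j t0 t1; have := exprn_ge0 j t0.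
    rewrite -natr1; nra.
  have amgm : v <= a * v ^+ 2 + (4 * a)^-1.
    have h4 : (4 * a) * (a * v ^+ 2 + (4 * a)^-1 - v) = (2 * a * v - 1) ^+ 2.
      by field; rewrite gt_eqF.
    have : 0 <= (4 * a) * (a * v ^+ 2 + (4 * a)^-1 - v) by rewrite h4 sqr_ge0.
    by rewrite pmulr_rge0 ?mulr_gt0// subr_ge0.
  have h5 : (1 - m%:R * u) * v ^+ 2 <= t ^+ m * v ^+ 2 by rewrite ler_wpM2r ?sqr_ge0.
  have h6 : (1 - m%:R * u) * v ^+ 2 = v ^+ 2 - m%:R * v.
    by rewrite mulrBl mul1r -mulrA expr2 (mulrA u) uv mul1r.
  have h7 : m%:R * v <= m%:R * (a * v ^+ 2 + (4 * a)^-1) by exact: ler_wpM2l.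
  have h8 : (1 - m%:R * a) * v ^+ 2 - m%:R / (4 * a) <= t ^+ m * v ^+ 2 by lra.
  have := ler_wpM2l (ltW d0) h8; set w := (4 * a)^-1; lra.
have cst_c k : rcontI 0 T (fun=> k) by move=> t _; exact: cvg_cst.
rewrite /lo rintD//; last by move=> t ht; exact: (cvgM (cvg_cst _) (cq t ht)).
rewrite (rintZ _ cq) rint_sqk ?T0 ?(ltW T1)// rint_cst// subr0.
have u0 : 0 < 1 - r * T by nra.
have na : m%:R * a <= N * a by rewrite ler_wpM2r ?(ltW a0)// /N; lra.
have na1 : m%:R * a <= 1 - 3 * a.
  have h1 : a * (4 * N) <= 1 by exact: le_trans aN e'1.
  rewrite /N in h1; nra.
have hT : 2 - 3 * a <= (1 - r ^+ 2) * (T / (1 - r * T)).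
  rewrite mulrA ler_pdivlMr//.
  have -> : (2 - 3 * a) * (1 - r * T) = a ^+ 2 * ((2 - 3 * a) * (1 + a - a ^+ 3)).
    by rewrite /r /T; ring.
  have -> : (1 - r ^+ 2) * T = a ^+ 2 * ((2 - a ^+ 2) * (1 - a ^+ 3)).
    by rewrite /r /T; ring.
  apply: ler_wpM2l; first exact: sqr_ge0.
  have h1 : 0 <= (2 - 3 * a) * a ^+ 3 by apply: mulr_ge0; lra.
  have h2 : a ^+ 3 <= a by rewrite !exprS expr0 mulr1; nra.
  have h3 : 0 <= a ^+ 2 * a ^+ 3 by apply: mulr_ge0; [exact: sqr_ge0|exact: ltW].
  have h4 : 0 <= a ^+ 2 by exact: sqr_ge0.
  have h5 : a ^+ 3 <= a ^+ 2 by rewrite exprS; apply: ler_piMl => //; lra.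
  rewrite expr2 in h3 h4 h5 *; move: h1 h2 h3 h5; set b := a ^+ 3 => *; lra.
have h9 : (1 - r ^+ 2) * m%:R / (4 * a) <= m%:R * a.
  have hq : 1 - r ^+ 2 <= a * (4 * a).
    have -> : a * (4 * a) = 4 * a ^+ 2 by ring.
    by rewrite /r; have := sqr_ge0 a; set b := a ^+ 2; have := sqr_ge0 b; nra.
  by rewrite ler_pdivrMr ?mulr_gt0// mulrC -[leRHS]mulrA; apply: ler_wpM2l.
have h10 : (1 - r ^+ 2) * m%:R / (4 * a) * T <= m%:R * a.
  apply: le_trans h9; apply: ler_piMr; last exact: ltW.
  by rewrite divr_ge0 ?mulr_ge0// ltW// mulr_gt0.
have : (1 - m%:R * a) * (2 - 3 * a) <= (1 - m%:R * a) * ((1 - r ^+ 2) * (T / (1 - r * T))).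
  by apply: ler_wpM2l => //; lra.
rewrite /N in aN; move: h10; set X := T / _; set Y := (1 - r ^+ 2) * _ / _; nra.
Qed.
End TestFunctions.

(** * Combinations of kernels at dyadic scales *)

Section DyadicTests.
Context {R : realType}.
Implicit Types (f g h : Cx R -> Cx R) (z w : Cx R) (c : nat -> Cx R) (r s t x a b M B p : R).
Local Notation dy := (@dy R).
Local Notation cut := (@cut R).

(** The exponent 2 - 1/p makes the H^p norms bounded in k ([tfun_HB]), while for p > 1 the radial
    integral tends to 0 ([tfun_rad]), which drives [compact_bet_small]. *)
Definition tfun p k z : Cx R := rc (2 `^ (- ((2 - p^-1) * k%:R))) * sqk (1 - dy k) z.

Lemma r01 k : 0 <= 1 - dy k < 1.
Proof. by rewrite subr_ge0 dy_le1 ltrBlDr ltrDl dy_gt0. Qed.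

Lemma pow2D x y : 2 `^ x * 2 `^ y = 2 `^ (x + y) :> R.
Proof. by rewrite powRD// pnatr_eq0 implybT. Qed.

Lemma tfun_rad p k : rad (tfun p k) (2 `^ (- ((1 - p^-1) * k%:R))).
Proof.
have h := @rad_sqk R _ _ (powR_ge0 2 (- ((2 - p^-1) * k%:R))) (r01 k).
rewrite (_ : 2 `^ (- ((1 - p^-1) * k%:R)) = 2 `^ (- ((2 - p^-1) * k%:R)) / (1 - (1 - dy k)))//.
have -> : 1 - (1 - dy k) = dy k by ring.
rewrite dyV natrX -powR_mulrn// pow2D; congr (_ `^ _); ring.
Qed.

Lemma tfun_re p k t : complex.Re (tfun p k (rc t)) =
  2 `^ (- ((2 - p^-1) * k%:R)) * (1 - (1 - dy k) * t)^-1 ^+ 2.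
Proof. by rewrite /tfun sqk_real -rcM. Qed.

Lemma tfun_re_ge0 p k t : 0 <= complex.Re (tfun p k (rc t)).
Proof. by rewrite tfun_re mulr_ge0 ?powR_ge0 ?sqr_ge0. Qed.

Definition tsum p K (a : nat -> R) z : Cx R := \sum_(k < K) rc (a k) * tfun p k z.

Lemma tsum_re p K (a : nat -> R) t : complex.Re (tsum p K a (rc t)) =
  \sum_(k < K) a k * complex.Re (tfun p k (rc t)).
Proof.
have hRe x (w : Cx R) : complex.Re (rc x * w) = x * complex.Re w.
  by rewrite CReM /= mul0r subr0.
rewrite /tsum; elim: K => [|K IH]; first by rewrite !big_ord0.
by rewrite big_ord_recr [RHS]big_ord_recr CReD hRe IH.
Qed.

Lemma tsum_analytic p K (a : nat -> R) : analytic (tsum p K a).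
Proof.
move=> z z1; rewrite /tsum; elim: K => [|K IH].
  rewrite (_ : (fun z => _) = fun=> 0); first exact: derivable_cst.
  by apply/funext => w; rewrite big_ord0.
rewrite (_ : (fun z => _) = (fun z => \sum_(k < K) rc (a k) * tfun p k z + rc (a K) * tfun p K z)).
  apply: derivableD; first exact: IH.
  by apply: derivableM; [exact: derivable_cst|exact: (tfun_rad p K).1].
by apply/funext => w; rewrite big_ord_recr.
Qed.

Lemma tfun_low p k t : 1 - dy k / 4 <= t <= 1 ->
  2 `^ (- ((2 - p^-1) * k%:R)) * (2 `^ (2 * k%:R) / 4) <= complex.Re (tfun p k (rc t)).
Proof.
move=> /andP[t0 t1]; rewrite tfun_re; apply: ler_wpM2l; first exact: powR_ge0.
have d0 := dy_gt0 (R := R) k; have d1 := dy_le1 (R := R) k.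
have u0 : 0 < 1 - (1 - dy k) * t by nra.
have u1 : 1 - (1 - dy k) * t <= 2 * dy k by nra.
have -> : 2 `^ (2 * k%:R) / 4 = (2 * dy k)^-1 ^+ 2 :> R.
  rewrite mulrC powRrM !powR_mulrn ?powR_ge0// -!exprM; rewrite invfM exprMn exprVn.
  by rewrite dyV -natrX -natrX; congr (_ * _); rewrite ?natrX -?exprM 1?mulnC//; field.
apply: lerXn2r; [by rewrite nnegrE invr_ge0 mulr_ge0// ltW|by rewrite nnegrE invr_ge0 ltW|].
by rewrite lef_pV2// posrE mulr_gt0.
Qed.

(** All summands are nonnegative on the radius, so the k-th one alone, for 1 - t between 2^-k / 8
    and 2^-k / 4, gives the bound; there t^n >= 1/2 because n 2^-k <= 2. The constant 64 is 4 * 8 *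
    2: size of the kernel, length of the interval, value of t^n. *)
Lemma tsum_mom_ge p K (a : nat -> R) k n B : (forall k, 0 <= a k) -> rad (tsum p K a) B ->
  (k < K)%N -> (n < (2 ^ k.+1).-1)%N ->
  a k * 2 `^ (- ((1 - p^-1) * k%:R)) / 64 <= cmod (mom (tsum p K a) n).
Proof.
move=> a0 hB kK hn; have d0 := dy_gt0 (R := R) k; have d1 := dy_le1 (R := R) k.
have re0 t : 0 <= complex.Re (tsum p K a (rc t)).
  by rewrite tsum_re; apply: sumr_ge0 => i _; rewrite mulr_ge0 ?tfun_re_ge0.
apply: le_trans (le_trans (ler_norm _) (normRe_le _)).
have x0 : 0 <= 1 - dy k / 4 by lra.
have x1 : 1 - dy k / 4 <= 1 - dy k / 8 by lra.
have x2 : 1 - dy k / 8 < 1 by lra.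
apply: le_trans (mom_ge n hB x0 x1 x2 (fun t _ => re0 t)).
set L := a k * (2 `^ (- ((2 - p^-1) * k%:R)) * (2 `^ (2 * k%:R) / 4)).
have L0 : 0 <= L by rewrite mulr_ge0 ?mulr_ge0 ?powR_ge0// divr_ge0 ?powR_ge0.
apply: (@le_trans _ _ (rint (1 - dy k / 4) (1 - dy k / 8) (fun=> L / 2))).
  rewrite rint_cst// /L.
  have -> : (1 - dy k / 8 - (1 - dy k / 4)) = dy k / 8 by field.
  rewrite le_eqVlt; apply/orP; left; apply/eqP.
  have -> : 2 `^ (- ((1 - p^-1) * k%:R)) = 2 `^ (- ((2 - p^-1) * k%:R)) * 2 `^ (2 * k%:R) * dy k :> R.
    by rewrite dy_powR !pow2D; congr (_ `^ _); ring.
  by field.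
apply: le_rint.
- by move=> t _; exact: cvg_cst.
- move=> t /andP[t0 t1]; have hu := ucont_radial hB.1 x2.
  apply: cvgM; last exact: exprn_continuous.
  by apply: (ccontI_Re hu); rewrite t1 (le_trans x0 t0).
move=> t /andP[t0 t1]; have t01 : 1 - dy k / 4 <= t <= 1 by rewrite t0 (le_trans t1)// ltW.
have hL : L <= complex.Re (tsum p K a (rc t)).
  rewrite tsum_re (bigD1 (Ordinal kK))//= -[leLHS]addr0; apply: lerD.
    by apply: ler_wpM2l => //; exact: tfun_low.
  by apply: sumr_ge0 => i _; rewrite mulr_ge0 ?tfun_re_ge0.
apply: ler_pM => //.
have tt0 : 0 <= t by lra.
have bern : 1 - n%:R * (1 - t) <= t ^+ n.
  have tt1 : t <= 1 by case/andP: t01.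
  elim: (n) => [|m IH]; first by rewrite mul0r subr0 expr0.
  rewrite exprS; have := exprn_ile1 m tt0 tt1; have := exprn_ge0 m tt0.
  rewrite -natr1; nra.
apply: le_trans bern.
have nd : n%:R * dy k <= 2.
  have h : n%:R <= 2 * (dy k)^-1 :> R.
    by rewrite dyV -natrM ler_nat -expnS; exact: leq_trans (ltnW hn) (leq_pred _).
  by rewrite -ler_pdivlMr.
have h1 : 1 - t <= dy k / 4 by lra.
have h2 : n%:R * (1 - t) <= n%:R * (dy k / 4) by exact: ler_wpM2l.
lra.
Qed.

(** Jordan's inequality at dyadic points, by halving: sin (2 y) <= 2 sin y. *)
Lemma sin_dy m : dy m <= sin (pi / 2 * dy m) :> R.
Proof.
elim: m => [|m IH]; first by rewrite /dy expr0 mulr1 sin_pihalf.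
have d0 := dy_gt0 (R := R) m; have d1 := dy_le1 (R := R) m; have p0 := pi_gt0 R.
have E : pi / 2 * dy m = pi / 2 * dy m.+1 + pi / 2 * dy m.+1 by rewrite dyS; field.
have s0 : 0 <= sin (pi / 2 * dy m.+1).
  by apply: sin_ge0_pi; rewrite dyS; apply/andP; split; nra.
have c1 := cos_le1 (pi / 2 * dy m.+1); rewrite E sinD in IH; have h := dyS (R := R) m.
move: h s0 IH c1; set s := sin _; set c := cos _; nra.
Qed.

Lemma sin_half_dy m x : pi * dy m.+1 <= x <= 2 * pi - pi * dy m.+1 -> dy m.+1 <= sin (x / 2).
Proof.
move=> /andP[h1 h2]; have d0 := dy_gt0 (R := R) m.+1; have d1 := dy_le1 (R := R) m.+1.
have p0 := pi_gt0 R.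
have main y : pi / 2 * dy m.+1 <= y <= pi / 2 -> dy m.+1 <= sin y.
  move=> /andP[y0 y1]; apply: le_trans (sin_dy _) _.
  move: y0; rewrite le_eqVlt => /orP[/eqP -> //|y0].
  by rewrite ltW// ltr_sin// in_itv /=; apply/andP; split; nra.
case: (leP x pi) => hx.
  by apply: main; apply/andP; split; lra.
rewrite (_ : x / 2 = pi - (pi - x / 2)); last by ring.
by rewrite sinB sinpi cospi mul0r sub0r mulN1r opprK; apply: main; apply/andP; split; lra.
Qed.

(** For s <= 1/2 the radial gap 1 - s is large enough; for s > 1/2 the angular term 4 s sin^2 (x /
    2) is. *)
Lemma dist_dy s k m x : 0 <= s <= 1 - dy k -> pi * dy m.+1 <= x <= 2 * pi - pi * dy m.+1 ->
  (cmod (ei x - rc s) ^+ 2)^-1 <= 4 * (4 ^+ m).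
Proof.
move=> /andP[s0 s1] hx; have h1 := sin_half_dy hx; rewrite dist_ei_rc.
have d0 := dy_gt0 (R := R) m.+1; have d1 := dy_le1 (R := R) m; have dk := dy_gt0 (R := R) k; have dm := dy_gt0 (R := R) m.
have dE : dy m.+1 ^+ 2 = (4 * 4 ^+ m)^-1.
  by rewrite /dy -exprM mulnC exprM -exprS (_ : (2^-1) ^+ 2 = 4^-1 :> R) ?exprVn//; field.
have h2 : dy m.+1 ^+ 2 <= sin (x / 2) ^+ 2.
  by apply: lerXn2r; rewrite ?nnegrE ?(ltW d0)// (le_trans (ltW d0) h1).
have h3 : (4 * 4 ^+ m)^-1 <= (1 - s) ^+ 2 + 4 * s * sin (x / 2) ^+ 2 :> R.
  rewrite -dE; rewrite dyS in h2 *; case: (leP s 2^-1) => hs.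
    have h4 : (dy m / 2) ^+ 2 <= (1 - s) ^+ 2.
      apply: lerXn2r; rewrite ?nnegrE; lra.
    by apply: le_trans h4 _; rewrite lerDl mulr_ge0 ?sqr_ge0// mulr_ge0.
  have h5 : 4 * 2^-1 * (dy m / 2) ^+ 2 <= 4 * s * sin (x / 2) ^+ 2.
    by apply: ler_pM => //; rewrite ?sqr_ge0//; lra.
  by have := sqr_ge0 (1 - s); have := sqr_ge0 (dy m / 2); lra.
have n0 : (0 : R) < 4 * 4 ^+ m by rewrite mulr_gt0// exprn_gt0.
rewrite -[leRHS]invrK lef_pV2// posrE ?invr_gt0//.
by apply: lt_le_trans h3; rewrite invr_gt0.
Qed.

(** The circle is cut into arcs at angular distance about pi 2^-m from the point 1, two symmetric
    ones for each m < K and a cap for m = K; V m bounds F on the m-th pair. *)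
Lemma rint_dyadic (F : R -> R) (V : nat -> R) K : rcont F -> (forall m, 0 <= V m) ->
  (forall x, F x <= V K) ->
  (forall m x, (m < K)%N -> pi * dy m.+1 <= x <= 2 * pi - pi * dy m.+1 -> F x <= V m) ->
  rmean F <= \sum_(m < K.+1) dy m * V m.
Proof.
move=> cF V0 hK hm; have p0 := pi_gt0 R.
have dd k := dy_gt0 (R := R) k; have d1 k := dy_le1 (R := R) k.
have cst_c a b k : rcontI a b (fun=> k) by move=> t _; exact: cvg_cst.
have bnd a b v : a <= b -> (forall x, a <= x <= b -> F x <= v) -> rint a b F <= v * (b - a).
  move=> ab h; rewrite -rint_cst//; apply: le_rint => //; exact: rcontW.
have main m : (m <= K)%N ->
    rint (pi * dy m) (2 * pi - pi * dy m) F <= \sum_(k < m) (pi * dy k) * V k.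
  elim: m => [|m IH] hmK.
    rewrite big_ord0 /dy expr0 mulr1 (_ : 2 * pi - pi = pi); last by ring.
    by rewrite rint.unlock set_itv1 Rintegral_set1.
  have dS := dyS (R := R) m; have dm := dd m; have dm1 := d1 m.
  have ea : pi * dy m.+1 = pi * dy m / 2 by rewrite dS; ring.
  have pm : 0 < pi * dy m by exact: mulr_gt0.
  have pm1 : pi * dy m <= pi by apply: ler_piMr => //; exact: ltW.
  have h x := @hm m x hmK; rewrite ea in h *.
  rewrite (@rint_split _ _ _ (pi * dy m)); [|by apply/andP; split; lra|exact: rcontW].
  rewrite (@rint_split _ (pi * dy m) _ (2 * pi - pi * dy m)); [|by apply/andP; split; lra|exact: rcontW].
  rewrite big_ord_recr /=.
  have h1 : rint (pi * dy m / 2) (pi * dy m) F <= V m * (pi * dy m - pi * dy m / 2).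
    by apply: bnd; [lra|move=> x /andP[x0 x1]; apply: h; apply/andP; split; lra].
  have h2 : rint (2 * pi - pi * dy m) (2 * pi - pi * dy m / 2) F <=
      V m * (2 * pi - pi * dy m / 2 - (2 * pi - pi * dy m)).
    by apply: bnd; [lra|move=> x /andP[x0 x1]; apply: h; apply/andP; split; lra].
  have := IH (ltnW hmK); move: h1 h2; set A := rint _ _ _; set B := rint _ _ _; lra.
rewrite /rmean mulrC ler_pdivrMr; last exact: pi2_gt0.
have pK : 0 < pi * dy K by exact: mulr_gt0.
have pK1 : pi * dy K <= pi by apply: ler_piMr => //; exact: ltW.
rewrite (@rint_split _ _ _ (pi * dy K)); [|by apply/andP; split; lra|exact: rcontW].
rewrite (@rint_split _ (pi * dy K) _ (2 * pi - pi * dy K)); [|by apply/andP; split; lra|exact: rcontW].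
have h1 : rint 0 (pi * dy K) F <= V K * (pi * dy K - 0) by apply: bnd => //; exact: ltW.
have h2 : rint (2 * pi - pi * dy K) (2 * pi) F <= V K * (2 * pi - (2 * pi - pi * dy K)).
  by apply: bnd => //; lra.
have -> : \sum_(m < K.+1) dy m * V m = \sum_(m < K) dy m * V m + dy K * V K by rewrite big_ord_recr.
have := main K (leqnn _); have -> : \sum_(k < K) pi * dy k * V k = (\sum_(k < K) dy k * V k) * pi.
  by rewrite mulr_suml; apply: eq_bigr => k _; ring.
have S0 : 0 <= (\sum_(k < K) dy k * V k) * pi.
  apply: mulr_ge0; last exact: ltW.
  by apply: sumr_ge0 => k _; apply: mulr_ge0; [exact: ltW|exact: V0].
move: h1 h2; set A := rint 0 (pi * dy K) F; set B := rint (2 * pi - pi * dy K) (2 * pi) F; lra.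
Qed.

(** At angular distance 2^-m the kernel of scale k has size 4^(min k m). After normalisation the
    decay is 2^(-(m - k) / p) for k <= m and 2^(-(2 - 1/p) (k - m)), which is faster, for k > m. *)
Lemma tkernel p (k m : nat) : 1 < p ->
  2 `^ (- (m%:R / p)) * (2 `^ (- ((2 - p^-1) * k%:R)) * 2 `^ (2 * (minn k m)%:R)) <= gk (q_ p^-1) m k.
Proof.
move=> p1; have p0 : 0 < p by lra.
have i0 : 0 < p^-1 by rewrite invr_gt0.
have i1 : p^-1 < 1 by rewrite invf_lt1.
rewrite !pow2D; apply: pow2_gk; first exact: ltW.
  case: (leqP k m) => km; first by lra.
  have : m%:R < k%:R :> R by rewrite ltr_nat.
  nra.
case: (leqP k m) => km; last first.
  have : m%:R < k%:R :> R by rewrite ltr_nat.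
  nra.
have : k%:R <= m%:R :> R by rewrite ler_nat.
nra.
Qed.

Definition Ctest p : R := (2 / (1 - q_ p^-1)) * 4.

(** On each arc the sum of kernels is bounded by a geometric average of the a k, so Schur's test
    bounds the H^p norm by the l^p norm of a. This allows testing on all blocks at once. *)
Lemma tsum_HB p K (a : nat -> R) : 1 < p -> (forall k, 0 <= a k) ->
  HB p%:E (tsum p K a) (Ctest p * (\sum_(k < K) a k `^ p) `^ p^-1).
Proof.
move=> p1 a0; have p0 : 0 < p by lra.
have i0 : 0 < p^-1 by rewrite invr_gt0.
have i1 : p^-1 < 1 by rewrite invf_lt1.
have hq : (0 : R) <= q_ p^-1 < 1 by exact: q_lt1.
have Q0 : 0 < 2 / (1 - q_ p^-1) :> R by case/andP: hq => _ h; rewrite divr_gt0// subr_gt0.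
have C0 : 0 <= Ctest p by rewrite /Ctest mulr_ge0// ltW.
have S0 : 0 <= \sum_(k < K) a k `^ p by apply: sumr_ge0 => k _; exact: powR_ge0.
have ha := @tsum_analytic p K a; have B0 := mulr_ge0 C0 (powR_ge0 (\sum_(k < K) a k `^ p) p^-1).
split => //; apply/(hardy_pP p0 B0 ha) => r hr; have [r0 r1] := andP hr.
rewrite powRM ?powR_ge0// -powRrM mulVf ?gt_eqF// powRr1//.
pose w k := 2 `^ (- ((2 - p^-1) * k%:R)) : R.
pose V m := (\sum_(k < K) a k * (w k * (4 * 2 `^ (2 * (minn k m)%:R)))) `^ p.
have bnd x (b : nat -> R) : (forall k, (k < K)%N -> cmod (sqk (1 - dy k) (circle r x)) <= b k) ->
    cmod (tsum p K a (circle r x)) `^ p <= (\sum_(k < K) a k * (w k * b k)) `^ p.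
  move=> h; apply: ge0_ler_powR; rewrite ?nnegrE ?cmod_ge0 ?(ltW p0)//.
    apply: sumr_ge0 => k _; rewrite mulr_ge0// mulr_ge0 ?powR_ge0//.
    exact: le_trans (cmod_ge0 _) (h k (ltn_ord k)).
  apply: le_trans (cmod_sum _ _ _) _; apply: ler_sum => k _.
  rewrite cmodM cmod_rc ger0_norm//; apply: ler_wpM2l => //.
  rewrite /tfun cmodM cmod_rc ger0_norm ?powR_ge0//.
  by apply: ler_wpM2l; [exact: powR_ge0|exact: h].
have pw4 m : 2 `^ (2 * m%:R) = 4 ^+ m :> R.
  by rewrite powRrM !powR_mulrn ?powR_ge0// -natrX.
have hs k : 0 <= (1 - dy k) * r <= 1 - dy k.
  have /andP[d0 d1] := r01 k; apply/andP; split.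
    by apply: mulr_ge0 => //; exact: ltW.
  by apply: ler_piMr => //; exact: ltW.
have hb4 k x : cmod (sqk (1 - dy k) (circle r x)) <= 4 * 2 `^ (2 * k%:R).
  rewrite cmod_sqk_circle dist_ei_rc; set s := _ * r.
  have d0 := dy_gt0 (R := R) k; have /andP[s0 s1] := hs k.
  have h1 : dy k ^+ 2 <= (1 - s) ^+ 2 + 4 * s * sin (x / 2) ^+ 2.
    apply: (@le_trans _ _ ((1 - s) ^+ 2)); first by apply: lerXn2r; rewrite ?nnegrE /s; lra.
    by rewrite lerDl mulr_ge0 ?sqr_ge0// mulr_ge0.
  have h2 : (dy k ^+ 2)^-1 = 4 ^+ k :> R.
    by rewrite -exprVn dyV natrX -exprM mulnC exprM -natrX.
  rewrite pw4; apply: (@le_trans _ _ (dy k ^+ 2)^-1).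
    by rewrite lef_pV2// posrE ?exprn_gt0//; apply: lt_le_trans h1; rewrite exprn_gt0.
  rewrite h2; have : (0 : R) <= 4 ^+ k by rewrite exprn_ge0.
  lra.
have r0' : 0 <= r < 1 by rewrite (ltW r0).
apply: le_trans (@rint_dyadic _ V K _ (fun m => powR_ge0 _ _) _ _) _.
- by apply: (rcont_powR p0 _ (rcont_cmod (dan_ccont ha r0'))) => x; exact: cmod_ge0.
- move=> x; apply: (bnd x (fun k => 4 * 2 `^ (2 * (minn k K)%:R))) => k kK; have /minn_idPl -> : (k <= K)%N by exact: ltnW.
  exact: hb4.
- move=> m x mK hx; apply: (bnd x (fun k => 4 * 2 `^ (2 * (minn k m)%:R))) => k kK; case: (leqP k m) => km; first exact: hb4.
  by rewrite cmod_sqk_circle pw4; apply: dist_dy (hs k) hx.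
apply: (@le_trans _ _ (\sum_(m < K.+1) (\sum_(k < K) gk (q_ p^-1) m k * (4 * a k)) `^ p)).
  apply: ler_sum => m _; rewrite /V.
  have -> : dy m = (2 `^ (- (m%:R / p))) `^ p :> R.
    by rewrite -powRrM mulNr divfK ?gt_eqF// dy_powR.
  rewrite -powRM ?powR_ge0//; last first.
    by apply: sumr_ge0 => k _; rewrite !mulr_ge0 ?powR_ge0.
  apply: ge0_ler_powR; rewrite ?nnegrE ?(ltW p0)//.
  - apply: mulr_ge0; first exact: powR_ge0.
    by apply: sumr_ge0 => k _; rewrite !mulr_ge0 ?powR_ge0.
  - apply: sumr_ge0 => k _; rewrite !mulr_ge0//; apply: gk_ge0; by case/andP: hq.
  rewrite mulr_sumr; apply: ler_sum => k _.
  have := ler_wpM2r (_ : 0 <= 4 * a k) (tkernel k m p1); rewrite mulr_ge0// => /(_ isT).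
  by rewrite /w; set A := 2 `^ _; set B := 2 `^ _; set C := 2 `^ _; nra.
have y0 (k : 'I_K) : 0 <= 4 * a k by rewrite mulr_ge0.
apply: le_trans (schur_geom K.+1 (ltW p1) hq y0) _.
have -> : Ctest p `^ p = (2 / (1 - q_ p^-1)) `^ p * 4 `^ p by apply: powRM => //; exact: ltW.
rewrite -mulrA; apply: ler_wpM2l; first exact: powR_ge0.
by rewrite mulr_sumr; apply: ler_sum => k _; rewrite powRM.
Qed.

End DyadicTests.

(** * The exponents 1 and infinity *)

Section EndpointCases.
Context {R : realType}.
Implicit Types (f g h : Cx R -> Cx R) (z w : Cx R) (c : nat -> Cx R) (r s t x a b M B : R) (p : \bar R).

Lemma tails_small (F : nat -> R) C : (forall n, 0 <= F n) -> (forall N, \sum_(n < N) F n <= C) ->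
  forall e, 0 < e -> exists N0, forall N, \sum_(N0 <= n < N) F n <= e.
Proof.
move=> F0 hC e e0; pose A := range (fun N => \sum_(n < N) F n).
have hA : has_sup A.
  split; first by exists (\sum_(n < 0) F n), 0%N.
  by exists C => _ [N _ <-]; exact: hC.
have [_ [N0 _ <-] hN] := sup_adherent e0 hA; exists N0 => N.
case: (leqP N N0) => hNN; first by rewrite big_geq// ltW.
have : \sum_(n < N) F n <= sup A by apply: sup_upper_bound => //; exists N.
rewrite -!(big_mkord xpredT F) (@big_cat_nat _ _ _ N0 0%N N)//=; last exact: ltnW.
rewrite -(big_mkord xpredT F) in hN; lra.
Qed.

Section FixedSymbol.
Variables (g : Cx R -> Cx R) (c : nat -> Cx R).
Hypothesis gc : has_ps 1 (cderiv g) c.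
Local Notation T := (hilbert_op g).

(** Unit vectors whose moments up to index N are at least 2 - d have images of norm at least 2 - d
    times the l^2 norm of the first N coefficients. *)
Lemma op_bound_H1 M : op_bound 1%:E 2%:E T M -> (hardy_norm 2%:E (cderiv g) <= (M / 2)%:E)%E.
Proof.
have p1 : (1 <= 1%:E :> \bar R)%E by [].
move=> hM; have M0 := op_bound_ge0 p1 hM.
have M2 : 0 <= M / 2 by rewrite divr_ge0.
apply/(hardy2P gc M2) => N; set S := \sum_(n < N) _.
have S0 : 0 <= S by apply: sumr_ge0 => n _; exact: sqr_ge0.
pose s := Num.sqrt S; have s0 : 0 <= s by exact: sqrtr_ge0.
have sS : s ^+ 2 = S by rewrite sqr_sqrtr.
rewrite -sS; apply: lerXn2r; rewrite ?nnegrE//.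
rewrite ler_pdivlMr//; apply/ler_addgt0Pl => e e0; rewrite addrC.
pose d := Num.min 1 (e / (s + 1)).
have s1 : 0 < s + 1 by lra.
have d0 : 0 < d by rewrite lt_min ltr01 divr_gt0.
have d1 : d <= 1 by rewrite ge_min lexx.
have de : d * (s + 1) <= e by rewrite -ler_pdivlMr// ge_min lexx orbT.
have [r hr hm] := mom_sqk_lower N d0.
have := (op_boundP gc p1 M0).1 hM _ _ (HB_sqk hr) N; rewrite mulr1 => hN.
suff : (2 - d) * s <= M by nra.
have h2 : ((2 - d) * s) ^+ 2 <= M ^+ 2.
  apply: le_trans hN; rewrite exprMn sS /S mulr_sumr; apply: ler_sum => n _.
  rewrite cmodM exprMn mulrC; apply: ler_wpM2l; first exact: sqr_ge0.
  have h := hm n (ltnW (ltn_ord n)).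
  apply: lerXn2r; rewrite ?nnegrE ?cmod_ge0//; first by lra.
  by apply: le_trans h (le_trans (ler_norm _) (normRe_le _)).
by rewrite -(@ler_sqr _ ((2 - d) * s)) ?nnegrE ?mulr_ge0//; lra.
Qed.

Lemma H1_level Q : 0 <= Q -> (hardy_norm 2%:E (cderiv g) <= Q%:E)%E ->
  op_bound 1%:E 2%:E T (pi * Q).
Proof.
have p1 : (1 <= 1%:E :> \bar R)%E by [].
move=> Q0 /(hardy2P gc Q0) hQ.
apply/(op_boundP gc p1 (mulr_ge0 (pi_ge0 R) Q0)) => f B hf N.
have [_ B0 _] := hf.
apply: (@le_trans _ _ (\sum_(n < N) (pi * B) ^+ 2 * cmod (c n) ^+ 2)).
  apply: ler_sum => n _; rewrite cmodM exprMn mulrC; apply: ler_wpM2r; first exact: sqr_ge0.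
  by apply: lerXn2r; rewrite ?nnegrE ?cmod_ge0 ?mulr_ge0 ?pi_ge0//; exact: mom_bound p1 hf.
rewrite -mulr_sumr (_ : (pi * Q * B) ^+ 2 = (pi * B) ^+ 2 * Q ^+ 2); last by ring.
by apply: ler_wpM2l; [exact: sqr_ge0|exact: hQ].
Qed.

Lemma H1_tails : hardy 2%:E (cderiv g) -> small_tails c 1%:E.
Proof.
have p1 : (1 <= 1%:E :> \bar R)%E by [].
move=> hg e e0; have [Q Q0 hQ] := hardy_fin (isT : 2%:E != -oo%E) hg.
have hQ' : (hardy_norm 2%:E (cderiv g) <= Q%:E)%E by rewrite hQ.
have pp : 0 < pi ^+ 2 :> R by rewrite exprn_gt0// pi_gt0.
have ep : 0 < e / pi ^+ 2 by rewrite divr_gt0.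
have [N0 hN] := tails_small (fun n => sqr_ge0 (cmod (c n))) ((hardy2P gc Q0).1 hQ') ep.
exists N0 => f hf N; have := hN N; rewrite ler_pdivlMr// mulr_suml; apply: le_trans.
apply: ler_sum => n _; rewrite cmodM exprMn; apply: ler_wpM2l; first exact: sqr_ge0.
by apply: lerXn2r; rewrite ?nnegrE ?cmod_ge0 ?pi_ge0//; have := mom_bound n p1 hf; rewrite mulr1.
Qed.

(** The norm sees radii in (0, 1); the origin is reached by continuity. *)
Lemma HB_infty_le f B z : HB +oo%E f B -> cmod z < 1 -> cmod (f z) <= B.
Proof.
move=> [hf B0 /(hardy_inftyP _ hf) h] z1.
have [z0|zn0] := eqVneq z 0; last by apply: h; rewrite z1 cmod_gt0 zn0.
apply/ler_addgt0Pl => e e0.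
have hc : {for 0, continuous (fun t : R => cmod (f (rc t)))}.
  have h21 : 2^-1 < 1 :> R by lra.
  have := ccontI_cmod (ucont_radial hf h21); apply.
  by rewrite lexx invr_ge0 ler0n.
have /cvg_at_right_filter/cvgrPdist_le/(_ _ e0) h1 := hc.
near (0 : R)^'+ => t.
have t0 : 0 < t by near: t; exact: nbhs_right_gt.
have t1 : t < 1 by near: t; exact: nbhs_right_lt.
have : `|cmod (f (rc 0)) - cmod (f (rc t))| <= e by near: t.
have : cmod (f (rc t)) <= B by apply: h; rewrite cmod_rc gtr0_norm// t0.
by rewrite ler_norml z0 => h5 /andP[_ h2]; rewrite -[0 in leLHS]rc0; lra.
Unshelve. all: by end_near. Qed.

Lemma rint_Xn a n : 0 <= a -> rint 0 a (fun t => t ^+ n) = a ^+ n.+1 / n.+1%:R.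
Proof.
move=> a0.
have hd (x : R) : is_derive x (1 : R) (fun t : R => t ^+ n.+1 / n.+1%:R) (x ^+ n).
  have h1 : is_derive x (1 : R) (fun t : R => t ^+ n.+1) (n.+1%:R * x ^+ n).
    apply: DeriveDef; first exact: exprn_derivable.
    by rewrite exp_derive /GRing.scale /= mulr1.
  have h2 := is_deriveM h1 (is_derive_cst (n.+1%:R^-1 : R) x (1 : R)).
  apply: is_derive_eq h2 _; rewrite /GRing.scale /= mulr0 add0r.
  by rewrite mulrA mulVf ?mul1r// pnatr_eq0.
have hc : rcontI 0 a (fun t : R => t ^+ n) by move=> t _; exact: exprn_continuous.
by rewrite (rint_FTC a0 hc hd) expr0n /= mul0r subr0.
Qed.

Lemma mom_infty f B n : HB +oo%E f B -> cmod (mom f n) <= B / n.+1%:R.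
Proof.
move=> hf; have [ha B0 _] := hf; have p1 : (1 <= +oo :> \bar R)%E by exact: leey.
apply: (cmod_lim_le (N := 0) (@mom_lim R f _ n (HB_rad p1 hf))) => J _.
apply: le_trans (cmod_mom_trunc J n ha) _.
have J1 := cut_lt1 (R := R) J; have J0 := cut_ge0 (R := R) J.
have cX : rcontI 0 (cut J) (fun t : R => t ^+ n) by move=> t _; exact: exprn_continuous.
apply: (@le_trans _ _ (rint 0 (cut J) (fun t => B * t ^+ n))).
  apply: le_rint.
  - exact: ucont_amom J1.
  - by move=> t ht; exact: (cvgM (cvg_cst _) (cX t ht)).
  - move=> t /andP[t0 tJ]; apply: ler_wpM2r; first exact: exprn_ge0.
    by apply: (HB_infty_le hf); rewrite cmod_rc ger0_norm// (le_lt_trans tJ).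
rewrite (rintZ _ cX) rint_Xn//; apply: ler_wpM2l => //; rewrite -[leRHS]mul1r.
by apply: ler_wpM2r; rewrite ?invr_ge0//; apply: exprn_ile1 => //; exact: ltW.
Qed.

(** The function 1 attains the bound of [mom_infty], which is what gives an equality of norms for p
    = infinity. *)
Lemma mom_cst1 n : n.+1%:R^-1 <= cmod (mom (fun=> 1 : Cx R) n).
Proof.
have p1 : (1 <= 1%:E :> \bar R)%E by [].
have hr := HB_rad p1 (HB_cst1 p1).
apply: le_trans (le_trans (ler_norm _) (normRe_le _)).
apply/ler_addgt0Pl => e e0; rewrite addrC.
have key x : 0 <= x < 1 -> x ^+ n.+1 / n.+1%:R <= complex.Re (mom (fun=> 1 : Cx R) n).
  move=> /andP[x0 x1]; rewrite -rint_Xn//.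
  have := mom_ge n hr (lexx 0) x0 x1 _; rewrite /=.
  by under eq_rint do rewrite mul1r; apply.
have hc : {for 1, continuous (fun x : R => x ^+ n.+1 / n.+1%:R)}.
  by apply: cvgM; [exact: exprn_continuous|exact: cvg_cst].
have /cvg_at_left_filter/cvgrPdist_le/(_ _ e0) h1 := hc.
near (1 : R)^'- => x.
have x1 : x < 1 by near: x; exact: nbhs_left_lt.
have x0 : 0 <= x by near: x; apply: nbhs_left_ge; exact: ltr01.
have h2 : `|1 ^+ n.+1 / n.+1%:R - x ^+ n.+1 / n.+1%:R| <= e by near: x.
have x01 : 0 <= x < 1 by rewrite x0.
have h3 := key x x01.
have h4 : 1 ^+ n.+1 / n.+1%:R - x ^+ n.+1 / n.+1%:R <= e by exact: le_trans (ler_norm _) h2.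
rewrite expr1n div1r in h4; move: h3 h4; set Y := _ / _; set Z := _^-1; lra.
Unshelve. all: by end_near. Qed.

End FixedSymbol.
End EndpointCases.

(** * Block estimates for 1 < p < infinity *)

Section InteriorCases.
Context {R : realType}.
Implicit Types (f g h : Cx R -> Cx R) (c : nat -> Cx R) (b M B p pt : R).

(** This is beta_k, with 1 - 1/p standing for 1 / p'. *)
Definition bet p c k : R := Num.sqrt (blk c k) * 2 `^ (- ((1 - p^-1) * k%:R)).

Lemma bet_ge0 p c k : 0 <= bet p c k.
Proof. by rewrite mulr_ge0 ?sqrtr_ge0 ?powR_ge0. Qed.

Lemma blkE p c k : blk c k = (bet p c k * 2 `^ ((1 - p^-1) * k%:R)) ^+ 2.
Proof.
rewrite /bet -mulrA pow2D addNr powRr0 mulr1 sqr_sqrtr//; exact: blk_ge0.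
Qed.

Lemma sum_nat_ge0_le (F : nat -> R) K0 K : (forall k, 0 <= F k) ->
  \sum_(K0 <= k < K) F k <= \sum_(k < K) F k.
Proof.
move=> F0; case: (leqP K0 K) => h; last first.
  by rewrite big_geq ?(ltnW h)//; apply: sumr_ge0.
rewrite -(big_mkord xpredT F) (@big_cat_nat _ _ _ K0 0%N K)//= lerDr.
exact: sumr_ge0.
Qed.

Lemma powR_2Vp (S p : R) : 0 <= S -> 0 < p -> (S `^ p^-1) ^+ 2 = S `^ (2 / p).
Proof. by move=> S0 p0; rewrite -powR_mulrn ?powR_ge0// -powRrM mulrC. Qed.

(** The embedding of l^p in l^2: each x k is at most S^(1/p), which is inserted into the second
    factor of x^2 = x^p x^(2-p). *)
Lemma sum_sq_le (x : nat -> R) p K0 K S : 0 < p <= 2 -> (forall k, 0 <= x k) -> 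
  \sum_(k < K) x k `^ p <= S -> \sum_(K0 <= k < K) x k ^+ 2 <= (S `^ p^-1) ^+ 2.
Proof.
move=> /andP[p0 p2] x0 hS; have S0 : 0 <= S by apply: le_trans hS; apply: sumr_ge0 => k _; exact: powR_ge0.
have i0 : 0 < p^-1 by rewrite invr_gt0.
have xS (k : nat) : (k < K)%N -> x k <= S `^ p^-1.
  move=> kK; have h : x k `^ p <= S.
    apply: le_trans hS; rewrite (bigD1 (Ordinal kK))//= lerDl.
    by apply: sumr_ge0 => i _; exact: powR_ge0.
  have -> : x k = (x k `^ p) `^ p^-1 by rewrite -powRrM mulfV ?gt_eqF// powRr1.
  by apply: ge0_ler_powR; rewrite ?nnegrE ?powR_ge0// ltW.
have e2 : 0 <= 2 - p by lra.
have split2 y : 0 <= y -> y ^+ 2 = y `^ p * y `^ (2 - p).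
  move=> y0; have [->|yn0] := eqVneq y 0; first by rewrite expr0n powR0 ?gt_eqF// mul0r.
  by rewrite -powRD ?yn0 ?implybT// addrC subrK powR_mulrn.
apply: (@le_trans _ _ (\sum_(k < K) x k `^ p * (S `^ p^-1) `^ (2 - p))).
  apply: le_trans (@sum_nat_ge0_le (fun k => x k ^+ 2) _ _ _) _; first by move=> k; exact: sqr_ge0.
  apply: ler_sum => k _; rewrite split2//; apply: ler_wpM2l; first exact: powR_ge0.
  by apply: ge0_ler_powR; rewrite ?nnegrE ?powR_ge0// xS.
rewrite -mulr_suml; apply: (@le_trans _ _ (S * (S `^ p^-1) `^ (2 - p))).
  by apply: ler_wpM2r => //; exact: powR_ge0.
have SE : S = (S `^ p^-1) `^ p by rewrite -powRrM mulVf ?gt_eqF// powRr1.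
by rewrite {1}SE -split2// powR_ge0.
Qed.

(** Young's inequality for the terms divided by A^(1/u) and B^(1/v). The division makes A = 0 and B
    = 0 separate cases, in which every product vanishes. *)
Lemma holder_fin (a b : nat -> R) (u v A B : R) K0 K : 0 < u -> 0 < v -> u^-1 + v^-1 = 1 ->
  0 <= A -> 0 <= B -> (forall k, 0 <= a k) -> (forall k, 0 <= b k) ->
  \sum_(K0 <= k < K) a k `^ u <= A -> \sum_(K0 <= k < K) b k `^ v <= B ->
  \sum_(K0 <= k < K) a k * b k <= A `^ u^-1 * B `^ v^-1.
Proof.
move=> u0 v0 uv A0 B0 a0 b0 hA hB.
have hV (y s : R) : 0 < y -> (y^-1) `^ s = (y `^ s)^-1.
  move=> y0; have yn : y `^ s != 0 by rewrite gt_eqF ?powR_gt0.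
  by apply: (mulIf yn); rewrite mulVf// -powRM ?invr_ge0 ?(ltW y0)// mulVf ?powR1// gt_eqF.
have key X Y : 0 < X -> 0 < Y -> \sum_(K0 <= k < K) a k `^ u <= X ->
    \sum_(K0 <= k < K) b k `^ v <= Y -> \sum_(K0 <= k < K) a k * b k <= X `^ u^-1 * Y `^ v^-1.
  move=> X0 Y0 hX hY; set P := X `^ u^-1; set Q := Y `^ v^-1.
  have P0 : 0 < P by exact: powR_gt0.
  have Q0 : 0 < Q by exact: powR_gt0.
  have Pu : P `^ u = X by rewrite /P -powRrM mulVf ?gt_eqF// powRr1// ltW.
  have Qv : Q `^ v = Y by rewrite /Q -powRrM mulVf ?gt_eqF// powRr1// ltW.
  have PQ : 0 < P * Q by exact: mulr_gt0.
  rewrite -[leRHS]mul1r -ler_pdivrMr// mulr_suml.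
  apply: (@le_trans _ _ (\sum_(K0 <= k < K) (a k `^ u * (X^-1 / u) + b k `^ v * (Y^-1 / v)))).
    apply: ler_sum => k _.
    have ap : 0 <= a k / P by rewrite divr_ge0// ltW.
    have bq : 0 <= b k / Q by rewrite divr_ge0// ltW.
    have := conjugate_powR ap bq u0 v0 uv.
    have Ea : (a k / P) `^ u = a k `^ u / X by rewrite powRM ?invr_ge0 ?(ltW P0)// hV// Pu.
    have Eb : (b k / Q) `^ v = b k `^ v / Y by rewrite powRM ?invr_ge0 ?(ltW Q0)// hV// Qv.
    rewrite Ea Eb.
    rewrite (_ : a k / P * (b k / Q) = a k * b k / (P * Q)); last by field; rewrite !gt_eqF.
    by move/le_trans; apply; rewrite !mulrA.
  rewrite big_split -!mulr_suml /= -[leRHS]uv.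
  have iu : 0 < u^-1 by rewrite invr_gt0.
  have iv : 0 < v^-1 by rewrite invr_gt0.
  apply: lerD; rewrite mulrA ler_piMl ?(ltW iu) ?(ltW iv)// ler_pdivrMr// mul1r//.
have AE : 0 < 1 + A by lra.
have BE : 0 < 1 + B by lra.
have [Az|An0] := eqVneq A 0.
  have z k : (K0 <= k < K)%N -> a k = 0.
    move=> hk; have h : \sum_(K0 <= k < K) a k `^ u = 0.
      apply: le_anti; apply/andP; split; first by apply: le_trans hA _; rewrite Az.
      by apply: sumr_ge0 => i _; exact: powR_ge0.
    move/eqP : h; rewrite psumr_eq0; last by move=> i _; exact: powR_ge0.
    by move=> /allP/(_ k); rewrite mem_index_iota hk => /(_ isT) /=; rewrite powR_eq0 => /andP[/eqP].
  rewrite big_nat big1 ?mulr_ge0 ?powR_ge0// => k hk; by rewrite z// mul0r.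
have [Bz|Bn0] := eqVneq B 0.
  have z k : (K0 <= k < K)%N -> b k = 0.
    move=> hk; have h : \sum_(K0 <= k < K) b k `^ v = 0.
      apply: le_anti; apply/andP; split; first by apply: le_trans hB _; rewrite Bz.
      by apply: sumr_ge0 => i _; exact: powR_ge0.
    move/eqP : h; rewrite psumr_eq0; last by move=> i _; exact: powR_ge0.
    by move=> /allP/(_ k); rewrite mem_index_iota hk => /(_ isT) /=; rewrite powR_eq0 => /andP[/eqP].
  rewrite big_nat big1 ?mulr_ge0 ?powR_ge0// => k hk; by rewrite z// mulr0.
by apply: key => //; rewrite lt_neqAle eq_sym ?An0 ?Bn0.
Qed.

Section FixedSymbol.
Variables (g : Cx R -> Cx R) (c : nat -> Cx R).
Hypothesis gc : has_ps 1 (cderiv g) c.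
Local Notation T := (hilbert_op g).

(** The operator bound tested on [tsum]. The weights stay free: an indicator gives [bet_le], a power
    of [bet] gives [bet_sum_le]. *)
Lemma mom_blocks_lower p M K (a : nat -> R) : 1 < p -> op_bound p%:E 2%:E T M ->
  (forall k, 0 <= a k) ->
  \sum_(k < K) (bet p c k * a k) ^+ 2 <= (64 * M * Ctest p * (\sum_(k < K) a k `^ p) `^ p^-1) ^+ 2.
Proof.
move=> p1 hM a0; have p1' : (1 <= p%:E)%E by rewrite lee_fin ltW.
have M0 := op_bound_ge0 p1' hM.
have hF := tsum_HB K p1 a0; have hr := HB_rad p1' hF.
have := (op_boundP gc p1' M0).1 hM _ _ hF ((2 ^ K).-1).
rewrite -(big_mkord xpredT (fun n => cmod (c n * mom (tsum p K a) n) ^+ 2)).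
rewrite (@block_sum R _ 0 K)// big_mkord => h.
set X := (\sum_(k < K) _ `^ p) `^ _ in h *.
have -> : (64 * M * Ctest p * X) ^+ 2 = 64 ^+ 2 * (M * (Ctest p * X)) ^+ 2.
  by move: (Ctest p) => C; ring.
rewrite -ler_pdivrMl ?exprn_gt0//; apply: le_trans h.
rewrite mulr_sumr; apply: ler_sum => k _.
rewrite [X in _ * X]exprMn.
have -> : (64 ^+ 2)^-1 * (bet p c k ^+ 2 * a k ^+ 2) = blk c k * (a k * 2 `^ (- ((1 - p^-1) * k%:R)) / 64) ^+ 2.
  rewrite (blkE p) -exprMn -exprVn -!exprMn; congr (_ ^+ 2).
  rewrite powRN; have : 2 `^ ((1 - p^-1) * k%:R) != 0 :> R by rewrite gt_eqF// powR_gt0.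
  by move: (2 `^ _) => y yn0; field.
rewrite /blk mulr_suml !big_nat; apply: ler_sum => n /andP[n1 n2].
rewrite cmodM [X in _ <= X]exprMn; apply: ler_wpM2l; first exact: sqr_ge0.
apply: lerXn2r; rewrite ?nnegrE ?cmod_ge0//.
  by rewrite divr_ge0// mulr_ge0 ?powR_ge0.
exact: (tsum_mom_ge a0 hr (ltn_ord k) n2).
Qed.

Lemma bet_le p M k : 1 < p -> op_bound p%:E 2%:E T M -> bet p c k <= 64 * M * Ctest p.
Proof.
move=> p1 hM; have p1' : (1 <= p%:E)%E by rewrite lee_fin ltW.
have p0 : 0 < p by lra.
have M0 := op_bound_ge0 p1' hM.
have := @mom_blocks_lower p M k.+1 (fun j => (j == k)%:R) p1 hM (fun _ => ler0n _ _).
have -> : \sum_(j < k.+1) (j == k :> nat)%:R `^ p = 1 :> R.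
  rewrite (bigD1 ord_max)//= eqxx powR1 big1 ?addr0// => j jk.
  have /negbTE jk' : val j != k by exact: jk.
  by rewrite jk' powR0// gt_eqF.
rewrite powR1 mulr1 (bigD1 ord_max)//= eqxx mulr1 => h.
have h1 : bet p c k ^+ 2 <= (64 * M * Ctest p) ^+ 2.
  by apply: le_trans h; rewrite lerDl; apply: sumr_ge0 => j _; exact: sqr_ge0.
have C0 : 0 <= Ctest p.
  by have [_ + _] := tsum_HB 1 p1 (fun _ => ler01); rewrite big_ord1 powR1 powR1 mulr1.
have W0 := mulr_ge0 (mulr_ge0 (ler0n R 64) M0) C0.
by rewrite -(@ler_sqr _ (bet p c k)) ?nnegrE ?bet_ge0.
Qed.

(** The weights bet^(pt/p) are extremal for Hoelder's inequality: both sums in [mom_blocks_lower]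
    become S, and S <= W^2 S^(2/p) is solved for S by 2/pt + 2/p = 1. *)
Lemma bet_sum_le p pt M K : 2 < p -> pt^-1 = 2^-1 - p^-1 -> op_bound p%:E 2%:E T M ->
  \sum_(k < K) bet p c k `^ pt <= (64 * M * Ctest p) `^ pt.
Proof.
move=> p2 hpt hM; have p1 : 1 < p by lra.
have p1' : (1 <= p%:E)%E by rewrite lee_fin ltW.
have p0 : 0 < p by lra.
have i0 : 0 < p^-1 by rewrite invr_gt0.
have i2 : p^-1 < 2^-1 by rewrite ltf_pV2 ?posrE.
have pt0 : 0 < pt by rewrite -invr_gt0 hpt; lra.
have M0 := op_bound_ge0 p1' hM.
have C0 : 0 <= Ctest p.
  by have [_ + _] := tsum_HB 1 p1 (fun _ => ler01); rewrite big_ord1 powR1 powR1 mulr1.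
have ptE : 1 + pt / p = pt / 2.
  have : pt * pt^-1 = 1 by rewrite mulfV// gt_eqF.
  by rewrite hpt; lra.
set S := \sum_(k < K) _; set W := 64 * M * Ctest p.
have W0 : 0 <= W := mulr_ge0 (mulr_ge0 (ler0n R 64) M0) C0.
have S0 : 0 <= S by apply: sumr_ge0 => k _; exact: powR_ge0.
have := @mom_blocks_lower p M K (fun j => bet p c j `^ (pt / p)) p1 hM (fun _ => powR_ge0 _ _).
have -> : \sum_(k < K) (bet p c k `^ (pt / p)) `^ p = S.
  by apply: eq_bigr => k _; rewrite -powRrM divfK// gt_eqF.
have -> : \sum_(k < K) (bet p c k * bet p c k `^ (pt / p)) ^+ 2 = S.
  apply: eq_bigr => k _; have b0 := bet_ge0 p c k.
  have [->|bn0] := eqVneq (bet p c k) 0; first by rewrite mul0r expr0n powR0// gt_eqF.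
  rewrite -{1}(powRr1 b0) -powRD ?bn0 ?implybT// ptE -powR_mulrn ?powR_ge0// -powRrM.
  by rewrite divfK.
rewrite -/W => h.
have [->|Sn0] := eqVneq S 0; first exact: powR_ge0.
have Sp : 0 < S by rewrite lt_neqAle eq_sym Sn0.
have h2 : (S `^ pt^-1) ^+ 2 <= W ^+ 2.
  rewrite exprMn powR_2Vp// in h; rewrite powR_2Vp//.
  have h3 : S = S `^ (2 / pt) * S `^ (2 / p).
    rewrite -powRD ?Sn0 ?implybT// (_ : 2 / pt + 2 / p = 1) ?powRr1//.
    by rewrite hpt; field; rewrite gt_eqF.
  rewrite {1}h3 in h; move: h; rewrite ler_pM2r//; exact: powR_gt0.
have h4 : S `^ pt^-1 <= W by rewrite -(@ler_sqr _ (S `^ pt^-1)) ?nnegrE ?powR_ge0.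
have -> : S = (S `^ pt^-1) `^ pt by rewrite -powRrM mulVf ?gt_eqF// powRr1.
by apply: ge0_ler_powR; rewrite ?nnegrE ?powR_ge0// ltW.
Qed.

Definition Cup p : R := Cmom p `^ p^-1.

(** x k is 2^(k / p') times the largest moment on block k; its l^p bound is all that is kept of
    f. *)
Lemma mom_norm_le p f B : 1 < p -> HB p%:E f B -> exists2 x : nat -> R, (forall k, 0 <= x k) &
  (forall K, (\sum_(k < K) x k `^ p) <= (Cup p * B) `^ p) /\
  forall K0 K, (K0 <= K)%N ->
  \sum_((2 ^ K0).-1 <= m < (2 ^ K).-1) cmod (c m * mom f m) ^+ 2 <=
  \sum_(K0 <= k < K) bet p c k ^+ 2 * x k ^+ 2.
Proof.
move=> p1 [hf B0 hB]; have p0 : 0 < p by lra.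
have [n hn hm] := mom_block_sum f c.
exists (fun k => 2 `^ ((1 - p^-1) * k%:R) * cmod (mom f (n k))).
  by move=> k; rewrite mulr_ge0 ?powR_ge0 ?cmod_ge0.
split=> [K|K0 K hK].
  apply: le_trans (mom_dyadic K p1 B0 hf hB hn) _.
  rewrite powRM ?powR_ge0// /Cup -powRrM mulVf ?gt_eqF// powRr1//; exact: Cmom_ge0.
apply: le_trans (hm K0 K hK) _; apply: ler_sum => k _.
by rewrite le_eqVlt; apply/orP; left; apply/eqP; rewrite (blkE p); ring.
Qed.

Lemma powR_rootK (x p : R) : 0 <= x -> 0 < p -> (x `^ p) `^ p^-1 = x.
Proof. by move=> x0 p0; rewrite -powRrM mulfV ?gt_eqF// powRr1. Qed.

(** The supremum of beta times the l^2 norm of x, which its l^p norm bounds for p <= 2. The start K0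
    is free: K0 = 0 gives boundedness, large K0 gives small tails. *)
Lemma blocks_upper2 p b K0 f B : 1 < p <= 2 -> (forall k, (K0 <= k)%N -> bet p c k <= b) ->
  HB p%:E f B -> forall N, \sum_((2 ^ K0).-1 <= m < N) cmod (c m * mom f m) ^+ 2 <= (Cup p * b * B) ^+ 2.
Proof.
move=> /andP[p1 p2] hb hf N; have p0 : 0 < p by lra.
have [x x0 [hx hsum]] := mom_norm_le p1 hf; have [_ B0 _] := hf.
have b0 : 0 <= b by exact: le_trans (bet_ge0 p c K0) (hb K0 (leqnn _)).
have CB : 0 <= Cup p * B by rewrite mulr_ge0 ?powR_ge0.
pose K := maxn K0 N.
apply: (@le_trans _ _ (\sum_((2 ^ K0).-1 <= m < (2 ^ K).-1) cmod (c m * mom f m) ^+ 2)).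
  have NK : (N <= (2 ^ K).-1)%N.
    rewrite -ltnS prednK ?expn_gt0//.
    by apply: leq_ltn_trans (leq_maxr K0 N) _; exact: ltn_expl.
  case: (leqP (2 ^ K0).-1 N) => h.
    rewrite [leRHS](@big_cat_nat _ _ _ N)//= lerDl; apply: sumr_ge0 => n _; exact: sqr_ge0.
  rewrite big_geq ?(ltnW h)//; apply: sumr_ge0 => n _; exact: sqr_ge0.
apply: le_trans (hsum K0 K (leq_maxl _ _)) _.
apply: (@le_trans _ _ (b ^+ 2 * \sum_(K0 <= k < K) x k ^+ 2)).
  rewrite mulr_sumr !big_nat; apply: ler_sum => k /andP[hk _].
  apply: ler_wpM2r; first exact: sqr_ge0.
  by apply: lerXn2r; rewrite ?nnegrE ?bet_ge0// hb.
rewrite (_ : Cup p * b * B = b * (Cup p * B)) 1?exprMn; last by ring.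
apply: ler_wpM2l; first exact: sqr_ge0.
have p02 : 0 < p <= 2 by rewrite p0.
apply: le_trans (sum_sq_le K0 p02 x0 (hx K)) _.
by rewrite powR_rootK.
Qed.

(** Hoelder's inequality for beta^2 and x^2 with the conjugate exponents pt / 2 and p / 2. *)
Lemma blocks_upper_gt2 p pt b K0 f B : 2 < p -> pt^-1 = 2^-1 - p^-1 -> 0 <= b ->
  (forall K, \sum_(K0 <= k < K) bet p c k `^ pt <= b `^ pt) ->
  HB p%:E f B -> forall N, \sum_((2 ^ K0).-1 <= m < N) cmod (c m * mom f m) ^+ 2 <= (Cup p * b * B) ^+ 2.
Proof.
move=> p2 hpt b0 hb hf N; have p1 : 1 < p by lra.
have p0 : 0 < p by lra.
have i0 : 0 < p^-1 by rewrite invr_gt0.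
have i2 : p^-1 < 2^-1 by rewrite ltf_pV2 ?posrE.
have pt0 : 0 < pt by rewrite -invr_gt0 hpt; lra.
have [x x0 [hx hsum]] := mom_norm_le p1 hf; have [_ B0 _] := hf.
have CB : 0 <= Cup p * B by rewrite mulr_ge0 ?powR_ge0.
pose K := maxn K0 N.
apply: (@le_trans _ _ (\sum_((2 ^ K0).-1 <= m < (2 ^ K).-1) cmod (c m * mom f m) ^+ 2)).
  have NK : (N <= (2 ^ K).-1)%N.
    rewrite -ltnS prednK ?expn_gt0//.
    by apply: leq_ltn_trans (leq_maxr K0 N) _; exact: ltn_expl.
  case: (leqP (2 ^ K0).-1 N) => h.
    rewrite [leRHS](@big_cat_nat _ _ _ N)//= lerDl; apply: sumr_ge0 => n _; exact: sqr_ge0.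
  rewrite big_geq ?(ltnW h)//; apply: sumr_ge0 => n _; exact: sqr_ge0.
apply: le_trans (hsum K0 K (leq_maxl _ _)) _.
have pw2 (y q : R) : 0 <= y -> (y ^+ 2) `^ (q / 2) = y `^ q.
  by move=> y0; rewrite -powR_mulrn// -powRrM mulrCA mulfV ?mulr1.
have uv : (pt / 2)^-1 + (p / 2)^-1 = 1.
  by rewrite !invfM invrK hpt; field; rewrite gt_eqF.
have h := @holder_fin (fun k => bet p c k ^+ 2) (fun k => x k ^+ 2) (pt / 2) (p / 2)
  (b `^ pt) ((Cup p * B) `^ p) K0 K (divr_gt0 pt0 _) (divr_gt0 p0 _) uv (powR_ge0 _ _) (powR_ge0 _ _)
  (fun _ => sqr_ge0 _) (fun _ => sqr_ge0 _).
apply: le_trans (h _ _ _ _) _ => //.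
- by under eq_bigr do rewrite pw2 ?bet_ge0//.
- under eq_bigr do rewrite pw2//.
  by apply: le_trans (sum_nat_ge0_le _ _ _) (hx K) => k; exact: powR_ge0.
rewrite -!powRrM !invfM !invrK !mulrA !mulfV ?gt_eqF// !mul1r.
rewrite -!powR_mulrn ?mulr_ge0 ?powR_ge0//.
have -> : Cup p * b * B = b * (Cup p * B) by ring.
by rewrite (powRM _ b0 CB).
Qed.

End FixedSymbol.

End InteriorCases.

(** * A weak-type bound in Stolz angles *)

Section StolzKernel.
Context {R : realType}.
Implicit Types (f g h : Cx R -> Cx R) (z w : Cx R) (c : R) (r s t x y u M B L eta kap rho : R).
Local Notation mu := (@lebesgue_measure R).

Lemma le_cos x y : 0 <= x -> x <= y -> y <= pi -> cos y <= cos x.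
Proof.
move=> x0; rewrite le_eqVlt => /orP[/eqP -> //|xy] ypi; apply: ltW.
by rewrite ltr_cos// in_itv /=; apply/andP; split; lra.
Qed.

Lemma sin_ge_cos (w : R) : 0 <= w <= pi -> w * cos w <= sin w.
Proof.
move=> /andP[w0 wpi].
have cc a b : rcontI a b (cos : R -> R) by move=> t _; exact: continuous_cos.
have hd (t : R) : is_derive t (1 : R) (sin : R -> R) (cos t) by exact: is_derive_sin.
have := rint_FTC w0 (cc 0 w) hd; rewrite sin0 subr0 => <-.
rewrite mulrC -[w in X in _ * X]subr0 -rint_cst//; apply: le_rint => //.
  by move=> t _; exact: cvg_cst.
by move=> t /andP[t0 tw]; apply: le_cos.
Qed.

(** The parameter interval misjudges distances where 0 and 2 pi meet; keeping x at distance d from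
    both ends bounds |y - x| by 2 pi - d. Halving the angle twice reduces the claim to w cos w <=
    sin w. *)
Lemma chord_lower d : 0 < d <= pi -> exists2 c, 0 < c & forall x y, d <= x <= 2 * pi - d ->
  0 <= y <= 2 * pi -> c * `|y - x| <= cmod (ei y - ei x).
Proof.
move=> /andP[d0 dpi]; have p0 := pi_gt0 R.
pose c1 : R := cos (pi / 4); pose c2 := cos (pi / 2 - d / 4).
have c10 : 0 < c1 by apply: cos_gt0_pihalf; apply/andP; split; lra.
have c20 : 0 < c2 by apply: cos_gt0_pihalf; apply/andP; split; lra.
have key u : 0 <= u <= 2 * pi - d -> c1 ^+ 2 * c2 / 2 * u <= sin (u / 2).
  move=> /andP[u0 u1].
  have a1 : c1 <= cos (u / 8) by apply: le_cos; lra.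
  have a2 : c2 <= cos (u / 4) by apply: le_cos; lra.
  have h1 : u / 8 * cos (u / 8) <= sin (u / 8) by apply: sin_ge_cos; apply/andP; split; lra.
  have h2 : u / 8 * c1 <= sin (u / 8) by apply: le_trans h1; apply: ler_wpM2l => //; lra.
  have h3 : u / 4 * c1 ^+ 2 <= sin (u / 4).
    have -> : u / 4 = u / 8 + u / 8 by field.
    rewrite sinD [cos _ * sin _]mulrC; have h : u / 8 * c1 * c1 <= sin (u / 8) * cos (u / 8).
      by apply: ler_pM => //; rewrite ?mulr_ge0 ?(ltW c10)//; lra.
    by rewrite expr2 mulrA; lra.
  have -> : u / 2 = u / 4 + u / 4 by field.
  rewrite sinD [cos _ * sin _]mulrC; have h : u / 4 * c1 ^+ 2 * c2 <= sin (u / 4) * cos (u / 4).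
    by apply: ler_pM => //; rewrite ?mulr_ge0 ?sqr_ge0 ?(ltW c20)//; lra.
  by move: h; set a := c1 ^+ 2; lra.
have cc0 : 0 < c1 ^+ 2 * c2 by rewrite mulr_gt0// exprn_gt0.
exists (c1 ^+ 2 * c2) => // x y /andP[x0 x1] /andP[y0 y1].
set v := `|y - x|; have v0 : 0 <= v by exact: normr_ge0.
have v1 : v <= 2 * pi - d by rewrite ler_norml; apply/andP; split; lra.
have hv := key v; rewrite v0 v1 in hv; have {}hv := hv isT.
have sq : cmod (ei y - ei x) ^+ 2 = (2 * sin (v / 2)) ^+ 2.
  have -> : cmod (ei y - ei x) = cmod (1 - ei (y - x)).
    rewrite -[RHS]mul1r -(cmod_ei x) -cmodM mulrBr mulr1 -eiD.
    have -> : x + (y - x) = y by ring.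
    by rewrite cmodC.
  rewrite sin_half exprMn; have -> : (2 : R) ^+ 2 = 4 by ring.
  congr (_ * _); rewrite /v; case: (ger0P (y - x)) => // _.
  by rewrite mulNr sinN sqrrN.
have s0 : 0 <= 2 * sin (v / 2).
  by rewrite mulr_ge0//; apply: le_trans hv; rewrite mulr_ge0// divr_ge0// ltW.
have e : cmod (ei y - ei x) = 2 * sin (v / 2).
  by apply/eqP; rewrite -(@eqrXn2 _ 2%N) ?cmod_ge0// sq.
rewrite e; lra.
Qed.

(** The radius rho lies beyond the midpoint of |z| and 1, so the circle keeps distance eta / 2 from
    z, which gives the first bound. Far from x the Stolz condition makes the chord from x to y at
    most twice the distance to z, which gives the second. *)
Lemma poisson_stolz c s x y z rho : 0 < c -> 1 < s -> c * `|y - x| <= cmod (ei y - ei x) ->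
  cmod z < 1 -> cmod (z - ei x) < s * (1 - cmod z) ->
  1 - (1 - cmod z) / 2 <= rho < 1 ->
  poisson rho z y <= 8 / (1 - cmod z) /\
  (2 * (s + 1) / c * (1 - cmod z) <= `|y - x| ->
   poisson rho z y <= 8 * (1 - cmod z) / (c * `|y - x|) ^+ 2).
Proof.
move=> c0 s1 hc z1 hz /andP[rz r1]; set eta := 1 - cmod z in hz rz *.
have e0 : 0 < eta by rewrite subr_gt0.
have zr : cmod z < rho by rewrite /eta in rz e0; lra.
have r0 := le_lt_trans (cmod_ge0 z) zr.
have num : rho ^+ 2 - cmod z ^+ 2 <= 2 * eta by rewrite /eta; have := cmod_ge0 z; nra.
have num0 : 0 <= rho ^+ 2 - cmod z ^+ 2 by have := cmod_ge0 z; nra.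
have dc : cmod (circle rho y) = rho by rewrite cmod_circle ger0_norm// ltW.
have low (m : R) : 0 < m -> m <= cmod (circle rho y - z) -> poisson rho z y <= 2 * eta / m ^+ 2.
  move=> m0 hm; rewrite /poisson; apply: ler_pM => //.
    by rewrite invr_ge0 sqr_ge0.
  rewrite lef_pV2 ?posrE ?exprn_gt0//; last exact: lt_le_trans hm.
  by apply: lerXn2r; rewrite ?nnegrE ?(ltW m0) ?cmod_ge0.
split.
  have -> : 8 / eta = 2 * eta / (eta / 2) ^+ 2 by field; rewrite gt_eqF.
  apply: low; first by rewrite divr_gt0.
  have := cmodD (circle rho y - z) z; rewrite subrK dc /eta; rewrite /eta in rz; lra.
rewrite mulrAC ler_pdivrMr// => hk.
have u0 : 0 < `|y - x|.
  rewrite -(pmulr_lgt0 _ c0); apply: lt_le_trans hk.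
  by rewrite mulr_gt0// mulr_gt0//; lra.
have cu : 0 < c * `|y - x| by exact: mulr_gt0.
have -> : 8 * eta / (c * `|y - x|) ^+ 2 = 2 * eta / (c * `|y - x| / 2) ^+ 2.
  by field; rewrite !gt_eqF.
apply: low; first by rewrite divr_gt0.
have t1 : cmod (ei y - ei x) <= cmod (circle rho y - z) + (cmod (z - ei x) + (1 - rho)).
  have -> : ei y - ei x = (circle rho y - z) + ((z - ei x) + (ei y - circle rho y)) by ring.
  apply: le_trans (cmodD _ _) _; rewrite lerD2l; apply: le_trans (cmodD _ _) _; rewrite lerD2l.
  have -> : ei y - circle rho y = rc (1 - rho) * ei y by rewrite circleE rcB mulrBl mul1r.
  by rewrite cmodM cmod_ei mulr1 cmod_rc ger0_norm// subr_ge0 ltW.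
by rewrite mulrC in hk; nra.
Qed.

(** Intervals of radius 2^j kap eta about x are exhausted one doubling at a time. Each doubling
    divides the bound on K by 4 and doubles that on the integral of F, so the contributions halve;
    the factor 1 - 2^-j records their geometric sum. *)
Lemma maximal_bound (F K : R -> R) c x eta kap L : 0 < c -> 0 < eta -> 0 < kap -> 0 <= x <= 2 * pi -> 0 <= L ->
  rcont F -> (forall y, 0 <= F y) -> rcont K -> (forall y, 0 <= K y) ->
  (forall b, 0 < b -> rint (Num.max 0 (x - b)) (Num.min (2 * pi) (x + b)) F <= 2 * b * L) ->
  (forall y, 0 <= y <= 2 * pi -> K y <= 8 / eta) ->
  (forall y, 0 <= y <= 2 * pi -> kap * eta <= `|y - x| -> K y <= 8 * eta / (c * `|y - x|) ^+ 2) ->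
  rint 0 (2 * pi) (fun y => F y * K y) <= (16 * kap + 64 / (c ^+ 2 * kap)) * L.
Proof.
move=> c0 e0 k0 /andP[x0 x1] L0 cF F0 cK K0 hF hK1 hK2; have p0 := pi_gt0 R.
pose b j := (2 ^ j)%:R * (kap * eta).
have ke : 0 < kap * eta by exact: mulr_gt0.
have b0 j : 0 < b j by rewrite mulr_gt0// ltr0n expn_gt0.
have bS j : b j.+1 = 2 * b j by rewrite /b expnS natrM -mulrA.
pose l j := Num.max 0 (x - b j); pose r j := Num.min (2 * pi) (x + b j).
have lP j : [/\ 0 <= l j, l j <= x & x - b j <= l j].
  by rewrite /l; split; rewrite ?le_max ?ge_max ?lexx ?orbT ?x0//= gerBl ltW.
have rP j : [/\ r j <= 2 * pi, x <= r j & r j <= x + b j].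
  by rewrite /r; split; rewrite ?le_min ?ge_min ?lexx ?orbT ?x1//= lerDl ltW.
have lS j : l j.+1 <= l j.
  rewrite /l ge_max le_max lexx /= le_max; apply/orP; right; rewrite bS; have := b0 j; lra.
have rS j : r j <= r j.+1.
  rewrite /r le_min ge_min lexx /= ge_min; apply/orP; right; rewrite bS; have := b0 j; lra.
have cFK : rcont (fun y => F y * K y) by exact: rcont_mul.
have bnd a a' v : 0 <= a -> a <= a' -> a' <= 2 * pi -> (forall y, a <= y <= a' -> K y <= v) ->
    rint a a' (fun y => F y * K y) <= v * rint a a' F.
  move=> a0 aa a1 h; rewrite -(rintZ _ (@rcontW R a a' F cF)); apply: le_rint.
  - exact: rcontW.
  - by apply: rcontW; exact: rcont_mul (@rcont_cst R v) cF.
  - by move=> y hy; rewrite mulrC; apply: ler_wpM2r => //; exact: h.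
have F00 a a' : a <= a' -> 0 <= rint a a' F.
  move=> aa; rewrite -[leLHS](mul0r (a' - a)) -rint_cst//; apply: le_rint => [t _||y _]; [exact: cvg_cst|exact: rcontW|exact: F0].
have main j : rint (l j) (r j) (fun y => F y * K y) <=
    (16 * kap + 64 / (c ^+ 2 * kap) * (1 - dy j)) * L.
  elim: j => [|j IH].
    have [l0 l1 l2] := lP 0%N; have [r0 r1 r2] := rP 0%N.
    rewrite /dy expr0 subrr mulr0 addr0.
    apply: le_trans (bnd _ _ (8 / eta) l0 (le_trans l1 r1) r0 _) _.
      by move=> y /andP[h1 h2]; apply: hK1; rewrite (le_trans l0 h1) (le_trans h2 r0).
    have h := hF _ (b0 0%N); apply: (@le_trans _ _ (8 / eta * (2 * b 0%N * L))).
      by apply: ler_wpM2l h; rewrite divr_ge0// ltW.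
    rewrite le_eqVlt; apply/orP; left; apply/eqP; rewrite /b expn0 mul1r; field; by rewrite gt_eqF.
  have [l0 l1 l2] := lP j.+1; have [r0 r1 r2] := rP j.+1.
  have [l0' l1' l2'] := lP j; have [r0' r1' r2'] := rP j.
  have lj := lS j; have rj := rS j.
  pose v := 8 * eta / (c * b j) ^+ 2.
  have v0 : 0 <= v by rewrite divr_ge0 ?sqr_ge0// mulr_ge0// ltW.
  have hv y : 0 <= y <= 2 * pi -> b j <= `|y - x| -> K y <= v.
    move=> hy hb; have kb : kap * eta <= b j by rewrite /b ler_peMl ?(ltW ke)// ler1n expn_gt0.
    apply: le_trans (hK2 y hy (le_trans kb hb)) _; apply: ler_wpM2l; first by rewrite mulr_ge0// ltW.
    have cb : 0 < c * b j by rewrite mulr_gt0.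
    have cu : c * b j <= c * `|y - x| by rewrite ler_pM2l.
    rewrite lef_pV2 ?posrE ?exprn_gt0//; last exact: lt_le_trans cu.
    by apply: lerXn2r; rewrite ?nnegrE ?(ltW cb)// (le_trans (ltW cb)).
  have sp (G : R -> R) : rcont G -> rint (l j.+1) (r j.+1) G =
      rint (l j.+1) (l j) G + (rint (l j) (r j) G + rint (r j) (r j.+1) G).
    move=> cG; rewrite (@rint_split R _ _ (l j)); [|by rewrite lj (le_trans l1' (le_trans r1' rj))|exact: rcontW].
    by rewrite (@rint_split R (l j) _ (r j)); [|by rewrite rj (le_trans l1' r1')|exact: rcontW].
  rewrite (sp _ cFK).
  have hL : rint (l j.+1) (l j) (fun y => F y * K y) <= v * rint (l j.+1) (l j) F.
    have [->|ne] := eqVneq (l j.+1) (l j); first by rewrite rint.unlock !set_itv1 !Rintegral_set1 mulr0.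
    apply: bnd => //; first exact: le_trans l1' x1.
    move=> y /andP[h1 h2]; apply: hv.
      by rewrite (le_trans l0 h1) (le_trans h2 (le_trans l1' x1)).
    have lE : l j = x - b j.
      rewrite /l; case: leP => // h; exfalso; move/eqP : ne; apply.
      apply/eqP; rewrite eq_le lj /=; rewrite /l (max_l (ltW h)); exact: l0.
    by rewrite distrC ler_normr lerBrDr -lerBrDl -lE h2.
  have hR : rint (r j) (r j.+1) (fun y => F y * K y) <= v * rint (r j) (r j.+1) F.
    have [->|ne] := eqVneq (r j) (r j.+1); first by rewrite rint.unlock !set_itv1 !Rintegral_set1 mulr0.
    apply: bnd => //; first exact: le_trans x0 r1'.
    move=> y /andP[h1 h2]; apply: hv.
      by rewrite (le_trans (le_trans x0 r1') h1) (le_trans h2 r0).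
    have rE : r j = x + b j.
      rewrite /r; case: leP => // h; exfalso; move/eqP : ne; apply.
      apply/eqP; rewrite eq_le rj /=; rewrite /r (min_l h); exact: r0.
    by rewrite ler_normr lerBrDl -rE h1.
  have hFj := hF _ (b0 j.+1).
  have eF := sp _ cF.
  have hF' : rint (l j.+1) (l j) F + rint (r j) (r j.+1) F <= 2 * b j.+1 * L.
    apply: le_trans hFj; by rewrite eF addrCA lerDr; exact: F00 (le_trans l1' r1').
  have hv2 : v * (2 * b j.+1 * L) = 64 / (c ^+ 2 * kap) * (dy j / 2) * L.
    have dE : dy j = (2 ^ j)%:R^-1 :> R by rewrite -dyV invrK.
    rewrite /v bS /b dE; have : (2 ^ j)%:R != 0 :> R by rewrite pnatr_eq0 expn_eq0.
    by move: (2 ^ j)%:R => q qn0; field; rewrite qn0 !gt_eqF.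
  have := ler_wpM2l v0 hF'; rewrite hv2 mulrDr dyS.
  by move: IH hL hR; set A := rint _ _ _; set B := rint (l j.+1) _ _; set C := rint (r j) _ _; lra.
have [j hj] : exists j, 2 * pi <= b j.
  exists (Num.truncn (2 * pi / (kap * eta))).+1.
  rewrite /b -ler_pdivrMr//; apply: le_trans (ltW (truncnS_gt _)) _.
  by rewrite ler_nat ltnW// ltn_expl.
have := main j; rewrite {1}/l {1}/r.
have -> : Num.max 0 (x - b j) = 0 by apply/max_idPl; lra.
have -> : Num.min (2 * pi) (x + b j) = 2 * pi by apply/min_idPl; lra.
move/le_trans; apply; apply: ler_wpM2r => //; rewrite lerD2l; apply: ler_piMr.
  by rewrite divr_ge0// mulr_ge0 ?sqr_ge0// ltW.
by have := dy_gt0 (R := R) j; lra.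
Qed.

Lemma HL_avg (F : R -> R) (x b L : R) : rcont F -> (forall y, 0 <= F y) -> 0 < b ->
  (HL_maximal (F \_ `[0%R, (2 * pi)%R]) x <= L%:E)%E ->
  rint (Num.max 0 (x - b)) (Num.min (2 * pi) (x + b)) F <= 2 * b * L.
Proof.
move=> cF F0 b0 hL; set l := Num.max _ _; set r := Num.min _ _.
have mF (D : set R) : measurable_fun D (fun y => (F y)%:E).
  apply/measurable_EFinP; apply: measurable_funTS; apply: continuous_measurable_fun; exact: cF.
have : (iavg (F \_ `[0%R, (2 * pi)%R]) (ball x b) <= L%:E)%E.
  by apply: le_trans hL; apply: ereal_sup_ubound; exists b => //=; rewrite in_itv /= b0.
rewrite iavg_restrict//; last exact: measurable_ball.
rewrite lebesgue_measure_ball ?(ltW b0)// -[b *+ 2]mulr_natl inver mulf_eq0 pnatr_eq0 /= gt_eqF//.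
set I := (\int[_]_(_ in _) _)%E.
have hI : ((rint l r F)%:E <= I)%E.
  rewrite -(@integral_rint R l r F) ?/rcontI; last by move=> t _; exact: cF.
  case: (leP r l) => hlr.
    have -> : (\int[mu]_(t in `[l, r]) (F t)%:E = 0)%E.
      move: hlr; rewrite le_eqVlt => /orP[/eqP ->|h]; first by rewrite set_itv1 integral_set1.
      by rewrite set_itv_ge ?integral_set0// bnd_simp -ltNge.
    by apply: integral_ge0.
  rewrite integral_itv_bndoo; last exact: mF.
  have -> : I = (\int[mu]_(y in `[0%R, (2 * pi)%R] `&` ball x b) (F y)%:E)%E.
    by apply: eq_integral => y _; rewrite ger0_norm.
  apply: ge0_subset_integral => //.
  - by apply: measurableI => //; exact: measurable_ball.
  - exact: mF.
  - by move=> y _; rewrite lee_fin.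
  move=> y /=; rewrite in_itv /= /l /r gt_max lt_min => /andP[/andP[h1 h2] /andP[h3 h4]]; split.
    by rewrite in_itv /= !ltW.
  by rewrite /ball /= ltr_distlC; apply/andP; split; lra.
move=> h; have : ((2 * b)^-1%:E * (rint l r F)%:E <= L%:E)%E.
  by apply: le_trans h; apply: lee_wpmul2l => //; rewrite lee_fin invr_ge0 mulr_ge0// ltW.
by rewrite -EFinM lee_fin mulrC ler_pdivrMr ?mulr_gt0// mulrC.
Qed.

Lemma rmean_le_l2 (t : Cx R -> Cx R) (A : nat -> Cx R) (e r : R) : has_ps 1 t A -> 0 <= e ->
  (forall N, \sum_(n < N) cmod (A n) ^+ 2 <= e ^+ 2) -> 0 < r < 1 ->
  rmean (fun x => cmod (t (circle r x))) <= e.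
Proof.
move=> ht e0 hA hr; have h2 := (hardy2P ht e0).2 hA.
have ha : analytic t := has_ps_dan ht.
have h12 : (1 : R) <= 2 by rewrite ler1n.
have := (hardy_pP ltr01 e0 ha).1 (hardy_mono h12 e0 ha h2) r hr.
by rewrite powRr1//; under rmeanE do rewrite powRr1 ?cmod_ge0//.
Qed.

(** Boundary values of t are not yet at hand, so the maximal inequality is applied on the circles of
    radius [rho j]. A point escapes the exceptional set when infinitely many j have a small maximal
    function there, and for a given z one such j with [rho j] close enough to 1 suffices. *)
Lemma weak_type (s d : R) : 1 < s -> 0 < d <= pi -> exists2 C : R, 0 < C &
  forall (t : Cx R -> Cx R) (A : nat -> Cx R) (e lam : R), has_ps 1 t A -> 0 <= e ->
  (forall N, \sum_(n < N) cmod (A n) ^+ 2 <= e ^+ 2) -> 0 < lam ->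
  exists E : set R, [/\ measurable E, (mu E <= (C * e / lam)%:E)%E &
    forall x, d <= x <= 2 * pi - d -> ~ E x -> forall z, stolz s (circle 1 x) z -> cmod (t z) <= lam].
Proof.
move=> s1 hd; have p0 := pi_gt0 R; have [d0 d1] := andP hd.
have [c c0 hc] := chord_lower hd.
pose kap := 2 * (s + 1) / c; have k0 : 0 < kap by rewrite divr_gt0// mulr_gt0//; lra.
pose C0 := 16 * kap + 64 / (c ^+ 2 * kap).
have C00 : 0 < C0.
  by apply: addr_gt0; [exact: mulr_gt0|rewrite divr_gt0// mulr_gt0// exprn_gt0].
exists (3 * C0); first exact: mulr_gt0.
move=> t A e lam ht e0 hA lam0.
have ha : analytic t := has_ps_dan ht.
pose lam' := 2 * pi * lam / C0.
have lam'0 : 0 < lam' by rewrite divr_gt0// !mulr_gt0.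
pose rho j : R := 1 - dy j.+1; pose F j x := cmod (t (circle (rho j) x)).
have rho01 j : 0 < rho j < 1.
  have := dy_gt0 (R := R) j.+1; have := dy_le1 (R := R) j; rewrite /rho dyS => *.
  by apply/andP; split; lra.
have cF j : rcont (F j).
  by apply: rcont_cmod; apply: (dan_ccont ha); case/andP: (rho01 j) => /ltW -> ->.
have F0 j y : 0 <= F j y by exact: cmod_ge0.
pose I : set R := [set` `[0, 2 * pi]].
have locF j : locally_integrable setT (F j \_ I).
  apply: integrable_locally_restrict; first exact: measurable_itv.
  by apply: (@rcontI_integrable R 0 (2 * pi)); exact: rcontW.
pose H j := [set x | (HL_maximal (F j \_ I) x > lam'%:E)%E].
have mH j : measurable (H j).
  rewrite -[X in measurable X]setTI; apply: emeasurable_fun_o_infty => //.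
  exact: measurable_HL_maximal.
have muH j : (mu (H j) <= (3 * C0 * e / lam)%:E)%E.
  apply: le_trans (maximal_inequality (locF j) lam'0) _.
  have -> : (\int[mu]_(y in setT) `|((F j \_ I) y)%:E|)%E = (rint 0 (2 * pi) (F j))%:E.
    rewrite -integral_rint; last exact: rcontW.
    rewrite [RHS]integral_mkcond; apply: eq_integral => y _.
    rewrite /patch; case: ifPn => _ /=; last by rewrite normr0.
    by rewrite ger0_norm.
  rewrite -EFinM lee_fin.
  have h := rmean_le_l2 ht e0 hA (rho01 j); rewrite /rmean mulrC ler_pdivrMr ?pi2_gt0// in h.
  apply: (@le_trans _ _ (3 / lam' * (e * (2 * pi)))).
    by apply: ler_wpM2l h; rewrite divr_ge0// ltW.
  rewrite le_eqVlt; apply/orP; left; apply/eqP; rewrite /lam'.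
  have fld (q P l a : R) : 0 < q -> 0 < P -> 0 < l -> 3 / (2 * P * l / q) * (a * (2 * P)) = 3 * q * a / l.
    by move=> q0 P0 l0; field; rewrite ?(gt_eqF q0) ?(gt_eqF P0) ?(gt_eqF l0).
  exact: fld.
(* The union of the increasing sets G J is the lower limit of the H j, so its measure is at most
   their common bound. *)
pose G J := \bigcap_(j in [set j | (J <= j)%N]) H j.
have mG J : measurable (G J) by apply: bigcap_measurable => //; exists J => /=.
exists (\bigcup_J G J); split.
- exact: bigcup_measurable.
- have ndG : nondecreasing_seq G.
    move=> i j ij; rewrite subsetEset => x hx k /= jk; apply: hx => /=; exact: leq_trans ij jk.
  have lim := @nondecreasing_cvg_mu _ _ _ mu G mG (bigcup_measurable (fun k _ => mG k)) ndG.
  rewrite -(cvg_lim (@ereal_hausdorff R) lim); apply: lime_le; first exact: cvgP lim.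
  apply: nearW => J /=; apply: le_trans (muH J); apply: le_measure; rewrite ?inE.
  + exact: mG.
  + exact: mH.
  + by move=> x; apply => /=.
move=> x hx nE z [z1 hz].
pose eta := 1 - cmod z; have eta0 : 0 < eta by rewrite subr_gt0.
have [J hJ] : exists J, 1 - eta / 2 <= cut (R := R) J.
  by apply: cut_near; lra.
have [j [Jj nH]] : exists j, (J <= j)%N /\ ~ H j x.
  apply: contrapT => hn; apply: nE; exists J => // j /= Jj; apply: contrapT => nH.
  by apply: hn; exists j.
have hrho : 1 - (1 - cmod z) / 2 <= rho j < 1.
  have /andP[_ ->] := rho01 j; rewrite andbT; apply: le_trans hJ _.
  by apply: cut_le; exact: leqW.
have zr : cmod z < rho j by case/andP: hrho => + _; rewrite -/eta /eta in eta0 *; lra.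
have [_ r1] := andP (rho01 j).
have hLx : (HL_maximal (F j \_ I) x <= lam'%:E)%E by rewrite leNgt; apply/negP.
have x02 : 0 <= x <= 2 * pi by case/andP: hx => *; apply/andP; split; lra.
have hz' : cmod (z - ei x) < s * (1 - cmod z) by move: hz; rewrite circleE mul1r.
apply: le_trans (poisson_le ha zr r1) _.
rewrite /rmean mulrC ler_pdivrMr ?pi2_gt0//.
have := @maximal_bound (F j) (poisson (rho j) z) c x eta kap lam' c0 eta0 k0 x02 (ltW lam'0)
  (cF j) (F0 j) (rcont_poisson zr) (fun y => poisson_ge0 y zr)
  (fun b b0 => HL_avg (cF j) (F0 j) b0 hLx) _ _.
rewrite -/C0 (_ : C0 * lam' = lam * (2 * pi)); last by rewrite /lam'; field; rewrite gt_eqF.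
apply => y hy.
  by have [] := poisson_stolz c0 s1 (hc x y hx hy) z1 hz' hrho.
by have [_] := poisson_stolz c0 s1 (hc x y hx hy) z1 hz' hrho; apply.
Qed.

End StolzKernel.

(** * Fatou's theorem for H^2 *)

Section Fatou.
Context {R : realType}.
Implicit Types (f g h : Cx R -> Cx R) (z w l : Cx R) (A B : nat -> Cx R) (r s x y M e d : R).
Local Notation mu := (@lebesgue_measure R).
Local Notation dy := (@dy R).

Lemma dy_small d : 0 < d -> exists K, forall j, (K <= j)%N -> dy j < d.
Proof.
move=> d0; have d2 : 1 - d / 2 < 1 by lra.
have [K hK] := cut_near d2.
by exists K => j Kj; have := cut_le (R := R) Kj; rewrite /cut in hK *; lra.
Qed.

Lemma has_ps_trunc (R0 : R) A N0 :
  has_ps R0 (psum A N0) (fun n => if (n < N0)%N then A n else 0).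
Proof.
split.
  move=> r /andP[r0 _]; exists (\sum_(n < N0) cmod (A n) * r ^+ n) => n.
  have h0 i : 0 <= cmod (A i) * r ^+ i by rewrite mulr_ge0 ?cmod_ge0 ?exprn_ge0.
  case: ifP => hn; last by rewrite cmod0 mul0r; apply: sumr_ge0.
  by rewrite (bigD1 (Ordinal hn))//= lerDl; apply: sumr_ge0.
move=> z _; apply/cvgC_P => e e0; exists N0 => // n /= hn.
rewrite (_ : psum _ n z = psum A N0 z) ?subrr ?cmod0 ?(ltW e0)//.
rewrite /psum -!(big_mkord xpredT (fun i => (if (i < N0)%N then A i else 0) * z ^+ i)).
rewrite (@big_cat_nat _ _ _ N0 0%N n)//= [X in _ + X]big_nat [X in _ + X]big1 ?addr0.
  by rewrite big_mkord; apply: eq_bigr => i _; rewrite ltn_ord.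
by move=> i /andP[h _]; rewrite ltnNge h mul0r.
Qed.

(** [Nm] lets a caller keep prescribed initial coefficients in the polynomial, as
    [le_circle_norm_radial] does. *)
Lemma tail_approx f A M e Nm : has_ps 1 f A -> (forall N, \sum_(n < N) cmod (A n) ^+ 2 <= M) ->
  0 < e -> exists2 N0, (Nm <= N0)%N & exists2 B, has_ps 1 (f \- psum A N0) B &
    forall N, \sum_(n < N) cmod (B n) ^+ 2 <= e ^+ 2.
Proof.
move=> hf hM e0; have e2 : 0 < e ^+ 2 by exact: exprn_gt0.
have [N1 hN] := tails_small (fun n => sqr_ge0 (cmod (A n))) hM e2.
pose N0 := maxn N1 Nm; exists N0; first exact: leq_maxr.
eexists; first exact: has_ps_sub hf (has_ps_trunc 1 A N0).
move=> N; set F := fun n => cmod (A n - (if (n < N0)%N then A n else 0)) ^+ 2.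
have F0 n : 0 <= F n by exact: sqr_ge0.
apply: le_trans (@tail_le R F N0 N (e ^+ 2) F0 _) _.
  move=> K; apply: (@le_trans _ _ (\sum_(N0 <= n < K) cmod (A n) ^+ 2)).
    by rewrite !big_nat; apply: ler_sum => n /andP[h _]; rewrite /F ltnNge h subr0.
  case: (leqP N0 K) => hK; last by rewrite big_geq ?(ltnW hK)// ltW.
  apply: le_trans (hN K); rewrite (@big_cat_nat _ _ _ N0 N1 K) ?leq_maxl//= lerDr.
  by apply: sumr_ge0 => n _; exact: sqr_ge0.
rewrite big1 ?add0r// => n _; by rewrite /F ltn_ord subrr cmod0 expr0n.
Qed.

Lemma contC_psum A N z : {for z, continuous (psum A N)}.
Proof.
apply: contC_sum => n; apply: contC_mul; first exact: contC_cst.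
by apply: contC_exp; exact: cvg_id.
Qed.

(** f minus a long partial sum is small in Stolz angles off a set of small measure, and the partial
    sum is continuous. The value L still depends on e; [fatou_ae] removes this. *)
Lemma stolz_osc f A M : has_ps 1 f A -> (forall N, \sum_(n < N) cmod (A n) ^+ 2 <= M) ->
  exists E : set R, [/\ measurable E, mu E = 0%E & forall x, 0 <= x <= 2 * pi -> ~ E x ->
    forall s e, 1 < s -> 0 < e -> exists L, exists2 d, 0 < d &
      forall z, stolz s (circle 1 x) z -> cmod (z - circle 1 x) < d -> cmod (f z - L) <= e].
Proof.
move=> hf hM; have p0 := pi_gt0 R.
(* k sets the aperture, the error and the distance from 0 and 2 pi at once, n the measure: for each
   k the intersection over n is a null set. *)
have step (k n : nat) : exists E : set R, exists N0, [/\ measurable E, (mu E <= (n.+1%:R^-1)%:E)%E &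
    forall x, pi * dy k <= x <= 2 * pi - pi * dy k -> ~ E x ->
    forall z, stolz k.+2%:R (circle 1 x) z -> cmod (f z - psum A N0 z) <= k.+1%:R^-1].
  have s1 : (1 : R) < k.+2%:R by rewrite ltr1n.
  have hd : 0 < pi * dy k <= pi.
    rewrite mulr_gt0 ?dy_gt0//=; apply: ler_piMr; [exact: ltW|exact: dy_le1].
  have [C C0 hC] := weak_type s1 hd.
  have k0 : (0 : R) < k.+1%:R^-1 by rewrite invr_gt0.
  pose e := k.+1%:R^-1 / (C * n.+1%:R); have e0 : 0 < e by rewrite divr_gt0// mulr_gt0.
  have [N0 _ [B hB hBe]] := tail_approx 0 hf hM e0.
  have [E [mE muE hE]] := hC _ _ _ _ hB (ltW e0) hBe k0.
  exists E, N0; split => //.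
  apply: le_trans muE _; rewrite lee_fin le_eqVlt; apply/orP; left; apply/eqP.
  have fld (q a b : R) : q != 0 -> a != 0 -> b != 0 -> q * (a / (q * b)) / a = b^-1.
    by move=> q0 a0 b0; field; rewrite a0 b0 q0.
  by apply: fld; rewrite ?gt_eqF.
have [E hE] := @choice _ _ (fun kn (E : set R) => exists N0, [/\ measurable E, (mu E <= (kn.2.+1%:R^-1)%:E)%E &
    forall x, pi * dy kn.1 <= x <= 2 * pi - pi * dy kn.1 -> ~ E x ->
    forall z, stolz kn.1.+2%:R (circle 1 x) z -> cmod (f z - psum A N0 z) <= kn.1.+1%:R^-1])
  (fun kn => step kn.1 kn.2).
pose G k := \bigcap_n E (k, n).
have mE k n : measurable (E (k, n)) by have [N0 []] := hE (k, n).
have mG k : measurable (G k) by exact: bigcapT_measurable.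
have muG k : mu (G k) = 0%E.
  apply/eqP; rewrite eq_le measure_ge0 andbT; apply/lee_addgt0Pr => e e0; rewrite add0e.
  have [n hn] : exists n, n.+1%:R^-1 <= e.
    near \oo => n; exists n; near: n.
    by have := @near_infty_natSinv_lt R (PosNum e0); apply: filterS => n /ltW.
  have [N0 [_ h _]] := hE (k, n).
  apply: (@le_trans _ _ (mu (E (k, n)))).
    by apply: le_measure; rewrite ?inE; [exact: mG|exact: mE|move=> x; apply].
  by apply: le_trans h _; rewrite lee_fin.
have neg : mu.-negligible ([set 0] `|` [set 2 * pi] `|` \bigcup_k G k).
  apply: negligibleU.
    apply: negligibleU.
      by exists [set 0]; split => //; exact: lebesgue_measure_set1.
    by exists [set 2 * pi]; split => //; exact: lebesgue_measure_set1.
  by apply: negligible_bigcup => k; exists (G k); split; [exact: mG|exact: muG|].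
have [N [mN muN hN]] := neg; exists N; split => // x /andP[x0 x1] nN s e s1 e0.
have xn0 : x != 0 by apply/eqP => E0; apply: nN; apply: hN; left; left.
have xnp : x != 2 * pi by apply/eqP => E0; apply: nN; apply: hN; left; right.
have xg0 : 0 < x by rewrite lt_neqAle eq_sym xn0.
have xl2 : x < 2 * pi by rewrite lt_neqAle xnp.
have [k [k1 k2 k3]] : exists k : nat, [/\ s <= k.+2%:R, k.+1%:R^-1 <= e / 2 &
    pi * dy k <= x <= 2 * pi - pi * dy k].
  have m0 : 0 < Num.min x (2 * pi - x) / pi by rewrite divr_gt0// lt_min xg0 subr_gt0.
  have e2 : 0 < e / 2 by rewrite divr_gt0.
  have [K hK] := dy_small m0.
  near \oo => k; exists k; split.
  - apply: (@le_trans _ _ k%:R); last by rewrite ler_nat -addn2 leq_addr.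
    by near: k; exact: nbhs_infty_ger.
  - near: k; have := @near_infty_natSinv_lt R (PosNum e2); by apply: filterS => n /ltW.
  have Kk : (K <= k)%N by near: k; exists K.
  have := ltW (hK k Kk).
  rewrite ler_pdivlMr// mulrC le_min => /andP[? ?]; apply/andP; split; lra.
have nG : ~ G k x by move=> h; apply: nN; apply: hN; right; exists k.
have [n nE] : exists n, ~ E (k, n) x.
  by apply: contrapT => h; apply: nG => n _; apply: contrapT => h2; apply: h; exists n.
have [N0 [_ _ hz]] := hE (k, n).
have e2 : 0 < e / 2 by rewrite divr_gt0.
exists (psum A N0 (circle 1 x)).
have /cvgC_P/(_ _ e2)/nbhsC_P[d d0 hd] := @contC_psum A N0 (circle 1 x).
exists d => // z [z1 zs] zd.
have h1 : cmod (f z - psum A N0 z) <= e / 2.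
  apply: le_trans k2; apply: (hz x k3 nE); split => //; apply: lt_le_trans zs _.
  by apply: ler_wpM2r => //; rewrite subr_ge0 ltW.
have h2 : cmod (psum A N0 z - psum A N0 (circle 1 x)) <= e / 2 by exact: hd.
rewrite -(subrK (psum A N0 z) (f z)) -addrA; apply: le_trans (cmodD _ _) _.
by rewrite (splitr e); exact: lerD h1 h2.
Unshelve. all: by end_near. Qed.

Lemma stolz_radial s x j : 1 < s -> stolz s (circle 1 x) (circle (1 - dy j) x).
Proof.
move=> s1; have d0 := dy_gt0 (R := R) j; have d1 := dy_le1 (R := R) j.
have c1 : cmod (circle (1 - dy j) x) = 1 - dy j by rewrite cmod_circle ger0_norm//; lra.
split; first by rewrite c1; lra.
rewrite c1 !circleE -mulrBl cmodM cmod_ei mulr1 -rcB cmod_rc.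
have -> : 1 - dy j - 1 = - dy j by ring.
by rewrite normrN gtr0_norm//; nra.
Qed.

Lemma nt_limitP f x l : nt_limit f (circle 1 x) l <->
  forall s e, 1 < s -> 0 < e -> exists2 d, 0 < d &
    forall z, stolz s (circle 1 x) z -> cmod (z - circle 1 x) < d -> cmod (f z - l) <= e.
Proof.
split => [h s e s1 e0|h s s1].
  have /cvgC_P/(_ _ e0) := h s s1; rewrite /within /=.
  by move=> /nbhsC_P[d d0 hd]; exists d => // z hz zd; exact: hd.
apply/cvgC_P => e e0; have [d d0 hd] := h s e s1 e0.
by rewrite /within /=; apply/nbhsC_P; exists d => // z zd hz; exact: hd.
Qed.

Lemma nt_limit_radial f x l : nt_limit f (circle 1 x) l ->
  f (circle (1 - dy j) x) @[j --> \oo] --> l.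
Proof.
move=> /nt_limitP h; apply/cvgC_P => e e0.
have s1 : 1 < 2 :> R by rewrite ltr1n.
have [d d0 hd] := h 2 e s1 e0.
have [K hK] := dy_small d0.
exists K => // j /= Kj; apply: hd; first exact: stolz_radial.
rewrite !circleE -mulrBl cmodM cmod_ei mulr1 -rcB cmod_rc.
have -> : 1 - dy j - 1 = - dy j :> R by ring.
by rewrite normrN gtr0_norm ?dy_gt0//; exact: hK.
Qed.

Lemma nt_limit_unique f x l l' : nt_limit f (circle 1 x) l -> nt_limit f (circle 1 x) l' -> l = l'.
Proof. by move=> /nt_limit_radial h /nt_limit_radial; exact: cvgC_unique. Qed.

Lemma boundaryE f x l : nt_limit f (circle 1 x) l -> boundary f x = l.
Proof.
move=> h; rewrite /boundary; apply: (nt_limit_unique _ h).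
by have := @xgetPex _ 0 (nt_limit f (circle 1 x)) (ex_intro _ l h).
Qed.

(** Bounded radial values have a limit point, and small oscillation forces it to be the limit in
    every Stolz angle, because the radius lies in all of them. *)
Lemma fatou_ae f A M : has_ps 1 f A -> (forall N, \sum_(n < N) cmod (A n) ^+ 2 <= M) ->
  exists E : set R, [/\ measurable E, mu E = 0%E & forall x, 0 <= x <= 2 * pi -> ~ E x ->
    exists l, nt_limit f (circle 1 x) l].
Proof.
move=> hf hM; have [E [mE muE h]] := stolz_osc hf hM; exists E; split => // x hx nE.
have hosc := h x hx nE; have s2 : 1 < 2 :> R by rewrite ltr1n.
have dist j : cmod (circle (1 - dy j) x - circle 1 x) = dy j :> R.
  rewrite !circleE -mulrBl cmodM cmod_ei mulr1 -rcB cmod_rc.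
  have -> : 1 - dy j - 1 = - dy j :> R by ring.
  by rewrite normrN gtr0_norm ?dy_gt0.
have [L0 [d0 d00 hd0]] := hosc 2 1 s2 ltr01.
have [K0 hK0] := dy_small d00.
have bnd (n k : nat) : cmod (f (circle (1 - dy (K0 + n)) x)) <= 1 + cmod L0.
  have := hd0 _ (stolz_radial x (K0 + n) s2); rewrite dist => /(_ (hK0 _ (leq_addr _ _))) h1.
  by rewrite -(subrK L0 (f _)); apply: le_trans (cmodD _ _) _; rewrite lerD2r.
(* The family is constant in its second index, so [diag_extract] acts as the Bolzano-Weierstrass
   theorem and l 0 is the limit point. *)
have [phi hphi [l hl]] := diag_extract bnd.
exists (l 0%N); apply/nt_limitP => s e s1 e0.
have e3 : 0 < e / 3 by rewrite divr_gt0.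
have [L [d d1 hd]] := hosc s (e / 3) s1 e3; exists d => // z zs zd.
have hz := hd z zs zd.
have [K hK] := dy_small d1.
near \oo => n.
have phin : (n <= phi n)%N.
  elim: (n) => // i IH; apply: leq_ltn_trans IH _.
  by move/increasing_seqP : hphi; exact.
have Kn : (K <= K0 + phi n)%N.
  by apply: leq_trans (leq_trans _ phin) (leq_addl _ _); near: n; exists K.
have h1 := hd _ (stolz_radial x (K0 + phi n) s1); rewrite dist in h1.
have {}h1 := h1 (hK _ Kn).
have h2 : cmod (f (circle (1 - dy (K0 + phi n)) x) - l 0%N) <= e / 3.
  apply: le_trans (hl n 0%N (leq0n _)) _.
  by near: n; have := @near_infty_natSinv_lt R (PosNum e3); apply: filterS => m /ltW.
set v := f (circle _ _) in h1 h2.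
have -> : f z - l 0%N = (f z - L) + ((L - v) + (v - l 0%N)) by ring.
apply: le_trans (cmodD _ _) _; have := cmodD (L - v) (v - l 0%N); rewrite (cmodC L v); lra.
Unshelve. all: by end_near. Qed.

End Fatou.

(** * Norms of boundary values *)

Section BoundaryNorm.
Context {R : realType}.
Implicit Types (f g h : Cx R -> Cx R) (z w l : Cx R) (A B : nat -> Cx R) (r s x y M W e d : R).
Local Notation mu := (@lebesgue_measure R).
Local Notation dy := (@dy R).
Import HBNNSimple.

(* No measurability of [f] or [F] is needed: the integral of a nonnegative
   function is a supremum over the simple functions below it. *)
Lemma le_integral_off_null (D N : set R) (f F : R -> \bar R) :
  measurable N -> mu N = 0%E -> (forall x, 0 <= f x)%E -> (forall x, 0 <= F x)%E ->
  (forall x, D x -> ~ N x -> (f x <= F x)%E) ->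
  (\int[mu]_(x in D) f x <= \int[mu]_(x in D) F x)%E.
Proof.
move=> mN muN f0 F0 fF; rewrite !ge0_integralE//.
apply: ge_ereal_sup => _ [h /= hf <-].
pose h' := proj_nnsfun h (measurableC mN).
have -> : sintegral mu h = sintegral mu h'.
  rewrite -!integralT_nnsfun (@ge0_negligible_integral _ _ _ mu setT N)//; last first.
  - by move=> x _; rewrite lee_fin.
  - by apply/measurable_EFinP; exact: measurable_funPT.
  rewrite setTD integral_mkcond; apply: eq_integral => x _.
  by rewrite /h' -mrestrict /patch; case: ifPn.
apply: ereal_sup_ubound; exists h' => //= x.
have hx := hf x; rewrite mindicE /patch in hx *.
have [|_] := boolP (x \in ~` N); last by rewrite mulr0; case: ifPn.
rewrite mulr1 inE => nN; apply: le_trans hx _; case: ifPn => //; rewrite inE => Dx.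
exact: fF.
Qed.

Lemma circle_norm2P (u : R -> Cx R) W : 0 <= W ->
  (circle_norm 2 u <= W%:E)%E <->
  (\int[mu]_(x in `[0%R, (2 * pi)%R]) (cmod (u x) `^ 2)%:E <= (2 * pi * W ^+ 2)%:E)%E.
Proof.
move=> W0; rewrite /circle_norm; set I := (\int[_]_(_ in _) _)%E.
have I0 : (0 <= I)%E by apply: integral_ge0 => x _; rewrite lee_fin powR_ge0.
have p0 : 0 < 2 * pi :> R := pi2_gt0; have i0 : 0 < (2 * pi)^-1 :> R by rewrite invr_gt0.
case: I I0 => [i||]//.
  move=> i0'; rewrite lee_fin in i0'.
  rewrite -EFinM poweR_EFin !lee_fin powR_inv_le ?mulr_ge0 ?(ltW i0)//.
  by rewrite powR_mulrn// mulrC ler_pdivrMr// [W ^+ 2 * _]mulrC.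
move=> _; rewrite gt0_muley ?lte_fin// poweRyr ?invr_eq0 ?pnatr_eq0//.
Qed.

Section Radial.
Variables (h : Cx R -> Cx R) (B : nat -> Cx R).
Hypothesis hh : has_ps 1 h B.

Definition rsq j x : \bar R := (cmod (h (circle (1 - dy j) x)) ^+ 2)%:E.
(** A measurable substitute for |psi|^2, defined everywhere and equal to it off a null set;
    integrals are compared through it. *)
Definition rsq_lim x := limn_einf (fun j => rsq j x).

Lemma rsq_ge0 j x : (0 <= rsq j x)%E. Proof. by rewrite lee_fin sqr_ge0. Qed.

Lemma rsq_cont j : rcont (fun x => cmod (h (circle (1 - dy j) x)) ^+ 2).
Proof.
have ha : analytic h := has_ps_dan hh.
have c1 : rcont (fun x => cmod (h (circle (1 - dy j) x))).
  by apply: rcont_cmod; apply: (dan_ccont ha); exact: r01.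
by move=> x; exact: (cvgM (c1 x) (c1 x)).
Qed.

Lemma rsq_meas D j : measurable_fun D (rsq j).
Proof.
apply/measurable_EFinP; apply: measurable_funTS; apply: continuous_measurable_fun; exact: rsq_cont.
Qed.

Lemma rsq_lim_meas D : measurable_fun D rsq_lim.
Proof.
rewrite /rsq_lim /limn_einf; apply: measurableT_comp => //.
apply: measurable_fun_limn_esup => j; apply: measurableT_comp => //; exact: rsq_meas.
Qed.

Lemma rsq_lim_ge0 x : (0 <= rsq_lim x)%E.
Proof.
rewrite /rsq_lim limn_einf_lim; apply: lime_ge; first exact: is_cvg_einfs.
by apply: nearW => n; apply: le_ereal_inf_tmp => _ [m /= _ <-]; exact: rsq_ge0.
Qed.

Lemma rsq_lim_int W : (forall N, \sum_(n < N) cmod (B n) ^+ 2 <= W ^+ 2) ->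
  (\int[mu]_(x in `[0%R, (2 * pi)%R]) rsq_lim x <= (2 * pi * W ^+ 2)%:E)%E.
Proof.
move=> hW; have hI j : (\int[mu]_(x in `[0%R, (2 * pi)%R]) rsq j x <= (2 * pi * W ^+ 2)%:E)%E.
  rewrite /rsq integral_rint; last by apply: rcontW; exact: rsq_cont.
  suff hp : rmean (fun x => cmod (h (circle (1 - dy j) x)) ^+ 2) <= W ^+ 2.
    rewrite /rmean mulrC ler_pdivrMr ?pi2_gt0// in hp.
    by rewrite lee_fin [leRHS]mulrC.
  apply: (parseval_le hh (r01 j)) => N; apply: le_trans (hW N); apply: ler_sum => n _.
  apply: ler_piMr; first exact: sqr_ge0.
  by have /andP[a b] := r01 (R := R) j; apply: exprn_ile1 => //; exact: ltW.
apply: (@le_trans _ _ (limn_einf (fun j => \int[mu]_(x in `[0%R, (2 * pi)%R]) rsq j x))%E).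
  apply: fatou => //; first by move=> j; exact: rsq_meas.
  by move=> j x _; exact: rsq_ge0.
rewrite limn_einf_lim; apply: lime_le; first exact: is_cvg_einfs.
apply: nearW => n; apply: le_trans (hI n).
by apply: ereal_inf_lbound; exists n => /=.
Qed.

Variables (psi : R -> Cx R) (E : set R).
Hypotheses (mE : measurable E) (muE : mu E = 0%E).
Hypothesis hpsi : forall x, 0 <= x <= 2 * pi -> ~ E x ->
  h (circle (1 - dy j) x) @[j --> \oo] --> psi x.

Lemma rsq_limE x : 0 <= x <= 2 * pi -> ~ E x -> rsq_lim x = (cmod (psi x) `^ 2)%:E.
Proof.
move=> hx nE; rewrite /rsq_lim.
have hc : cmod (h (circle (1 - dy j) x)) @[j --> \oo] --> cmod (psi x).
  apply/cvgrPdist_le => e e0; move/cvgC_P : (hpsi hx nE) => /(_ _ e0); apply: filterS => j.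
  apply: le_trans; set a := h _; set b := psi x.
  have h1 := cmodD (a - b) b; have h2 := cmodD (b - a) a.
  rewrite subrK in h1; rewrite subrK (cmodC b) in h2.
  by rewrite ler_norml; apply/andP; split; lra.
rewrite powR_mulrn ?cmod_ge0//; apply: (cvg_limn_einf_sup _).1.
by apply/cvg_EFin; [exact: nearW|exact: (cvgM hc hc)].
Qed.

Lemma rsq_lim_psi : (\int[mu]_(x in `[0%R, (2 * pi)%R]) rsq_lim x =
  \int[mu]_(x in `[0%R, (2 * pi)%R]) (cmod (psi x) `^ 2)%:E)%E.
Proof.
apply/eqP; rewrite eq_le; apply/andP; split; apply: (le_integral_off_null mE muE).
- exact: rsq_lim_ge0.
- by move=> x; rewrite lee_fin powR_ge0.
- by move=> x; rewrite /= in_itv /= => hx nE; rewrite rsq_limE.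
- by move=> x; rewrite lee_fin powR_ge0.
- exact: rsq_lim_ge0.
- by move=> x; rewrite /= in_itv /= => hx nE; rewrite rsq_limE.
Qed.

Lemma circle_norm_radial_le W : 0 <= W -> (forall N, \sum_(n < N) cmod (B n) ^+ 2 <= W ^+ 2) ->
  (circle_norm 2 psi <= W%:E)%E.
Proof. by move=> W0 hW; apply/(circle_norm2P _ W0); rewrite -rsq_lim_psi; exact: rsq_lim_int. Qed.

End Radial.

(** A long partial sum P is continuous up to the circle, so Parseval applies to it at radius 1, and
    on the circle P is psi minus a function of small norm. Squaring this difference costs the factor
    2, harmless in two-sided estimates. *)
Lemma le_circle_norm_radial h B (psi : R -> Cx R) E M W : has_ps 1 h B ->
  (forall N, \sum_(n < N) cmod (B n) ^+ 2 <= M) ->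
  measurable E -> mu E = 0%E ->
  (forall x, 0 <= x <= 2 * pi -> ~ E x -> h (circle (1 - dy j) x) @[j --> \oo] --> psi x) ->
  0 <= W -> (circle_norm 2 psi <= W%:E)%E ->
  forall N, \sum_(n < N) cmod (B n) ^+ 2 <= 2 * W ^+ 2.
Proof.
move=> hh hM mE muE hpsi W0 hW N; apply/ler_addgt0Pl => e e0; rewrite addrC.
(* The remainder enters the final bound as 2 q^2 = e. *)
pose q := Num.sqrt (e / 2); have q0 : 0 < q by rewrite sqrtr_gt0 divr_gt0.
have qE : q ^+ 2 = e / 2 by rewrite sqr_sqrtr// divr_ge0// ltW.
have [N0 hN [D hD hDq]] := tail_approx N hh hM q0.
(* As a polynomial, the partial sum is a power series of radius 2, which puts the unit circle
   inside. *)
have h2 := has_ps_trunc 2 B N0.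
pose P := psum B N0; pose phi x := psi x - P (circle 1 x).
have hphi x : 0 <= x <= 2 * pi -> ~ E x ->
    (h \- P) (circle (1 - dy j) x) @[j --> \oo] --> phi x.
  move=> hx nE; apply: (cvgB (hpsi x hx nE)).
  have hc : {for circle 1 x, continuous P} by exact: contC_psum.
  apply: (cvg_comp (fun j : nat => circle (1 - dy j) x) P) hc.
  apply/cvgC_P => a a0; have [K hK] := dy_small a0; exists K => // j /= Kj.
  rewrite !circleE -mulrBl cmodM cmod_ei mulr1 -rcB cmod_rc.
  have -> : 1 - dy j - 1 = - dy j by ring.
  by rewrite normrN gtr0_norm ?dy_gt0// ltW// hK.
have I1 := (circle_norm2P psi W0).1 hW.
have I2 := rsq_lim_int hD hDq.
rewrite -(rsq_lim_psi mE muE hpsi) in I1.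
have key : (\int[mu]_(x in `[0%R, (2 * pi)%R]) (cmod (P (circle 1 x)) ^+ 2)%:E <=
   (2 * (2 * pi * W ^+ 2) + 2 * (2 * pi * q ^+ 2))%:E)%E.
  apply: (@le_trans _ _ (\int[mu]_(x in `[0%R, (2 * pi)%R]) (2%:E * rsq_lim h x + 2%:E * rsq_lim (h \- P)%R x))%E).
    apply: (le_integral_off_null mE muE).
    - by move=> x; rewrite lee_fin sqr_ge0.
    - by move=> x; rewrite adde_ge0// mule_ge0// rsq_lim_ge0.
    move=> x; rewrite /= in_itv /= => hx nE.
    rewrite (rsq_limE hpsi hx nE) (rsq_limE hphi hx nE) !powR_mulrn ?cmod_ge0//.
    rewrite -!EFinM -EFinD lee_fin.
    have -> : P (circle 1 x) = psi x - phi x by rewrite /phi; ring.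
    exact: sqr_cmodB_le.
  rewrite ge0_integralD//=; last 4 first.
  - by move=> x _; rewrite mule_ge0// rsq_lim_ge0.
  - by apply: measurable_funeM; exact: rsq_lim_meas hh _.
  - by move=> x _; rewrite mule_ge0// rsq_lim_ge0.
  - by apply: measurable_funeM; exact: rsq_lim_meas hD _.
  rewrite !ge0_integralZl//=; last 4 first.
  - exact: rsq_lim_meas hD _.
  - by move=> x _; exact: rsq_lim_ge0.
  - exact: rsq_lim_meas hh _.
  - by move=> x _; exact: rsq_lim_ge0.
  have e2 (x : \bar R) (y : R) : (x <= y%:E)%E -> (2%:E * x <= (2 * y)%:E)%E.
    by move=> xy; rewrite EFinM; apply: lee_wpmul2l.
  by apply: le_trans (leeD (e2 _ _ I1) (e2 _ _ I2)) _; rewrite -EFinD.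
have cP : rcont (fun x => cmod (P (circle 1 x)) ^+ 2).
  have c1 : rcont (fun x => cmod (P (circle 1 x))).
    by apply: rcont_cmod; apply: (dan_ccont (has_ps_dan h2)); apply/andP; split; lra.
  by move=> x; exact: (cvgM (c1 x) (c1 x)).
rewrite integral_rint in key; last exact: rcontW.
rewrite lee_fin in key.
have h12 : 1 < 2 :> R by rewrite ltr1n.
have r12 : 0 <= (1 : R) < 2 by rewrite ler01 h12.
have pv := parseval_ge N0 h2 r12.
have hmean : rmean (fun x => cmod (P (circle 1 x)) ^+ 2) <= 2 * W ^+ 2 + e.
  rewrite /rmean mulrC ler_pdivrMr ?pi2_gt0//; apply: le_trans key _.
  by rewrite qE le_eqVlt; apply/orP; left; apply/eqP; field.
have hN0 : \sum_(n < N0) cmod (B n) ^+ 2 <= 2 * W ^+ 2 + e.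
  apply: le_trans hmean; apply: le_trans pv; apply: ler_sum => n _.
  by rewrite ltn_ord expr1n mulr1.
apply: le_trans hN0; rewrite -(subnKC hN) big_split_ord /= lerDl.
by apply: sumr_ge0 => i _; exact: sqr_ge0.
Qed.

End BoundaryNorm.

(** * Translations of the boundary function *)

Section ModulusOfContinuity.
Context {R : realType}.
Implicit Types (f g h : Cx R -> Cx R) (z w l : Cx R) (A b : nat -> Cx R) (p r s t x y M W V e d be : R).
Local Notation mu := (@lebesgue_measure R).
Local Notation dy := (@dy R).

Lemma sin_le (w : R) : 0 <= w -> sin w <= w.
Proof.
move=> w0; have cc a a' : rcontI a a' (cos : R -> R) by move=> t _; exact: continuous_cos.
have hd (t : R) : is_derive t (1 : R) (sin : R -> R) (cos t) by exact: is_derive_sin.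
have := rint_FTC w0 (cc 0 w) hd; rewrite sin0 subr0 => <-.
rewrite -[leRHS]mul1r -{2}[w]subr0 -rint_cst//; apply: le_rint => //.
  by move=> t _; exact: cvg_cst.
Qed.

Lemma cmod_ei_sub1 d n : cmod (ei d ^+ n - 1) ^+ 2 = 4 * sin (n%:R * d / 2) ^+ 2.
Proof. by rewrite cmodC -ei_mulrn sin_half. Qed.

Lemma cmod_ei_sub1_le d n : 0 <= d -> cmod (ei d ^+ n - 1) ^+ 2 <= (n%:R * d) ^+ 2.
Proof.
move=> d0; rewrite cmod_ei_sub1; set w := n%:R * d / 2.
have w0 : 0 <= w by rewrite divr_ge0// mulr_ge0.
have h1 := sin_le w0.
have -> : n%:R * d = 2 * w by rewrite /w; field.
have h2 : sin w ^+ 2 <= w ^+ 2.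
  have h3 : - w <= sin w.
    case: (lerP w 1) => w1; last by apply: le_trans (sin_geN1 w); lra.
    apply: (@le_trans _ _ 0); first by lra.
    by apply: sin_ge0_pi; rewrite w0 /=; have := pi_ge2 R; lra.
  have : 0 <= (w - sin w) * (w + sin w) by apply: mulr_ge0; lra.
  by rewrite !expr2; lra.
have e4 : (2 : R) ^+ 2 = 4 by ring.
rewrite exprMn e4; lra.
Qed.

Lemma cmod_ei_sub1_le2 d n : cmod (ei d ^+ n - 1) ^+ 2 <= 4.
Proof.
have h : cmod (ei d ^+ n - 1) <= 2.
  by apply: le_trans (cmodB _ _) _; rewrite cmodX cmod_ei expr1n cmod1; lra.
by have := cmod_ge0 (ei d ^+ n - 1); nra.
Qed.

Section Shift.
Variables (g : Cx R -> Cx R) (b : nat -> Cx R).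
Hypothesis gb : has_ps 1 g b.

Definition shift_coef d n : Cx R := b n * (ei d ^+ n - 1).

Lemma has_ps_rot d : has_ps 1 (fun z => g (ei d * z)) (fun n => b n * ei d ^+ n).
Proof.
split; first by apply: (crad_le gb.1) => n; rewrite cmodM cmodX cmod_ei expr1n mulr1.
move=> z z1; have z1' : cmod (ei d * z) < 1 by rewrite cmodM cmod_ei mul1r.
rewrite (_ : psum (fun n => b n * ei d ^+ n) ^~ z = psum b ^~ (ei d * z)); first exact: gb.2.
by apply: funext => N; rewrite /psum; apply: eq_bigr => n _; rewrite exprMn mulrA.
Qed.

Lemma has_ps_shift d : has_ps 1 ((fun z => g (ei d * z)) \- g) (shift_coef d).
Proof.
have := has_ps_sub (has_ps_rot d) gb.
by rewrite (_ : (fun n => _) = shift_coef d)//; apply: funext => n; rewrite /shift_coef mulrBr mulr1.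
Qed.

Lemma nt_limit_rot d x l : nt_limit (fun z => g (ei d * z)) (circle 1 x) l ->
  nt_limit g (circle 1 (x + d)) l.
Proof.
move=> /nt_limitP h; apply/nt_limitP => s e s1 e0; have [a a0 ha] := h s e s1 e0.
have eN z : ei d * (ei (- d) * z) = z by rewrite mulrA ei_mulrV mul1r.
have cN z : cmod (ei (- d) * z) = cmod z by rewrite cmodM cmod_ei mul1r.
have cB z : cmod (ei (- d) * z - circle 1 x) = cmod (z - circle 1 (x + d)).
  rewrite -[RHS](cN) mulrBr; congr (cmod (_ - _)).
  by rewrite !circleE !mul1r -eiD; congr ei; ring.
exists a => // z [z1 z2] z3; rewrite -{1}(eN z); apply: ha; last by rewrite cB.
by split; rewrite cN// cB.
Qed.

Hypothesis gM : exists M, forall N, \sum_(n < N) cmod (b n) ^+ 2 <= M.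

(** The value at x + d is obtained as the limit of the rotated function at x, since x + d may leave
    the interval [0, 2 pi] on which [fatou_ae] speaks. *)
Lemma shift_boundary d : exists E : set R, [/\ measurable E, mu E = 0%E &
  forall x, 0 <= x <= 2 * pi -> ~ E x ->
    ((fun z => g (ei d * z)) \- g) (circle (1 - dy j) x) @[j --> \oo] -->
      boundary g (x + d) - boundary g x].
Proof.
have [M hM] := gM; have [E1 [m1 n1 h1]] := fatou_ae gb hM.
have hM' N : \sum_(n < N) cmod (b n * ei d ^+ n) ^+ 2 <= M.
  by apply: le_trans (hM N); apply: ler_sum => n _; rewrite cmodM cmodX cmod_ei expr1n mulr1.
have [E2 [m2 n2 h2]] := fatou_ae (has_ps_rot d) hM'.
exists (E1 `|` E2); split; first exact: measurableU.
  exact: null_set_setU.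
move=> x hx nE; have [l1 hl1] := h1 x hx (fun h0 : E1 x => nE (or_introl h0)).
have [l2 hl2] := h2 x hx (fun h0 : E2 x => nE (or_intror h0)).
rewrite (boundaryE hl1) (boundaryE (nt_limit_rot hl2)).
exact: (cvgB (nt_limit_radial hl2) (nt_limit_radial hl1)).
Qed.

Lemma shift_norm_le d W : 0 <= W ->
  (forall N, \sum_(n < N) cmod (shift_coef d n) ^+ 2 <= W ^+ 2) ->
  (circle_norm 2 (fun x => boundary g (x + d) - boundary g x)%R <= W%:E)%E.
Proof.
move=> W0 hW; have [E [mE muE hE]] := shift_boundary d.
exact: (circle_norm_radial_le (has_ps_shift d) mE muE hE W0 hW).
Qed.

Lemma le_shift_norm d W : 0 <= W ->
  (circle_norm 2 (fun x => boundary g (x + d) - boundary g x)%R <= W%:E)%E ->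
  forall N, \sum_(n < N) cmod (shift_coef d n) ^+ 2 <= 2 * W ^+ 2.
Proof.
move=> W0 hW; have [E [mE muE hE]] := shift_boundary d; have [M hM] := gM.
apply: (le_circle_norm_radial (M := 4 * M) (has_ps_shift d) _ mE muE hE W0 hW) => N.
apply: le_trans (_ : 4 * \sum_(n < N) cmod (b n) ^+ 2 <= _); last by apply: ler_wpM2l.
rewrite mulr_sumr; apply: ler_sum => n _; rewrite /shift_coef cmodM exprMn mulrC.
by apply: ler_wpM2r; [exact: sqr_ge0|exact: cmod_ei_sub1_le2].
Qed.

End Shift.

Definition dcoef b n : Cx R := n.+1%:R * b n.+1.

Lemma cmod_dcoef b n : cmod (dcoef b n) = n.+1%:R * cmod (b n.+1).
Proof. by rewrite /dcoef -rcn cmodM cmod_rc ger0_norm. Qed.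

Lemma sum_recl_nat (F : nat -> R) N : F 0%N = 0 -> (forall n, 0 <= F n) ->
  \sum_(n < N) F n <= \sum_(n < N) F n.+1.
Proof.
move=> F0 Fp; case: N => [|N]; first by rewrite !big_ord0.
rewrite big_ord_recl F0 add0r big_ord_recr /= lerDl; exact: Fp.
Qed.

Lemma block_bound b k n : ((2 ^ k).-1 <= n < (2 ^ k.+1).-1)%N ->
  1 <= n.+1%:R * dy k <= 2.
Proof.
move=> /andP[h1 h2]; have d0 := dy_gt0 (R := R) k; apply/andP; split.
  by rewrite -ler_pdivrMr// div1r dyV ler_nat; move: h1; rewrite -ltnS prednK// expn_gt0.
rewrite -ler_pdivlMr// dyV -natrM ler_nat -expnS.
by apply: leq_trans h2 (leq_pred _).
Qed.

(** For d = 2^-k and n in block k the angle (n + 1) d / 2 lies in [1/2, 1], where the sine is at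
    least sin (1/2), so this one translation sees the whole block. Coefficient n of the derivative
    pairs with coefficient n + 1 of the function. *)
Lemma blk_shift b k V : (forall N, \sum_(n < N) cmod (shift_coef b (dy k) n) ^+ 2 <= V) ->
  blk (dcoef b) k * (dy k * sin 2^-1) ^+ 2 <= V.
Proof.
move=> hV; apply: le_trans (hV (2 ^ k.+1)%N).
have sh0 n : 0 <= cmod (shift_coef b (dy k) n) ^+ 2 by exact: sqr_ge0.
apply: (@le_trans _ _ (\sum_((2 ^ k).-1 <= n < (2 ^ k.+1).-1) cmod (shift_coef b (dy k) n.+1) ^+ 2)).
  rewrite /blk mulr_suml !big_nat; apply: ler_sum => n hn.
  have /andP[h1 h2] := block_bound b hn.
  rewrite /shift_coef cmod_dcoef cmodM !exprMn cmod_ei_sub1.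
  have ph := pihalf_ge1 R.
  have s0 : 0 < sin 2^-1 :> R by apply: sin_gt0_pihalf; apply/andP; split; lra.
  have sm : sin 2^-1 <= sin (n.+1%:R * dy k / 2).
    have : 2^-1 <= n.+1%:R * dy k / 2 by lra.
    rewrite le_eqVlt => /orP[/eqP <-//|lt]; apply: ltW; rewrite ltr_sin// in_itv /=; apply/andP; split; lra.
  have h3 : sin 2^-1 ^+ 2 <= sin (n.+1%:R * dy k / 2) ^+ 2.
    by apply: lerXn2r; rewrite ?nnegrE ?(ltW s0)// (le_trans (ltW s0)).
  have h4 : (n.+1%:R * dy k) ^+ 2 <= 4 by nra.
  have h5 : (n.+1%:R * dy k) ^+ 2 * sin 2^-1 ^+ 2 <= 4 * sin (n.+1%:R * dy k / 2) ^+ 2.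
    by apply: ler_pM; rewrite ?sqr_ge0.
  have := ler_wpM2l (sqr_ge0 (cmod (b n.+1))) h5; rewrite exprMn; lra.
have -> : \sum_((2 ^ k).-1 <= n < (2 ^ k.+1).-1) cmod (shift_coef b (dy k) n.+1) ^+ 2 =
    \sum_((2 ^ k).-1.+1 <= n < (2 ^ k.+1)%N) cmod (shift_coef b (dy k) n) ^+ 2 by rewrite big_add1.
exact: sum_nat_ge0_le.
Qed.

Definition lip_eps p : R := Num.min p^-1 (1 - p^-1).
Definition lip_sum p : R := 2 / (1 - q_ (lip_eps p)).

Lemma lip_eps_gt0 p : 1 < p -> 0 < lip_eps p.
Proof.
by move=> p1; have p0 : 0 < p; [lra|rewrite lt_min invr_gt0 p0 subr_gt0 invf_lt1].
Qed.

(** The gain min (2^-2j, 2^-2k), weighted for block k, splits into the expected factor 2^(-2j/p) and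
    a decay in |j - k|. *)
Lemma lip_kernel p (j k : nat) : 1 < p ->
  2 `^ (2 * ((1 - p^-1) * k%:R)) * Num.min (dy j ^+ 2) (dy k ^+ 2) <=
  gk (q_ (lip_eps p)) j k * 2 `^ (- (2 * (j%:R / p))).
Proof.
move=> p1; have e0 := lip_eps_gt0 p1.
have [e1 e2] : lip_eps p <= p^-1 /\ lip_eps p <= 1 - p^-1 by rewrite /lip_eps !ge_min !lexx orbT.
have sq m : dy m ^+ 2 = 2 `^ (- (2 * m%:R)) :> R.
  by rewrite dy_powR -powR_mulrn ?powR_ge0// -powRrM; congr (_ `^ _); ring.
apply: (@le_trans _ _ (2 `^ (2 * ((1 - p^-1) * k%:R) - 2 * (maxn j k)%:R))).
  rewrite -pow2D; apply: ler_wpM2l; first exact: powR_ge0.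
  by rewrite -sq ge_min; case: (leqP j k) => jk; rewrite lexx ?orbT.
have -> : 2 * ((1 - p^-1) * k%:R) - 2 * (maxn j k)%:R =
   (2 * ((1 - p^-1) * k%:R) - 2 * (maxn j k)%:R + 2 * (j%:R / p)) - 2 * (j%:R / p) by ring.
rewrite -pow2D; apply: ler_wpM2r; first exact: powR_ge0.
apply: pow2_gk; first exact: ltW.
  case: (leqP j k) => jk.
    have : j%:R <= k%:R :> R by rewrite ler_nat.
    nra.
  have : k%:R < j%:R :> R by rewrite ltr_nat.
  nra.
case: (leqP j k) => jk.
  have : j%:R <= k%:R :> R by rewrite ler_nat.
  nra.
have : k%:R < j%:R :> R by rewrite ltr_nat.
nra.
Qed.

(** Common core of two estimates: translations at scale 2^-j, and with j = 0 the l^2 norm itself,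
    where the minimum is 2^-2k. *)
Lemma block_weight_sum p b j N (F : nat -> R) : 1 < p -> (forall n, 0 <= F n) ->
  (forall k n, ((2 ^ k).-1 <= n < (2 ^ k.+1).-1)%N ->
     F n <= 4 * (cmod (dcoef b n) ^+ 2 * Num.min (dy j ^+ 2) (dy k ^+ 2))) ->
  \sum_(n < N) F n <= 4 * 2 `^ (- (2 * (j%:R / p))) *
    \sum_(k < N) gk (q_ (lip_eps p)) j k * bet p (dcoef b) k ^+ 2.
Proof.
move=> p1 F0 hF.
have NN : (N <= (2 ^ N).-1)%N by have : (N < 2 ^ N)%N := @ltn_expl 2 N isT; case: (2 ^ N)%N.
apply: (@le_trans _ _ (\sum_((2 ^ 0).-1 <= n < (2 ^ N).-1) F n)).
  rewrite -(big_mkord xpredT F) (@big_cat_nat _ _ _ N 0%N (2 ^ N).-1)//= lerDl; exact: sumr_ge0.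
rewrite block_sum// big_mkord mulr_sumr; apply: ler_sum => k _.
apply: (@le_trans _ _ (4 * (blk (dcoef b) k * Num.min (dy j ^+ 2) (dy k ^+ 2)))).
  rewrite /blk mulr_suml mulr_sumr !big_nat; apply: ler_sum => n hn; exact: hF.
rewrite (blkE p) exprMn -[(2 `^ _) ^+ 2]powR_mulrn ?powR_ge0// -powRrM [_ * 2]mulrC.
have := ler_wpM2l (sqr_ge0 (bet p (dcoef b) k)) (lip_kernel j k p1).
set m := Num.min _ _; set X := 2 `^ (2 * _); set Y := 2 `^ (- _); set Z := gk _ _ _; set T := bet _ _ _ ^+ 2; lra.
Qed.

(** With m = n + 1, |e^(imd) - 1|^2 is at most (m d)^2 and at most 4, which on block k is at most 4
    (m 2^-k)^2. The alternative j = 0 takes care of large d. *)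
Lemma shift_le p b d j N : 1 < p -> 0 <= d -> d <= dy j \/ j = 0%N ->
  \sum_(n < N) cmod (shift_coef b d n) ^+ 2 <= 4 * 2 `^ (- (2 * (j%:R / p))) *
    \sum_(k < N) gk (q_ (lip_eps p)) j k * bet p (dcoef b) k ^+ 2.
Proof.
move=> p1 d0 hj.
apply: le_trans (@sum_recl_nat (fun n => cmod (shift_coef b d n) ^+ 2) N _ _) _.
- by rewrite /shift_coef expr0 subrr mulr0 cmod0 expr0n.
- by move=> n; exact: sqr_ge0.
apply: (@block_weight_sum p b j N (fun n => cmod (shift_coef b d n.+1) ^+ 2) p1) => [n|k n hn]; first exact: sqr_ge0.
rewrite /shift_coef cmod_dcoef cmodM exprMn [(_.+1%:R * _) ^+ 2]exprMn.
have /andP[h1 h2] := block_bound b hn.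
have k1 : cmod (ei d ^+ n.+1 - 1) ^+ 2 <= 4 * (n.+1%:R ^+ 2 * dy k ^+ 2).
  apply: le_trans (cmod_ei_sub1_le2 d n.+1) _; rewrite -exprMn; nra.
have k2 : cmod (ei d ^+ n.+1 - 1) ^+ 2 <= 4 * (n.+1%:R ^+ 2 * dy j ^+ 2).
  case: hj => [hd|->].
    apply: le_trans (cmod_ei_sub1_le n.+1 d0) _; rewrite exprMn.
    have : d ^+ 2 <= dy j ^+ 2 by apply: lerXn2r; rewrite ?nnegrE// (le_trans d0).
    have := sqr_ge0 (n.+1%:R : R); have := sqr_ge0 (dy j); set X := n.+1%:R ^+ 2; nra.
  apply: le_trans (cmod_ei_sub1_le2 d n.+1) _; rewrite /dy expr0 expr1n mulr1.
  have : (1 : R) <= n.+1%:R ^+ 2 by rewrite exprn_ege1// ler1n.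
  lra.
have k3 : cmod (ei d ^+ n.+1 - 1) ^+ 2 <= 4 * (n.+1%:R ^+ 2 * Num.min (dy j ^+ 2) (dy k ^+ 2)).
  by rewrite /Num.min; case: ifP.
have := ler_wpM2l (sqr_ge0 (cmod (b n.+1))) k3; lra.
Qed.

Lemma gk_bet_sum p b j N be : 1 < p -> (forall k, bet p (dcoef b) k <= be) ->
  \sum_(k < N) gk (q_ (lip_eps p)) j k * bet p (dcoef b) k ^+ 2 <= lip_sum p * be ^+ 2.
Proof.
move=> p1 hb; have hq := q_lt1 (lip_eps_gt0 p1).
apply: (@le_trans _ _ (\sum_(k < N) gk (q_ (lip_eps p)) j k * be ^+ 2)).
  apply: ler_sum => k _; apply: ler_wpM2l; first by apply: gk_ge0; case/andP: hq.
  by apply: lerXn2r; rewrite ?nnegrE ?bet_ge0// (le_trans (bet_ge0 p (dcoef b) k)).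
by rewrite -mulr_suml; apply: ler_wpM2r; [exact: sqr_ge0|exact: gk_sum].
Qed.

Lemma l2_of_bet p b be : 1 < p -> (forall k, bet p (dcoef b) k <= be) ->
  forall N, \sum_(n < N) cmod (b n) ^+ 2 <= cmod (b 0%N) ^+ 2 + 4 * (lip_sum p * be ^+ 2).
Proof.
move=> p1 hb N.
have h : \sum_(n < N) cmod (b n.+1) ^+ 2 <= 4 * (lip_sum p * be ^+ 2).
  apply: le_trans (@block_weight_sum p b 0%N N (fun n => cmod (b n.+1) ^+ 2) p1 _ _) _.
  - by move=> n; exact: sqr_ge0.
  - move=> k n hn; have /andP[h1 h2] := block_bound b hn.
    have -> : Num.min (dy 0 ^+ 2) (dy k ^+ 2) = dy k ^+ 2.
      rewrite min_r// /dy expr0 expr1n; apply: exprn_ile1; [exact: ltW (dy_gt0 k)|exact: dy_le1].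
    rewrite cmod_dcoef exprMn; have : (1 : R) <= (n.+1%:R * dy k) ^+ 2 by rewrite exprn_ege1.
    have := sqr_ge0 (cmod (b n.+1)); rewrite exprMn.
    set X := cmod _ ^+ 2; set Y := _ ^+ 2 * dy k ^+ 2 => X0 Y1.
    have : X <= X * Y by rewrite ler_peMr.
    rewrite /Y; lra.
  rewrite mul0r mulr0 oppr0 powRr0 mulr1; apply: ler_wpM2l => //; exact: gk_bet_sum.
case: N h => [|N] h.
  by rewrite big_ord0; apply: addr_ge0; [exact: sqr_ge0|rewrite big_ord0 in h].
rewrite big_ord_recl lerD2l; apply: le_trans h; rewrite big_ord_recr /= lerDl; exact: sqr_ge0.
Qed.

Lemma dyadic_scale d : 0 < d -> exists2 j, d <= dy j \/ j = 0%N & dy j <= 2 * d.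
Proof.
move=> d0; case: (lerP 1 d) => d1.
  by exists 0%N; [right|rewrite /dy expr0; lra].
have ex : exists m, dy m < d by have [K hK] := dy_small d0; exists K; exact: hK.
have hm := ex_minnP ex; case: hm => m hm hmin.
case: m hm hmin => [|m] hm hmin.
  by move: hm; rewrite /dy expr0 => h; lra.
exists m; last by move: hm; rewrite dyS; lra.
by left; rewrite leNgt; apply/negP => /hmin; rewrite ltnn.
Qed.

End ModulusOfContinuity.

Lemma sum_ltn_le (K N : nat) : (\sum_(k < N) (k < K) <= minn N K)%N.
Proof.
elim: N => [|n IH]; first by rewrite big_ord0.
rewrite big_ord_recr /=; apply: leq_trans (leq_add IH (leqnn _)) _.
by case: (ltnP n K) => /= hn; lia.
Qed.

(** * Mean Lipschitz spaces in terms of beta *)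

Section LipschitzSpaces.
Context {R : realType}.
Implicit Types (f g h : Cx R -> Cx R) (b : nat -> Cx R) (p s t x y M W d be : R).
Local Notation dy := (@dy R).

Definition Clip p : R := 2 * Num.sqrt (lip_sum p) * 2 `^ p^-1.
Definition Cbet : R := 2 / sin 2^-1.

Lemma sin_half1_gt0 : 0 < sin 2^-1 :> R.
Proof. by have ph := pihalf_ge1 R; apply: sin_gt0_pihalf; apply/andP; split; lra. Qed.

Lemma Cbet_gt0 : 0 < Cbet. Proof. by rewrite divr_gt0// sin_half1_gt0. Qed.

Lemma lip_sum_gt0 p : 1 < p -> 0 < lip_sum p.
Proof.
by move=> p1; have /andP[_ h] := q_lt1 (lip_eps_gt0 p1); rewrite divr_gt0// subr_gt0.
Qed.

Lemma Clip_ge0 p : 0 <= Clip p.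
Proof. by rewrite !mulr_ge0 ?sqrtr_ge0 ?powR_ge0. Qed.

Lemma dy_root p j d : 0 < p -> 0 <= d -> dy j <= 2 * d ->
  2 `^ (- (j%:R / p)) <= 2 `^ p^-1 * d `^ p^-1.
Proof.
move=> p0 d0 h; have i0 : 0 <= p^-1 by rewrite invr_ge0 ltW.
have -> : 2 `^ (- (j%:R / p)) = dy j `^ p^-1 by rewrite dy_powR -powRrM mulNr.
rewrite -powRM//; apply: ge0_ler_powR; rewrite ?nnegrE ?(ltW (dy_gt0 j))//.
by rewrite mulr_ge0.
Qed.

Section Symbol.
Variables (g : Cx R -> Cx R) (b : nat -> Cx R).
Hypothesis gb : has_ps 1 g b.

(** V has to bound the kernel sums at the scales 2^-j <= 2 t, so the same estimate serves the large
    and the little Lipschitz space. *)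
Lemma modulus_le_gen p V t : 1 < p -> 0 <= V -> 0 < t ->
  (exists M, forall N, \sum_(n < N) cmod (b n) ^+ 2 <= M) ->
  (forall j N, dy j <= 2 * t \/ 2 * t <= 1 -> dy j <= 2 * t ->
     \sum_(k < N) gk (q_ (lip_eps p)) j k * bet p (dcoef b) k ^+ 2 <= V) ->
  (modulus_cont 2 g t <= (2 * Num.sqrt V * 2 `^ p^-1 * t `^ p^-1)%:E)%E.
Proof.
move=> p1 V0 t0 hM hV; have p0 : 0 < p by lra.
apply: ge_ereal_sup => _ [d /= + <-]; rewrite in_itv /= => /andP[d0 dt].
have [j hj hj2] := dyadic_scale d0.
have jt : dy j <= 2 * t by lra.
pose W := 2 * Num.sqrt V * 2 `^ (- (j%:R / p)).
have W0 : 0 <= W by rewrite !mulr_ge0 ?sqrtr_ge0 ?powR_ge0.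
apply: (@le_trans _ _ W%:E).
  apply: (shift_norm_le gb hM W0) => N.
  apply: le_trans (shift_le b N p1 (ltW d0) hj) _.
  have -> : W ^+ 2 = 4 * 2 `^ (- (2 * (j%:R / p))) * V.
    rewrite /W !exprMn sqr_sqrtr// -[(2 `^ _) ^+ 2]powR_mulrn ?powR_ge0// -powRrM.
    have -> : - (j%:R / p) * 2 = - (2 * (j%:R / p)) by ring.
    ring.
  by apply: ler_wpM2l; [rewrite mulr_ge0 ?powR_ge0|apply: hV => //; left].
rewrite lee_fin /W -[leRHS]mulrA; apply: ler_wpM2l; first by rewrite mulr_ge0 ?sqrtr_ge0.
apply: dy_root => //; exact: ltW.
Qed.

Lemma lip_of_bet p be t : 1 < p -> (forall k, bet p (dcoef b) k <= be) -> 0 < t ->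
  (modulus_cont 2 g t <= (Clip p * be * t `^ p^-1)%:E)%E.
Proof.
move=> p1 hb t0; have be0 : 0 <= be by apply: le_trans (hb 0%N); exact: bet_ge0.
have A0 := ltW (lip_sum_gt0 p1).
have := @modulus_le_gen p (lip_sum p * be ^+ 2) t p1 _ t0 _ _.
rewrite sqrtrM// sqrtr_sqr (ger0_norm be0).
rewrite (_ : 2 * (Num.sqrt (lip_sum p) * be) * 2 `^ p^-1 = Clip p * be); last by rewrite /Clip; ring.
apply; first by rewrite mulr_ge0 ?sqr_ge0.
  by eexists; exact: l2_of_bet p1 hb.
by move=> j N _ _; exact: gk_bet_sum.
Qed.

(** The translation by exactly 2^-k isolates block k. Rounding the square root of 2 up to 2 gives
    the constant [Cbet]. *)
Lemma bet_of_lip p k W : 1 < p -> 0 <= W ->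
  (exists M, forall N, \sum_(n < N) cmod (b n) ^+ 2 <= M) ->
  (modulus_cont 2 g (dy k) <= (W * dy k `^ p^-1)%:E)%E -> bet p (dcoef b) k <= Cbet * W.
Proof.
move=> p1 W0 hM hW; have d0 := dy_gt0 (R := R) k; have s0 := sin_half1_gt0.
set Y := dy k `^ p^-1; have Y0 : 0 < Y by exact: powR_gt0.
have WY : 0 <= W * Y by rewrite mulr_ge0// ltW.
have hc : (circle_norm 2 (fun x => boundary g (x + dy k) - boundary g x)%R <= (W * Y)%:E)%E.
  by apply: le_trans hW; apply: ereal_sup_ubound; exists (dy k) => //=; rewrite in_itv /= d0 lexx.
have := blk_shift (le_shift_norm gb hM WY hc).
rewrite (blkE p) -exprMn.
have -> : bet p (dcoef b) k * 2 `^ ((1 - p^-1) * k%:R) * (dy k * sin 2^-1) = bet p (dcoef b) k * sin 2^-1 * Y.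
  have -> : Y = 2 `^ ((1 - p^-1) * k%:R) * dy k.
    by rewrite /Y dy_powR -powRrM pow2D; congr (_ `^ _); ring.
  ring.
rewrite exprMn [(W * Y) ^+ 2]exprMn [2 * _]mulrA ler_pM2r ?exprn_gt0// => h.
have h2 : (bet p (dcoef b) k * sin 2^-1) ^+ 2 <= (2 * W) ^+ 2 by rewrite [leRHS]exprMn; have := sqr_ge0 W; nra.
rewrite /Cbet mulrAC ler_pdivlMr//.
by rewrite -(@ler_sqr _ (bet p (dcoef b) k * _)) ?nnegrE ?mulr_ge0 ?bet_ge0 ?(ltW s0).
Qed.

Lemma hardy2_l2 : hardy 2%:E g <-> exists M, forall N, \sum_(n < N) cmod (b n) ^+ 2 <= M.
Proof.
split => [hg|[M hM]].
  have [Q Q0 hQ] := hardy_fin (isT : 2%:E != -oo%E) hg.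
  by exists (Q ^+ 2); apply/(hardy2P gb Q0); rewrite hQ.
have M0 : 0 <= M by have := hM 0%N; rewrite big_ord0.
apply: (hardy2_fin gb (sqrtr_ge0 M) _).1 => N; by rewrite sqr_sqrtr.
Qed.

Lemma bet_bounded_tail p (K : nat) V : (forall k, (K <= k)%N -> bet p (dcoef b) k <= V) ->
  exists be, forall k, bet p (dcoef b) k <= be.
Proof.
move=> h; exists (`|V| + \sum_(k < K) bet p (dcoef b) k) => k.
have S0 (L : nat) : 0 <= \sum_(k < L) bet p (dcoef b) k by apply: sumr_ge0 => i _; exact: bet_ge0.
case: (leqP K k) => hk.
  apply: le_trans (h k hk) _; apply: le_trans (ler_norm V) _; by rewrite lerDl.
apply: (@le_trans _ _ (\sum_(k < K) bet p (dcoef b) k)); last by rewrite lerDr.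
by rewrite (bigD1 (Ordinal hk))//= lerDl; apply: sumr_ge0 => i _; exact: bet_ge0.
Qed.

Lemma near_dy (P : R -> Prop) : (\forall t \near 0^'+, P t) -> exists K, forall k, (K <= k)%N -> P (dy k).
Proof.
move=> [e /= e0 he]; have [K hK] := dy_small e0; exists K => k hk; apply: he.
  by rewrite /= sub0r normrN gtr0_norm ?dy_gt0// hK.
exact: dy_gt0.
Qed.

Lemma lipschitz_meanP p : 1 < p ->
  lipschitz_mean 2 p^-1 g <-> exists be, forall k, bet p (dcoef b) k <= be.
Proof.
move=> p1; split.
  move=> [/hardy2_l2 hM [M M0 /near_dy[K hK]]].
  apply: (@bet_bounded_tail p K (Cbet * M)) => k hk.
  by apply: bet_of_lip => //; [exact: ltW|exact: hK].
move=> [be hb]; have be0 : 0 <= be by apply: le_trans (hb 0%N); exact: bet_ge0.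
split; first by apply/hardy2_l2; eexists; exact: l2_of_bet p1 hb.
have C0 := Clip_ge0 p; exists (Clip p * be + 1); first by rewrite ltr_wpDl// mulr_ge0.
near=> t; have t0 : 0 < t by near: t; exact: nbhs_right_gt.
apply: le_trans (lip_of_bet p1 hb t0) _; rewrite lee_fin.
by apply: ler_wpM2r; [exact: powR_ge0|rewrite lerDl].
Unshelve. all: by end_near. Qed.

(** For the converse the kernel sum is split at K2: later blocks have beta <= eta, and the K2
    earlier ones carry a kernel at most q^(j - K2), negligible once j is large, that is, once t is
    small. *)
Lemma little_lipschitz_meanP p : 1 < p -> little_lipschitz_mean 2 p^-1 g <->
  (forall e, 0 < e -> exists K, forall k, (K <= k)%N -> bet p (dcoef b) k <= e).
Proof.
move=> p1; have Cb := Cbet_gt0; split.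
  move=> [/hardy2_l2 hM h] e e0.
  have ec : 0 < e / Cbet by rewrite divr_gt0.
  have [K hK] := near_dy (h _ ec); exists K => k hk.
  have := bet_of_lip p1 (ltW ec) hM (hK k hk).
  by rewrite mulrC divfK// gt_eqF.
move=> h; have [K1 hK1] := h 1 ltr01; have [be hb] := bet_bounded_tail hK1.
have be0 : 0 <= be by apply: le_trans (hb 0%N); exact: bet_ge0.
have hM : exists M, forall N, \sum_(n < N) cmod (b n) ^+ 2 <= M by eexists; exact: l2_of_bet p1 hb.
split; first exact/hardy2_l2.
move=> e e0; have A0 := lip_sum_gt0 p1.
have T0 : 0 < 2 `^ p^-1 :> R by exact: powR_gt0.
(* Chosen so that the bound of [modulus_le_gen] is exactly e t^(1/p); half of V goes to each part of
   the split sum. *)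
pose V := (e / (2 * 2 `^ p^-1)) ^+ 2.
have V0 : 0 < V by rewrite exprn_gt0// divr_gt0// mulr_gt0.
have V2 : 0 < V / 2 by rewrite divr_gt0.
pose eta := Num.sqrt (V / 2 / lip_sum p).
have eta0 : 0 < eta by rewrite sqrtr_gt0 divr_gt0.
have [K2 hK2] := h eta eta0.
have hq := q_lt1 (lip_eps_gt0 p1); have [q0 q1] := andP hq.
set q := q_ _ in hq q0 q1.
have [J hJ] : exists J, forall j, (J <= j)%N -> K2%:R * (q ^+ (j - K2) * be ^+ 2) <= V / 2.
  have X0 : 0 <= K2%:R * be ^+ 2 by rewrite mulr_ge0 ?sqr_ge0.
  have hg := @cvg_geometric R (K2%:R * be ^+ 2) q; rewrite ger0_norm// in hg.
  move/cvgrPdist_le : (hg q1) => /(_ _ V2) [J _ hJ]; exists (J + K2)%N => j hj.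
  have := hJ (j - K2)%N; rewrite /= leq_subRL ?(leq_trans (leq_addl _ _) hj)// addnC => /(_ hj).
  rewrite sub0r normrN => /(le_trans (ler_norm _)); apply: le_trans.
  by rewrite le_eqVlt; apply/orP; left; apply/eqP; ring.
have dJ := dy_gt0 (R := R) J.
near=> t; have t0 : 0 < t by near: t; exact: nbhs_right_gt.
have tJ : t < dy J / 4 by near: t; apply: nbhs_right_lt; rewrite divr_gt0.
have := @modulus_le_gen p V t p1 (ltW V0) t0 hM _.
have -> : 2 * Num.sqrt V * 2 `^ p^-1 = e.
  rewrite /V sqrtr_sqr ger0_norm; last by rewrite divr_ge0 ?mulr_ge0 ?(ltW T0)// ltW.
  by field; rewrite gt_eqF.
apply => j N _ jt.
have Jj : (J <= j)%N.
  rewrite leqNgt; apply/negP => jJ; have := dy_le (R := R) (ltnW jJ); have := dy_gt0 (R := R) j; lra.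
apply: (@le_trans _ _ (\sum_(k < N) (gk q j k * eta ^+ 2) + K2%:R * (q ^+ (j - K2) * be ^+ 2))).
  apply: (@le_trans _ _ (\sum_(k < N) (gk q j k * eta ^+ 2 + (k < K2)%N%:R * (q ^+ (j - K2) * be ^+ 2)))).
    apply: ler_sum => k _; have g0 : 0 <= gk q j k by exact: gk_ge0.
    case: (ltnP k K2) => hk.
      rewrite mul1r; apply: (@le_trans _ _ (q ^+ (j - K2) * be ^+ 2)).
        apply: ler_pM => //; first exact: sqr_ge0.
          by apply: ler_wiXn2l => //; [exact: ltW|rewrite (leq_trans _ (leq_addr _ _))// leq_sub2l// ltnW].
        by apply: lerXn2r; rewrite ?nnegrE ?bet_ge0.
      by rewrite lerDr mulr_ge0 ?sqr_ge0.
    rewrite mul0r addr0; apply: ler_wpM2l => //.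
    by apply: lerXn2r; rewrite ?nnegrE ?bet_ge0 ?(ltW eta0)//; exact: hK2.
  rewrite big_split lerD2l -mulr_suml; apply: ler_wpM2r.
    by rewrite mulr_ge0 ?sqr_ge0 ?exprn_ge0.
  rewrite -natr_sum ler_nat.
  exact: leq_trans (sum_ltn_le K2 N) (geq_minr _ _).
have h1 : \sum_(k < N) (gk q j k * eta ^+ 2) <= V / 2.
  rewrite -mulr_suml; apply: (@le_trans _ _ (lip_sum p * eta ^+ 2)).
    by apply: ler_wpM2r; [exact: sqr_ge0|exact: gk_sum].
  by rewrite sqr_sqrtr ?(ltW (divr_gt0 V2 A0))// mulrC divfK// gt_eqF.
by have := hJ j Jj; lra.
Unshelve. all: by end_near. Qed.

End Symbol.

Section ZeroAtOrigin.
Variables (g : Cx R -> Cx R) (b : nat -> Cx R).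
Hypothesis gb : has_ps 1 g b.
Let g1 : Cx R -> Cx R := fun z => g z - g 0.
Let b1 n : Cx R := if n is 0 then 0 else b n.

Lemma has_ps_at0 : g 0 = b 0%N.
Proof.
have h0 : cmod (0 : Cx R) < 1 by rewrite cmod0.
apply: (cvgC_unique (gb.2 0 h0)); apply/cvgC_P => e e0; exists 1%N => // -[|n] //= _.
rewrite /psum big_ord_recl expr0 mulr1 big1 ?addr0 ?subrr ?cmod0 ?ltW//.
by move=> i _; rewrite expr0n mulr0.
Qed.

Lemma has_ps_sub0 : has_ps 1 g1 b1.
Proof.
have h := has_ps_sub gb (has_ps_trunc 1 b 1).
have h2 : has_ps 1 (g \- psum b 1) b1.
  by move: h; rewrite (_ : (fun n => _) = b1)//; apply: funext => -[|n] /=; rewrite ?subrr ?subr0.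
apply: has_ps_eq h2 _ => z z1; rewrite /g1 has_ps_at0 /= /psum.
by rewrite big_ord1 expr0 mulr1.
Qed.

Lemma dcoef_sub0 : dcoef b1 = dcoef b. Proof. by []. Qed.

Lemma lipschitz_norm_ge p M k : 1 < p -> 0 <= M ->
  (lipschitz_norm 2 p^-1 g1 <= M%:E)%E -> bet p (dcoef b) k <= Cbet * M.
Proof.
move=> p1 M0; rewrite /lipschitz_norm; case: asboolP => [hl|_]; last by rewrite leye_eq.
move=> h; have hM := (hardy2_l2 has_ps_sub0).1 hl.1.
have d0 := dy_gt0 (R := R) k; have Y0 : 0 < dy k `^ p^-1 by exact: powR_gt0.
rewrite -dcoef_sub0; apply: (bet_of_lip has_ps_sub0 p1 M0 hM).
have h2 : (modulus_cont 2 g1 (dy k) * ((dy k `^ p^-1)^-1)%:E <= M%:E)%E.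
  apply: le_trans h; rewrite -[leLHS]add0e; apply: leeD; first by rewrite lee_fin cmod_ge0.
  by apply: ereal_sup_ubound; exists (dy k) => //=; rewrite in_itv /= d0.
by rewrite EFinM -lee_pdivrMr.
Qed.

Lemma lipschitz_norm_le p be : 1 < p -> (forall k, bet p (dcoef b) k <= be) ->
  (lipschitz_norm 2 p^-1 g1 <= (Clip p * be)%:E)%E.
Proof.
move=> p1 hb; rewrite /lipschitz_norm; case: asboolP => [_|]; last first.
  by move=> hn; exfalso; apply: hn; apply/(lipschitz_meanP has_ps_sub0 p1); exists be; exact: hb.
rewrite {1}/g1 subrr cmod0 add0e; apply: ge_ereal_sup => _ [t /= + <-].
rewrite in_itv /= andbT => t0; have Y0 : 0 < t `^ p^-1 by exact: powR_gt0.
have hb1 k : bet p (dcoef b1) k <= be := hb k.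
by rewrite lee_pdivrMr// -EFinM; exact: (lip_of_bet has_ps_sub0 p1 hb1 t0).
Qed.

Lemma lipschitz_norm_ge0 p : (0 <= lipschitz_norm 2 p^-1 g1)%E.
Proof.
rewrite /lipschitz_norm; case: asboolP => // _; apply: adde_ge0; first by rewrite lee_fin cmod_ge0.
apply: (@le_trans _ _ (modulus_cont 2 g1 1 * ((1 `^ p^-1)^-1)%:E)%E).
  apply: mule_ge0; last by rewrite lee_fin invr_ge0 powR_ge0.
  apply: (@le_trans _ _ (circle_norm 2 (fun x => boundary g1 (x + 1) - boundary g1 x)%R)).
    exact: poweR_ge0.
  by apply: ereal_sup_ubound; exists 1 => //=; rewrite in_itv /= ltr01 lexx.
by apply: ereal_sup_ubound; exists 1 => //=; rewrite in_itv /= ltr01.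
Qed.

End ZeroAtOrigin.
End LipschitzSpaces.

(** * The mixed norm in terms of beta *)

Section MixedNorm.
Context {R : realType}.
Implicit Types (f g h : Cx R -> Cx R) (c : nat -> Cx R) (p pt r s t x y M W d b : R).
Local Notation mu := (@lebesgue_measure R).
Local Notation dy := (@dy R).
Local Notation cut := (@cut R).

(** Half-open, so that each radius lies in exactly one ring. *)
Definition ring_itv j : set R := `[cut j, cut j.+1[%classic.

Lemma ring_itvP r : 0 < r < 1 -> exists j, ring_itv j r.
Proof.
move=> /andP[r0 r1]; have ex : exists j, r < cut j.
  have [J hJ] : exists J, (r + 1) / 2 <= cut J by apply: cut_near; lra.
  by exists J; lra.
case: (ex_minnP ex) => -[|j] hj hmin; first by rewrite cut0 in hj; lra.
exists j; rewrite /ring_itv /= in_itv /= hj andbT leNgt; apply/negP => /hmin.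
by rewrite ltnn.
Qed.

Lemma ring_itv_inj i j r : ring_itv i r -> ring_itv j r -> i = j.
Proof.
rewrite /ring_itv /= !in_itv /= => /andP[i1 i2] /andP[j1 j2].
case: (ltngtP i j) => // h.
  by have := lt_le_trans i2 (le_trans (cut_le (R := R) h) j1); rewrite ltxx.
by have := lt_le_trans j2 (le_trans (cut_le (R := R) h) i1); rewrite ltxx.
Qed.

Lemma ring_itv_measure j : mu (ring_itv j) = (dy j.+1)%:E.
Proof.
rewrite /ring_itv lebesgue_measure_itv /= lte_fin.
have e := cutS (R := R) j; have d0 := dy_gt0 (R := R) j.
have -> : cut j < cut j.+1 by lra.
by rewrite -EFinB e dyS.
Qed.

Lemma measurable_ring j : measurable (ring_itv j). Proof. exact: measurable_itv. Qed.

Definition stepf (a : nat -> R) j r : \bar R := ((a j)%:E * (\1_(ring_itv j) r)%:E)%E.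

Lemma stepf_ge0 a j r : (forall j, 0 <= a j) -> (0 <= stepf a j r)%E.
Proof. by move=> a0; rewrite mule_ge0 ?lee_fin. Qed.

Lemma stepf_meas a j D : measurable_fun D (stepf a j).
Proof.
apply: measurable_funeM; apply/measurable_EFinP; apply: measurable_funTS.
by apply: measurable_indic; exact: measurable_ring.
Qed.

Lemma stepf_int a j : (forall j, 0 <= a j) ->
  (\int[mu]_(r in `]0%R, 1%R[) stepf a j r = (a j)%:E * mu (ring_itv j `&` `]0%R, 1%R[))%E.
Proof.
move=> a0; rewrite ge0_integralZl_EFin//; last first.
  apply/measurable_EFinP; apply: measurable_funTS; apply: measurable_indic; exact: measurable_ring.
by rewrite integral_indic//; exact: measurable_ring.
Qed.

Lemma stepf_in a j r : ring_itv j r -> stepf a j r = (a j)%:E.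
Proof. by move=> h; rewrite /stepf indicE mem_set// mule1. Qed.

Lemma stepf_out a i j r : ring_itv i r -> i <> j -> stepf a j r = 0%E.
Proof.
move=> h ij; rewrite /stepf indicE memNset ?mule0// => hj.
by apply: ij; exact: ring_itv_inj h hj.
Qed.

(** h is dominated by a series of step functions that is integrated termwise; measurability enters
    through these step functions. *)
Lemma step_upper (h : R -> \bar R) (a : nat -> R) B : (forall j, 0 <= a j) ->
  (forall r, 0 <= h r)%E ->
  (forall j r, 0 < r < 1 -> ring_itv j r -> (h r <= (a j)%:E)%E) ->
  (forall J, \sum_(j < J) a j * dy j.+1 <= B) ->
  (\int[mu]_(r in `]0%R, 1%R[) h r <= B%:E)%E.
Proof.
move=> a0 h0 hle hB.
have s0 j r : (0 <= stepf a j r)%E by exact: stepf_ge0.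
apply: (@le_trans _ _ (\int[mu]_(r in `]0%R, 1%R[) (\sum_(j <oo) stepf a j r))%E).
  apply: (@le_integral_off_null R _ set0) => //.
    by move=> r; apply: nneseries_ge0.
  move=> r /=; rewrite in_itv /= => hr _; have [i hi] := ring_itvP hr.
  apply: le_trans (hle i r hr hi) _; rewrite -(stepf_in a hi).
  apply: le_trans (nneseries_lim_ge i.+1 (fun n _ _ => s0 n r)).
  by rewrite big_nat_recr//= leeDr//; apply: sume_ge0.
rewrite integral_nneseries//; last by move=> j; exact: stepf_meas.
apply: lime_le; first by apply: is_cvg_nneseries => j _ _; apply: integral_ge0.
apply: nearW => J; apply: (@le_trans _ _ (\sum_(j < J) a j * dy j.+1)%:E); last by rewrite lee_fin.
rewrite big_mkord -sumEFin; apply: lee_sum => j _.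
rewrite stepf_int// EFinM -ring_itv_measure; apply: lee_wpmul2l; first by rewrite lee_fin.
apply: le_measure; rewrite ?inE; [|exact: measurable_ring|by move=> x []].
by apply: measurableI => //; exact: measurable_ring.
Qed.

(** Ring 0 contains the radius 0, which the domain of integration omits; a 0 = 0 takes this ring out
    of the comparison. *)
Lemma step_lower (h : R -> \bar R) (a : nat -> R) : (forall j, 0 <= a j) -> a 0%N = 0 ->
  (forall r, 0 <= h r)%E ->
  (forall j r, 0 < r < 1 -> ring_itv j r -> ((a j)%:E <= h r)%E) ->
  forall J, ((\sum_(j < J) a j * dy j.+1)%:E <= \int[mu]_(r in `]0%R, 1%R[) h r)%E.
Proof.
move=> a0 az h0 hle J.
have s0 j r : (0 <= stepf a j r)%E by exact: stepf_ge0.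
apply: (@le_trans _ _ (\int[mu]_(r in `]0%R, 1%R[) (\sum_(0 <= j < J) stepf a j r))%E).
  rewrite ge0_integral_sum//; last by move=> j; exact: stepf_meas.
  rewrite big_mkord -sumEFin; apply: lee_sum => j _; rewrite stepf_int// EFinM.
  have [j0|jn0] := eqVneq (j : nat) 0%N; first by rewrite j0 az !mul0e.
  rewrite -ring_itv_measure (_ : ring_itv j `&` _ = ring_itv j)//.
  apply/seteqP; split => [x []//|x hx]; split => //.
  move: hx; rewrite /ring_itv /= !in_itv /= => /andP[h1 h2].
  rewrite (lt_trans h2 (cut_lt1 _)) andbT; apply: lt_le_trans h1.
  have h1j : (0 < j)%N by rewrite lt0n.
  by have := cut_le (R := R) h1j; rewrite /cut /dy expr1; lra.
apply: (@le_integral_off_null R _ set0) => //.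
  by move=> r; apply: sume_ge0.
move=> r /=; rewrite in_itv /= => hr _; have [i hi] := ring_itvP hr.
apply: le_trans (hle i r hr hi); rewrite big_mkord.
case: (ltnP i J) => iJ.
  rewrite (bigD1 (Ordinal iJ))//= (stepf_in a hi) big1 ?adde0//.
  by move=> j ji; apply: stepf_out hi _ => ij; move/eqP : ji; apply; apply: val_inj.
rewrite big1 ?lee_fin// => j _; apply: stepf_out hi _ => ij.
by move: iJ; rewrite ij leqNgt ltn_ord.
Qed.

Definition mean_sq g r : R := rmean (fun x => cmod (g (circle r x)) `^ 2).

Definition mixed_density g pt r : \bar R :=
  (integral_mean 2%:E r g `^ pt * ((pt / 2 + 1) * (1 - r ^+ 2) `^ (pt / 2))%:E)%E.

Section Weighted.
Variables (G : Cx R -> Cx R) (c : nat -> Cx R) (p pt : R).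
Hypothesis Gc : has_ps 1 G c.
Hypotheses (p2 : 2 < p) (hpt : pt^-1 = 2^-1 - p^-1).

Local Notation m := (mean_sq G).
Local Notation hw := (mixed_density G pt).

Lemma pt_gt2 : 2 < pt.
Proof.
have p0 : 0 < p by exact: lt_trans p2.
have i0 : 0 < p^-1 by rewrite invr_gt0.
have i2 : p^-1 < 2^-1 by rewrite ltf_pV2 ?posrE.
have t0 : 0 < pt by rewrite -invr_gt0 hpt; lra.
by rewrite -ltf_pV2 ?posrE// hpt; lra.
Qed.

Lemma weight_ge0 r : (0 <= hw r)%E.
Proof.
rewrite mule_ge0 ?poweR_ge0// lee_fin mulr_ge0 ?powR_ge0//.
by have := pt_gt2; lra.
Qed.

Lemma mean_sq_ge0 r : 0 <= m r.
Proof. by apply: rmean_ge0 => x; exact: powR_ge0. Qed.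

Lemma weightE r : 0 < r < 1 -> hw r = ((pt / 2 + 1) * (m r * (1 - r ^+ 2)) `^ (pt / 2))%:E.
Proof.
move=> /andP[r0 r1]; have hr : 0 <= r < 1 by rewrite ltW.
have w0 : 0 <= 1 - r ^+ 2 by nra.
rewrite /mixed_density /integral_mean circle_normE//; last exact: dan_ccont (has_ps_dan Gc) hr.
rewrite -/(m r) poweR_EFin -EFinM -powRrM (powRM _ (mean_sq_ge0 r) w0).
by rewrite [2^-1 * pt]mulrC mulrCA.
Qed.

Lemma mean_sq_le r V : 0 <= r < 1 -> (forall N, \sum_(n < N) cmod (c n) ^+ 2 * r ^+ (2 * n) <= V) -> m r <= V.
Proof.
move=> hr hV; have := parseval_le Gc hr hV.
by rewrite /mean_sq; congr (_ <= _); apply: rmeanE => x; rewrite powR_mulrn ?cmod_ge0.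
Qed.

Lemma le_mean_sq r N : 0 <= r < 1 -> \sum_(n < N) cmod (c n) ^+ 2 * r ^+ (2 * n) <= m r.
Proof.
move=> hr; have := parseval_ge N Gc hr; move/le_trans; apply.
by rewrite le_eqVlt; apply/orP; left; apply/eqP; apply: rmeanE => x; rewrite powR_mulrn ?cmod_ge0.
Qed.

(** This is where the exponent pt and the weight pt / 2 come from: since 1 / pt = 1/2 - 1/p, a ring
    of length 2^-k on which the mean square is B_k^2 and 1 - r^2 is 2^-k would contribute exactly
    beta_k^pt. *)
Lemma bet_powE k : bet p c k `^ pt = dy k * (blk c k * dy k) `^ (pt / 2).
Proof.
have t2 := pt_gt2; have b0 := bet_ge0 p c k; have d0 := dy_gt0 (R := R) k.
rewrite (blkE p) exprMn -mulrA powRM ?sqr_ge0//; last by rewrite mulr_ge0 ?sqr_ge0// ltW.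
rewrite -[bet p c k ^+ 2]powR_mulrn// -powRrM (_ : 2%:R * (pt / 2) = pt); last by field.
rewrite mulrCA -[LHS]mulr1; congr (_ * _).
rewrite -[(2 `^ _) ^+ 2]powR_mulrn ?powR_ge0// -powRrM dy_powR pow2D -powRrM pow2D.
rewrite -[LHS](powRr0 2); congr (_ `^ _).
have : pt * pt^-1 = 1 by rewrite mulfV// gt_eqF//; lra.
rewrite hpt; have pn : p != 0 by rewrite gt_eqF// (lt_trans _ p2).
move=> h; have -> : (1 - p^-1) * k%:R * 2%:R + - k%:R = k%:R * (1 - 2 * p^-1) by ring.
have -> : - k%:R + k%:R * (1 - 2 * p^-1) * (pt / 2) = k%:R * (pt * (2^-1 - p^-1) - 1) by field.
by rewrite h subrr mulr0.
Qed.

(** Block k is read on ring k + 2, where n (1 - r) <= 1/2 and so r^(2n) >= 1/4; there 1 - r^2 >=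
    2^-k / 8, whence 32 = 4 * 8. The separate factor 8 comes from the length 2^-(k+3) of that
    ring. *)
Lemma mixed_lower W J : 0 <= W -> (mixed_norm 2%:E pt (pt / 2) G <= W%:E)%E ->
  \sum_(j < J) bet p c j `^ pt <= 8 * 32 `^ (pt / 2) * W `^ pt.
Proof.
have t2 := pt_gt2; move=> W0 hW.
have t0 : 0 < pt by lra.
have hI : (\int[mu]_(r in `]0%R, 1%R[) hw r <= (W `^ pt)%:E)%E.
  move: hW; rewrite /mixed_norm; set I := (\int[_]_(_ in _) _)%E.
  have I0 : (0 <= I)%E by apply: integral_ge0 => r _; exact: weight_ge0.
  case: I I0 => [i||]//.
    by rewrite lee_fin => i0; rewrite poweR_EFin !lee_fin powR_inv_le.
  by move=> _; rewrite poweRyr ?leye_eq// invr_eq0 gt_eqF.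
(* The two innermost rings are given up, which also meets the condition a 0 = 0 of [step_lower]. *)
pose a j : R := if j is k.+2 then (blk c k * dy k / 32) `^ (pt / 2) else 0.
have a0 j : 0 <= a j by case: j => [|[|k]]//=; exact: powR_ge0.
have hle j r : 0 < r < 1 -> ring_itv j r -> ((a j)%:E <= hw r)%E.
  move=> hr; case: j => [|[|k]] hj; rewrite ?weight_ge0//=.
  have [r0 r1] := andP hr; have hr' : 0 <= r < 1 by rewrite ltW.
  rewrite weightE// lee_fin.
  have d0 := dy_gt0 (R := R) k; have d1 := dy_le1 (R := R) k.
  move: hj; rewrite /ring_itv /= in_itv /= /cut !dyS => /andP[h1 h2].
  have m1 : blk c k / 4 <= m r.
    apply: le_trans (@le_mean_sq r (2 ^ k.+1).-1 hr').
    rewrite -(big_mkord xpredT (fun n => cmod (c n) ^+ 2 * r ^+ (2 * n))).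
    apply: (@le_trans _ _ (\sum_((2 ^ k).-1 <= n < (2 ^ k.+1).-1) cmod (c n) ^+ 2 * r ^+ (2 * n))).
      rewrite /blk mulr_suml !big_nat; apply: ler_sum => n hn.
      apply: ler_wpM2l; first exact: sqr_ge0.
      have /andP[_ hn2] := @block_bound R (fun=> 0) k n hn.
      have bern : 1 - n%:R * (1 - r) <= r ^+ n.
        elim: (n) => [|i IH]; first by rewrite mul0r subr0 expr0.
        rewrite exprS; have := exprn_ile1 i (ltW r0) (ltW r1); have := exprn_ge0 i (ltW r0).
        rewrite -natr1; nra.
      have n1 : n%:R <= n.+1%:R :> R by rewrite ler_nat.
      have half : 2^-1 <= r ^+ n.
        apply: le_trans bern; have : n%:R * (1 - r) <= n.+1%:R * (dy k / 4) by apply: ler_pM => //; lra.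
        lra.
      rewrite mulnC exprM.
      have : (2^-1 : R) ^+ 2 <= (r ^+ n) ^+ 2 by apply: lerXn2r; rewrite ?nnegrE ?exprn_ge0// ?invr_ge0// ltW.
      by rewrite (_ : (2^-1 : R) ^+ 2 = 4^-1)//; field.
    rewrite big_mkord; apply: (@sum_nat_ge0_le R (fun n => cmod (c n) ^+ 2 * r ^+ (2 * n))) => n.
    by rewrite mulr_ge0 ?sqr_ge0// exprn_ge0// ltW.
  have w1 : dy k / 8 <= 1 - r ^+ 2 by nra.
  have B0 := blk_ge0 c k.
  apply: (@le_trans _ _ ((m r * (1 - r ^+ 2)) `^ (pt / 2))); last first.
    by apply: ler_peMl; [exact: powR_ge0|lra].
  apply: ge0_ler_powR; rewrite ?nnegrE; [lra|by rewrite divr_ge0// mulr_ge0// ltW| |].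
    by rewrite mulr_ge0 ?mean_sq_ge0//; nra.
  have := ler_pM (_ : 0 <= blk c k / 4) (_ : 0 <= dy k / 8) m1 w1.
  rewrite !divr_ge0 ?(ltW d0)// => /(_ isT isT); lra.
have hS := step_lower a0 erefl weight_ge0 hle J.+2.
have {hS} : \sum_(j < J.+2) a j * dy j.+1 <= W `^ pt by rewrite -lee_fin; exact: le_trans hS hI.
rewrite !big_ord_recl /= !mul0r !add0r => h.
have hE j : bet p c j `^ pt = 8 * 32 `^ (pt / 2) * (a j.+2 * dy j.+3).
  have v0 : 0 <= 32^-1 :> R by rewrite invr_ge0.
  have x0 : 0 <= blk c j * dy j by rewrite mulr_ge0 ?blk_ge0// ltW// dy_gt0.
  rewrite bet_powE /= (powRM _ x0 v0).
  have -> : (32^-1) `^ (pt / 2) = (32 `^ (pt / 2))^-1 :> R.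
    have n0 : 32 `^ (pt / 2) != 0 :> R by rewrite gt_eqF ?powR_gt0.
    have w0 : 0 <= 32 :> R by [].
    by apply: (mulIf n0); rewrite mulVf// -(powRM _ v0 w0) mulVf ?powR1.
  have n0 : 32 `^ (pt / 2) != 0 :> R by rewrite gt_eqF ?powR_gt0.
  rewrite !dyS; move: (32 `^ _) n0 => q n0; move: (_ `^ _) => X; by field.
rewrite (eq_bigr _ (fun (j : 'I_J) _ => hE j)) -mulr_sumr.
by apply: ler_wpM2l => //; rewrite mulr_ge0 ?powR_ge0.
Qed.

Lemma ring_kernel (j k : nat) : 1 < p ->
  2 `^ (2 * ((1 - p^-1) * k%:R)) * (dy j * Num.min 1 (dy k ^+ 2 / dy j ^+ 2)) * 2 `^ (- ((1 - 2 / p) * j%:R))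
   <= gk (q_ (lip_eps p)) j k.
Proof.
move=> p1; have e0 := lip_eps_gt0 p1.
have [e1 e2] : lip_eps p <= p^-1 /\ lip_eps p <= 1 - p^-1 by rewrite /lip_eps !ge_min !lexx orbT.
have d0 := dy_gt0 (R := R) j.
have mE : Num.min 1 (dy k ^+ 2 / dy j ^+ 2) = Num.min (dy j ^+ 2) (dy k ^+ 2) * 2 `^ (2 * j%:R).
  have -> : 2 `^ (2 * j%:R) = (dy j ^+ 2)^-1 :> R.
    by rewrite -exprVn dyV natrX powRrM !powR_mulrn// -!exprM mulnC.
  by rewrite minr_pMl ?invr_ge0 ?sqr_ge0// mulfV// expf_neq0// gt_eqF.
rewrite mE; have := lip_kernel j k p1.
rewrite -(ler_pM2r (powR_gt0 (2 * (j%:R / p)) (_ : 0 < 2))) ?ltr0n// -[X in _ <= X]mulrA pow2D addNr powRr0 mulr1.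
apply: le_trans; rewrite le_eqVlt; apply/orP; left; apply/eqP.
have -> : 2 `^ (2 * (j%:R / p)) = dy j * 2 `^ (2 * j%:R) * 2 `^ (- ((1 - 2 / p) * j%:R)) :> R.
  by rewrite dy_powR !pow2D; congr (_ `^ _); ring.
by ring.
Qed.

(** For r in ring j and n in block k, r^n is at most 1 and, by (n + 1) r^n <= 1 / (1 - r), at most 2
    * 2^(j - k). Up to a factor 4 the square of the better bound is [mn]. *)
Lemma ring_mean_le j r N : 0 < r < 1 -> ring_itv j r ->
  (\sum_(n < N) cmod (c n) ^+ 2 * r ^+ (2 * n)) * (1 - r ^+ 2) <=
  8 * 2 `^ ((1 - 2 / p) * j%:R) * \sum_(k < N) gk (q_ (lip_eps p)) j k * bet p c k ^+ 2.
Proof.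
move=> /andP[r0 r1]; rewrite /ring_itv /= in_itv /= /cut dyS => /andP[h1 h2].
have p1 : 1 < p by apply: lt_trans p2; lra.
have d0 := dy_gt0 (R := R) j; have w0 : 0 <= 1 - r ^+ 2 by nra.
have w1 : 1 - r ^+ 2 <= 2 * dy j by nra.
have F0 n : 0 <= cmod (c n) ^+ 2 * r ^+ (2 * n) by rewrite mulr_ge0 ?sqr_ge0// exprn_ge0// ltW.
have NK : (N <= (2 ^ N).-1)%N by rewrite -ltnS prednK ?expn_gt0// ltn_expl.
apply: (@le_trans _ _ ((\sum_(0 <= k < N) \sum_((2 ^ k).-1 <= n < (2 ^ k.+1).-1) cmod (c n) ^+ 2 * r ^+ (2 * n)) * (1 - r ^+ 2))).
  apply: ler_wpM2r => //; rewrite -(@block_sum _ (fun n => cmod (c n) ^+ 2 * r ^+ (2 * n)) 0%N)//.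
  rewrite -(big_mkord xpredT (fun n => cmod (c n) ^+ 2 * r ^+ (2 * n))) (@big_cat_nat _ _ _ N 0%N (2 ^ N).-1)//=.
  by rewrite lerDl; apply: sumr_ge0.
rewrite big_mkord mulr_suml mulr_sumr; apply: ler_sum => k _.
have e0 : 0 <= dy k ^+ 2 / dy j ^+ 2 by rewrite divr_ge0 ?sqr_ge0.
set mn := Num.min 1 (dy k ^+ 2 / dy j ^+ 2).
have mn0 : 0 <= mn by rewrite /mn le_min ler01.
have hb : \sum_((2 ^ k).-1 <= n < (2 ^ k.+1).-1) cmod (c n) ^+ 2 * r ^+ (2 * n) <= blk c k * (4 * mn).
  rewrite /blk mulr_suml !big_nat; apply: ler_sum => n hn.
  apply: ler_wpM2l; first exact: sqr_ge0.
  have /andP[hn1 _] := @block_bound R (fun=> 0) k n hn.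
  have rn0 : 0 <= r ^+ n by rewrite exprn_ge0// ltW.
  have rn1 : r ^+ n <= 1 by rewrite exprn_ile1// ltW.
  have dk := dy_gt0 (R := R) k.
  have h3 : r ^+ n * dy j <= 2 * dy k.
    have := natmul_exp_le n (_ : 0 <= r < 1); rewrite r1 (ltW r0) => /(_ isT) h3.
    have i1 : (1 - r)^-1 * (dy j / 2) <= 1 by rewrite mulrC ler_pdivrMr; lra.
    have h4 : n.+1%:R * r ^+ n * (dy j / 2) <= 1.
      by apply: le_trans i1; apply: ler_wpM2r => //; lra.
    have h5 : 0 <= (n.+1%:R * dy k - 1) * (r ^+ n * dy j).
      by rewrite mulr_ge0 ?subr_ge0// mulr_ge0// ltW.
    have h6 : 0 <= (1 - n.+1%:R * r ^+ n * (dy j / 2)) * dy k by rewrite mulr_ge0 ?subr_ge0// ltW.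
    lra.
  rewrite mulnC exprM -ler_pdivrMl// /mn le_min; apply/andP; split; first nra.
  rewrite ler_pdivlMr ?exprn_gt0// -mulrA ler_pdivrMl// -exprMn.
  have : (r ^+ n * dy j) ^+ 2 <= (2 * dy k) ^+ 2.
    by apply: lerXn2r; rewrite ?nnegrE ?mulr_ge0// ltW.
  by rewrite [X in _ <= X -> _]exprMn (_ : (2 : R) ^+ 2 = 4)//; ring.
apply: (le_trans (ler_pM _ w0 hb w1)).
  by apply: sumr_ge0 => n _; exact: F0.
rewrite (blkE p).
have := ring_kernel j k p1; rewrite -/mn => hk.
have E0 : 0 < 2 `^ ((1 - 2 / p) * j%:R) :> R by rewrite powR_gt0.
have kE : 2 `^ (- ((1 - 2 / p) * j%:R)) = (2 `^ ((1 - 2 / p) * j%:R))^-1 :> R by rewrite powRN.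
rewrite kE ler_pdivrMr// in hk.
have sq : (2 `^ ((1 - p^-1) * k%:R)) ^+ 2 = 2 `^ (2 * ((1 - p^-1) * k%:R)) :> R.
  by rewrite expr2 pow2D; congr (_ `^ _); ring.
rewrite exprMn sq.
have := ler_wpM2l (_ : 0 <= 8 * bet p c k ^+ 2) hk; rewrite mulr_ge0 ?sqr_ge0// => /(_ isT).
lra.
Qed.

(** Schur's test in l^(pt/2), available because pt > 2, applied to the sequence beta^2. The sums
    over all blocks are limits L j of increasing partial sums, and the finite inequality passes to
    the limit. *)
Lemma mixed_upper b : 0 <= b -> (forall K, \sum_(k < K) bet p c k `^ pt <= b `^ pt) ->
  (mixed_norm 2%:E pt (pt / 2) G <= (((pt / 2 + 1) * (8 * lip_sum p) `^ (pt / 2)) `^ pt^-1 * b)%:E)%E.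
Proof.
move=> b0 hb; have t2 := pt_gt2; have t0 : 0 < pt by lra.
have th : 1 <= pt / 2 by lra.
have p1 : 1 < p by apply: lt_trans p2; lra.
have hq := q_lt1 (lip_eps_gt0 p1); have [q0 q1] := andP hq.
pose S j K : R := \sum_(k < K) gk (q_ (lip_eps p)) j k * bet p c k ^+ 2.
have S0 j K : 0 <= S j K.
  by apply: sumr_ge0 => k _; rewrite mulr_ge0 ?sqr_ge0 ?gk_ge0.
have Sm j : nondecreasing_seq (S j).
  by apply/nondecreasing_seqP => K; rewrite /S big_ord_recr /= lerDl mulr_ge0 ?sqr_ge0 ?gk_ge0.
have bk k : bet p c k <= b.
  have := hb k.+1; rewrite big_ord_recr /= => h.
  have h' : bet p c k `^ pt <= b `^ pt.
    by apply: le_trans h; rewrite lerDr; apply: sumr_ge0 => i _; exact: powR_ge0.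
  by move: h'; rewrite -powR_inv_le ?powR_ge0 ?bet_ge0// -powRrM mulfV ?gt_eqF// powRr1 ?bet_ge0.
have Sb j K : S j K <= lip_sum p * b ^+ 2.
  apply: (@le_trans _ _ (\sum_(k < K) gk (q_ (lip_eps p)) j k * b ^+ 2)).
    by apply: ler_sum => k _; apply: ler_wpM2l; [exact: gk_ge0|apply: lerXn2r; rewrite ?nnegrE ?bet_ge0].
  by rewrite -mulr_suml; apply: ler_wpM2r; [exact: sqr_ge0|exact: gk_sum].
have Sc j : cvgn (S j).
  by apply: nondecreasing_is_cvgn => //; exists (lip_sum p * b ^+ 2) => _ [K _ <-].
pose L j := limn (S j).
have SL j K : S j K <= L j by exact: nondecreasing_cvgn_le.
have L0 j : 0 <= L j by exact: le_trans (S0 j 0%N) (SL j 0%N).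
pose a j := (pt / 2 + 1) * (8 * 2 `^ ((1 - 2 / p) * j%:R) * L j) `^ (pt / 2).
have a0 j : 0 <= a j by rewrite mulr_ge0 ?powR_ge0//; lra.
have hle j r : 0 < r < 1 -> ring_itv j r -> (hw r <= (a j)%:E)%E.
  move=> hr hj; rewrite weightE// lee_fin; apply: ler_wpM2l; first by lra.
  have [r0 r1] := andP hr; have hr' : 0 <= r < 1 by rewrite ltW.
  have w0 : 0 < 1 - r ^+ 2 by nra.
  apply: ge0_ler_powR; rewrite ?nnegrE; [lra|by rewrite mulr_ge0 ?mean_sq_ge0// ltW| |].
    by rewrite mulr_ge0// mulr_ge0 ?powR_ge0.
  rewrite -ler_pdivlMr//; apply: mean_sq_le => // N; rewrite ler_pdivlMr//.
  apply: le_trans (ring_mean_le N hr hj) _; apply: ler_wpM2l; last exact: SL.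
  by rewrite mulr_ge0 ?powR_ge0.
have schurL J : \sum_(j < J) L j `^ (pt / 2) <= lip_sum p `^ (pt / 2) * b `^ pt.
  have lim : (\sum_(j < J) S j K `^ (pt / 2)) @[K --> \oo] --> \sum_(j < J) L j `^ (pt / 2).
    apply: cvg_big; [exact: add_continuous|move=> j _].
    by apply: cvg_powR; [lra|exact: S0|exact: L0|exact: Sc].
  rewrite -(cvg_lim _ lim)//; apply: limr_le; first by apply/cvg_ex; eexists; exact: lim.
  apply: nearW => K; apply: (le_trans (@schur_geom R (pt / 2) _ J K (fun k => bet p c k ^+ 2) th hq _)).
    by move=> k; exact: sqr_ge0.
  apply: ler_wpM2l; first exact: powR_ge0.
  apply: le_trans (hb K); apply: ler_sum => k _.
  by rewrite -powR_mulrn ?bet_ge0// -powRrM (_ : 2%:R * (pt / 2) = pt)//; field.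
have aE j : a j * dy j.+1 = (pt / 2 + 1) / 2 * 8 `^ (pt / 2) * L j `^ (pt / 2).
  have e8 : 0 <= 8 * 2 `^ ((1 - 2 / p) * j%:R) :> R by rewrite mulr_ge0 ?powR_ge0.
  have e1 : 0 <= 8 :> R by [].
  rewrite /a (powRM _ e8 (L0 j)) (powRM _ e1 (powR_ge0 _ _)) -powRrM dyS dy_powR.
  have -> : (1 - 2 / p) * j%:R * (pt / 2) = j%:R.
    have : pt * pt^-1 = 1 by rewrite mulfV// gt_eqF.
    have pn : p != 0 by rewrite gt_eqF// (lt_trans _ p2).
    rewrite hpt => h; have -> : (1 - 2 / p) * j%:R * (pt / 2) = j%:R * (pt * (2^-1 - p^-1)) by field.
    by rewrite h mulr1.
  have : 2 `^ j%:R * 2 `^ (- j%:R) = 1 :> R by rewrite pow2D subrr powRr0.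
  move: (2 `^ j%:R) (2 `^ (- j%:R)) (8 `^ _) (L j `^ _) => u v w z huv.
  have -> : (pt / 2 + 1) * (w * u * z) * (v / 2) = (pt / 2 + 1) / 2 * w * z * (u * v) by ring.
  by rewrite huv mulr1.
have ls0 : 0 <= lip_sum p by rewrite /lip_sum divr_ge0// subr_ge0 ltW.
have e8 : 0 <= 8 :> R by [].
have := step_upper a0 weight_ge0 hle (B := (pt / 2 + 1) * (8 * lip_sum p) `^ (pt / 2) * b `^ pt).
rewrite /mixed_norm; set I := (\int[_]_(_ in _) _)%E.
have I0 : (0 <= I)%E by apply: integral_ge0 => r _; exact: weight_ge0.
move=> hI; have {}hI : (I <= ((pt / 2 + 1) * (8 * lip_sum p) `^ (pt / 2) * b `^ pt)%:E)%E.
  apply: hI => J; under eq_bigr do rewrite aE.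
  rewrite -mulr_sumr (powRM _ e8 ls0).
  have c0 : 0 <= (pt / 2 + 1) * 8 `^ (pt / 2) by rewrite mulr_ge0 ?powR_ge0//; lra.
  have s1 := ler_wpM2l c0 (schurL J).
  have s0 : 0 <= (pt / 2 + 1) * 8 `^ (pt / 2) * \sum_(j < J) L j `^ (pt / 2).
    by rewrite mulr_ge0//; apply: sumr_ge0 => j _; exact: powR_ge0.
  move: s1 s0; lra.
case: I I0 hI => [i||]//; rewrite !lee_fin => i0 hi.
have k0 : 0 <= (pt / 2 + 1) * (8 * lip_sum p) `^ (pt / 2) by rewrite mulr_ge0 ?powR_ge0//; lra.
rewrite powR_inv_le// ?mulr_ge0 ?powR_ge0//.
by rewrite (powRM _ (powR_ge0 _ _) b0) -powRrM mulVf ?gt_eqF// powRr1.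
Qed.

End Weighted.
End MixedNorm.

(** * Assembly of the four cases *)

Section Assembly.
Context {R : realType}.
Implicit Types (f g h : Cx R -> Cx R) (b c : nat -> Cx R) (M B e x y : R).

Lemma analytic_ps g : analytic g ->
  exists2 b, has_ps 1 g b & has_ps 1 (cderiv g) (dcoef b).
Proof.
by move=> ag; have [b gb] := dan_has_ps ltr01 ag; exists b; [exact: gb|exact: (has_ps_cderiv gb)].
Qed.

Lemma geom_small (C q y : R) : 0 <= C -> 0 <= q < 1 -> 0 < y ->
  exists K, forall k, (K <= k)%N -> C * q ^+ k <= y.
Proof.
move=> C0 hq y0; have [q0 q1] := andP hq.
have d0 : 0 < 1 - q by lra.
have x0 : 0 <= C / (1 - q) / y by rewrite !divr_ge0// ltW.
exists (Num.bound (C / (1 - q) / y)) => k hk.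
have h1 := archi_boundP x0.
have h2 : C / (1 - q) / y < k.+1%:R by apply: lt_le_trans h1 _; rewrite ler_nat leqW.
have h3 := ler_wpM2l C0 (natmul_exp_le k hq).
rewrite ltr_pdivrMr// in h2.
have h4 : k.+1%:R * (C * q ^+ k) <= k.+1%:R * y by move: h2 h3; lra.
by rewrite -(ler_pM2l (ltr0Sn R k)).
Qed.

Lemma tsum_delta p k : tsum p k.+1 (fun j => (j == k)%:R) = tfun p k :> (Cx R -> Cx R).
Proof.
apply/funext => z; rewrite /tsum (bigD1 ord_max)//= eqxx mul1r big1 ?addr0// => j jk.
have /negbTE -> : val j != k by exact: jk.
by rewrite mul0r.
Qed.

Lemma tfun_HB p k : 1 < p -> HB p%:E (tfun p k : Cx R -> Cx R) (Ctest p).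
Proof.
move=> p1; have := @tsum_HB R p k.+1 (fun j => (j == k)%:R) p1 (fun _ => ler0n _ _).
rewrite tsum_delta (_ : \sum_(j < k.+1) (j == k :> nat)%:R `^ p = 1) ?powR1 ?mulr1//.
rewrite (bigD1 ord_max)//= eqxx powR1 big1 ?addr0// => j jk.
have /negbTE -> : val j != k by exact: jk.
by rewrite powR0// gt_eqF//; lra.
Qed.

Section FixedSymbol.
Variables (g : Cx R -> Cx R) (c : nat -> Cx R).
Hypothesis gc : has_ps 1 (cderiv g) c.
Local Notation T := (hilbert_op g).

Lemma tfun_block_lower p k : 1 < p ->
  (bet p c k / 64) ^+ 2 <= \sum_(n < (2 ^ k.+1).-1) cmod (c n * mom (tfun p k) n) ^+ 2.
Proof.
move=> p1; set F := fun n => cmod (c n * mom (tfun p k) n) ^+ 2.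
have F0 n : 0 <= F n by exact: sqr_ge0.
apply: le_trans (sum_nat_ge0_le (2 ^ k).-1 _ F0).
have -> : (bet p c k / 64) ^+ 2 = blk c k * (2 `^ (- ((1 - p^-1) * k%:R)) / 64) ^+ 2.
  rewrite /bet -mulrA exprMn sqr_sqrtr ?blk_ge0//.
rewrite /blk mulr_suml !big_nat; apply: ler_sum => n /andP[_ hn].
rewrite /F cmodM [X in _ <= X]exprMn; apply: ler_wpM2l; first exact: sqr_ge0.
apply: lerXn2r; rewrite ?nnegrE ?cmod_ge0 ?divr_ge0 ?powR_ge0//.
have h := (@tsum_mom_ge R p k.+1 (fun j => (j == k)%:R) k n _ (fun _ => ler0n _ _)).
move: (h (2 `^ (- ((1 - p^-1) * k%:R)))); rewrite tsum_delta eqxx mul1r; apply => //.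
exact: tfun_rad.
Qed.

(* Along a sequence of test functions concentrating at 1 the moments tend to 0, so the
   limit provided by compactness can only be 0. *)
Lemma compact_bet_small p : 1 < p -> compact_op p%:E 2%:E T ->
  forall e, 0 < e -> exists K, forall k, (K <= k)%N -> bet p c k <= e.
Proof.
move=> p1 [_ hT] e e0; apply: contrapT => hno.
have p1' : (1 <= p%:E)%E by rewrite lee_fin ltW.
have /choice[ks hks] : forall n, exists k, (n <= k)%N /\ e < bet p c k.
  move=> n; apply: contrapT => hn; apply: hno; exists n => k nk; rewrite leNgt.
  by apply/negP => hk; apply: hn; exists k.
have hF n : HB p%:E (tfun p (ks n) : Cx R -> Cx R) (Ctest p) by exact: tfun_HB.
have [||phi hphi [h hh hlim]] := hT (fun n => tfun p (ks n)).
- by move=> n; exact: HB_hardy (hF n).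
- by exists (Ctest p) => n; have [] := hF n.
have [A hA] := dan_has_ps ltr01 hh.1.
have hphij j : (j <= ks (phi j))%N.
  apply: leq_trans (hks (phi j)).1; elim: j => // i IH; apply: leq_ltn_trans IH _.
  by move/increasing_seqP : hphi; exact.
have hlim' y : 0 < y -> exists J, forall j, (J <= j)%N -> forall N,
    \sum_(k < N) cmod (c k * mom (tfun p (ks (phi j))) k - A k) ^+ 2 <= y ^+ 2.
  move=> y0; have /fine_cvgP[hfin /cvgrPdist_le/(_ y y0) h1] := hlim.
  have [J _ hJ] := filterI hfin h1; exists J => j /hJ [/= h2].
  rewrite sub0r normrN => /(le_trans (ler_norm _)) h3.
  have hsub := has_ps_sub (hilbert_ps gc p1' (hF (phi j))) hA.
  by apply: (hardy2P hsub (ltW y0)).1; rewrite -lee_fin fineK in h3.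
have p0 : 0 < p by lra.
have s0 : 0 < 1 - p^-1 by rewrite subr_gt0 invf_lt1.
have rate k : 2 `^ (- ((1 - p^-1) * k%:R)) = q_ (1 - p^-1) ^+ k :> R.
  by rewrite /q_ -mulNr powRrM powR_mulrn// powR_ge0.
(* If A m were nonzero, far along the subsequence c m times the m-th moment would be of size at most
   |A m| / 3 and yet within |A m| / 3 of A m. *)
have A0 m : A m = 0.
  apply/eqP; rewrite -cmod_eq0 -[_ == 0]negbK; apply/negP => Am.
  have x0 : 0 < cmod (A m) by rewrite lt_neqAle eq_sym Am cmod_ge0.
  have x3 : 0 < cmod (A m) / 3 by rewrite divr_gt0.
  have [J hJ] := hlim' _ x3.
  have [K hK] := geom_small (cmod_ge0 (c m)) (q_lt1 s0) x3.
  pose j := maxn J K; have Jj : (J <= j)%N by exact: leq_maxl.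
  have Kj : (K <= ks (phi j))%N by apply: leq_trans (hphij j); exact: leq_maxr.
  have h1 := hK _ Kj; rewrite -rate in h1.
  have h2 : cmod (c m * mom (tfun p (ks (phi j))) m) <= cmod (A m) / 3.
    by rewrite cmodM; apply: le_trans h1; apply: ler_wpM2l; [exact: cmod_ge0|exact: mom_le (tfun_rad _ _)].
  have := hJ j Jj m.+1; rewrite big_ord_recr /= => h3.
  have h4 : cmod (c m * mom (tfun p (ks (phi j))) m - A m) <= cmod (A m) / 3.
    rewrite -(ler_pXn2r (_ : (0 < 2)%N)) ?nnegrE ?cmod_ge0 ?(ltW x3)//.
    by apply: le_trans h3; rewrite lerDr; apply: sumr_ge0 => i _; exact: sqr_ge0.
  have := cmodB (c m * mom (tfun p (ks (phi j))) m) (c m * mom (tfun p (ks (phi j))) m - A m).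
  by rewrite subKr; lra.
have [J hJ] := hlim' (e / 64) (divr_gt0 e0 (ltr0n R 64)).
have h1 := tfun_block_lower (ks (phi J)) p1.
have := hJ J (leqnn _) (2 ^ (ks (phi J)).+1).-1.
under eq_bigr do rewrite A0 subr0.
move=> /(le_trans h1); have h2 := (hks (phi J)).2.
by rewrite ler_pXn2r ?nnegrE ?divr_ge0 ?bet_ge0 ?(ltW e0)//; lra.
Qed.

(** Bounds in real numbers are traded for extended norms, so that infinite values are compared too.
    The constant involves C1 and C2 alone, hence not the symbol, and the 1 in the maximum keeps it
    positive. *)
Lemma op_norm_comparable p (C1 C2 : R) (y : \bar R) : (1 <= p)%E -> (0 <= y)%E ->
  (forall B, 0 <= B -> (y <= B%:E)%E -> op_bound p 2%:E T (C1 * B)) ->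
  (forall M, 0 <= M -> op_bound p 2%:E T M -> (y <= (C2 * M)%:E)%E) ->
  comparable (Num.max 1 (Num.max C1 C2)) (op_norm p 2%:E T) y.
Proof.
move=> p1 y0 h1 h2; set C := Num.max 1 _.
have C0 : 0 < C by rewrite lt_max ltr01.
have C1C : C1 <= C by rewrite /C !le_max lexx orbT.
have C2C : C2 <= C by rewrite /C !le_max lexx !orbT.
split.
  apply: le_op_norm => M hM; have M0 := op_bound_ge0 p1 hM.
  apply: (@le_trans _ _ ((C^-1)%:E * (C2 * M)%:E)%E).
    by apply: lee_wpmul2l; [rewrite lee_fin invr_ge0 ltW|exact: h2].
  by rewrite -EFinM lee_fin ler_pdivrMl//; apply: ler_wpM2r.
case: y y0 h1 {h2} => [B||]// y0 h1.
  have B0 : 0 <= B by rewrite -lee_fin.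
  apply: le_trans (op_norm_le (h1 B B0 (lexx _))) _.
  by rewrite lee_fin; apply: ler_wpM2r.
by rewrite gt0_muley ?lte_fin// leey.
Qed.

End FixedSymbol.

Lemma theorem1_H1 g : analytic g ->
  [/\ [<-> bounded_op 1%:E 2%:E (hilbert_op g);
           compact_op 1%:E 2%:E (hilbert_op g);
           hardy 2%:E (cderiv g)],
      (2%:E * hardy_norm 2%:E (cderiv g) <= op_norm 1%:E 2%:E (hilbert_op g))%E
    & (op_norm 1%:E 2%:E (hilbert_op g) <= pi%:E * hardy_norm 2%:E (cderiv g))%E].
Proof.
move=> /analytic_ps[b gb gc]; have l1 : (1 <= 1%:E :> \bar R)%E by [].
have bh : bounded_op 1%:E 2%:E (hilbert_op g) -> hardy 2%:E (cderiv g).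
  move=> [M hM]; split; first exact: has_ps_dan gc.
  exact: le_lt_trans (op_bound_H1 gc hM) (ltry _).
split.
- tfae.
  + by move=> /bh /(H1_tails gc); exact: small_tails_compact.
  + by move=> /(compact_bounded gc l1) /bh.
  + by move=> /(H1_tails gc); exact: small_tails_bounded.
- apply: le_op_norm => M hM.
  apply: le_trans (lee_wpmul2l (_ : (0 <= 2%:E)%E) (op_bound_H1 gc hM)) _; first by rewrite lee_fin.
  by rewrite -EFinM lee_fin mulrCA mulfV// mulr1.
- have h0 := hardy_norm_ge0 (cderiv g) (isT : (2%:E : \bar R) != -oo%E).
  have H := H1_level gc.
  case: (hardy_norm _ _) h0 H => [r||]// h0 H.
    by rewrite -EFinM; apply: op_norm_le; apply: H.
  by rewrite gt0_muley ?lte_fin ?pi_gt0// leey.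
Qed.

Section SmallExponent.
Variables (p : R) (g : Cx R -> Cx R) (b : nat -> Cx R).
Hypotheses (p12 : 1 < p <= 2) (gb : has_ps 1 g b) (gc : has_ps 1 (cderiv g) (dcoef b)).
Local Notation T := (hilbert_op g).

Let p1 : 1 < p. Proof. by case/andP: p12. Qed.
Let p1' : (1 <= p%:E)%E. Proof. by rewrite lee_fin ltW. Qed.
Let Cup0 : 0 <= Cup p. Proof. exact: powR_ge0. Qed.

Lemma op_bound_bet M : (forall k, bet p (dcoef b) k <= M) -> op_bound p%:E 2%:E T (Cup p * M).
Proof.
move=> hM; have M0 : 0 <= M := le_trans (bet_ge0 p (dcoef b) 0%N) (hM 0%N).
apply/(op_boundP gc p1' (mulr_ge0 Cup0 M0)) => f B hf N.
have := @blocks_upper2 R (dcoef b) p M 0%N f B p12 (fun k _ => hM k) hf N.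
by rewrite big_mkord.
Qed.

Lemma bounded_lipschitz : bounded_op p%:E 2%:E T <-> lipschitz_mean 2 p^-1 g.
Proof.
rewrite (lipschitz_meanP gb p1); split=> [[M hM]|[M hM]].
  by exists (64 * M * Ctest p) => k; exact: (bet_le gc k p1 hM).
by exists (Cup p * M); exact: op_bound_bet.
Qed.

Lemma compact_little_lipschitz : compact_op p%:E 2%:E T <-> little_lipschitz_mean 2 p^-1 g.
Proof.
rewrite (little_lipschitz_meanP gb p1); split; first exact: compact_bet_small gc p p1.
move=> hs; apply: (small_tails_compact gc p1') => e e0.
pose d := Num.sqrt e / (Cup p + 1); have s0 : 0 < Num.sqrt e by rewrite sqrtr_gt0.
have c1 : 0 < Cup p + 1 by have := Cup0; lra.
have d0 : 0 < d by rewrite divr_gt0.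
have [K hK] := hs d d0; exists (2 ^ K).-1 => f hf N.
apply: le_trans (blocks_upper2 p12 hK hf N) _.
rewrite mulr1 -[leRHS](sqr_sqrtr (ltW e0)); apply: lerXn2r.
- by rewrite nnegrE mulr_ge0// ltW.
- by rewrite nnegrE ltW.
- by rewrite mulrCA ler_piMr ?(ltW s0)// ler_pdivrMr// mul1r; have := Cup0; lra.
Qed.

Lemma op_norm_lipschitz :
  comparable (Num.max 1 (Num.max (Cup p * Cbet) (Clip p * (64 * Ctest p))))
    (op_norm p%:E 2%:E T) (lipschitz_norm 2 p^-1 (fun z => g z - g 0)).
Proof.
apply: op_norm_comparable => //.
- exact: lipschitz_norm_ge0.
- move=> B B0 hB; rewrite -mulrA; apply: op_bound_bet => k.
  exact: (lipschitz_norm_ge gb k p1 B0 hB).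
- move=> M M0 hM.
  have -> : Clip p * (64 * Ctest p) * M = Clip p * (64 * M * Ctest p) by ring.
  by apply: (lipschitz_norm_le gb p1) => k; exact: (bet_le gc k p1 hM).
Qed.

End SmallExponent.

Section LargeExponent.
Variables (p pt : R) (g : Cx R -> Cx R) (c : nat -> Cx R).
Hypotheses (p2 : 2 < p) (hpt : pt^-1 = 2^-1 - p^-1) (gc : has_ps 1 (cderiv g) c).
Local Notation T := (hilbert_op g).
Local Notation Kmix := ((8 * 32 `^ (pt / 2)) `^ pt^-1).
Local Notation Cmix := (((pt / 2 + 1) * (8 * lip_sum p) `^ (pt / 2)) `^ pt^-1).

Let p1 : 1 < p. Proof. by apply: lt_trans p2; rewrite ltr1n. Qed.
Let p1' : (1 <= p%:E)%E. Proof. by rewrite lee_fin ltW. Qed.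
Let Cup0 : 0 <= Cup p. Proof. exact: powR_ge0. Qed.
Let pt0 : 0 < pt. Proof. by apply: lt_trans (pt_gt2 p2 hpt). Qed.

Lemma mixed_bet_sum W K : 0 <= W -> (mixed_norm 2%:E pt (pt / 2) (cderiv g) <= W%:E)%E ->
  \sum_(k < K) bet p c k `^ pt <= (Kmix * W) `^ pt.
Proof.
move=> W0 hW; have k0 : 0 <= 8 * 32 `^ (pt / 2) :> R by rewrite mulr_ge0 ?powR_ge0.
rewrite (powRM _ (powR_ge0 _ _) W0) -powRrM mulVf ?gt_eqF// powRr1//.
exact: mixed_lower gc p2 hpt _ _ W0 hW.
Qed.

Lemma op_bound_bet_sum M : 0 <= M -> (forall K, \sum_(k < K) bet p c k `^ pt <= M `^ pt) ->
  op_bound p%:E 2%:E T (Cup p * M).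
Proof.
move=> M0 hM; apply/(op_boundP gc p1' (mulr_ge0 Cup0 M0)) => f B hf N.
have := @blocks_upper_gt2 R c p pt M 0%N f B p2 hpt M0 _ hf N.
by rewrite big_mkord; apply => K; rewrite big_mkord.
Qed.

(** A bounded sum of nonnegative terms has small tails, and the block estimate from K on is uniform
    over the unit ball: this is why boundedness implies compactness for p > 2. *)
Lemma bet_sum_tails M : (forall K, \sum_(k < K) bet p c k `^ pt <= M) -> small_tails c p%:E.
Proof.
move=> hM e e0; pose d := Num.sqrt e / (Cup p + 1); have s0 : 0 < Num.sqrt e by rewrite sqrtr_gt0.
have c1 : 0 < Cup p + 1 by have := Cup0; lra.
have d0 : 0 < d by rewrite divr_gt0.
have [K hK] := tails_small (fun k => powR_ge0 (bet p c k) pt) hM (powR_gt0 pt d0).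
exists (2 ^ K).-1 => f hf N.
apply: le_trans (blocks_upper_gt2 p2 hpt (ltW d0) hK hf N) _.
rewrite mulr1 -[leRHS](sqr_sqrtr (ltW e0)); apply: lerXn2r.
- by rewrite nnegrE mulr_ge0// ltW.
- by rewrite nnegrE ltW.
- by rewrite mulrCA ler_piMr ?(ltW s0)// ler_pdivrMr// mul1r; have := Cup0; lra.
Qed.

Lemma mixed_norm_ge0 : (0 <= mixed_norm 2%:E pt (pt / 2) (cderiv g))%E.
Proof. exact: poweR_ge0. Qed.

Lemma bounded_mixed :
  [<-> bounded_op p%:E 2%:E T; compact_op p%:E 2%:E T; mixed_space 2%:E pt (pt / 2) (cderiv g)].
Proof.
have bs M : op_bound p%:E 2%:E T M -> forall K, \sum_(k < K) bet p c k `^ pt <= (64 * M * Ctest p) `^ pt.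
  by move=> hM K; exact: bet_sum_le gc _ _ _ _ p2 hpt hM.
tfae.
- by move=> [M /bs /bet_sum_tails]; exact: small_tails_compact.
- move=> /(compact_bounded gc p1')[M hM]; split; first exact: has_ps_dan gc.
  have M0 := op_bound_ge0 p1' hM.
  have t0 : 0 <= 64 * M * Ctest p.
    by have [_ h _] := tfun_HB 0 p1; rewrite mulr_ge0// mulr_ge0.
  exact: le_lt_trans (mixed_upper gc p2 hpt t0 (bs M hM)) (ltry _).
- move=> [_]; have h0 := mixed_norm_ge0; have H := mixed_bet_sum.
  case: (mixed_norm _ _ _ _) h0 H => [W||]// h0 H _.
  have W0 : 0 <= W by rewrite -lee_fin.
  exists (Cup p * (Kmix * W)); apply: op_bound_bet_sum; first by rewrite mulr_ge0 ?powR_ge0.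
  by move=> K; exact: H.
Qed.

Lemma op_norm_mixed :
  comparable (Num.max 1 (Num.max (Cup p * Kmix) (Cmix * (64 * Ctest p))))
    (op_norm p%:E 2%:E T) (mixed_norm 2%:E pt (pt / 2) (cderiv g)).
Proof.
apply: op_norm_comparable => //; first exact: mixed_norm_ge0.
- move=> B B0 hB; rewrite -mulrA; apply: op_bound_bet_sum; first by rewrite mulr_ge0 ?powR_ge0.
  by move=> K; exact: mixed_bet_sum.
- move=> M M0 hM.
  have -> : Cmix * (64 * Ctest p) * M = Cmix * (64 * M * Ctest p) by ring.
  apply: (mixed_upper gc p2 hpt) => [|K]; last exact: bet_sum_le gc _ _ _ _ p2 hpt hM.
  by have [_ h _] := tfun_HB 0 p1; rewrite mulr_ge0// mulr_ge0.
Qed.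

End LargeExponent.

Section Endpoint.
Variables (g : Cx R -> Cx R) (b : nat -> Cx R).
Hypotheses (gb : has_ps 1 g b) (gc : has_ps 1 (cderiv g) (dcoef b)).
Local Notation T := (hilbert_op g).

Let p1 : (1 <= +oo :> \bar R)%E. Proof. exact: leey. Qed.

(** The constant function 1 has moments 1 / (n + 1), the largest possible in the unit ball, and this
    factor turns (n + 1) b_(n+1) back into b_(n+1): no constant is lost in either direction. *)
Lemma op_bound_infty M : 0 <= M -> op_bound +oo%E 2%:E T M <->
  (hardy_norm 2%:E (fun z => g z - g 0)%R <= M%:E)%E.
Proof.
move=> M0; rewrite (hardy2P (has_ps_sub0 gb) M0) (op_boundP gc p1 M0); split.
  move=> /(_ _ _ (HB_cst1 p1)) h [|N]; first by rewrite big_ord0 sqr_ge0.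
  rewrite big_ord_recl /= cmod0 expr0n add0r; rewrite mulr1 in h.
  apply: le_trans (h N); apply: ler_sum => n _; apply: lerXn2r; rewrite ?nnegrE ?cmod_ge0//.
  rewrite cmodM cmod_dcoef mulrAC; apply: ler_peMl; first exact: cmod_ge0.
  have := ler_wpM2l (ler0n R n.+1) (mom_cst1 (R := R) n).
  by rewrite mulfV.
move=> h f B hf N; have := h N.+1; rewrite big_ord_recl /= cmod0 expr0n add0r => {}h.
have [_ B0 _] := hf; rewrite exprMn; apply: le_trans (ler_wpM2r (sqr_ge0 B) h).
rewrite mulr_suml; apply: ler_sum => n _; rewrite -exprMn.
apply: lerXn2r; rewrite ?nnegrE ?mulr_ge0 ?cmod_ge0//.
rewrite cmodM cmod_dcoef mulrAC mulrC; apply: ler_wpM2l; first exact: cmod_ge0.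
have := ler_wpM2l (ler0n R n.+1) (mom_infty n hf).
by rewrite mulrC mulrCA mulfV// mulr1 mulrC.
Qed.

Lemma infty_tails : hardy 2%:E g -> small_tails (dcoef b) +oo%E.
Proof.
move=> /(hardy2_l2 gb)[M hM] e e0.
have F0 n : 0 <= cmod (b n.+1) ^+ 2 by exact: sqr_ge0.
have hF N : \sum_(n < N) cmod (b n.+1) ^+ 2 <= M.
  by have := hM N.+1; rewrite big_ord_recl /=; have := sqr_ge0 (cmod (b 0%N)); lra.
have [K hK] := tails_small F0 hF e0; exists K => f hf N.
apply: le_trans (hK N); rewrite !big_nat; apply: ler_sum => n _.
apply: lerXn2r; rewrite ?nnegrE ?cmod_ge0//.
rewrite cmodM cmod_dcoef mulrAC mulrC; apply: ler_piMr; first exact: cmod_ge0.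
have := ler_wpM2l (ler0n R n.+1) (mom_infty n hf).
by rewrite mulrC mul1r mulfV.
Qed.

Lemma op_bound_infty_hardy M : op_bound +oo%E 2%:E T M -> hardy 2%:E g.
Proof.
move=> hM; have M0 := op_bound_ge0 p1 hM; apply/(hardy2_l2 gb).
have := (op_bound_infty M0).1 hM; rewrite (hardy2P (has_ps_sub0 gb) M0) => h.
exists (cmod (b 0%N) ^+ 2 + M ^+ 2) => -[|N]; first by rewrite big_ord0 addr_ge0 ?sqr_ge0.
have := h N.+1; rewrite !big_ord_recl /= cmod0 expr0n add0r; lra.
Qed.

Lemma bounded_infty :
  [<-> bounded_op +oo%E 2%:E T; compact_op +oo%E 2%:E T; hardy 2%:E g].
Proof.
tfae.
- by move=> [M /op_bound_infty_hardy /infty_tails]; exact: small_tails_compact.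
- by move=> /(compact_bounded gc p1)[M]; exact: op_bound_infty_hardy.
- by move=> /infty_tails; exact: small_tails_bounded.
Qed.

Lemma op_norm_infty : op_norm +oo%E 2%:E T = hardy_norm 2%:E (fun z => g z - g 0).
Proof.
apply/eqP; rewrite eq_le; apply/andP; split; last first.
  by apply: le_op_norm => M hM; apply/op_bound_infty => //; exact: op_bound_ge0 p1 hM.
have h0 := hardy_norm_ge0 (fun z => g z - g 0) (isT : (2%:E : \bar R) != -oo%E).
have H := op_bound_infty.
case: (hardy_norm _ _) h0 H => [r||]// h0 H; last by rewrite leey.
by apply: op_norm_le; apply/H; rewrite -?lee_fin.
Qed.

End Endpoint.
End Assembly.

Local Close Scope complex_scope.

Theorem theorem1 (R : realType) :
  (* (i) *)
  (forall g : Cx R -> Cx R, analytic g ->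
    [/\ [<-> bounded_op 1%:E 2%:E (hilbert_op g);
             compact_op 1%:E 2%:E (hilbert_op g);
             hardy 2%:E (cderiv g)],
        (2%:E * hardy_norm 2%:E (cderiv g)
           <= op_norm 1%:E 2%:E (hilbert_op g))%E
      & (op_norm 1%:E 2%:E (hilbert_op g)
           <= pi%:E * hardy_norm 2%:E (cderiv g))%E]) /\
  (* (ii) *)
  (forall p : R, 1 < p <= 2 ->
    [/\ (forall g : Cx R -> Cx R, analytic g ->
           (bounded_op p%:E 2%:E (hilbert_op g) <->
            lipschitz_mean 2 (p^-1) g)),
        (exists2 M : R, 0 < M &
           forall g : Cx R -> Cx R, analytic g ->
             comparable M (op_norm p%:E 2%:E (hilbert_op g))
               (lipschitz_norm 2 (p^-1) (fun z => g z - g 0)))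
      & (forall g : Cx R -> Cx R, analytic g ->
           (compact_op p%:E 2%:E (hilbert_op g) <->
            little_lipschitz_mean 2 (p^-1) g))]) /\
  (* (iii) *)
  (forall p pt : R, 2 < p -> pt^-1 = 2^-1 - p^-1 ->
    (forall g : Cx R -> Cx R, analytic g ->
       [<-> bounded_op p%:E 2%:E (hilbert_op g);
            compact_op p%:E 2%:E (hilbert_op g);
            mixed_space 2%:E pt (pt / 2) (cderiv g)]) /\
    (exists2 M : R, 0 < M &
       forall g : Cx R -> Cx R, analytic g ->
         comparable M (op_norm p%:E 2%:E (hilbert_op g))
           (mixed_norm 2%:E pt (pt / 2) (cderiv g)))) /\
  (* (iv) *)
  (forall g : Cx R -> Cx R, analytic g ->
    [<-> bounded_op +oo%E 2%:E (hilbert_op g);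
         compact_op +oo%E 2%:E (hilbert_op g);
         hardy 2%:E g] /\
    op_norm +oo%E 2%:E (hilbert_op g) =
      hardy_norm 2%:E (fun z => g z - g 0)).
Proof.
split; first exact: theorem1_H1.
split.
  move=> p p12; split.
  - by move=> g /analytic_ps[b gb gc]; exact: (bounded_lipschitz p12 gb gc).
  - exists (Num.max 1 (Num.max (Cup p * Cbet) (Clip p * (64 * Ctest p)))).
      by rewrite lt_max ltr01.
    by move=> g /analytic_ps[b gb gc]; exact: (op_norm_lipschitz p12 gb gc).
  - by move=> g /analytic_ps[b gb gc]; exact: (compact_little_lipschitz p12 gb gc).
split.
  move=> p pt p2 hpt; split.
    by move=> g /analytic_ps[b gb gc]; exact: (bounded_mixed p2 hpt gc).
  exists (Num.max 1 (Num.max (Cup p * (8 * 32 `^ (pt / 2)) `^ pt^-1)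
      (((pt / 2 + 1) * (8 * lip_sum p) `^ (pt / 2)) `^ pt^-1 * (64 * Ctest p)))).
    by rewrite lt_max ltr01.
  by move=> g /analytic_ps[b gb gc]; exact: (op_norm_mixed p2 hpt gc).
by move=> g /analytic_ps[b gb gc]; split; [exact: bounded_infty gb gc|exact: op_norm_infty gb gc].
Qed.
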